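(* (Setting in context.) For the dihedral group $I_{2k}$ with multiplicity $(\alpha,\beta)$, $\alpha,\beta>0$, and $z_1,z_2\in\mathbb{C}\setminus\{0\}$, for $\mathrm{Re}\,s$ sufficiently large \[\mathcal{L}(E_{\kappa}(z_{1},z_{2},t))(s)=\Gamma(k(\alpha+\beta)+1)\int_{-1}^{1}\int_{-1}^{1}f_{I_{2k}}(s)\,d\mu_{\alpha}(u)\,d\mu_{\beta}(v).\] For an odd-$k$ dihedral group $I_k$ with multiplicity $\alpha>0$, \[\mathcal{L}(E_{\kappa}(z_{1},z_{2},t))(s)=\Gamma(k\alpha+1)\int_{-1}^{1}g_{I_{k}}(s)\,d\mu_{\alpha}(u).\] Here $f_{I_{2k}}$ and $g_{I_k}$ are evaluated at $\omega=z_1/|z_1|$, $\eta=z_2/|z_2|$, $b=|z_1||z_2|$ and the given $u,v$.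
   Context: Identify $\mathbb{R}^2$ with $\mathbb{C}$. $I_N$ denotes the dihedral group of order $2N$ (symmetries of the regular $N$-gon). For a reflection group $G$ with root system $\mathcal R$, positive subsystem $\mathcal R_+$, and $G$-invariant multiplicity $\kappa$, the Dunkl operators are $T_if(x)=\partial_if(x)+\sum_{\alpha\in\mathcal R_+}\kappa(\alpha)\alpha_i\frac{f(x)-f(r_\alpha x)}{\langle\alpha,x\rangle}$, $\Delta_\kappa=T_1^2+T_2^2$, and $\mathcal H_j(\upsilon_\kappa)$ is the space of homogeneous polynomials of degree $j$ annihilated by $\Delta_\kappa$. For $I_{2k}$, $\kappa$ takes value $\alpha$ on one class of reflections and $\beta$ on the other, with weight $\upsilon_\kappa(z)=|\frac{z^k-\bar z^k}{2i}|^{2\alpha}|\frac{z^k+\bar z^k}{2}|^{2\beta}$ and $\langle\kappa\rangle=k(\alpha+\beta)$; for odd $k$, $I_k$ has one class, weight $\upsilon_\kappa(z)=|\frac{z^k-\bar z^k}{2i}|^{2\alpha}$ and $\langle\kappa\rangle=k\alpha$. $P_j(G;\omega,\eta)$ is the reproducing kernel of $\mathcal H_j(\upsilon_\kappa)$ restricted to the unit circle with respect to $\langle f,g\rangle=\int_{S^1}f\bar g\,\upsilon_\kappa d\sigma/\int_{S^1}\upsilon_\kappa d\sigma$. For $z_1=|z_1|\omega$, $z_2=|z_2|\eta$, $b=|z_1||z_2|$, $t\ge0$: $E_\kappa(z_1,z_2,t)=2^{\langle\kappa\rangle}\Gamma(\langle\kappa\rangle+1)\sum_{j\ge0}(-i)^jb^{-\langle\kappa\rangle}J_{j+\langle\kappa\rangle}(bt)P_j(G;\omega,\eta)$;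 the Dunkl kernel is $E_\kappa(z_1,z_2)=E_\kappa(z_1,z_2,1)$. $\mathcal L$ is the Laplace transform in $t$. $d\mu_\gamma(w)=c_\gamma(1+w)(1-w^2)^{\gamma-1}dw$ on $[-1,1]$ with $c_\gamma=B(\frac12,\gamma)^{-1}$. With $r=\sqrt{s^2+b^2}$, $R=s+r$, $w=-ib/R$, $X(u,v)=(\mathrm{Im}\,\omega^{k})(\mathrm{Im}\,\eta^{k})u+(\mathrm{Re}\,\omega^{k})(\mathrm{Re}\,\eta^{k})v$: $f_{I_{2k}}(s)=\frac{2^{k(\alpha+\beta)}}{rR^{k(\alpha+\beta)}}\frac{1-w^2}{1-w^{2k}}\frac{1-2w^{k}\mathrm{Re}(\omega^{k}\bar\eta^{k})+w^{2k}}{1-2\mathrm{Re}(\omega\bar\eta)w+w^2}\frac{1-w^{2k}}{(1-2w^{k}X(u,v)+w^{2k})^{\alpha+\beta+1}}$ and $g_{I_{k}}(s)=\frac{2^{k\alpha}}{rR^{k\alpha}}\frac{1-w^2}{1-w^{2k}}\frac{1-2w^{k}\mathrm{Re}(\omega^{k}\bar\eta^{k})+w^{2k}}{1-2\mathrm{Re}(\omega\bar\eta)w+w^2}\frac{1-w^{2k}}{(1-2w^{k}X(u,1)+w^{2k})^{\alpha+1}}$ (principal branches). *)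

(* Defs.v *)
From Stdlib Require Import Reals Lra Factorial.
From Coquelicot Require Import Coquelicot.
Open Scope R_scope.

Fixpoint fsum (n : nat) (f : nat -> R) : R :=
  match n with O => 0 | S p => fsum p f + f p end.

(* |x|^a with the convention 0^a = 0 (used with a > 0) *)
Definition powabs (x a : R) : R :=
  if Req_EM_T x 0 then 0 else Rpower (Rabs x) a.

(* x^a for x >= 0, with 0^a = 0 (used with a > 0) *)
Definition rpow0 (x a : R) : R :=
  if Rlt_dec 0 x then Rpower x a else 0.

Definition Gamma (x : R) : R :=
  RInt_gen (fun t => Rpower t (x - 1) * exp (- t)) (at_right 0) (Rbar_locally p_infty).

Definition Beta (a b : R) : R := Gamma a * Gamma b / Gamma (a + b).

Definition besselJ (nu x : R) : R :=
  Series (fun m => (-1) ^ m / (INR (fact m) * Gamma (INR m + nu + 1))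
                   * (rpow0 (x / 2) nu * (x / 2) ^ (2 * m))).

Definition Cexp (z : C) : C := (exp (Re z) * cos (Im z), exp (Re z) * sin (Im z)).

Definition Carg (z : C) : R :=
  if Rle_dec 0 (Im z) then acos (Re z / Cmod z) else - acos (Re z / Cmod z).

Definition Clog (z : C) : C := (ln (Cmod z), Carg z).

Definition Cpowr (z : C) (a : R) : C :=
  if Req_EM_T (Cmod z) 0 then RtoC 0 else Cexp (RtoC a * Clog z).

(* Mirrors of I_N: the lines through 0 at angles phi_m = m PI / N, m = 0..N-1. *)
Definition mirror_angle (N m : nat) : R := PI * INR m / INR N.

(* reflection in the m-th mirror: z |-> e^{2 i phi} conj z *)
Definition refl (N m : nat) (x : C) : C :=
  let p := mirror_angle N m in
  (cos (2 * p) * fst x + sin (2 * p) * snd x, sin (2 * p) * fst x - cos (2 * p) * snd x).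

Definition root1 (N m : nat) : R := - sin (mirror_angle N m).
Definition root2 (N m : nat) : R := cos (mirror_angle N m).
Definition rdot (N m : nat) (x : C) : R := root1 N m * fst x + root2 N m * snd x.

(* Dunkl operators T_1, T_2 for I_N with multiplicity kap m on the m-th mirror.
   (Summing over all N mirrors = over a positive subsystem: each term is
   invariant under alpha -> -alpha and under rescaling of alpha.) *)
Definition dunkl1 (N : nat) (kap : nat -> R) (f : C -> R) (x : C) : R :=
  Derive (fun t => f (t, snd x)) (fst x)
  + fsum N (fun m => kap m * root1 N m * (f x - f (refl N m x)) / rdot N m x).

Definition dunkl2 (N : nat) (kap : nat -> R) (f : C -> R) (x : C) : R :=
  Derive (fun t => f (fst x, t)) (snd x)
  + fsum N (fun m => kap m * root2 N m * (f x - f (refl N m x)) / rdot N m x).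

Definition dunkl_lap (N : nat) (kap : nat -> R) (f : C -> R) (x : C) : R :=
  dunkl1 N kap (dunkl1 N kap f) x + dunkl2 N kap (dunkl2 N kap f) x.

(* regular points (off all mirrors), where the Dunkl operators are given by
   the formula literally; Delta_kappa p is a polynomial, so vanishing there is
   equivalent to vanishing identically. *)
Definition regular (N : nat) (x : C) : Prop :=
  forall m, (m < N)%nat -> rdot N m x <> 0.

Definition hpoly (j : nat) (c : nat -> R) (x : C) : R :=
  fsum (S j) (fun i => c i * fst x ^ i * snd x ^ (j - i)).

Definition dunkl_harmonic (N : nat) (kap : nat -> R) (j : nat) (c : nat -> R) : Prop :=
  forall x, regular N x -> dunkl_lap N kap (hpoly j c) x = 0.

Definition circ_inner (ups : C -> R) (f g : C -> R) : R :=
  RInt (fun th => f (cos th, sin th) * g (cos th, sin th) * ups (cos th, sin th)) 0 (2 * PI)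
  / RInt (fun th => ups (cos th, sin th)) 0 (2 * PI).

Definition is_repr_kernel (N : nat) (kap : nat -> R) (ups : C -> R) (j : nat)
    (K : C -> C -> R) : Prop :=
  (forall eta, Cmod eta = 1 ->
     exists c, dunkl_harmonic N kap j c /\
               forall om, Cmod om = 1 -> K om eta = hpoly j c om) /\
  (forall c, dunkl_harmonic N kap j c ->
     forall eta, Cmod eta = 1 -> hpoly j c eta = circ_inner ups (hpoly j c) (fun om => K om eta)).

(* I_{2k}: value alpha on the mirrors m even (zeros of Im z^k), beta on m odd *)
Definition kap_I2k (a b : R) (m : nat) : R := if Nat.even m then a else b.
Definition ups_I2k (k : nat) (a b : R) (z : C) : R :=
  powabs (Im (Cpow z k)) (2 * a) * powabs (Re (Cpow z k)) (2 * b).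
(* I_k, k odd: one class *)
Definition kap_Ik (a : R) (m : nat) : R := a.
Definition ups_Ik (k : nat) (a : R) (z : C) : R := powabs (Im (Cpow z k)) (2 * a).

(* kb = <kappa>; P j = P_j(G; . , .) *)
Definition unitC (z : C) : C := Cdiv z (RtoC (Cmod z)).

Definition dunklE (kb : R) (P : nat -> C -> C -> R) (z1 z2 : C) (t : R) : C :=
  let b := Cmod z1 * Cmod z2 in
  let om := unitC z1 in let eta := unitC z2 in
  let a j := Rpower 2 kb * Gamma (kb + 1) * Rpower b (- kb)
             * besselJ (INR j + kb) (b * t) * P j om eta in
  (Series (fun j => Re (Cpow (0, -1) j) * a j),
   Series (fun j => Im (Cpow (0, -1) j) * a j)).

Definition c_mu (g : R) : R := / Beta (1 / 2) g.

Definition int_mu (g : R) (h : R -> C) : C :=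
  RInt_gen (V := C_R_CompleteNormedModule)
    (fun w => Cmult (RtoC (c_mu g * (1 + w) * Rpower (1 - w ^ 2) (g - 1))) (h w))
    (at_right (-1)) (at_left 1).

Definition dih_integrand (k : nat) (kb e : R) (om eta : C) (b : R) (s : C) (X : R) : C :=
  let r := Cpowr (Cplus (Cmult s s) (RtoC (b * b))) (1 / 2) in
  let RR := Cplus s r in
  let w := Cdiv (Copp (Cmult (0, 1) (RtoC b))) RR in
  let one := RtoC 1 in
  let wk := Cpow w k in
  let w2k := Cpow w (2 * k)%nat in
  let t1 := Cdiv (RtoC (Rpower 2 kb)) (Cmult r (Cpowr RR kb)) in
  let t2 := Cdiv (Cminus one (Cpow w 2)) (Cminus one w2k) in
  let t3 := Cdiv
      (Cplus (Cminus one (Cmult (RtoC (2 * Re (Cmult (Cpow om k) (Cpow (Cconj eta) k)))) wk)) w2k)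
      (Cplus (Cminus one (Cmult (RtoC (2 * Re (Cmult om (Cconj eta)))) w)) (Cpow w 2)) in
  let t4 := Cdiv (Cminus one w2k)
      (Cpowr (Cplus (Cminus one (Cmult (RtoC (2 * X)) wk)) w2k) e) in
  Cmult (Cmult (Cmult t1 t2) t3) t4.

Definition Xuv (k : nat) (om eta : C) (u v : R) : R :=
  Im (Cpow om k) * Im (Cpow eta k) * u + Re (Cpow om k) * Re (Cpow eta k) * v.

Definition f_I2k (k : nat) (a b : R) (om eta : C) (bb : R) (s : C) (u v : R) : C :=
  dih_integrand k (INR k * (a + b)) (a + b + 1) om eta bb s (Xuv k om eta u v).

Definition g_Ik (k : nat) (a : R) (om eta : C) (bb : R) (s : C) (u : R) : C :=
  dih_integrand k (INR k * a) (a + 1) om eta bb s (Xuv k om eta u 1).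

Definition laplace_is (F : R -> C) (s : C) (L : C) : Prop :=
  is_RInt_gen (V := C_R_NormedModule)
    (fun t => Cmult (Cexp (Copp (Cmult s (RtoC t)))) (F t))
    (at_point 0) (Rbar_locally p_infty) L.

(* Main.v *)
(* Let zeta = eta conj(omega) and w = -ib/R. The kernel P_j is computed explicitly: in the variable z^k the
   group I_{2k} becomes the group generated by the two coordinate reflections, where the intertwining
   operator is a product of two one-dimensional ones, x^n |-> n!/gamma_n x^n. Expanding the powers of
   1 - 2 W X(u,v) + W^2 in this way gives its mean with respect to mu_alpha x mu_beta as a series
   sum_q W^q D_q, because n!/gamma_n are exactly the moments of mu. The polynomials
   C_q = D_q - zbar eta D_{q-1} are annihilated by T_1 + i T_2, the function z^l C_q(z^k) with n = kq + l is
   annihilated by T_1 + i T_2 for I_{2k}, and P_n is the sum of such a function of degree n and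
   the conjugate of zeta times the one of degree n - 1; harmonics of degree n span at most two
   dimensions and the reproducing property is checked on a generator with the divergence theorem on the circle.
   Summation over n gives
   sum_n w^n P_n = (1 - w^2) (1 - 2 w^k Re zeta^k + w^{2k}) / (1 - 2 w Re zeta + w^2) sum_q w^{kq} D_q.
   Finally the Laplace transform of J_nu(bt) is b^nu / (r R^nu), so transforming the Dunkl kernel term by
   term replaces (-i)^j J_{j+<kappa>}(bt) by b^<kappa> w^j / (r R^<kappa>), which produces this series.
   For k odd the second multiplicity is 0 and the integration over v is replaced by v = 1. *)
Require Import Defs.
From Stdlib Require Import Reals Lra Lia ZArith Factorial FunctionalExtensionality.
From Coquelicot Require Import Coquelicot.
Open Scope R_scope.

(** * Formal polynomials and their Dunkl operators *)

(** The kernels [P j] are known only through their two defining properties, so they are identified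
    by pairing them with the explicit polynomial [KN], which requires [KN] to be harmonic, real on
    the circle and reproducing. First-order operators make the passage to z^k possible: summed over
    a class of mirrors, the phases of the reflections become power sums of roots of unity, nearly
    all of which vanish. The Laplacian is then recovered from the two products of T_1 + i T_2 and
    T_1 - i T_2, whose sum is twice the Laplacian. The literal Dunkl formula divides by a linear
    form and has a meaning only off the mirrors, while the Laplacian applies it twice. Hence the
    syntactic polynomials with division-free quotients, and the density arguments that lead from
    functions to polynomials and back. All exchanges of sums and integrals rest on explicit
    majorants. The condition 64 |z_1| |z_2| <= Re s forces |w| <= 1/64, which leaves room for the
    growth 8^q of the D_q, for 16^n of the P_n, and for the factor e^(bt) lost in bounding Bessel
    functions. *)

Fixpoint csum (n : nat) (f : nat -> C) : C :=
  match n with O => RtoC 0 | S p => (csum p f + f p)%C end.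

Lemma csum_ext n f g : (forall i, (i < n)%nat -> f i = g i) -> csum n f = csum n g.
Proof.
  induction n as [|n IH]; intros H; simpl; auto.
  rewrite IH, H; auto.
Qed.

Lemma csum_plus n f g : csum n (fun i => (f i + g i)%C) = (csum n f + csum n g)%C.
Proof. induction n as [|n IH]; simpl; [|rewrite IH]; ring. Qed.

Lemma csum_mult c n f : csum n (fun i => (c * f i)%C) = (c * csum n f)%C.
Proof. induction n as [|n IH]; simpl; [|rewrite IH]; ring. Qed.

Lemma csum_zero n f : (forall i, (i < n)%nat -> f i = RtoC 0) -> csum n f = RtoC 0.
Proof.
  intros H. induction n as [|n IH]; simpl; auto.
  rewrite IH, H; auto. ring.
Qed.

Lemma csum_swap n m (f : nat -> nat -> C) :
  csum n (fun i => csum m (f i)) = csum m (fun j => csum n (fun i => f i j)).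
Proof.
  induction n as [|n IH]; simpl.
  - symmetry; apply csum_zero; auto.
  - rewrite IH, <- csum_plus. reflexivity.
Qed.

Lemma csum_single n f i0 :
  (i0 < n)%nat -> (forall i, (i < n)%nat -> i <> i0 -> f i = RtoC 0) -> csum n f = f i0.
Proof.
  induction n as [|n IH]; intros Hi H; [lia|]; simpl.
  destruct (Nat.eq_dec i0 n) as [->|Hn].
  - rewrite csum_zero; [ring|]. intros i Hin; apply H; lia.
  - rewrite IH, (H n); try lia; [ring|]. intros i Hin; apply H; lia.
Qed.

Lemma csum_S_l n f : csum (S n) f = (f O + csum n (fun i => f (S i)))%C.
Proof.
  induction n as [|n IH]; [simpl; ring|].
  change (csum (S (S n)) f) with (csum (S n) f + f (S n))%C. rewrite IH. simpl. ring.
Qed.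

Lemma csum_conj n f : Cconj (csum n f) = csum n (fun i => Cconj (f i)).
Proof.
  induction n as [|n IH]; simpl; [unfold Cconj, RtoC; simpl; f_equal; ring|].
  rewrite Cplus_conj, IH. reflexivity.
Qed.

(* Polynomial functions are represented by expressions, on which derivatives and divided differences,
   hence Dunkl operators, are computed without any division. *)
Inductive pol := PC (c : C) | PX | PY | PA (p q : pol) | PM (p q : pol).

Fixpoint ev (p : pol) (x : C) : C :=
  match p with
  | PC c => c
  | PX => RtoC (fst x)
  | PY => RtoC (snd x)
  | PA p q => (ev p x + ev q x)%C
  | PM p q => (ev p x * ev q x)%C
  end.

Fixpoint psubst (p u v : pol) : pol :=
  match p with
  | PC c => PC c
  | PX => u
  | PY => v
  | PA p q => PA (psubst p u v) (psubst q u v)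
  | PM p q => PM (psubst p u v) (psubst q u v)
  end.

Lemma ev_psubst p u v x y :
  ev u x = RtoC (fst y) -> ev v x = RtoC (snd y) -> ev (psubst p u v) x = ev p y.
Proof.
  intros Hu Hv. induction p as [c| | |p IHp q IHq|p IHp q IHq]; simpl; auto.
  - rewrite IHp, IHq; auto.
  - rewrite IHp, IHq; auto.
Qed.

Fixpoint psum (n : nat) (F : nat -> pol) : pol :=
  match n with O => PC 0 | S m => PA (psum m F) (F m) end.

Lemma ev_psum n F x : ev (psum n F) x = csum n (fun i => ev (F i) x).
Proof. induction n as [|n IH]; simpl; [|rewrite IH]; reflexivity. Qed.

Fixpoint ppow (p : pol) (n : nat) : pol :=
  match n with O => PC 1 | S m => PM p (ppow p m) end.

Lemma ev_ppow p n x : ev (ppow p n) x = (ev p x ^ n)%C.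
Proof. induction n as [|n IH]; simpl; [|rewrite IH]; reflexivity. Qed.

Fixpoint pconj (p : pol) : pol :=
  match p with
  | PC c => PC (Cconj c)
  | PX => PX
  | PY => PY
  | PA p q => PA (pconj p) (pconj q)
  | PM p q => PM (pconj p) (pconj q)
  end.

Lemma Cconj_RtoC r : Cconj (RtoC r) = RtoC r.
Proof. unfold Cconj, RtoC; simpl; f_equal; ring. Qed.

Lemma ev_pconj p x : ev (pconj p) x = Cconj (ev p x).
Proof.
  induction p as [c| | |p IHp q IHq|p IHp q IHq]; simpl; rewrite ?Cconj_RtoC; auto.
  - rewrite IHp, IHq, Cplus_conj; auto.
  - rewrite IHp, IHq, Cmult_conj; auto.
Qed.

Definition PZ : pol := PA PX (PM (PC Ci) PY).

Definition PZb : pol := PA PX (PM (PC (- Ci)%C) PY).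

Lemma C_decomp (x : C) : (RtoC (fst x) + Ci * RtoC (snd x))%C = x.
Proof. destruct x as [u v]; unfold Ci, RtoC, Cplus, Cmult; simpl; f_equal; ring. Qed.

Lemma Cconj_decomp (x : C) : (RtoC (fst x) + - Ci * RtoC (snd x))%C = Cconj x.
Proof.
  destruct x as [u v]; unfold Ci, RtoC, Cplus, Cmult, Copp, Cconj; simpl; f_equal; ring.
Qed.

Lemma ev_PZ x : ev PZ x = x.
Proof. exact (C_decomp x). Qed.

Lemma ev_PZb x : ev PZb x = Cconj x.
Proof. exact (Cconj_decomp x). Qed.

Lemma Ci_sqr : (Ci * Ci)%C = (- (1))%C.
Proof. unfold Ci, Cmult, Copp, RtoC; simpl; f_equal; ring. Qed.

Fixpoint dx (p : pol) : pol :=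
  match p with
  | PC _ => PC 0 | PX => PC 1 | PY => PC 0
  | PA p q => PA (dx p) (dx q)
  | PM p q => PA (PM (dx p) q) (PM p (dx q))
  end.

Fixpoint dy (p : pol) : pol :=
  match p with
  | PC _ => PC 0 | PX => PC 0 | PY => PC 1
  | PA p q => PA (dy p) (dy q)
  | PM p q => PA (PM (dy p) q) (PM p (dy q))
  end.

Lemma is_derive_eq (f : R -> R) (x a b : R) : is_derive f x a -> a = b -> is_derive f x b.
Proof. intros H <-; exact H. Qed.

Lemma is_derive_cont (f : R -> R) x d : is_derive f x d -> continuous f x.
Proof.
  intros H. apply (ex_derive_continuous (K := R_AbsRing) (V := R_NormedModule)).
  exists d; exact H.
Qed.

Lemma is_derive_Rmult (f g : R -> R) x a b :
  is_derive f x a -> is_derive g x b ->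
  is_derive (fun t => f t * g t) x (a * g x + f x * b).
Proof.
  intros Hf Hg. apply (is_derive_mult f g x a b Hf Hg).
  intros n m; unfold mult; simpl; ring.
Qed.

(** One chain rule serves horizontal and vertical lines (partial derivatives), the normal of a
    mirror (density) and the unit circle (integration by parts). The derivative enters as a variable
    [d] with an equation, so that each use may supply it in simplified form. *)
Lemma ev_derive_curve p (X Y : R -> R) (t x' y' : R) :
  is_derive X t x' -> is_derive Y t y' -> forall d : C,
  d = (ev (dx p) (X t, Y t) * RtoC x' + ev (dy p) (X t, Y t) * RtoC y')%C ->
  is_derive (fun t => Re (ev p (X t, Y t))) t (Re d) /\
  is_derive (fun t => Im (ev p (X t, Y t))) t (Im d).
Proof.
  intros HX HY d ->. induction p as [c| | |p IHp q IHq|p IHp q IHq].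
  - simpl ev. replace (RtoC 0 * RtoC x' + RtoC 0 * RtoC y')%C with (RtoC 0) by ring.
    split; apply (is_derive_const (V := R_NormedModule)).
  - simpl ev. replace (RtoC 1 * RtoC x' + RtoC 0 * RtoC y')%C with (RtoC x') by ring. simpl.
    split; [exact HX|apply (is_derive_const (V := R_NormedModule))].
  - simpl ev. replace (RtoC 0 * RtoC x' + RtoC 1 * RtoC y')%C with (RtoC y') by ring. simpl.
    split; [exact HY|apply (is_derive_const (V := R_NormedModule))].
  - destruct IHp as [Hp1 Hp2], IHq as [Hq1 Hq2]. split.
    + eapply (is_derive_eq (fun t => Re (ev p (X t, Y t)) + Re (ev q (X t, Y t)))).
      { apply (@is_derive_plus R_AbsRing R_NormedModule); eassumption. }
      unfold plus; simpl; unfold Re, Im; ring.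
    + eapply (is_derive_eq (fun t => Im (ev p (X t, Y t)) + Im (ev q (X t, Y t)))).
      { apply (@is_derive_plus R_AbsRing R_NormedModule); eassumption. }
      unfold plus; simpl; unfold Re, Im; ring.
  - destruct IHp as [Hp1 Hp2], IHq as [Hq1 Hq2]. split.
    + eapply (is_derive_eq (fun t => Re (ev p (X t, Y t)) * Re (ev q (X t, Y t))
        - Im (ev p (X t, Y t)) * Im (ev q (X t, Y t)))).
      { apply (@is_derive_minus R_AbsRing R_NormedModule); apply is_derive_Rmult; eassumption. }
      unfold minus, plus, opp; simpl; unfold Re, Im; ring.
    + eapply (is_derive_eq (fun t => Re (ev p (X t, Y t)) * Im (ev q (X t, Y t))
        + Im (ev p (X t, Y t)) * Re (ev q (X t, Y t)))).
      { apply (@is_derive_plus R_AbsRing R_NormedModule); apply is_derive_Rmult; eassumption. }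
      unfold plus; simpl; unfold Re, Im; ring.
Qed.

Lemma C_ext (z w : C) : Re z = Re w -> Im z = Im w -> z = w.
Proof. destruct z, w; simpl; intros -> ->; reflexivity. Qed.

Lemma ev_derive_x p (x y : R) :
  is_derive (fun t => Re (ev p (t, y))) x (Re (ev (dx p) (x, y))) /\
  is_derive (fun t => Im (ev p (t, y))) x (Im (ev (dx p) (x, y))).
Proof.
  apply (ev_derive_curve p (fun t => t) (fun _ => y) x 1 0).
  - apply (is_derive_id (K := R_AbsRing)).
  - apply (is_derive_const (K := R_AbsRing) (V := R_NormedModule)).
  - ring.
Qed.

Lemma ev_derive_y p (x y : R) :
  is_derive (fun t => Re (ev p (x, t))) y (Re (ev (dy p) (x, y))) /\
  is_derive (fun t => Im (ev p (x, t))) y (Im (ev (dy p) (x, y))).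
Proof.
  apply (ev_derive_curve p (fun _ => x) (fun t => t) y 0 1).
  - apply (is_derive_const (K := R_AbsRing) (V := R_NormedModule)).
  - apply (is_derive_id (K := R_AbsRing)).
  - ring.
Qed.

(** Different expressions may define the same function. Since [dx] computes a genuine partial
    derivative, it depends on that function alone; together with the analogues for [dy] and [dd]
    this makes the Dunkl operators well defined on polynomial functions. *)
Lemma dx_ext p q : (forall x, ev p x = ev q x) -> forall x, ev (dx p) x = ev (dx q) x.
Proof.
  intros H [x y].
  destruct (ev_derive_x p x y) as [P1 P2], (ev_derive_x q x y) as [Q1 Q2].
  apply C_ext.
  - rewrite <- (is_derive_unique _ _ _ P1), <- (is_derive_unique _ _ _ Q1).
    apply Derive_ext; intros t; rewrite H; reflexivity.
  - rewrite <- (is_derive_unique _ _ _ P2), <- (is_derive_unique _ _ _ Q2).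
    apply Derive_ext; intros t; rewrite H; reflexivity.
Qed.

Lemma dy_ext p q : (forall x, ev p x = ev q x) -> forall x, ev (dy p) x = ev (dy q) x.
Proof.
  intros H [x y].
  destruct (ev_derive_y p x y) as [P1 P2], (ev_derive_y q x y) as [Q1 Q2].
  apply C_ext.
  - rewrite <- (is_derive_unique _ _ _ P1), <- (is_derive_unique _ _ _ Q1).
    apply Derive_ext; intros t; rewrite H; reflexivity.
  - rewrite <- (is_derive_unique _ _ _ P2), <- (is_derive_unique _ _ _ Q2).
    apply Derive_ext; intros t; rewrite H; reflexivity.
Qed.

(* Degrees are integers, and [PC 0] has every degree, so that differentiation lowers
   the degree by one without exception. *)
Inductive hom : Z -> pol -> Prop :=
| hom_zero z : hom z (PC 0)
| hom_const c : hom 0 (PC c)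
| hom_X : hom 1 PX
| hom_Y : hom 1 PY
| hom_add z p q : hom z p -> hom z q -> hom z (PA p q)
| hom_mul z1 z2 z p q : hom z1 p -> hom z2 q -> (z = z1 + z2)%Z -> hom z (PM p q).

Lemma hom_scal z c p : hom z p -> hom z (PM (PC c) p).
Proof. intros H. eapply hom_mul; [apply hom_const|exact H|lia]. Qed.

Lemma hom_psum z n F : (forall i, (i < n)%nat -> hom z (F i)) -> hom z (psum n F).
Proof.
  induction n as [|n IH]; intros H; simpl; [apply hom_zero|].
  apply hom_add; auto.
Qed.

Lemma hom_ppow z p n : hom z p -> hom (z * Z.of_nat n) (ppow p n).
Proof.
  intros H. induction n as [|n IH]; simpl ppow.
  - replace (z * Z.of_nat 0)%Z with 0%Z by lia. apply hom_const.
  - eapply hom_mul; [exact H|exact IH|lia].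
Qed.

Lemma hom_PZ : hom 1 PZ.
Proof. apply hom_add; [apply hom_X|apply hom_scal, hom_Y]. Qed.

Lemma hom_PZb : hom 1 PZb.
Proof. apply hom_add; [apply hom_X|apply hom_scal, hom_Y]. Qed.

Lemma hom_pconj z p : hom z p -> hom z (pconj p).
Proof.
  induction 1; simpl; try (constructor; auto; fail).
  - replace (Cconj 0) with (RtoC 0) by (symmetry; apply Cconj_RtoC). constructor.
  - econstructor; eauto.
Qed.

Lemma hom_psubst_linear z p u v : hom z p -> hom 1 u -> hom 1 v -> hom z (psubst p u v).
Proof.
  intros H Hu Hv. induction H; simpl; auto; try (constructor; auto; fail).
  econstructor; eauto.
Qed.

Lemma hom_psubst d z p u v :
  hom z p -> hom d u -> hom d v -> hom (d * z) (psubst p u v).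
Proof.
  intros H Hu Hv. induction H; simpl; auto; try (constructor; auto; fail).
  - replace (d * 0)%Z with 0%Z by lia. constructor.
  - replace (d * 1)%Z with d by lia. auto.
  - replace (d * 1)%Z with d by lia. auto.
  - econstructor; eauto. subst; ring.
Qed.

Lemma hom_dx z p : hom z p -> hom (z - 1) (dx p).
Proof.
  induction 1; simpl; try (constructor; auto; fail).
  subst. apply hom_add; econstructor; eauto; lia.
Qed.

Lemma hom_dy z p : hom z p -> hom (z - 1) (dy p).
Proof.
  induction 1; simpl; try (constructor; auto; fail).
  subst. apply hom_add; econstructor; eauto; lia.
Qed.

Lemma euler z p x : hom z p ->
  (RtoC (fst x) * ev (dx p) x + RtoC (snd x) * ev (dy p) x)%C = (RtoC (IZR z) * ev p x)%C.
Proof.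
  induction 1; simpl; try ring.
  - transitivity ((RtoC (fst x) * ev (dx p) x + RtoC (snd x) * ev (dy p) x) +
      (RtoC (fst x) * ev (dx q) x + RtoC (snd x) * ev (dy q) x))%C; [ring|].
    rewrite IHhom1, IHhom2; ring.
  - subst. rewrite plus_IZR, RtoC_plus.
    replace (RtoC (fst x) * (ev (dx p) x * ev q x + ev p x * ev (dx q) x)
      + RtoC (snd x) * (ev (dy p) x * ev q x + ev p x * ev (dy q) x))%C with
      ((RtoC (fst x) * ev (dx p) x + RtoC (snd x) * ev (dy p) x) * ev q x +
       ev p x * (RtoC (fst x) * ev (dx q) x + RtoC (snd x) * ev (dy q) x))%C by ring.
    rewrite IHhom1, IHhom2. ring.
Qed.

(** A product of negative degree has a factor of negative degree. This closes the later inductions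
    in which operators lower the degree. *)
Lemma hom_neg z p : hom z p -> (z < 0)%Z -> forall x, ev p x = RtoC 0.
Proof.
  induction 1; intros Hz x; simpl; try lia; auto.
  - rewrite IHhom1, IHhom2; auto; ring.
  - assert (D : (z1 < 0 \/ z2 < 0)%Z) by lia. destruct D.
    + rewrite IHhom1; auto; ring.
    + rewrite IHhom2; auto; ring.
Qed.

(** In a product of positive degree one factor has positive degree, and it is enough to split that
    one. The lemma serves as induction on the degree. *)
Lemma hom_decomp z p : hom z p -> (0 < z)%Z ->
  exists p1 p2, hom (z - 1) p1 /\ hom (z - 1) p2 /\
    forall x, ev p x = (RtoC (fst x) * ev p1 x + RtoC (snd x) * ev p2 x)%C.
Proof.
  induction 1 as [z|c| | |z p q Hp IHp Hq IHq|z1 z2 z p q Hp IHp Hq IHq E]; intros Hz; try lia.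
  - exists (PC 0), (PC 0). repeat split; try constructor. intros; simpl; ring.
  - exists (PC 1), (PC 0). repeat split; try constructor. intros; simpl; ring.
  - exists (PC 0), (PC 1). repeat split; try constructor. intros; simpl; ring.
  - destruct (IHp Hz) as (p1 & p2 & A1 & A2 & A3), (IHq Hz) as (q1 & q2 & B1 & B2 & B3).
    exists (PA p1 q1), (PA p2 q2). repeat split; try (constructor; auto; fail).
    intros x; simpl. rewrite A3, B3. ring.
  - destruct (Z_lt_le_dec 0 z1) as [L1|L1].
    + destruct (IHp L1) as (p1 & p2 & A1 & A2 & A3).
      exists (PM p1 q), (PM p2 q). repeat split; try (econstructor; eauto; lia).
      intros x; simpl. rewrite A3. ring.
    + assert (L2 : (0 < z2)%Z) by lia.
      destruct (IHq L2) as (q1 & q2 & A1 & A2 & A3).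
      exists (PM p q1), (PM p q2). repeat split; try (econstructor; eauto; lia).
      intros x; simpl. rewrite A3. ring.
Qed.

Lemma hom_0_const p : hom 0 p -> exists c, forall x, ev p x = c.
Proof.
  intros H. remember 0%Z as z eqn:E. revert E.
  induction H as [z|c| | |z p q Hp IHp Hq IHq|z1 z2 z p q Hp IHp Hq IHq E0]; intros E; try lia.
  - exists (RtoC 0); auto.
  - exists c; auto.
  - destruct (IHp E) as [c1 H1], (IHq E) as [c2 H2]. exists (c1 + c2)%C.
    intros; simpl; rewrite H1, H2; auto.
  - destruct (Z.eq_dec z1 0) as [Z1|Z1].
    + assert (Z2 : z2 = 0%Z) by lia.
      destruct (IHp Z1) as [c1 H1], (IHq Z2) as [c2 H2]. exists (c1 * c2)%C.
      intros; simpl; rewrite H1, H2; auto.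
    + exists (RtoC 0). intros x; simpl.
      assert (D : (z1 < 0 \/ z2 < 0)%Z) by lia. destruct D.
      * rewrite (hom_neg _ _ Hp); auto; ring.
      * rewrite (hom_neg _ _ Hq); auto; ring.
Qed.

(** * Reflections, divided differences and density of the complement of the mirrors *)

Definition reflA (phi : R) (x : C) : C :=
  (cos (2 * phi) * fst x + sin (2 * phi) * snd x, sin (2 * phi) * fst x - cos (2 * phi) * snd x).

Definition lin (phi : R) (x : C) : R := - sin phi * fst x + cos phi * snd x.

Definition plin (phi : R) : pol :=
  PA (PM (PC (RtoC (- sin phi))) PX) (PM (PC (RtoC (cos phi))) PY).

Definition prefl (phi : R) (p : pol) : pol :=
  psubst p
    (PA (PM (PC (RtoC (cos (2 * phi)))) PX) (PM (PC (RtoC (sin (2 * phi)))) PY))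
    (PA (PM (PC (RtoC (sin (2 * phi)))) PX) (PM (PC (RtoC (- cos (2 * phi)))) PY)).

(** The quotient of the difference between p and its reflection by the linear form of the mirror. On
    a coordinate it is twice the component of the unit root; on products it obeys the Leibniz rule
    twisted by the reflection. *)
Fixpoint dd (phi : R) (p : pol) : pol :=
  match p with
  | PC _ => PC 0
  | PX => PC (RtoC (2 * - sin phi))
  | PY => PC (RtoC (2 * cos phi))
  | PA p q => PA (dd phi p) (dd phi q)
  | PM p q => PA (PM (dd phi p) q) (PM (prefl phi p) (dd phi q))
  end.

Lemma ev_plin phi x : ev (plin phi) x = RtoC (lin phi x).
Proof. unfold lin; simpl. rewrite <- !RtoC_mult, <- RtoC_plus. reflexivity. Qed.

Lemma ev_prefl phi p x : ev (prefl phi p) x = ev p (reflA phi x).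
Proof.
  apply ev_psubst; simpl; rewrite <- !RtoC_mult, <- RtoC_plus; f_equal; ring.
Qed.

Lemma ev_dd phi p x : (ev p x - ev p (reflA phi x))%C = (RtoC (lin phi x) * ev (dd phi p) x)%C.
Proof.
  induction p as [c| | |p IHp q IHq|p IHp q IHq].
  - simpl; ring.
  - unfold lin; simpl. rewrite <- RtoC_minus, <- RtoC_mult, sin_2a, cos_2a_sin. f_equal; ring.
  - unfold lin; simpl. rewrite <- RtoC_minus, <- RtoC_mult, sin_2a, cos_2a_cos. f_equal; ring.
  - simpl. transitivity ((ev p x - ev p (reflA phi x)) + (ev q x - ev q (reflA phi x)))%C; [ring|].
    rewrite IHp, IHq; ring.
  - simpl. rewrite ev_prefl.
    transitivity ((ev p x - ev p (reflA phi x)) * ev q x +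
      ev p (reflA phi x) * (ev q x - ev q (reflA phi x)))%C; [ring|].
    rewrite IHp, IHq; ring.
Qed.

Lemma hom_prefl z phi p : hom z p -> hom z (prefl phi p).
Proof.
  intros H; apply hom_psubst_linear; auto; apply hom_add; apply hom_scal; constructor.
Qed.

Lemma hom_dd z phi p : hom z p -> hom (z - 1) (dd phi p).
Proof.
  induction 1; simpl; try (constructor; auto; fail).
  subst. apply hom_add; econstructor; eauto using hom_prefl; lia.
Qed.

Lemma continuous_punctured_zero (f : R -> R) (x : R) :
  continuous f x -> (forall t, t <> x -> f t = 0) -> f x = 0.
Proof.
  intros Hc H. destruct (Req_dec (f x) 0) as [E|N]; auto. exfalso.
  assert (L : locally (f x) (fun y => y <> 0)).
  { assert (Hp : 0 < Rabs (f x)) by (apply Rabs_pos_lt; auto).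
    exists (mkposreal _ Hp). intros y Hy Ey. subst y.
    unfold ball in Hy; simpl in Hy. unfold AbsRing_ball, abs, minus, plus, opp in Hy; simpl in Hy.
    rewrite Rplus_0_l, Rabs_Ropp in Hy. lra. }
  destruct (Hc _ L) as [d Hd].
  apply (Hd (x + d / 2)).
  - unfold ball; simpl. unfold AbsRing_ball, abs, minus, plus, opp; simpl.
    replace (x + d / 2 + - x) with (d / 2) by ring.
    destruct d as [d Hd']; simpl in *. rewrite Rabs_pos_eq; lra.
  - apply H. destruct d as [d Hd']; simpl in *. lra.
Qed.

(** Polynomials are continuous, so the value at a point of the mirror is a limit of zero values
    along the normal. *)
Lemma lin_density phi r :
  (forall x, lin phi x <> 0 -> ev r x = RtoC 0) -> forall x, ev r x = RtoC 0.
Proof.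
  intros H [x y]. destruct (Req_dec (lin phi (x, y)) 0) as [E|N]; auto.
  (* The line through the point in the direction of the unit root: at parameter t the linear form
     takes the value t. *)
  set (X := fun t : R => x - t * sin phi). set (Y := fun t : R => y + t * cos phi).
  assert (EX : X 0 = x) by (unfold X; ring). assert (EY : Y 0 = y) by (unfold Y; ring).
  assert (HX : is_derive X 0 (- sin phi)) by (unfold X; auto_derive; auto; ring).
  assert (HY : is_derive Y 0 (cos phi)) by (unfold Y; auto_derive; auto; ring).
  destruct (ev_derive_curve r X Y 0 _ _ HX HY _ eq_refl) as [D1 D2].
  assert (Z : forall t, t <> 0 -> ev r (X t, Y t) = RtoC 0).
  { intros t Ht. apply H. unfold lin in *; simpl in *. unfold X, Y.
    replace (- sin phi * (x - t * sin phi) + cos phi * (y + t * cos phi)) with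
      ((- sin phi * x + cos phi * y) + t * (Rsqr (sin phi) + Rsqr (cos phi))) by (unfold Rsqr; ring).
    rewrite E, sin2_cos2. lra. }
  rewrite <- EX, <- EY. apply C_ext.
  - apply (continuous_punctured_zero (fun t => Re (ev r (X t, Y t)))).
    + exact (is_derive_cont _ _ _ D1).
    + intros t Ht. rewrite Z; auto.
  - apply (continuous_punctured_zero (fun t => Im (ev r (X t, Y t)))).
    + exact (is_derive_cont _ _ _ D2).
    + intros t Ht. rewrite Z; auto.
Qed.

(** Mirrors are removed one at a time. Multiplied by the linear form of the last mirror, r vanishes
    on that mirror too, so the induction applies to the product, and off the mirror the factor is
    cancelled. *)
Lemma lins_density n (theta : nat -> R) r :
  (forall x, (forall m, (m < n)%nat -> lin (theta m) x <> 0) -> ev r x = RtoC 0) ->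
  forall x, ev r x = RtoC 0.
Proof.
  revert r. induction n as [|n IH]; intros r H.
  - intros x; apply H; intros; lia.
  - apply (lin_density (theta n)). intros x Hx.
    assert (P : ev (PM (plin (theta n)) r) x = RtoC 0).
    { apply IH. intros y Hy. simpl ev. destruct (Req_dec (lin (theta n) y) 0) as [E|N].
      - pose proof (ev_plin (theta n) y) as P. simpl in P. rewrite P, E. ring.
      - rewrite (H y); [ring|]. intros m Hm. destruct (Nat.eq_dec m n) as [->|]; auto.
        apply Hy; lia. }
    change (ev (plin (theta n)) x * ev r x = 0)%C in P. rewrite ev_plin in P.
    assert (HC : RtoC (lin (theta n) x) <> RtoC 0) by (intros E; apply Hx; apply RtoC_inj; auto).
    transitivity (/ RtoC (lin (theta n) x) * (RtoC (lin (theta n) x) * ev r x))%C; [field; auto|].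
    rewrite P; ring.
Qed.

Lemma ev_eq_density phi p q :
  (forall x, lin phi x <> 0 -> ev p x = ev q x) -> forall x, ev p x = ev q x.
Proof.
  intros H x. assert (E := lin_density phi (PA p (PM (PC (- (1))%C) q))). simpl in E.
  transitivity (ev q x + (ev p x + - (1) * ev q x))%C; [ring|].
  rewrite E; [ring|]. intros y Hy; rewrite (H y Hy); ring.
Qed.

(** The quotient is determined off the mirror and, by density, everywhere. Later divided differences
    are computed by exhibiting a polynomial quotient. *)
Lemma dd_unique phi p q :
  (forall x, (ev p x - ev p (reflA phi x) = RtoC (lin phi x) * ev q x)%C) ->
  forall x, ev (dd phi p) x = ev q x.
Proof.
  intros H. apply (ev_eq_density phi). intros x Hx.
  assert (HC : RtoC (lin phi x) <> RtoC 0) by (intros E; apply Hx, RtoC_inj; auto).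
  transitivity (/ RtoC (lin phi x) * (RtoC (lin phi x) * ev (dd phi p) x))%C; [field; auto|].
  rewrite <- ev_dd, H. field; auto.
Qed.

Lemma dd_ext phi p q : (forall x, ev p x = ev q x) -> forall x, ev (dd phi p) x = ev (dd phi q) x.
Proof. intros H. apply dd_unique. intros x. rewrite !H. apply ev_dd. Qed.

(** * The Dunkl operators of two classes of mirrors, acting on polynomials *)

Definition angA (k j : nat) : R := PI * INR j / INR k.

(** [angA] and [angB] are the angles of the even and of the odd mirrors of I_{2k}. For odd k the
    first family alone consists of all mirrors of I_k, and the second one receives multiplicity
    0. *)
Definition angB (k j : nat) : R := PI * (2 * INR j + 1) / (2 * INR k).

Definition dsum (k : nat) (a b : R) (c : R -> R) (p : pol) : pol :=
  PA (PM (PC (RtoC a)) (psum k (fun j => PM (PC (RtoC (c (angA k j)))) (dd (angA k j) p))))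
     (PM (PC (RtoC b)) (psum k (fun j => PM (PC (RtoC (c (angB k j)))) (dd (angB k j) p)))).

Definition T1 k a b p := PA (dx p) (dsum k a b (fun t => (- sin t)%R) p).

Definition T2 k a b p := PA (dy p) (dsum k a b cos p).

(** [TB] and [TH] are the Dunkl analogues of twice the derivatives with respect to conj z and to
    z. *)
Definition TB k a b p := PA (T1 k a b p) (PM (PC Ci) (T2 k a b p)).

Definition TH k a b p := PA (T1 k a b p) (PM (PC (- Ci)%C) (T2 k a b p)).

Definition Lap k a b p := PA (T1 k a b (T1 k a b p)) (T2 k a b (T2 k a b p)).

Lemma ev_dsum k a b c p x : ev (dsum k a b c p) x =
  (RtoC a * csum k (fun j => RtoC (c (angA k j)) * ev (dd (angA k j) p) x) +
   RtoC b * csum k (fun j => RtoC (c (angB k j)) * ev (dd (angB k j) p) x))%C.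
Proof. unfold dsum; simpl. rewrite !ev_psum. reflexivity. Qed.

Lemma dsum_ext k a b c p q : (forall x, ev p x = ev q x) ->
  forall x, ev (dsum k a b c p) x = ev (dsum k a b c q) x.
Proof.
  intros H x. rewrite !ev_dsum. f_equal; f_equal; apply csum_ext; intros i _;
    f_equal; apply dd_ext; auto.
Qed.

Lemma T1_ext k a b p q : (forall x, ev p x = ev q x) ->
  forall x, ev (T1 k a b p) x = ev (T1 k a b q) x.
Proof. intros H x; unfold T1; cbn [ev]. rewrite (dx_ext p q), (dsum_ext _ _ _ _ p q); auto. Qed.

Lemma T2_ext k a b p q : (forall x, ev p x = ev q x) ->
  forall x, ev (T2 k a b p) x = ev (T2 k a b q) x.
Proof. intros H x; unfold T2; cbn [ev]. rewrite (dy_ext p q), (dsum_ext _ _ _ _ p q); auto. Qed.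

Lemma dsum_lin k a b c p q u v x :
  ev (dsum k a b c (PA (PM (PC u) p) (PM (PC v) q))) x =
  (u * ev (dsum k a b c p) x + v * ev (dsum k a b c q) x)%C.
Proof.
  rewrite !ev_dsum. simpl.
  assert (E : forall ang : nat -> R,
    csum k (fun j => (RtoC (c (ang j)) * (0 * ev p x + u * ev (dd (ang j) p) x +
      (0 * ev q x + v * ev (dd (ang j) q) x)))%C) =
    (u * csum k (fun j => RtoC (c (ang j)) * ev (dd (ang j) p) x) +
     v * csum k (fun j => RtoC (c (ang j)) * ev (dd (ang j) q) x))%C).
  { intros ang. rewrite <- !csum_mult, <- csum_plus. apply csum_ext; intros; ring. }
  rewrite !E. ring.
Qed.

Lemma T1_lin k a b p q u v x :
  ev (T1 k a b (PA (PM (PC u) p) (PM (PC v) q))) x =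
  (u * ev (T1 k a b p) x + v * ev (T1 k a b q) x)%C.
Proof.
  unfold T1.
  change (ev (dx (PA (PM (PC u) p) (PM (PC v) q))) x +
    ev (dsum k a b (fun t => (- sin t)%R) (PA (PM (PC u) p) (PM (PC v) q))) x =
    u * (ev (dx p) x + ev (dsum k a b (fun t => (- sin t)%R) p) x) +
    v * (ev (dx q) x + ev (dsum k a b (fun t => (- sin t)%R) q) x))%C.
  rewrite dsum_lin. simpl. ring.
Qed.

Lemma T2_lin k a b p q u v x :
  ev (T2 k a b (PA (PM (PC u) p) (PM (PC v) q))) x =
  (u * ev (T2 k a b p) x + v * ev (T2 k a b q) x)%C.
Proof.
  unfold T2.
  change (ev (dy (PA (PM (PC u) p) (PM (PC v) q))) x +
    ev (dsum k a b cos (PA (PM (PC u) p) (PM (PC v) q))) x =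
    u * (ev (dy p) x + ev (dsum k a b cos p) x) +
    v * (ev (dy q) x + ev (dsum k a b cos q) x))%C.
  rewrite dsum_lin. simpl. ring.
Qed.

Lemma T_of_comb (T : pol -> pol)
  (Hext : forall p q, (forall x, ev p x = ev q x) -> forall x, ev (T p) x = ev (T q) x)
  (Hlin : forall p q u v x, ev (T (PA (PM (PC u) p) (PM (PC v) q))) x =
     (u * ev (T p) x + v * ev (T q) x)%C) f p q u v :
  (forall x, ev f x = (u * ev p x + v * ev q x)%C) ->
  forall x, ev (T f) x = (u * ev (T p) x + v * ev (T q) x)%C.
Proof. intros H x. rewrite <- Hlin. apply Hext. intros y. rewrite H. reflexivity. Qed.

Lemma T1_comb k a b f p q u v : (forall x, ev f x = (u * ev p x + v * ev q x)%C) ->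
  forall x, ev (T1 k a b f) x = (u * ev (T1 k a b p) x + v * ev (T1 k a b q) x)%C.
Proof. apply (T_of_comb (T1 k a b)); [apply T1_ext|apply T1_lin]. Qed.

Lemma T2_comb k a b f p q u v : (forall x, ev f x = (u * ev p x + v * ev q x)%C) ->
  forall x, ev (T2 k a b f) x = (u * ev (T2 k a b p) x + v * ev (T2 k a b q) x)%C.
Proof. apply (T_of_comb (T2 k a b)); [apply T2_ext|apply T2_lin]. Qed.

Lemma Lap_comb k a b f p q u v : (forall x, ev f x = (u * ev p x + v * ev q x)%C) ->
  forall x, ev (Lap k a b f) x = (u * ev (Lap k a b p) x + v * ev (Lap k a b q) x)%C.
Proof.
  intros H x. unfold Lap.
  change (ev (T1 k a b (T1 k a b f)) x + ev (T2 k a b (T2 k a b f)) x =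
    u * (ev (T1 k a b (T1 k a b p)) x + ev (T2 k a b (T2 k a b p)) x) +
    v * (ev (T1 k a b (T1 k a b q)) x + ev (T2 k a b (T2 k a b q)) x))%C.
  rewrite (T1_comb k a b (T1 k a b f) (T1 k a b p) (T1 k a b q) u v) by (apply T1_comb; auto).
  rewrite (T2_comb k a b (T2 k a b f) (T2 k a b p) (T2 k a b q) u v) by (apply T2_comb; auto).
  ring.
Qed.

(** The two orders of composition produce the commutator of T_1 and T_2 with opposite signs, and it
    cancels in the sum. Harmonicity will be proved by showing that both compositions vanish. *)
Lemma Lap_TB_TH k a b p x :
  (ev (TH k a b (TB k a b p)) x + ev (TB k a b (TH k a b p)) x = 2 * ev (Lap k a b p) x)%C.
Proof.
  assert (E : forall s x, ev (PA (T1 k a b p) (PM (PC s) (T2 k a b p))) x =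
    (1 * ev (T1 k a b p) x + s * ev (T2 k a b p) x)%C) by (intros; simpl; ring).
  unfold TB, TH, Lap; cbn [ev].
  rewrite !(T1_comb k a b _ _ _ _ _ (E _)), !(T2_comb k a b _ _ _ _ _ (E _)).
  assert (S := Ci_sqr).
  transitivity (2 * ev (T1 k a b (T1 k a b p)) x - 2 * (Ci * Ci) * ev (T2 k a b (T2 k a b p)) x)%C;
    [ring|]. rewrite S; ring.
Qed.

Lemma hom_dsum k a b c z p : hom z p -> hom (z - 1) (dsum k a b c p).
Proof.
  intros H. apply hom_add; apply hom_scal; apply hom_psum; intros; apply hom_scal, hom_dd; auto.
Qed.

Lemma hom_T1 k a b z p : hom z p -> hom (z - 1) (T1 k a b p).
Proof. intros H; apply hom_add; [apply hom_dx|apply hom_dsum]; auto. Qed.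

Lemma hom_T2 k a b z p : hom z p -> hom (z - 1) (T2 k a b p).
Proof. intros H; apply hom_add; [apply hom_dy|apply hom_dsum]; auto. Qed.

Lemma hom_Lap k a b z p : hom z p -> hom (z - 2) (Lap k a b p).
Proof.
  intros H; replace (z - 2)%Z with (z - 1 - 1)%Z by lia.
  apply hom_add; [apply hom_T1, hom_T1|apply hom_T2, hom_T2]; auto.
Qed.

(** The one fact about the group and its multiplicity that enters the operators: a sum over all
    mirrors splits into two classes of k angles. It holds for I_{2k} and, with b = 0, for I_k. *)
Definition class_sum (N : nat) (kap : nat -> R) (k : nat) (a b : R) : Prop :=
  forall F : R -> R, fsum N (fun m => kap m * F (mirror_angle N m)) =
    a * fsum k (fun j => F (angA k j)) + b * fsum k (fun j => F (angB k j)).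

Lemma fsum_ext n f g : (forall i, (i < n)%nat -> f i = g i) -> fsum n f = fsum n g.
Proof.
  induction n as [|n IH]; intros H; simpl; auto.
  rewrite IH, H; auto.
Qed.

Lemma Re_csum n f : Re (csum n f) = fsum n (fun i => Re (f i)).
Proof. induction n as [|n IH]; simpl; auto. rewrite <- IH. reflexivity. Qed.

Lemma Re_scal r z : Re (RtoC r * z)%C = r * Re z.
Proof. unfold Re; simpl; ring. Qed.

Lemma Im_scal r z : Im (RtoC r * z)%C = r * Im z.
Proof. unfold Im; simpl; ring. Qed.

Lemma lin_root N m x : lin (mirror_angle N m) x = rdot N m x.
Proof. reflexivity. Qed.

Lemma dsum_link N kap k a b (c : R -> R) p x : class_sum N kap k a b -> regular N x ->
  fsum N (fun m => kap m * c (mirror_angle N m) *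
    (Re (ev p x) - Re (ev p (refl N m x))) / rdot N m x) = Re (ev (dsum k a b c p) x).
Proof.
  intros H Hr. rewrite ev_dsum.
  set (F := fun t => c t * Re (ev (dd t p) x)).
  transitivity (fsum N (fun m => kap m * F (mirror_angle N m))).
  - apply fsum_ext. intros m Hm. specialize (Hr m Hm). rewrite <- lin_root in *.
    change (refl N m x) with (reflA (mirror_angle N m) x).
    assert (E := f_equal Re (ev_dd (mirror_angle N m) p x)).
    rewrite Re_scal in E. change (Re (?u - ?v)%C) with (Re u - Re v) in E. unfold F.
    rewrite E. field. auto.
  - rewrite H. change (Re (?u + ?v)%C) with (Re u + Re v). rewrite !Re_scal, !Re_csum.
    f_equal; f_equal; apply fsum_ext; intros i _; unfold F; rewrite Re_scal; reflexivity.
Qed.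

Lemma dunkl1_ev N kap k a b p x : class_sum N kap k a b -> regular N x ->
  dunkl1 N kap (fun y => Re (ev p y)) x = Re (ev (T1 k a b p) x).
Proof.
  intros H Hr. unfold dunkl1, T1. cbn [ev].
  change (Re (?u + ?v)%C) with (Re u + Re v). f_equal.
  - destruct x as [x y]; simpl. apply is_derive_unique, ev_derive_x.
  - rewrite <- (dsum_link N kap); auto.
Qed.

Lemma dunkl2_ev N kap k a b p x : class_sum N kap k a b -> regular N x ->
  dunkl2 N kap (fun y => Re (ev p y)) x = Re (ev (T2 k a b p) x).
Proof.
  intros H Hr. unfold dunkl2, T2. cbn [ev].
  change (Re (?u + ?v)%C) with (Re u + Re v). f_equal.
  - destruct x as [x y]; simpl. apply is_derive_unique, ev_derive_y.
  - rewrite <- (dsum_link N kap); auto.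
Qed.

Lemma lin_reflA phi psi x : lin psi (reflA phi x) = - lin (2 * phi - psi) x.
Proof. unfold lin, reflA; simpl. rewrite sin_minus, cos_minus. ring. Qed.

Lemma lin_PI phi x : lin (phi + PI) x = - lin phi x.
Proof. unfold lin. rewrite neg_sin, neg_cos. ring. Qed.

(** A reflection permutes the mirrors: the m-th one carries the i-th to the one of index 2m - i
    modulo N. The second Dunkl operator evaluates the first at reflected points, where the quotient
    formula must remain meaningful. *)
Lemma regular_refl N m x : (m < N)%nat -> regular N x -> regular N (refl N m x).
Proof.
  intros Hm Hr i Hi. rewrite <- lin_root.
  change (refl N m x) with (reflA (mirror_angle N m) x). rewrite lin_reflA.
  assert (HN : INR N <> 0) by (apply not_0_INR; lia).
  assert (L : exists i', (i' < N)%nat /\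
    (lin (2 * mirror_angle N m - mirror_angle N i) x = rdot N i' x \/
     lin (2 * mirror_angle N m - mirror_angle N i) x = - rdot N i' x)).
  (* Reduction of 2m - i modulo N. Each shift of the index by N turns the angle by PI and changes
     the sign of the linear form. *)
  { destruct (le_lt_dec i (2 * m)) as [L1|L1]; [destruct (le_lt_dec N (2 * m - i)) as [L2|L2]|].
    - exists (2 * m - i - N)%nat. split; [lia|right]. rewrite <- lin_root, <- lin_PI. f_equal.
      unfold mirror_angle. rewrite !minus_INR, mult_INR by lia. simpl; field; auto.
    - exists (2 * m - i)%nat. split; [lia|left]. rewrite <- lin_root. f_equal.
      unfold mirror_angle. rewrite !minus_INR, mult_INR by lia. simpl; field; auto.
    - exists (2 * m + N - i)%nat. split; [lia|right].
      rewrite <- lin_root. rewrite <- (Ropp_involutive (lin (_ - _) x)), <- lin_PI.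
      f_equal. f_equal.
      unfold mirror_angle. rewrite !minus_INR, plus_INR, mult_INR by lia. simpl; field; auto. }
  destruct L as (i' & Hi' & [E|E]); rewrite E; specialize (Hr i' Hi'); lra.
Qed.

Lemma locally_nonzero (f : R -> R) x : continuous f x -> f x <> 0 -> locally x (fun t => f t <> 0).
Proof.
  intros Hc Hn. apply (Hc (fun y => y <> 0)).
  assert (Hp : 0 < Rabs (f x)) by (apply Rabs_pos_lt; auto).
  exists (mkposreal _ Hp). intros y Hy Ey. subst y.
  unfold ball in Hy; simpl in Hy. unfold AbsRing_ball, abs, minus, plus, opp in Hy; simpl in Hy.
  rewrite Rplus_0_l, Rabs_Ropp in Hy. lra.
Qed.

Lemma locally_forall_lt (P : nat -> R -> Prop) (x : R) n :
  (forall m, (m < n)%nat -> locally x (P m)) -> locally x (fun t => forall m, (m < n)%nat -> P m t).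
Proof.
  induction n as [|n IH]; intros H.
  - apply filter_forall; intros; lia.
  - apply (filter_imp (fun t => (forall m, (m < n)%nat -> P m t) /\ P n t)).
    + intros t [H1 H2] m Hm. destruct (Nat.eq_dec m n) as [->|]; auto. apply H1; lia.
    + apply filter_and; auto.
Qed.

Lemma regular_locally_x N x y : regular N (x, y) -> locally x (fun t => regular N (t, y)).
Proof.
  intros H. apply locally_forall_lt. intros m Hm.
  apply (locally_nonzero (fun t => rdot N m (t, y))); [|apply H; auto].
  unfold rdot; simpl. eapply is_derive_cont. auto_derive; auto.
Qed.

Lemma regular_locally_y N x y : regular N (x, y) -> locally y (fun t => regular N (x, t)).
Proof.
  intros H. apply locally_forall_lt. intros m Hm.
  apply (locally_nonzero (fun t => rdot N m (x, t))); [|apply H; auto].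
  unfold rdot; simpl. eapply is_derive_cont. auto_derive; auto.
Qed.

(** Regular points form an open set stable under the reflections, so at such a point both the
    derivative and the difference part depend only on values at regular points. *)
Lemma dunkl1_local N kap f g x : (forall y, regular N y -> f y = g y) -> regular N x ->
  dunkl1 N kap f x = dunkl1 N kap g x.
Proof.
  intros H Hr. unfold dunkl1. f_equal.
  - apply Derive_ext_loc. destruct x as [x y]; simpl.
    apply (filter_imp (fun t => regular N (t, y))); [intros; apply H; auto|].
    apply regular_locally_x; auto.
  - apply fsum_ext; intros m Hm. rewrite !H; auto. apply regular_refl; auto.
Qed.

Lemma dunkl2_local N kap f g x : (forall y, regular N y -> f y = g y) -> regular N x ->
  dunkl2 N kap f x = dunkl2 N kap g x.
Proof.
  intros H Hr. unfold dunkl2. f_equal.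
  - apply Derive_ext_loc. destruct x as [x y]; simpl.
    apply (filter_imp (fun t => regular N (x, t))); [intros; apply H; auto|].
    apply regular_locally_y; auto.
  - apply fsum_ext; intros m Hm. rewrite !H; auto. apply regular_refl; auto.
Qed.

Lemma dunkl_lap_ev N kap k a b p x : class_sum N kap k a b -> regular N x ->
  dunkl_lap N kap (fun y => Re (ev p y)) x = Re (ev (Lap k a b p) x).
Proof.
  intros H Hr. unfold dunkl_lap.
  rewrite (dunkl1_local N kap _ (fun y => Re (ev (T1 k a b p) y))) by
    (auto; intros; apply dunkl1_ev; auto).
  rewrite (dunkl2_local N kap _ (fun y => Re (ev (T2 k a b p) y))) by
    (auto; intros; apply dunkl2_ev; auto).
  rewrite (dunkl1_ev N kap k a b), (dunkl2_ev N kap k a b); auto.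
Qed.

Lemma ev_dx_pconj p x : ev (dx (pconj p)) x = Cconj (ev (dx p) x).
Proof.
  induction p as [c| | |p IHp q IHq|p IHp q IHq]; simpl; rewrite ?Cconj_RtoC; auto.
  - rewrite IHp, IHq, Cplus_conj; auto.
  - rewrite IHp, IHq, Cplus_conj, !Cmult_conj, !ev_pconj; auto.
Qed.

Lemma ev_dy_pconj p x : ev (dy (pconj p)) x = Cconj (ev (dy p) x).
Proof.
  induction p as [c| | |p IHp q IHq|p IHp q IHq]; simpl; rewrite ?Cconj_RtoC; auto.
  - rewrite IHp, IHq, Cplus_conj; auto.
  - rewrite IHp, IHq, Cplus_conj, !Cmult_conj, !ev_pconj; auto.
Qed.

Lemma ev_dd_pconj phi p x : ev (dd phi (pconj p)) x = Cconj (ev (dd phi p) x).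
Proof.
  rewrite <- ev_pconj. revert x. apply dd_unique. intros x.
  rewrite !ev_pconj, <- Cminus_conj, ev_dd, Cmult_conj, Cconj_RtoC. reflexivity.
Qed.

Lemma ev_dsum_pconj k a b c p x : ev (dsum k a b c (pconj p)) x = Cconj (ev (dsum k a b c p) x).
Proof.
  rewrite !ev_dsum, Cplus_conj, !Cmult_conj, !Cconj_RtoC, !csum_conj.
  f_equal; f_equal; apply csum_ext; intros i _;
    rewrite Cmult_conj, Cconj_RtoC, ev_dd_pconj; reflexivity.
Qed.

Lemma ev_T1_pconj k a b p x : ev (T1 k a b (pconj p)) x = Cconj (ev (T1 k a b p) x).
Proof. unfold T1; cbn [ev]. rewrite ev_dx_pconj, ev_dsum_pconj, Cplus_conj. reflexivity. Qed.

Lemma ev_T2_pconj k a b p x : ev (T2 k a b (pconj p)) x = Cconj (ev (T2 k a b p) x).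
Proof. unfold T2; cbn [ev]. rewrite ev_dy_pconj, ev_dsum_pconj, Cplus_conj. reflexivity. Qed.

Lemma ev_Lap_pconj k a b p x : ev (Lap k a b (pconj p)) x = Cconj (ev (Lap k a b p) x).
Proof.
  unfold Lap; cbn [ev].
  rewrite (T1_ext k a b (T1 k a b (pconj p)) (pconj (T1 k a b p))),
    (T2_ext k a b (T2 k a b (pconj p)) (pconj (T2 k a b p))).
  - rewrite ev_T1_pconj, ev_T2_pconj, Cplus_conj; auto.
  - intros; rewrite ev_T2_pconj, ev_pconj; auto.
  - intros; rewrite ev_T1_pconj, ev_pconj; auto.
Qed.

Definition phpoly (j : nat) (c : nat -> R) : pol :=
  psum (S j) (fun i => PM (PM (PC (RtoC (c i))) (ppow PX i)) (ppow PY (j - i))).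

Lemma csum_RtoC n f : csum n (fun i => RtoC (f i)) = RtoC (fsum n f).
Proof. induction n as [|n IH]; simpl; auto. rewrite IH, RtoC_plus; auto. Qed.

Lemma ev_phpoly j c x : ev (phpoly j c) x = RtoC (hpoly j c x).
Proof.
  unfold phpoly, hpoly. rewrite ev_psum, <- csum_RtoC. apply csum_ext; intros i _.
  simpl. rewrite !ev_ppow, !RtoC_mult, !RtoC_pow. reflexivity.
Qed.

Lemma hom_phpoly j c : hom (Z.of_nat j) (phpoly j c).
Proof.
  apply hom_psum; intros i Hi.
  eapply hom_mul; [apply hom_scal, hom_ppow, hom_X|apply hom_ppow, hom_Y|lia].
Qed.

(** Harmonicity is given off the mirrors only; density over the N mirrors extends it to the
    plane. *)
Lemma dunkl_harmonic_Lap N kap k a b j c : class_sum N kap k a b ->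
  dunkl_harmonic N kap j c -> forall x, ev (Lap k a b (phpoly j c)) x = RtoC 0.
Proof.
  intros H Hh. apply (lins_density N (mirror_angle N)). intros x Hx.
  assert (Hr : regular N x) by exact Hx.
  assert (E : Re (ev (Lap k a b (phpoly j c)) x) = 0).
  { rewrite <- (dunkl_lap_ev N kap); auto. rewrite <- (Hh x Hr). f_equal.
    extensionality y. rewrite ev_phpoly; reflexivity. }
  (* Real coefficients make the polynomial equal to its conjugate, so its Laplacian is real and the
     vanishing of the real part suffices. *)
  assert (F : ev (Lap k a b (phpoly j c)) x = Cconj (ev (Lap k a b (phpoly j c)) x)).
  { rewrite <- ev_Lap_pconj. transitivity (1 * ev (Lap k a b (pconj (phpoly j c))) x +
      0 * ev (Lap k a b (pconj (phpoly j c))) x)%C; [|ring].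
    apply Lap_comb. intros y. rewrite ev_pconj, ev_phpoly, Cconj_RtoC. ring. }
  apply C_ext; auto. apply (f_equal Im) in F. rewrite im_conj in F.
  change (Im (RtoC 0)) with 0. lra.
Qed.

Definition is_hpolyC (n : nat) (f : C -> C) : Prop :=
  exists c : nat -> C, forall x,
    f x = csum (S n) (fun i => c i * RtoC (fst x) ^ i * RtoC (snd x) ^ (n - i))%C.

(** Brings an expression to the monomial form in which the reproducing property speaks of
    polynomials. In x p1 + y p2 the first term shifts the coefficients by one, the second keeps
    their places. *)
Lemma hom_hpolyC n : forall p, hom (Z.of_nat n) p -> is_hpolyC n (ev p).
Proof.
  induction n as [|n IH]; intros p Hp.
  - destruct (hom_0_const p Hp) as [c Hc]. exists (fun _ => c). intros x. rewrite Hc. simpl. ring.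
  - destruct (hom_decomp _ _ Hp ltac:(lia)) as (p1 & p2 & H1 & H2 & E).
    replace (Z.of_nat (S n) - 1)%Z with (Z.of_nat n) in H1, H2 by lia.
    destruct (IH _ H1) as [c1 E1], (IH _ H2) as [c2 E2].
    exists (fun i => ((match i with O => 0 | S i' => c1 i' end) +
      (if Nat.ltb i (S n) then c2 i else 0))%C).
    intros x. rewrite E, E1, E2, <- !csum_mult.
    set (X := RtoC (fst x)); set (Y := RtoC (snd x)).
    transitivity (csum (S (S n)) (fun i => match i with O => 0 | S i' => c1 i' end * X ^ i * Y ^ (S n - i))
      + csum (S (S n)) (fun i => (if Nat.ltb i (S n) then c2 i else 0) * X ^ i * Y ^ (S n - i)))%C.
    2: { rewrite <- csum_plus. apply csum_ext; intros i _. ring. }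
    f_equal.
    + symmetry. rewrite csum_S_l. simpl (S n - S _)%nat. rewrite Cmult_0_l, Cmult_0_l, Cplus_0_l.
      apply csum_ext; intros i _. rewrite Cpow_S. ring.
    + change (csum (S (S n)) ?f) with (csum (S n) f + f (S n))%C. cbv beta.
      rewrite Nat.ltb_irrefl, Cmult_0_l, Cmult_0_l, Cplus_0_r.
      apply csum_ext; intros i Hi. replace (Nat.ltb i (S n)) with true by
        (symmetry; apply Nat.ltb_lt; auto).
      replace (S n - i)%nat with (S (n - i)) by lia. rewrite Cpow_S. ring.
Qed.

Lemma Lap_dunkl_harmonic N kap k a b n p : class_sum N kap k a b ->
  hom (Z.of_nat n) p -> (forall x, ev (Lap k a b p) x = RtoC 0) ->
  exists c, dunkl_harmonic N kap n c /\ forall x, hpoly n c x = Re (ev p x).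
Proof.
  intros H Hp HL. destruct (hom_hpolyC n p Hp) as [c Hc].
  assert (E : forall x, hpoly n (fun i => Re (c i)) x = Re (ev p x)).
  { intros x. rewrite Hc, Re_csum. unfold hpoly. apply fsum_ext; intros i _.
    rewrite <- !RtoC_pow. unfold Re; simpl. ring. }
  exists (fun i => Re (c i)). split; auto.
  intros x Hx. replace (hpoly n (fun i => Re (c i))) with (fun y => Re (ev p y)).
  - rewrite (dunkl_lap_ev N kap k a b); auto. rewrite HL; reflexivity.
  - extensionality y; auto.
Qed.

(** * Lifting from the group with two mirrors *)

Definition E (t : R) : C := (cos t, sin t).

Lemma E_plus s t : E (s + t) = (E s * E t)%C.
Proof. unfold E, Cmult; simpl. rewrite cos_plus, sin_plus. f_equal; ring. Qed.

Lemma E_0 : E 0 = RtoC 1.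
Proof. unfold E. rewrite cos_0, sin_0. reflexivity. Qed.

Lemma E_pow t n : (E t ^ n)%C = E (INR n * t).
Proof.
  induction n as [|n IH].
  - simpl. rewrite Rmult_0_l, E_0. reflexivity.
  - rewrite Cpow_S, IH, <- E_plus, S_INR. f_equal; ring.
Qed.

Lemma E_conj t : Cconj (E t) = E (- t).
Proof. unfold E, Cconj; simpl. rewrite cos_neg, sin_neg. reflexivity. Qed.

Lemma E_neg_mult t : (E (- t) * E t)%C = RtoC 1.
Proof. rewrite <- E_plus, Rplus_opp_l. apply E_0. Qed.

Lemma E_2PI : E (2 * PI) = RtoC 1.
Proof. unfold E. rewrite cos_2PI, sin_2PI. reflexivity. Qed.

Lemma E_2PI_nat n : E (2 * PI * INR n) = RtoC 1.
Proof. rewrite Rmult_comm, <- E_pow, E_2PI, Cpow_1_l. reflexivity. Qed.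

Lemma E_PI : E PI = (- (1))%C.
Proof. unfold E. rewrite cos_PI, sin_PI. unfold Copp, RtoC; simpl; f_equal; ring. Qed.

Lemma E_neq_1 t : 0 < t < 2 * PI -> E t <> RtoC 1.
Proof.
  intros Ht H. apply (f_equal fst) in H. simpl in H.
  replace t with (2 * (t / 2)) in H by field. rewrite cos_2a_sin in H.
  assert (S : 0 < sin (t / 2)) by (apply sin_gt_0; lra).
  assert (0 < sin (t / 2) * sin (t / 2)) by (apply Rmult_lt_0_compat; auto). lra.
Qed.

(** The quotient (u^n - v^n) / (u - v), meaningful for u = v as well. *)
Definition geo (n : nat) (u v : C) : C := csum n (fun s => (u ^ (n - 1 - s) * v ^ s)%C).

Lemma geo_S n u v : geo (S n) u v = (u * geo n u v + v ^ n)%C.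
Proof.
  unfold geo at 1. cbn [csum]. f_equal.
  - unfold geo. rewrite <- csum_mult. apply csum_ext; intros i Hi.
    replace (S n - 1 - i)%nat with (S (n - 1 - i)) by lia. rewrite Cpow_S. ring.
  - replace (S n - 1 - n)%nat with 0%nat by lia. simpl; ring.
Qed.

Lemma geo_mult n u v : ((u - v) * geo n u v)%C = (u ^ n - v ^ n)%C.
Proof.
  induction n as [|n IH].
  - unfold geo; simpl; ring.
  - rewrite geo_S, !Cpow_S.
    transitivity (u * ((u - v) * geo n u v) + (u - v) * v ^ n)%C; [ring|]. rewrite IH; ring.
Qed.

Lemma root_sum t0 k m : (0 < m < k)%nat ->
  csum k (fun j => (E (t0 + 2 * PI * INR j / INR k) ^ m)%C) = RtoC 0.
Proof.
  intros Hm. assert (Hk : INR k <> 0) by (apply not_0_INR; lia).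
  set (r := E (2 * PI * INR m / INR k)).
  assert (Hr : r <> RtoC 1).
  { apply E_neq_1. assert (0 < INR m < INR k) by (split; [apply lt_0_INR|apply lt_INR]; lia).
    assert (P := PI_RGT_0). split.
    - apply Rdiv_lt_0_compat; nra.
    - apply Rmult_lt_reg_r with (INR k); [lra|]. unfold Rdiv.
      rewrite Rmult_assoc, Rinv_l, Rmult_1_r; nra. }
  assert (E1 : forall j, (E (t0 + 2 * PI * INR j / INR k) ^ m)%C = (E (INR m * t0) * r ^ j)%C).
  { intros j. unfold r. rewrite !E_pow, <- E_plus. f_equal. field; auto. }
  transitivity (csum k (fun j => (E (INR m * t0) * r ^ j)%C)); [apply csum_ext; auto|].
  rewrite (csum_mult _ _ (fun j => (r ^ j)%C)).
  assert (G : ((1 - r) * csum k (fun j => r ^ j))%C = RtoC 0).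
  { transitivity ((1 - r) * geo k 1 r)%C.
    - f_equal. apply csum_ext; intros i _. rewrite Cpow_1_l; ring.
    - rewrite geo_mult. unfold r. rewrite E_pow, Cpow_1_l.
      replace (INR k * (2 * PI * INR m / INR k)) with (2 * PI * INR m) by (field; auto).
      rewrite E_2PI_nat. ring. }
  assert (H1 : (1 - r)%C <> RtoC 0).
  { intros H. apply Hr. transitivity (1 - (1 - r))%C; [ring|]. rewrite H; ring. }
  assert (G0 : csum k (fun j => (r ^ j)%C) = RtoC 0).
  { transitivity (/ (1 - r) * ((1 - r) * csum k (fun j => r ^ j)))%C; [field; auto|].
    rewrite G; ring. }
  rewrite G0; ring.
Qed.

(** The reflection in a mirror of angle t is z -> E(2t) conj z. Over one class of mirrors the phases
    E(2t) are the k-th roots of [eps], which is 1 for the even and -1 for the odd mirrors. *)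
Definition root_family (k : nat) (eps : C) (rho : nat -> C) : Prop :=
  (forall j, (rho j ^ k)%C = eps) /\
  (forall m, (0 < m < k)%nat -> csum k (fun j => (rho j ^ m)%C) = RtoC 0).

Lemma root_family_A k : (1 <= k)%nat -> root_family k 1 (fun j => E (2 * angA k j)).
Proof.
  intros Hk. assert (HN : INR k <> 0) by (apply not_0_INR; lia). split.
  - intros j. rewrite E_pow. unfold angA.
    replace (INR k * (2 * (PI * INR j / INR k))) with (2 * PI * INR j) by (field; auto).
    apply E_2PI_nat.
  - intros m Hm. rewrite <- (root_sum 0 k m Hm) at 1. apply csum_ext; intros i _.
    f_equal. f_equal. unfold angA. field; auto.
Qed.

Lemma root_family_B k : (1 <= k)%nat -> root_family k (- (1))%C (fun j => E (2 * angB k j)).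
Proof.
  intros Hk. assert (HN : INR k <> 0) by (apply not_0_INR; lia). split.
  - intros j. rewrite E_pow. unfold angB.
    replace (INR k * (2 * (PI * (2 * INR j + 1) / (2 * INR k)))) with (2 * PI * INR j + PI)
      by (field; auto).
    rewrite E_plus, E_2PI_nat, E_PI. ring.
  - intros m Hm. rewrite <- (root_sum (PI / INR k) k m Hm) at 1. apply csum_ext; intros i _.
    f_equal. f_equal. unfold angB. field; auto.
Qed.

Lemma csum_const n c : csum n (fun _ => c) = (RtoC (INR n) * c)%C.
Proof.
  induction n as [|n IH]; [simpl; ring|]. cbn [csum]. rewrite IH, S_INR, RtoC_plus. ring.
Qed.

Lemma root_family_geo k eps rho l i u v : root_family k eps rho ->
  csum k (fun j => (rho j ^ i * geo l u (rho j * v))%C) =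
  csum l (fun s => (u ^ (l - 1 - s) * v ^ s * csum k (fun j => rho j ^ (i + s)))%C).
Proof.
  intros _. unfold geo.
  rewrite (csum_ext k _ (fun j => csum l (fun s => (u ^ (l - 1 - s) * v ^ s * rho j ^ (i + s))%C))).
  - rewrite csum_swap. apply csum_ext; intros s _. rewrite csum_mult. reflexivity.
  - intros j _. rewrite <- csum_mult. apply csum_ext; intros s _.
    rewrite Cpow_mult_l, Cpow_add_r. ring.
Qed.

(** The exponents of [rho j] run from 1 to l, below k, so every power sum vanishes. For l = k the
    exponent k is reached once, and without the extra factor [rho j] the exponent 0 survives: these
    are the next two lemmas. *)
Lemma root_geo_0 k eps rho l u v : root_family k eps rho -> (l < k)%nat ->
  csum k (fun j => (rho j * geo l u (rho j * v))%C) = RtoC 0.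
Proof.
  intros H Hl.
  rewrite (csum_ext k _ (fun j => (rho j ^ 1 * geo l u (rho j * v))%C)) by
    (intros; rewrite Cpow_1_r; auto).
  rewrite (root_family_geo k eps) by auto. apply csum_zero; intros s Hs.
  rewrite (proj2 H) by lia. ring.
Qed.

Lemma root_geo_k k eps rho u v : root_family k eps rho -> (1 <= k)%nat ->
  csum k (fun j => (rho j * geo k u (rho j * v))%C) = (RtoC (INR k) * eps * v ^ (k - 1))%C.
Proof.
  intros H Hk.
  rewrite (csum_ext k _ (fun j => (rho j ^ 1 * geo k u (rho j * v))%C)) by
    (intros; rewrite Cpow_1_r; auto).
  rewrite (root_family_geo k eps), (csum_single k _ (k - 1)) by
    (auto; try lia; intros s Hs Hn; rewrite (proj2 H) by lia; ring).
  replace (k - 1 - (k - 1))%nat with 0%nat by lia. replace (1 + (k - 1))%nat with k by lia.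
  rewrite (csum_ext k _ (fun _ => eps)) by (intros; apply (proj1 H)).
  rewrite csum_const. simpl; ring.
Qed.

Lemma root_geo_S k eps rho l u v : root_family k eps rho -> (S l <= k)%nat ->
  csum k (fun j => geo (S l) u (rho j * v)) = (RtoC (INR k) * u ^ l)%C.
Proof.
  intros H Hl.
  rewrite (csum_ext k _ (fun j => (rho j ^ 0 * geo (S l) u (rho j * v))%C)) by
    (intros; simpl; ring).
  rewrite (root_family_geo k eps), (csum_single (S l) _ 0) by
    (auto; try lia; intros s Hs Hn; rewrite (proj2 H) by lia; ring).
  simpl (0 + 0)%nat. rewrite (csum_ext k _ (fun _ => RtoC 1)) by (intros; reflexivity).
  rewrite csum_const. replace (S l - 1 - 0)%nat with l by lia. simpl; ring.
Qed.

(** * The group with two mirrors and lifting along z -> z^k *)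

Definition prx (p : pol) := psubst p (PM (PC (- (1))%C) PX) PY.

Definition pry (p : pol) := psubst p PX (PM (PC (- (1))%C) PY).

Lemma ev_prx p x : ev (prx p) x = ev p (- Cconj x)%C.
Proof.
  apply ev_psubst; cbn [ev].
  - change (fst (- Cconj x)%C) with (- fst x). rewrite RtoC_opp; ring.
  - change (snd (- Cconj x)%C) with (- - snd x). rewrite Ropp_involutive; reflexivity.
Qed.

Lemma ev_pry p x : ev (pry p) x = ev p (Cconj x).
Proof.
  apply ev_psubst; cbn [ev].
  - reflexivity.
  - change (snd (Cconj x)) with (- snd x). rewrite RtoC_opp; ring.
Qed.

Fixpoint ddx (p : pol) : pol :=
  match p with
  | PC _ => PC 0 | PX => PC 2 | PY => PC 0
  | PA p q => PA (ddx p) (ddx q)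
  | PM p q => PA (PM (ddx p) q) (PM (prx p) (ddx q))
  end.

Fixpoint ddy (p : pol) : pol :=
  match p with
  | PC _ => PC 0 | PX => PC 0 | PY => PC 2
  | PA p q => PA (ddy p) (ddy q)
  | PM p q => PA (PM (ddy p) q) (PM (pry p) (ddy q))
  end.

Lemma ev_ddx p x : (ev p x - ev (prx p) x)%C = (RtoC (fst x) * ev (ddx p) x)%C.
Proof.
  induction p as [c| | |p IHp q IHq|p IHp q IHq]; try (simpl; ring).
  - unfold prx in *; simpl. transitivity ((ev p x - ev (prx p) x) + (ev q x - ev (prx q) x))%C;
      [unfold prx; ring|]. unfold prx; rewrite IHp, IHq; ring.
  - unfold prx in *; simpl.
    transitivity ((ev p x - ev (prx p) x) * ev q x + ev (prx p) x * (ev q x - ev (prx q) x))%C;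
      [unfold prx; ring|]. unfold prx; rewrite IHp, IHq; ring.
Qed.

Lemma ev_ddy p x : (ev p x - ev (pry p) x)%C = (RtoC (snd x) * ev (ddy p) x)%C.
Proof.
  induction p as [c| | |p IHp q IHq|p IHp q IHq]; try (simpl; ring).
  - unfold pry in *; simpl. transitivity ((ev p x - ev (pry p) x) + (ev q x - ev (pry q) x))%C;
      [unfold pry; ring|]. unfold pry; rewrite IHp, IHq; ring.
  - unfold pry in *; simpl.
    transitivity ((ev p x - ev (pry p) x) * ev q x + ev (pry p) x * (ev q x - ev (pry q) x))%C;
      [unfold pry; ring|]. unfold pry; rewrite IHp, IHq; ring.
Qed.

(** Rank-one Dunkl operators in the coordinates of Z = z^k. Mirrors of multiplicity a are the zeros
    of Im z^k and those of multiplicity b the zeros of Re z^k; therefore b goes with x and a with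
    y. *)
Definition t1 (b : R) (p : pol) : pol := PA (dx p) (PM (PC (RtoC b)) (ddx p)).

Definition t2 (a : R) (p : pol) : pol := PA (dy p) (PM (PC (RtoC a)) (ddy p)).

Definition tb (a b : R) (p : pol) : pol := PA (t1 b p) (PM (PC Ci) (t2 a p)).

Definition th (a b : R) (p : pol) : pol := PA (t1 b p) (PM (PC (- Ci)%C) (t2 a p)).

Definition PReZ (k : nat) : pol := PM (PC (/ 2)%C) (PA (ppow PZ k) (ppow PZb k)).

Definition PImZ (k : nat) : pol :=
  PM (PC (/ (2 * Ci))%C) (PA (ppow PZ k) (PM (PC (- (1))%C) (ppow PZb k))).

Lemma C2_neq_0 : RtoC 2 <> RtoC 0.
Proof. intros H; apply RtoC_inj in H; lra. Qed.

Lemma Ci_neq_0 : Ci <> RtoC 0.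
Proof. intros H; apply (f_equal snd) in H; simpl in H; lra. Qed.

Lemma ev_PReZ k x : ev (PReZ k) x = RtoC (Re (x ^ k)%C).
Proof.
  unfold PReZ; cbn [ev]. rewrite !ev_ppow, ev_PZ, ev_PZb, <- Cpow_conj, re_alt.
  unfold Cdiv; ring.
Qed.

Lemma ev_PImZ k x : ev (PImZ k) x = RtoC (Im (x ^ k)%C).
Proof.
  unfold PImZ; cbn [ev]. rewrite !ev_ppow, ev_PZ, ev_PZb, <- Cpow_conj, im_alt.
  unfold Cdiv; ring.
Qed.

Definition pcomp (k : nat) (g : pol) : pol := psubst g (PReZ k) (PImZ k).

(* [z^l g(z^k)]: on such functions the Dunkl operators for [k] reduce to those for [k = 1] applied to [g]. *)
Definition plift (l k : nat) (g : pol) : pol := PM (ppow PZ l) (pcomp k g).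

Lemma ev_pcomp k g x : ev (pcomp k g) x = ev g (x ^ k)%C.
Proof. apply ev_psubst; [apply ev_PReZ|apply ev_PImZ]. Qed.

Lemma ev_plift l k g x : ev (plift l k g) x = (x ^ l * ev g (x ^ k))%C.
Proof. unfold plift; cbn [ev]. rewrite ev_ppow, ev_PZ, ev_pcomp. reflexivity. Qed.

Lemma hom_PReZ k : hom (Z.of_nat k) (PReZ k).
Proof.
  apply hom_scal, hom_add.
  - replace (Z.of_nat k) with (1 * Z.of_nat k)%Z by lia. apply hom_ppow, hom_PZ.
  - replace (Z.of_nat k) with (1 * Z.of_nat k)%Z by lia. apply hom_ppow, hom_PZb.
Qed.

Lemma hom_PImZ k : hom (Z.of_nat k) (PImZ k).
Proof.
  apply hom_scal, hom_add; [|apply hom_scal].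
  - replace (Z.of_nat k) with (1 * Z.of_nat k)%Z by lia. apply hom_ppow, hom_PZ.
  - replace (Z.of_nat k) with (1 * Z.of_nat k)%Z by lia. apply hom_ppow, hom_PZb.
Qed.

Lemma hom_plift l k q g : hom q g -> hom (Z.of_nat l + Z.of_nat k * q) (plift l k g).
Proof.
  intros H. apply (hom_mul (1 * Z.of_nat l) (Z.of_nat k * q)); try lia.
  - apply hom_ppow, hom_PZ.
  - apply hom_psubst; auto using hom_PReZ, hom_PImZ.
Qed.

Lemma reflA_E phi x : reflA phi x = (E (2 * phi) * Cconj x)%C.
Proof. unfold reflA, E, Cconj, Cmult; simpl. f_equal; ring. Qed.

Lemma lin_E phi x : (x - E (2 * phi) * Cconj x)%C = (2 * Ci * E phi * RtoC (lin phi x))%C.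
Proof.
  destruct x as [u v]. replace (2 * phi) with (phi + phi) by ring. rewrite E_plus.
  assert (S := sin2_cos2 phi). unfold Rsqr in S.
  assert (Su : sin phi * sin phi * u + cos phi * cos phi * u = u) by (rewrite <- Rmult_plus_distr_r, S; ring).
  assert (Sv : sin phi * sin phi * v + cos phi * cos phi * v = v) by (rewrite <- Rmult_plus_distr_r, S; ring).
  unfold E, lin, Cconj, Cmult, Cminus, Cplus, Copp, RtoC, Ci; simpl. f_equal.
  - rewrite <- Su at 1. ring.
  - rewrite <- Sv at 1. ring.
Qed.

Definition pgeo (n : nat) (p q : pol) : pol := psum n (fun s => PM (ppow p (n - 1 - s)) (ppow q s)).

Lemma ev_pgeo n p q x : ev (pgeo n p q) x = geo n (ev p x) (ev q x).
Proof.
  unfold pgeo, geo. rewrite ev_psum. apply csum_ext; intros; cbn [ev]. rewrite !ev_ppow; auto.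
Qed.

(** The reflected point w satisfies w^k = eps conj(y^k), the same for all mirrors of a class. Both
    y^l - w^l and y^k - w^k contain the factor y - w, which is the linear form times 2 i E(phi); the
    second one comes from the difference of g. *)
Lemma ev_dd_plift phi l k eps g dq :
  (E (2 * phi) ^ k)%C = eps ->
  (forall y, (ev g y - ev g (eps * Cconj y) = (y - eps * Cconj y) * ev dq y)%C) ->
  (exists g', forall y, ev g' y = ev g (eps * Cconj y)%C) ->
  forall x, ev (dd phi (plift l k g)) x = (2 * Ci * E phi *
    (geo l x (E (2 * phi) * Cconj x) * ev g (eps * Cconj (x ^ k)) +
     x ^ l * ev dq (x ^ k) * geo k x (E (2 * phi) * Cconj x)))%C.
Proof.
  intros He Hq [g' Hg'] x.
  set (G := fun n => pgeo n PZ (PM (PC (E (2 * phi))) PZb)).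
  set (Q := PM (PC (2 * Ci * E phi)%C) (PA (PM (G l) (pcomp k g')) (PM (PM (ppow PZ l) (pcomp k dq)) (G k)))).
  assert (EG : forall n y, ev (G n) y = geo n y (E (2 * phi) * Cconj y)).
  { intros n y. unfold G. rewrite ev_pgeo. cbn [ev]. rewrite ev_PZ, ev_PZb. reflexivity. }
  rewrite (dd_unique phi (plift l k g) Q).
  - unfold Q; cbn [ev]. rewrite !EG, !ev_pcomp, ev_ppow, ev_PZ, Hg'. reflexivity.
  - intros y. unfold Q; cbn [ev]. rewrite !EG, !ev_pcomp, ev_ppow, ev_PZ, Hg', !ev_plift, reflA_E.
    set (w := (E (2 * phi) * Cconj y)%C). set (z := (y ^ k)%C).
    assert (Hw : (w ^ k)%C = (eps * Cconj z)%C).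
    { unfold w, z. rewrite Cpow_mult_l, He, Cpow_conj. reflexivity. }
    rewrite Hw.
    transitivity ((y ^ l - w ^ l) * ev g (eps * Cconj z) +
      y ^ l * (ev g z - ev g (eps * Cconj z)))%C; [ring|].
    rewrite Hq.
    assert (G1 := geo_mult l y w). assert (G2 := geo_mult k y w). rewrite Hw in G2. fold z in G2.
    rewrite <- G1, <- G2.
    transitivity ((y - w) * (geo l y w * ev g (eps * Cconj z) + y ^ l * ev dq z * geo k y w))%C; [ring|].
    unfold w at 1. rewrite lin_E. ring.
Qed.

Ltac nz := repeat split; auto using C2_neq_0, Ci_neq_0.

Lemma ev_dx_ppow p n x :
  ev (dx (ppow p n)) x = (RtoC (INR n) * ev p x ^ (n - 1) * ev (dx p) x)%C.
Proof.
  induction n as [|n IH]; [simpl; ring|]. cbn [ppow dx ev]. rewrite IH, ev_ppow, S_INR, RtoC_plus.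
  replace (S n - 1)%nat with n by lia. destruct n as [|n]; [simpl; ring|].
  replace (S n - 1)%nat with n by lia. rewrite !Cpow_S. ring.
Qed.

Lemma ev_dy_ppow p n x :
  ev (dy (ppow p n)) x = (RtoC (INR n) * ev p x ^ (n - 1) * ev (dy p) x)%C.
Proof.
  induction n as [|n IH]; [simpl; ring|]. cbn [ppow dy ev]. rewrite IH, ev_ppow, S_INR, RtoC_plus.
  replace (S n - 1)%nat with n by lia. destruct n as [|n]; [simpl; ring|].
  replace (S n - 1)%nat with n by lia. rewrite !Cpow_S. ring.
Qed.

Lemma ev_dx_psubst g u v x : ev (dx (psubst g u v)) x =
  (ev (psubst (dx g) u v) x * ev (dx u) x + ev (psubst (dy g) u v) x * ev (dx v) x)%C.
Proof.
  induction g as [c| | |p IHp q IHq|p IHp q IHq]; cbn [psubst dx dy ev]; try ring.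
  - rewrite IHp, IHq; ring.
  - rewrite IHp, IHq; ring.
Qed.

Lemma ev_dy_psubst g u v x : ev (dy (psubst g u v)) x =
  (ev (psubst (dx g) u v) x * ev (dy u) x + ev (psubst (dy g) u v) x * ev (dy v) x)%C.
Proof.
  induction g as [c| | |p IHp q IHq|p IHp q IHq]; cbn [psubst dx dy ev]; try ring.
  - rewrite IHp, IHq; ring.
  - rewrite IHp, IHq; ring.
Qed.

Lemma ev_dx_PZ x : ev (dx PZ) x = RtoC 1. Proof. simpl; ring. Qed.

Lemma ev_dy_PZ x : ev (dy PZ) x = Ci. Proof. simpl; ring. Qed.

Lemma ev_dx_PZb x : ev (dx PZb) x = RtoC 1. Proof. simpl; ring. Qed.

Lemma ev_dy_PZb x : ev (dy PZb) x = (- Ci)%C. Proof. simpl; ring. Qed.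

Lemma dz_bar_pcomp k g x :
  (ev (dx (pcomp k g)) x + Ci * ev (dy (pcomp k g)) x)%C =
  (RtoC (INR k) * Cconj x ^ (k - 1) * (ev (dx g) (x ^ k) + Ci * ev (dy g) (x ^ k)))%C.
Proof.
  unfold pcomp. rewrite ev_dx_psubst, ev_dy_psubst. fold (pcomp k (dx g)) (pcomp k (dy g)).
  rewrite !ev_pcomp. unfold PReZ, PImZ. cbn [dx dy ev].
  rewrite !ev_dx_ppow, !ev_dy_ppow, ev_dx_PZ, ev_dy_PZ, ev_dx_PZb, ev_dy_PZb, ev_PZ, ev_PZb.
  set (A := ev (dx g) _). set (B := ev (dy g) _). set (K := RtoC (INR k)).
  set (U := (x ^ (k - 1))%C). set (V := (Cconj x ^ (k - 1))%C).
  assert (S := Ci_sqr).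
  transitivity (K * A * / 2 * (U * (1 + Ci * Ci) + V * (1 - Ci * Ci)) +
    K * B * / (2 * Ci) * (U * (1 + Ci * Ci) - V * (1 - Ci * Ci)))%C; [ring|].
  rewrite S. transitivity (K * V * (A + B * (- (1)) / Ci))%C.
  - field; nz.
  - rewrite <- S. field; nz.
Qed.

Lemma dz_pcomp k g x :
  (ev (dx (pcomp k g)) x - Ci * ev (dy (pcomp k g)) x)%C =
  (RtoC (INR k) * x ^ (k - 1) * (ev (dx g) (x ^ k) - Ci * ev (dy g) (x ^ k)))%C.
Proof.
  unfold pcomp. rewrite ev_dx_psubst, ev_dy_psubst. fold (pcomp k (dx g)) (pcomp k (dy g)).
  rewrite !ev_pcomp. unfold PReZ, PImZ. cbn [dx dy ev].
  rewrite !ev_dx_ppow, !ev_dy_ppow, ev_dx_PZ, ev_dy_PZ, ev_dx_PZb, ev_dy_PZb, ev_PZ, ev_PZb.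
  set (A := ev (dx g) _). set (B := ev (dy g) _). set (K := RtoC (INR k)).
  set (U := (x ^ (k - 1))%C). set (V := (Cconj x ^ (k - 1))%C).
  assert (S := Ci_sqr).
  transitivity (K * A * / 2 * (U * (1 - Ci * Ci) + V * (1 + Ci * Ci)) +
    K * B * / (2 * Ci) * (U * (1 - Ci * Ci) - V * (1 + Ci * Ci)))%C; [ring|].
  rewrite S. transitivity (K * U * (A - B * (- (1)) / Ci))%C.
  - field; nz.
  - rewrite <- S. field; nz.
Qed.

Lemma dz_bar_plift l k g x :
  (ev (dx (plift l k g)) x + Ci * ev (dy (plift l k g)) x)%C =
  (x ^ l * RtoC (INR k) * Cconj x ^ (k - 1) * (ev (dx g) (x ^ k) + Ci * ev (dy g) (x ^ k)))%C.
Proof.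
  unfold plift. cbn [dx dy ev]. rewrite ev_dx_ppow, ev_dy_ppow, ev_dx_PZ, ev_dy_PZ, ev_ppow, ev_PZ.
  assert (S := Ci_sqr).
  transitivity (RtoC (INR l) * x ^ (l - 1) * (1 + Ci * Ci) * ev (pcomp k g) x +
    x ^ l * (ev (dx (pcomp k g)) x + Ci * ev (dy (pcomp k g)) x))%C; [ring|].
  rewrite S, dz_bar_pcomp. ring.
Qed.

Lemma dz_plift l k g x :
  (ev (dx (plift l k g)) x - Ci * ev (dy (plift l k g)) x)%C =
  (2 * RtoC (INR l) * x ^ (l - 1) * ev g (x ^ k) +
   x ^ l * RtoC (INR k) * x ^ (k - 1) * (ev (dx g) (x ^ k) - Ci * ev (dy g) (x ^ k)))%C.
Proof.
  unfold plift. cbn [dx dy ev]. rewrite ev_dx_ppow, ev_dy_ppow, ev_dx_PZ, ev_dy_PZ, ev_ppow, ev_PZ.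
  assert (S := Ci_sqr).
  transitivity (RtoC (INR l) * x ^ (l - 1) * (1 - Ci * Ci) * ev (pcomp k g) x +
    x ^ l * (ev (dx (pcomp k g)) x - Ci * ev (dy (pcomp k g)) x))%C; [ring|].
  rewrite S, dz_pcomp, ev_pcomp. ring.
Qed.

Lemma E_Ci t : (RtoC (- sin t) + Ci * RtoC (cos t))%C = (Ci * E t)%C.
Proof. unfold E, Ci, Cmult, Cplus, RtoC; simpl; f_equal; ring. Qed.

Lemma E_Ci' t : (RtoC (- sin t) - Ci * RtoC (cos t))%C = (- Ci * E (- t))%C.
Proof.
  unfold E. rewrite cos_neg, sin_neg. apply C_ext; simpl; ring.
Qed.

Lemma csum_comb n c u v : (csum n u + c * csum n v)%C = csum n (fun i => (u i + c * v i)%C).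
Proof. rewrite <- csum_mult, <- csum_plus. reflexivity. Qed.

Lemma ev_TB k a b f x : ev (TB k a b f) x = (ev (dx f) x + Ci * ev (dy f) x +
  RtoC a * csum k (fun j => Ci * E (angA k j) * ev (dd (angA k j) f) x) +
  RtoC b * csum k (fun j => Ci * E (angB k j) * ev (dd (angB k j) f) x))%C.
Proof.
  unfold TB, T1, T2. cbn [ev]. rewrite !ev_dsum.
  rewrite (csum_ext k (fun j => Ci * E (angA k j) * _)%C (fun j =>
    RtoC (- sin (angA k j)) * ev (dd (angA k j) f) x +
    Ci * (RtoC (cos (angA k j)) * ev (dd (angA k j) f) x))%C) by
    (intros; rewrite <- E_Ci; ring).
  rewrite (csum_ext k (fun j => Ci * E (angB k j) * _)%C (fun j =>
    RtoC (- sin (angB k j)) * ev (dd (angB k j) f) x +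
    Ci * (RtoC (cos (angB k j)) * ev (dd (angB k j) f) x))%C) by
    (intros; rewrite <- E_Ci; ring).
  rewrite <- !csum_comb. ring.
Qed.

Lemma ev_TH k a b f x : ev (TH k a b f) x = (ev (dx f) x - Ci * ev (dy f) x +
  RtoC a * csum k (fun j => - Ci * E (- angA k j) * ev (dd (angA k j) f) x) +
  RtoC b * csum k (fun j => - Ci * E (- angB k j) * ev (dd (angB k j) f) x))%C.
Proof.
  unfold TH, T1, T2. cbn [ev]. rewrite !ev_dsum.
  rewrite (csum_ext k (fun j => - Ci * E (- angA k j) * _)%C (fun j =>
    RtoC (- sin (angA k j)) * ev (dd (angA k j) f) x +
    (- Ci) * (RtoC (cos (angA k j)) * ev (dd (angA k j) f) x))%C) by
    (intros; rewrite <- E_Ci'; ring).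
  rewrite (csum_ext k (fun j => - Ci * E (- angB k j) * _)%C (fun j =>
    RtoC (- sin (angB k j)) * ev (dd (angB k j) f) x +
    (- Ci) * (RtoC (cos (angB k j)) * ev (dd (angB k j) f) x))%C) by
    (intros; rewrite <- E_Ci'; ring).
  rewrite <- !csum_comb. ring.
Qed.

(* The divided differences of [g] along the two mirrors of [I_2], in the form [ev_dd_plift] needs. *)
Definition dqA (g : pol) : pol := PM (PC (/ (2 * Ci))%C) (ddy g).

Definition dqB (g : pol) : pol := PM (PC (/ 2)%C) (ddx g).

Lemma ev_dqA g y : (ev g y - ev g (1 * Cconj y) = (y - 1 * Cconj y) * ev (dqA g) y)%C.
Proof.
  rewrite !Cmult_1_l, im_alt', <- ev_pry, ev_ddy. unfold dqA; cbn [ev].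
  change (Im y) with (snd y). field; nz.
Qed.

Lemma ev_dqB g y : (ev g y - ev g (- (1) * Cconj y) = (y - - (1) * Cconj y) * ev (dqB g) y)%C.
Proof.
  replace (- (1) * Cconj y)%C with (- Cconj y)%C by ring.
  rewrite <- ev_prx, ev_ddx. unfold dqB; cbn [ev].
  change (RtoC (fst y)) with (RtoC (Re y)). rewrite re_alt. field; nz.
Qed.

Lemma dd_plift_A l k g j x : (1 <= k)%nat ->
  ev (dd (angA k j) (plift l k g)) x = (2 * Ci * E (angA k j) *
    (geo l x (E (2 * angA k j) * Cconj x) * ev g (1 * Cconj (x ^ k)) +
     x ^ l * ev (dqA g) (x ^ k) * geo k x (E (2 * angA k j) * Cconj x)))%C.
Proof.
  intros Hk. apply ev_dd_plift.
  - apply (proj1 (root_family_A k Hk)).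
  - apply ev_dqA.
  - exists (pry g). intros y. rewrite ev_pry, Cmult_1_l. reflexivity.
Qed.

Lemma dd_plift_B l k g j x : (1 <= k)%nat ->
  ev (dd (angB k j) (plift l k g)) x = (2 * Ci * E (angB k j) *
    (geo l x (E (2 * angB k j) * Cconj x) * ev g (- (1) * Cconj (x ^ k)) +
     x ^ l * ev (dqB g) (x ^ k) * geo k x (E (2 * angB k j) * Cconj x)))%C.
Proof.
  intros Hk. apply ev_dd_plift.
  - apply (proj1 (root_family_B k Hk)).
  - apply ev_dqB.
  - exists (prx g). intros y. rewrite ev_prx. f_equal. ring.
Qed.

Lemma E_double t : E (2 * t) = (E t * E t)%C.
Proof. rewrite <- E_plus. f_equal; ring. Qed.

(** The root contributes i E(t) and the divided difference 2 i E(t), together -2 E(2t). The first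
    power of the phase thus appears, and [root_geo_0] removes the reflected value [g1]; this is the
    reason for l < k. *)
Lemma csum_Q_bar k (ang : nat -> R) eps l u v g1 d f :
  root_family k eps (fun j => E (2 * ang j)) -> (l < k)%nat ->
  (forall j, f j = (2 * Ci * E (ang j) *
    (geo l u (E (2 * ang j) * v) * g1 + u ^ l * d * geo k u (E (2 * ang j) * v)))%C) ->
  csum k (fun j => Ci * E (ang j) * f j)%C =
  (- (2) * u ^ l * d * (RtoC (INR k) * eps * v ^ (k - 1)))%C.
Proof.
  intros H Hl Hf.
  rewrite (csum_ext k _ (fun j => - (2) * g1 * (E (2 * ang j) * geo l u (E (2 * ang j) * v)) +
    - (2) * u ^ l * d * (E (2 * ang j) * geo k u (E (2 * ang j) * v)))%C).
  - rewrite csum_plus, !csum_mult.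
    rewrite (root_geo_0 k eps (fun j => E (2 * ang j))), (root_geo_k k eps (fun j => E (2 * ang j)));
      auto; try lia. ring.
  - intros j _. rewrite Hf, !E_double. assert (S := Ci_sqr).
    set (e := E (ang j)). set (G := geo l u _). set (G' := geo k u _).
    transitivity (2 * (Ci * Ci) * (e * e) * (G * g1 + u ^ l * d * G'))%C; [ring|].
    rewrite S; ring.
Qed.

(** Here the phases of the root and of the divided difference cancel, only the exponent 0
    contributes to the sums, and the reflected value survives with u^(l-1). *)
Lemma csum_Q_hol k (ang : nat -> R) eps l u v g1 d f :
  root_family k eps (fun j => E (2 * ang j)) -> (l <= k)%nat -> (1 <= k)%nat ->
  (forall j, f j = (2 * Ci * E (ang j) *
    (geo l u (E (2 * ang j) * v) * g1 + u ^ l * d * geo k u (E (2 * ang j) * v)))%C) ->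
  csum k (fun j => - Ci * E (- ang j) * f j)%C =
  (2 * RtoC (INR k) * (match l with O => 0 | S l' => u ^ l' end * g1 + u ^ l * d * u ^ (k - 1)))%C.
Proof.
  intros H Hl Hk Hf.
  rewrite (csum_ext k _ (fun j => 2 * g1 * geo l u (E (2 * ang j) * v) +
    2 * u ^ l * d * geo k u (E (2 * ang j) * v))%C).
  - rewrite csum_plus, !csum_mult.
    destruct k as [|k]; [lia|].
    rewrite (root_geo_S (S k) eps (fun j => E (2 * ang j)) k) by auto.
    replace (S k - 1)%nat with k by lia.
    destruct l as [|l].
    + rewrite csum_zero; [ring|]. intros; reflexivity.
    + rewrite (root_geo_S (S k) eps (fun j => E (2 * ang j)) l) by auto. ring.
  - intros j _. rewrite Hf. assert (S := Ci_sqr). assert (N := E_neg_mult (ang j)).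
    set (e := E (ang j)) in *. set (e' := E (- ang j)) in *. set (G := geo l u _). set (G' := geo k u _).
    transitivity (- (2) * (Ci * Ci) * (e' * e) * (G * g1 + u ^ l * d * G'))%C; [ring|].
    rewrite S, N; ring.
Qed.

Lemma ev_tb_q a b g y : ev (tb a b g) y = (ev (dx g) y + Ci * ev (dy g) y
  - 2 * (RtoC a * ev (dqA g) y - RtoC b * ev (dqB g) y))%C.
Proof.
  unfold tb, t1, t2, dqA, dqB; cbn [ev]. assert (S := Ci_sqr).
  transitivity (ev (dx g) y + Ci * ev (dy g) y + RtoC b * ev (ddx g) y
    + RtoC a * ev (ddy g) y * (- (1)) / Ci)%C.
  - rewrite <- S. field; nz.
  - field; nz.
Qed.

Lemma ev_th_q a b g y : ev (th a b g) y = (ev (dx g) y - Ci * ev (dy g) y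
  + 2 * (RtoC a * ev (dqA g) y + RtoC b * ev (dqB g) y))%C.
Proof.
  unfold th, t1, t2, dqA, dqB; cbn [ev]. assert (S := Ci_sqr).
  transitivity (ev (dx g) y - Ci * ev (dy g) y + RtoC b * ev (ddx g) y
    - RtoC a * ev (ddy g) y * (- (1)) / Ci)%C.
  - rewrite <- S. field; nz.
  - field; nz.
Qed.

Lemma TB_plift k a b l g x : (l < k)%nat -> ev (TB k a b (plift l k g)) x =
  (x ^ l * RtoC (INR k) * Cconj x ^ (k - 1) * ev (tb a b g) (x ^ k))%C.
Proof.
  intros Hl. assert (Hk : (1 <= k)%nat) by lia.
  rewrite ev_TB, dz_bar_plift, ev_tb_q.
  rewrite (csum_Q_bar k (angA k) 1 l x (Cconj x) _ _ _ (root_family_A k Hk) Hl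
    (fun j => dd_plift_A l k g j x Hk)).
  rewrite (csum_Q_bar k (angB k) (- (1)) l x (Cconj x) _ _ _ (root_family_B k Hk) Hl
    (fun j => dd_plift_B l k g j x Hk)).
  ring.
Qed.

Lemma TH_plift k a b l g x : (l <= k)%nat -> (1 <= k)%nat -> ev (TH k a b (plift l k g)) x =
  (2 * RtoC (INR l) * x ^ (l - 1) * ev g (x ^ k) +
   x ^ l * RtoC (INR k) * x ^ (k - 1) * (ev (dx g) (x ^ k) - Ci * ev (dy g) (x ^ k)) +
   2 * RtoC (INR k) * (RtoC a * (match l with O => 0 | S l' => x ^ l' end * ev g (1 * Cconj (x ^ k)) +
      x ^ l * ev (dqA g) (x ^ k) * x ^ (k - 1)) +
     RtoC b * (match l with O => 0 | S l' => x ^ l' end * ev g (- (1) * Cconj (x ^ k)) +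
      x ^ l * ev (dqB g) (x ^ k) * x ^ (k - 1))))%C.
Proof.
  intros Hl Hk. rewrite ev_TH, dz_plift.
  rewrite (csum_Q_hol k (angA k) 1 l x (Cconj x) _ _ _ (root_family_A k Hk) Hl Hk
    (fun j => dd_plift_A l k g j x Hk)).
  rewrite (csum_Q_hol k (angB k) (- (1)) l x (Cconj x) _ _ _ (root_family_B k Hk) Hl Hk
    (fun j => dd_plift_B l k g j x Hk)).
  ring.
Qed.

Lemma TH_plift_0 k a b g x : (1 <= k)%nat -> ev (TH k a b (plift 0 k g)) x =
  (RtoC (INR k) * x ^ (k - 1) * ev (th a b g) (x ^ k))%C.
Proof. intros Hk. rewrite TH_plift, ev_th_q by lia. simpl (INR 0). simpl (x ^ 0)%C. ring. Qed.

(** Euler's identity and the equation for g eliminate the derivatives, and the divided differences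
    eliminate the reflected values, so only a multiple of g remains. The constant is twice the
    degree plus <kappa>. *)
Lemma TH_plift_S k a b l q g x : (S l <= k)%nat -> hom q g ->
  (forall y, ev (tb a b g) y = RtoC 0) ->
  ev (TH k a b (plift (S l) k g)) x =
  (2 * (RtoC (INR (S l)) + RtoC (INR k) * RtoC (IZR q) + RtoC (INR k) * (RtoC a + RtoC b)) *
   ev (plift l k g) x)%C.
Proof.
  intros Hl Hg Ht. rewrite TH_plift, ev_plift by lia.
  assert (Hk : (x * x ^ (k - 1) = x ^ k)%C).
  { destruct k; [lia|]. replace (S k - 1)%nat with k by lia. reflexivity. }
  replace (S l - 1)%nat with l by lia. rewrite !Cpow_S.
  set (z := (x ^ k)%C) in *. specialize (Ht z). rewrite ev_tb_q in Ht.
  assert (HE := euler q g z Hg).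
  assert (HA := ev_dqA g z). assert (HB := ev_dqB g z).
  assert (EX : (RtoC (fst z) = (z + Cconj z) / 2)%C) by apply re_alt.
  assert (EY : (RtoC (snd z) = (z - Cconj z) / (2 * Ci))%C) by apply im_alt.
  set (gx := ev (dx g) z) in *. set (gy := ev (dy g) z) in *. set (zb := Cconj z) in *.
  set (dA := ev (dqA g) z) in *. set (dB := ev (dqB g) z) in *.
  set (gA := ev g (1 * zb)%C) in *. set (gB := ev g (- (1) * zb)%C) in *. set (G := ev g z) in *.
  assert (H2 : (gx + Ci * gy = 2 * (RtoC a * dA - RtoC b * dB))%C).
  { transitivity (gx + Ci * gy - 2 * (RtoC a * dA - RtoC b * dB) + 2 * (RtoC a * dA - RtoC b * dB))%C;
      [ring|rewrite Ht; ring]. }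
  assert (H3 : (z * (gx - Ci * gy) + zb * (gx + Ci * gy) = 2 * RtoC (IZR q) * G)%C).
  { transitivity (2 * (RtoC (IZR q) * G))%C; [|ring]. rewrite <- HE, EX, EY.
    assert (S := Ci_sqr).
    transitivity ((z + zb) * gx - (z - zb) * gy * (- (1)) / Ci)%C.
    - rewrite <- S. field; nz.
    - field; nz. }
  (* Euler's identity in complex form, with the conj z derivative replaced through [tb g = 0]. The
     values at the reflected points are expressed by the divided differences in H5 and H6. *)
  assert (H4 : (z * (gx - Ci * gy) = 2 * RtoC (IZR q) * G - zb * (2 * (RtoC a * dA - RtoC b * dB)))%C).
  { rewrite <- H3, <- H2. ring. }
  assert (H5 : gA = (G - (z - 1 * zb) * dA)%C) by (rewrite <- HA; ring).
  assert (H6 : gB = (G - (z - - (1) * zb) * dB)%C) by (rewrite <- HB; ring).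
  rewrite H5, H6.
  transitivity (x ^ l * (2 * RtoC (INR (S l)) * G + RtoC (INR k) * ((x * x ^ (k - 1)) * (gx - Ci * gy)) +
    2 * RtoC (INR k) * (RtoC a * (G - (z - 1 * zb) * dA + (x * x ^ (k - 1)) * dA) +
      RtoC b * (G - (z - - (1) * zb) * dB + (x * x ^ (k - 1)) * dB))))%C; [ring|].
  rewrite Hk, H4. ring.
Qed.

(** * Multiplication by |x|^2 and the dimension of the space of harmonics *)

Definition PRho : pol := PM PZ PZb.

Lemma ev_PRho x : ev PRho x = (x * Cconj x)%C.
Proof. unfold PRho; cbn [ev]. rewrite ev_PZ, ev_PZb. reflexivity. Qed.

Lemma hom_PRho : hom 2 PRho.
Proof. apply (hom_mul 1 1); auto using hom_PZ, hom_PZb. Qed.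

Lemma ev_PRho_reflA phi x : ev PRho (reflA phi x) = ev PRho x.
Proof.
  rewrite !ev_PRho, reflA_E, Cmult_conj, Cconj_conj, E_conj.
  transitivity (E (- (2 * phi)) * E (2 * phi) * (x * Cconj x))%C; [ring|].
  rewrite E_neg_mult; ring.
Qed.

Lemma ev_dd_PRho phi x : ev (dd phi PRho) x = RtoC 0.
Proof.
  change (RtoC 0) with (ev (PC 0) x). revert x. apply dd_unique. intros x.
  rewrite ev_PRho_reflA. cbn [ev]. ring.
Qed.

Lemma ev_dd_PRho_mul phi f x : ev (dd phi (PM PRho f)) x = (ev PRho x * ev (dd phi f) x)%C.
Proof.
  change (ev (dd phi PRho) x * ev f x + ev (prefl phi PRho) x * ev (dd phi f) x =
    ev PRho x * ev (dd phi f) x)%C.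
  rewrite ev_dd_PRho, ev_prefl, ev_PRho_reflA. ring.
Qed.

Lemma ev_dsum_PRho k a b c f x :
  ev (dsum k a b c (PM PRho f)) x = (ev PRho x * ev (dsum k a b c f) x)%C.
Proof.
  rewrite !ev_dsum.
  assert (H : forall ang : nat -> R,
    csum k (fun j => RtoC (c (ang j)) * ev (dd (ang j) (PM PRho f)) x)%C =
    (ev PRho x * csum k (fun j => RtoC (c (ang j)) * ev (dd (ang j) f) x))%C).
  { intros ang. rewrite <- csum_mult. apply csum_ext; intros. rewrite ev_dd_PRho_mul; ring. }
  rewrite !H. ring.
Qed.

Lemma ev_T1_PRho k a b f x : ev (T1 k a b (PM PRho f)) x =
  (ev PRho x * ev (T1 k a b f) x + 2 * (RtoC (fst x) * ev f x))%C.
Proof.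
  unfold T1; cbn [ev]. rewrite ev_dsum_PRho.
  assert (H : ev (dx PRho) x = (2 * RtoC (fst x))%C) by (simpl; ring).
  change (ev (dx (PM PRho f)) x) with (ev (dx PRho) x * ev f x + ev PRho x * ev (dx f) x)%C.
  rewrite H. ring.
Qed.

Lemma ev_T2_PRho k a b f x : ev (T2 k a b (PM PRho f)) x =
  (ev PRho x * ev (T2 k a b f) x + 2 * (RtoC (snd x) * ev f x))%C.
Proof.
  unfold T2; cbn [ev]. rewrite ev_dsum_PRho.
  assert (H : ev (dy PRho) x = (2 * RtoC (snd x))%C).
  { simpl. assert (S := Ci_sqr).
    transitivity (- (2) * (Ci * Ci) * RtoC (snd x))%C; [ring|rewrite S; ring]. }
  change (ev (dy (PM PRho f)) x) with (ev (dy PRho) x * ev f x + ev PRho x * ev (dy f) x)%C.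
  rewrite H. ring.
Qed.

Definition kapC (k : nat) (a b : R) : C := (RtoC (INR k) * (RtoC a + RtoC b))%C.

(** The sum of the anticommutators of T_i with x_i. Every mirror contributes 2 f, because its root
    has norm one and its linear form changes sign under its own reflection; the derivatives give the
    degree by Euler's identity. *)
Lemma sum_T_x k a b z f x : hom z f ->
  (ev (T1 k a b (PM PX f)) x + ev (T2 k a b (PM PY f)) x +
   (RtoC (fst x) * ev (T1 k a b f) x + RtoC (snd x) * ev (T2 k a b f) x))%C =
  (2 * (RtoC (IZR z) + 1 + kapC k a b) * ev f x)%C.
Proof.
  intros Hf. unfold T1, T2; cbn [ev]. rewrite !ev_dsum. cbn [dx dy ev].
  assert (H : forall ang : nat -> R,
   (csum k (fun j => RtoC (- sin (ang j)) * ev (dd (ang j) (PM PX f)) x) +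
    csum k (fun j => RtoC (cos (ang j)) * ev (dd (ang j) (PM PY f)) x) +
    RtoC (fst x) * csum k (fun j => RtoC (- sin (ang j)) * ev (dd (ang j) f) x) +
    RtoC (snd x) * csum k (fun j => RtoC (cos (ang j)) * ev (dd (ang j) f) x) =
    RtoC (INR k) * (2 * ev f x))%C).
  { intros ang. rewrite <- csum_const, <- !csum_mult, <- !csum_plus. apply csum_ext; intros j _.
    set (t := ang j). cbn [dd ev]. rewrite !ev_prefl. cbn [ev].
    set (F := ev f x). set (D := ev (dd t f) x).
    transitivity (RtoC (2 * ((sin t) * (sin t) + cos t * cos t)) * F +
      RtoC (lin t (reflA t x) + lin t x) * D)%C.
    - unfold lin. rewrite !RtoC_mult, !RtoC_plus, !RtoC_mult, !RtoC_opp. ring.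
    - rewrite lin_reflA. replace (2 * t - t) with t by ring.
      assert (S := sin2_cos2 t). unfold Rsqr in S. rewrite S, Rplus_opp_l, Rmult_1_r. ring. }
  assert (HA := H (angA k)). assert (HB := H (angB k)). assert (HE := euler z f x Hf).
  revert HA HB.
  set (A1 := csum k (fun j => RtoC (- sin (angA k j)) * ev (dd (angA k j) (PM PX f)) x)%C).
  set (A2 := csum k (fun j => RtoC (cos (angA k j)) * ev (dd (angA k j) (PM PY f)) x)%C).
  set (A3 := csum k (fun j => RtoC (- sin (angA k j)) * ev (dd (angA k j) f) x)%C).
  set (A4 := csum k (fun j => RtoC (cos (angA k j)) * ev (dd (angA k j) f) x)%C).
  set (B1 := csum k (fun j => RtoC (- sin (angB k j)) * ev (dd (angB k j) (PM PX f)) x)%C).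
  set (B2 := csum k (fun j => RtoC (cos (angB k j)) * ev (dd (angB k j) (PM PY f)) x)%C).
  set (B3 := csum k (fun j => RtoC (- sin (angB k j)) * ev (dd (angB k j) f) x)%C).
  set (B4 := csum k (fun j => RtoC (cos (angB k j)) * ev (dd (angB k j) f) x)%C).
  intros HA HB. unfold kapC.
  transitivity (2 * ev f x + 2 * (RtoC (fst x) * ev (dx f) x + RtoC (snd x) * ev (dy f) x) +
    RtoC a * (A1 + A2 + RtoC (fst x) * A3 + RtoC (snd x) * A4) +
    RtoC b * (B1 + B2 + RtoC (fst x) * B3 + RtoC (snd x) * B4))%C; [ring|].
  rewrite HA, HB, HE. ring.
Qed.

(** Since |x|^2 is invariant, T_i (|x|^2 f) = |x|^2 T_i f + 2 x_i f; applied twice, this leaves the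
    anticommutators of [sum_T_x]. It is one of the sl(2) relations. *)
Lemma Lap_PRho k a b z f x : hom z f -> ev (Lap k a b (PM PRho f)) x =
  (ev PRho x * ev (Lap k a b f) x + 4 * (RtoC (IZR z) + 1 + kapC k a b) * ev f x)%C.
Proof.
  intros Hf. unfold Lap; cbn [ev].
  rewrite (T1_comb k a b _ (PM PRho (T1 k a b f)) (PM PX f) 1 2) by
    (intros; rewrite ev_T1_PRho; cbn [ev]; ring).
  rewrite (T2_comb k a b _ (PM PRho (T2 k a b f)) (PM PY f) 1 2) by
    (intros; rewrite ev_T2_PRho; cbn [ev]; ring).
  rewrite ev_T1_PRho, ev_T2_PRho.
  assert (H := sum_T_x k a b z f x Hf).
  transitivity (ev PRho x * (ev (T1 k a b (T1 k a b f)) x + ev (T2 k a b (T2 k a b f)) x) +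
    2 * (ev (T1 k a b (PM PX f)) x + ev (T2 k a b (PM PY f)) x +
   (RtoC (fst x) * ev (T1 k a b f) x + RtoC (snd x) * ev (T2 k a b f) x)))%C; [ring|].
  rewrite H. ring.
Qed.

Lemma Lap_PRho_pow k a b z f i : hom z f -> forall x,
  ev (Lap k a b (PM (ppow PRho (S i)) f)) x =
  (ev PRho x ^ S i * ev (Lap k a b f) x +
   4 * RtoC (INR (S i)) * (RtoC (INR (S i)) + RtoC (IZR z) + kapC k a b) *
   ev PRho x ^ i * ev f x)%C.
Proof.
  intros Hf. induction i as [|i IH]; intros x.
  - transitivity (1 * ev (Lap k a b (PM PRho f)) x + 0 * ev (Lap k a b f) x)%C.
    + apply Lap_comb. intros; cbn [ev ppow]; ring.
    + rewrite (Lap_PRho _ _ _ z) by auto. change (INR 1) with 1. cbn [Cpow]. ring.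
  - transitivity (1 * ev (Lap k a b (PM PRho (PM (ppow PRho (S i)) f))) x + 0 * ev (Lap k a b f) x)%C.
    + apply Lap_comb. intros; cbn [ev ppow]; ring.
    + rewrite (Lap_PRho _ _ _ (2 * Z.of_nat (S i) + z)).
      * rewrite IH. cbn [ev]. rewrite ev_ppow, plus_IZR, mult_IZR, <- INR_IZR_INZ.
        rewrite !RtoC_plus, !RtoC_mult, (S_INR (S i)), RtoC_plus, !Cpow_S. ring.
      * eapply hom_mul; [apply hom_ppow, hom_PRho|exact Hf|reflexivity].
Qed.

Lemma ev_PRho_nonzero phi x : lin phi x <> 0 -> ev PRho x <> RtoC 0.
Proof.
  intros H E. rewrite ev_PRho, <- Cmod2_conj in E.
  assert (Hx : x = RtoC 0).
  { apply Cmod_eq_0. apply RtoC_inj in E. apply Rsqr_0_uniq.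
    unfold Rsqr. simpl in E. lra. }
  apply H. subst x. unfold lin; simpl; ring.
Qed.

(** If |x|^(2i+2) g is harmonic, the commutator formula gives g = -(1/c) |x|^2 Lap g with c > 0, so
    the same polynomial is |x|^(2i+4) times one of degree lower by two. The exponent is general so
    that this can be repeated until the degree is negative. *)
Lemma Lap_PRho_inj k a b n : (1 <= k)%nat -> 0 <= a -> 0 <= b ->
  forall z g i, (z < Z.of_nat n)%Z -> hom z g ->
  (forall x, ev (Lap k a b (PM (ppow PRho (S i)) g)) x = RtoC 0) -> forall x, ev g x = RtoC 0.
Proof.
  intros Hk Ha Hb. induction n as [|n IH]; intros z g i Hz Hg HL.
  - intros x. apply (hom_neg z); auto.
  - destruct (Z_lt_le_dec z 0) as [Hneg|Hpos]; [intros x; apply (hom_neg z); auto|].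
    set (c := (4 * RtoC (INR (S i)) * (RtoC (INR (S i)) + RtoC (IZR z) + kapC k a b))%C).
    assert (Hc : c <> RtoC 0).
    { unfold c, kapC. rewrite <- !RtoC_plus, <- !RtoC_mult, <- !RtoC_plus, <- !RtoC_mult.
      intros E. apply RtoC_inj in E. apply IZR_le in Hpos.
      assert (1 <= INR (S i)) by (apply (le_INR 1); lia).
      assert (1 <= INR k) by (apply (le_INR 1); lia).
      assert (0 <= INR k * (a + b)) by (apply Rmult_le_pos; lra).
      assert (0 < 4 * INR (S i) * (INR (S i) + IZR z + INR k * (a + b))); [|lra].
      apply Rmult_lt_0_compat; lra. }
    assert (Eg : forall x, ev g x = ev (PM PRho (PM (PC (- / c)%C) (Lap k a b g))) x).
    { apply (ev_eq_density 0). intros x Hx. assert (R0 := ev_PRho_nonzero 0 x Hx).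
      assert (H := HL x). rewrite (Lap_PRho_pow k a b z) in H by auto. fold c in H.
      cbn [ev]. set (r := ev PRho x) in *. rewrite Cpow_S in H.
      assert (Hr : (r ^ i)%C <> RtoC 0) by (apply Cpow_nz; auto).
      transitivity (/ (c * r ^ i) * (r * r ^ i * ev (Lap k a b g) x + c * r ^ i * ev g x) +
        r * (- / c * ev (Lap k a b g) x))%C; [field; auto|]. rewrite H. ring. }
    assert (E0 : forall x, ev (PM (PC (- / c)%C) (Lap k a b g)) x = RtoC 0).
    { apply (IH (z - 2)%Z _ (S i)); [lia|apply hom_scal, hom_Lap; auto|].
      intros x. rewrite <- (HL x).
      transitivity (1 * ev (Lap k a b (PM (ppow PRho (S i)) g)) x + 0 * ev (Lap k a b g) x)%C; [|ring].
      apply Lap_comb. intros y. cbn [ppow ev]. rewrite (Eg y). cbn [ev]. ring. }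
    intros x. rewrite Eg. change (ev PRho x * ev (PM (PC (- / c)%C) (Lap k a b g)) x = 0)%C.
    rewrite E0; ring.
Qed.

Lemma hom_zdecomp z p : hom z p -> (0 < z)%Z ->
  exists q1 q2, hom (z - 1) q1 /\ hom (z - 1) q2 /\
    forall x, ev p x = (x * ev q1 x + Cconj x * ev q2 x)%C.
Proof.
  intros H Hz. destruct (hom_decomp z p H Hz) as (p1 & p2 & H1 & H2 & Hp).
  exists (PA (PM (PC (/ 2)%C) p1) (PM (PC (/ (2 * Ci))%C) p2)),
    (PA (PM (PC (/ 2)%C) p1) (PM (PC (- / (2 * Ci))%C) p2)).
  repeat split; try (apply hom_add; apply hom_scal; auto).
  intros x. rewrite Hp. cbn [ev].
  change (RtoC (fst x)) with (RtoC (Re x)). change (RtoC (snd x)) with (RtoC (Im x)).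
  rewrite re_alt, im_alt. field; nz.
Qed.

Lemma hom_ppow_nat p n : hom 1 p -> hom (Z.of_nat n) (ppow p n).
Proof. intros H. replace (Z.of_nat n) with (1 * Z.of_nat n)%Z by lia. apply hom_ppow; auto. Qed.

(** A monomial containing both z and conj z is divisible by |x|^2, so two coefficients determine a
    homogeneous polynomial modulo |x|^2. *)
Lemma hom_mod_PRho n p : hom (Z.of_nat (S n)) p ->
  exists s t p', hom (Z.of_nat (S n) - 2) p' /\
    forall x, ev p x = (s * x ^ S n + t * Cconj x ^ S n + ev PRho x * ev p' x)%C.
Proof.
  revert p. induction n as [|n IH]; intros p Hp;
    destruct (hom_zdecomp _ p Hp ltac:(lia)) as (q1 & q2 & H1 & H2 & E).
  - destruct (hom_0_const q1 H1) as [s Hs], (hom_0_const q2 H2) as [t Ht].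
    exists s, t, (PC 0). split; [constructor|]. intros x. rewrite E, Hs, Ht. simpl; ring.
  - replace (Z.of_nat (S (S n)) - 1)%Z with (Z.of_nat (S n)) in * by lia.
    destruct (IH q1 H1) as (s1 & t1 & p1 & P1 & E1), (IH q2 H2) as (s2 & t2 & p2 & P2 & E2).
    exists s1, t2, (PA (PA (PM (PC t1) (ppow PZb n)) (PM PZ p1)) (PA (PM (PC s2) (ppow PZ n)) (PM PZb p2))).
    split.
    + apply hom_add; apply hom_add.
      * apply hom_scal. replace (Z.of_nat (S (S n)) - 2)%Z with (Z.of_nat n) by lia.
        apply hom_ppow_nat, hom_PZb.
      * eapply hom_mul; [apply hom_PZ|exact P1|lia].
      * apply hom_scal. replace (Z.of_nat (S (S n)) - 2)%Z with (Z.of_nat n) by lia.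
        apply hom_ppow_nat, hom_PZ.
      * eapply hom_mul; [apply hom_PZb|exact P2|lia].
    + intros x. rewrite E, E1, E2. cbn [ev]. rewrite !ev_ppow, ev_PZ, ev_PZb, ev_PRho, !Cpow_S. ring.
Qed.

(* A homogeneous harmonic polynomial is determined by its residue modulo |x|^2, so
   harmonics of degree [S n] form a space of dimension at most two. *)
Lemma harmonic_span k a b n h psi psi' s0 : (1 <= k)%nat -> 0 <= a -> 0 <= b ->
  hom (Z.of_nat (S n)) h -> hom (Z.of_nat (S n)) psi -> hom (Z.of_nat (S n) - 2) psi' ->
  (forall x, ev (Lap k a b h) x = RtoC 0) -> (forall x, ev (Lap k a b psi) x = RtoC 0) ->
  (forall x, ev psi x = (s0 * x ^ S n + ev PRho x * ev psi' x)%C) -> s0 <> RtoC 0 ->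
  exists u v, forall x, ev h x = (u * ev psi x + v * Cconj (ev psi x))%C.
Proof.
  intros Hk Ha Hb Hh Hpsi Hpsi' Lh Lpsi Epsi Hs0.
  destruct (hom_mod_PRho n h Hh) as (s & t & p' & Hp' & Eh).
  (* Chosen to cancel the pure powers of z and of conj z: psi supplies the former, its conjugate the
     latter. What is left is a harmonic multiple of |x|^2, hence 0. *)
  set (u := (s / s0)%C). set (v := (t / Cconj s0)%C).
  assert (Hs0' : Cconj s0 <> RtoC 0).
  { intros H. apply Hs0. rewrite <- (Cconj_conj s0), H. apply Cconj_RtoC. }
  exists u, v.
  set (q := PA (PM (PC 1) p') (PM (PC (- (1))%C) (PA (PM (PC u) psi') (PM (PC v) (pconj psi'))))).
  assert (Eq : forall x, (ev h x - (u * ev psi x + v * Cconj (ev psi x)) = ev PRho x * ev q x)%C).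
  { intros x. unfold q; cbn [ev]. rewrite Eh, Epsi, ev_pconj, Cplus_conj, !Cmult_conj, Cpow_conj.
    replace (Cconj (ev PRho x)) with (ev PRho x).
    - unfold u, v. field. auto.
    - rewrite ev_PRho, Cmult_conj, Cconj_conj. ring. }
  assert (Hq : hom (Z.of_nat (S n) - 2) q).
  { apply hom_add; apply hom_scal; auto. apply hom_add; apply hom_scal; auto. apply hom_pconj; auto. }
  assert (Z0 : forall x, ev q x = RtoC 0).
  { apply (Lap_PRho_inj k a b (S n) Hk Ha Hb (Z.of_nat (S n) - 2) q 0); auto; [lia|].
    intros x. rewrite (Lap_comb k a b _ h (PA (PM (PC u) psi) (PM (PC v) (pconj psi))) 1 (- (1))%C).
    - rewrite (Lap_comb k a b (PA (PM (PC u) psi) (PM (PC v) (pconj psi))) psi (pconj psi) u v) by (intros; reflexivity).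
      rewrite Lh, Lpsi, ev_Lap_pconj, Lpsi, Cconj_RtoC. ring.
    - intros y. cbn [ppow ev]. rewrite ev_pconj.
      transitivity (ev PRho y * ev q y)%C; [ring|]. rewrite <- Eq. ring. }
  intros x. specialize (Eq x). rewrite Z0 in Eq.
  transitivity (ev h x - (u * ev psi x + v * Cconj (ev psi x)) + (u * ev psi x + v * Cconj (ev psi x)))%C;
    [ring|]. rewrite Eq. ring.
Qed.

(** * Commutation relations of the operators for two mirrors *)

Lemma RtoC_neq_0 r : r <> 0 -> RtoC r <> RtoC 0.
Proof. intros H E; apply H, RtoC_inj, E. Qed.

Lemma ev_eq_offX p q : (forall x, fst x <> 0 -> ev p x = ev q x) -> forall x, ev p x = ev q x.
Proof.
  intros H. apply (ev_eq_density (PI / 2)). intros x Hx. apply H. intros E. apply Hx.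
  unfold lin. rewrite cos_PI2, E. ring.
Qed.

Lemma ev_eq_offY p q : (forall x, snd x <> 0 -> ev p x = ev q x) -> forall x, ev p x = ev q x.
Proof.
  intros H. apply (ev_eq_density 0). intros x Hx. apply H. intros E. apply Hx.
  unfold lin. rewrite sin_0, E. ring.
Qed.

Lemma ddx_unique p q : (forall x, (ev p x - ev (prx p) x = RtoC (fst x) * ev q x)%C) ->
  forall x, ev (ddx p) x = ev q x.
Proof.
  intros H. apply ev_eq_offX. intros x Hx. apply RtoC_neq_0 in Hx.
  transitivity (/ RtoC (fst x) * (RtoC (fst x) * ev (ddx p) x))%C; [field; auto|].
  rewrite <- ev_ddx, H. field; auto.
Qed.

Lemma ddy_unique p q : (forall x, (ev p x - ev (pry p) x = RtoC (snd x) * ev q x)%C) ->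
  forall x, ev (ddy p) x = ev q x.
Proof.
  intros H. apply ev_eq_offY. intros x Hx. apply RtoC_neq_0 in Hx.
  transitivity (/ RtoC (snd x) * (RtoC (snd x) * ev (ddy p) x))%C; [field; auto|].
  rewrite <- ev_ddy, H. field; auto.
Qed.

Lemma ddx_ext p q : (forall x, ev p x = ev q x) -> forall x, ev (ddx p) x = ev (ddx q) x.
Proof. intros H. apply ddx_unique. intros x. rewrite ev_prx, !H, <- ev_prx. apply ev_ddx. Qed.

Lemma ddy_ext p q : (forall x, ev p x = ev q x) -> forall x, ev (ddy p) x = ev (ddy q) x.
Proof. intros H. apply ddy_unique. intros x. rewrite ev_pry, !H, <- ev_pry. apply ev_ddy. Qed.

Lemma t1_ext b p q : (forall x, ev p x = ev q x) -> forall x, ev (t1 b p) x = ev (t1 b q) x.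
Proof. intros H x. unfold t1; cbn [ev]. rewrite (dx_ext p q H), (ddx_ext p q H). reflexivity. Qed.

Lemma t2_ext a p q : (forall x, ev p x = ev q x) -> forall x, ev (t2 a p) x = ev (t2 a q) x.
Proof. intros H x. unfold t2; cbn [ev]. rewrite (dy_ext p q H), (ddy_ext p q H). reflexivity. Qed.

Lemma t1_comb b f p q u v : (forall x, ev f x = (u * ev p x + v * ev q x)%C) ->
  forall x, ev (t1 b f) x = (u * ev (t1 b p) x + v * ev (t1 b q) x)%C.
Proof.
  apply T_of_comb; [apply t1_ext|]. intros; unfold t1; cbn [dx ddx prx psubst ev]. ring.
Qed.

Lemma t2_comb a f p q u v : (forall x, ev f x = (u * ev p x + v * ev q x)%C) ->
  forall x, ev (t2 a f) x = (u * ev (t2 a p) x + v * ev (t2 a q) x)%C.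
Proof.
  apply T_of_comb; [apply t2_ext|]. intros; unfold t2; cbn [dy ddy pry psubst ev]. ring.
Qed.

Lemma tb_comb a b f p q u v : (forall x, ev f x = (u * ev p x + v * ev q x)%C) ->
  forall x, ev (tb a b f) x = (u * ev (tb a b p) x + v * ev (tb a b q) x)%C.
Proof.
  intros H x. unfold tb; cbn [ev]. rewrite (t1_comb b f p q u v H), (t2_comb a f p q u v H). ring.
Qed.

Lemma th_comb a b f p q u v : (forall x, ev f x = (u * ev p x + v * ev q x)%C) ->
  forall x, ev (th a b f) x = (u * ev (th a b p) x + v * ev (th a b q) x)%C.
Proof.
  intros H x. unfold th; cbn [ev]. rewrite (t1_comb b f p q u v H), (t2_comb a f p q u v H). ring.
Qed.

Lemma tb_scal a b f p u : (forall x, ev f x = (u * ev p x)%C) ->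
  forall x, ev (tb a b f) x = (u * ev (tb a b p) x)%C.
Proof.
  intros H x. rewrite (tb_comb a b f p p u 0); [ring|]. intros; rewrite H; ring.
Qed.

Lemma th_scal a b f p u : (forall x, ev f x = (u * ev p x)%C) ->
  forall x, ev (th a b f) x = (u * ev (th a b p) x)%C.
Proof.
  intros H x. rewrite (th_comb a b f p p u 0); [ring|]. intros; rewrite H; ring.
Qed.

Lemma hom_ddx z p : hom z p -> hom (z - 1) (ddx p).
Proof.
  assert (P : forall z p, hom z p -> hom z (prx p)).
  { intros; apply hom_psubst_linear; auto; try apply hom_scal; constructor. }
  induction 1; simpl; try (constructor; auto; fail).
  subst. apply hom_add; econstructor; eauto; lia.
Qed.

Lemma hom_ddy z p : hom z p -> hom (z - 1) (ddy p).
Proof.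
  assert (P : forall z p, hom z p -> hom z (pry p)).
  { intros; apply hom_psubst_linear; auto; try apply hom_scal; constructor. }
  induction 1; simpl; try (constructor; auto; fail).
  subst. apply hom_add; econstructor; eauto; lia.
Qed.

Lemma hom_t1 b z p : hom z p -> hom (z - 1) (t1 b p).
Proof. intros H; apply hom_add; [apply hom_dx|apply hom_scal, hom_ddx]; auto. Qed.

Lemma hom_t2 a z p : hom z p -> hom (z - 1) (t2 a p).
Proof. intros H; apply hom_add; [apply hom_dy|apply hom_scal, hom_ddy]; auto. Qed.

Lemma hom_tb a b z p : hom z p -> hom (z - 1) (tb a b p).
Proof. intros H; apply hom_add; [apply hom_t1|apply hom_scal, hom_t2]; auto. Qed.

Lemma hom_th a b z p : hom z p -> hom (z - 1) (th a b p).
Proof. intros H; apply hom_add; [apply hom_t1|apply hom_scal, hom_t2]; auto. Qed.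

Lemma t_euler a b z f x : hom z f ->
  (RtoC (fst x) * ev (t1 b f) x + RtoC (snd x) * ev (t2 a f) x)%C =
  (RtoC (IZR z) * ev f x + RtoC b * (RtoC (fst x) * ev (ddx f) x)
    + RtoC a * (RtoC (snd x) * ev (ddy f) x))%C.
Proof. intros H. rewrite <- (euler z f x H). unfold t1, t2; cbn [ev]. ring. Qed.

Lemma t1_PX b f x : ev (t1 b (PM PX f)) x =
  (RtoC (fst x) * ev (t1 b f) x + ev f x + RtoC b * (2 * (ev f x - RtoC (fst x) * ev (ddx f) x)))%C.
Proof. unfold t1; cbn [dx ddx prx psubst ev]. ring. Qed.

Lemma t1_PY b f x : ev (t1 b (PM PY f)) x = (RtoC (snd x) * ev (t1 b f) x)%C.
Proof. unfold t1; cbn [dx ddx prx psubst ev]. ring. Qed.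

Lemma t2_PX a f x : ev (t2 a (PM PX f)) x = (RtoC (fst x) * ev (t2 a f) x)%C.
Proof. unfold t2; cbn [dy ddy pry psubst ev]. ring. Qed.

Lemma t2_PY a f x : ev (t2 a (PM PY f)) x =
  (RtoC (snd x) * ev (t2 a f) x + ev f x + RtoC a * (2 * (ev f x - RtoC (snd x) * ev (ddy f) x)))%C.
Proof. unfold t2; cbn [dy ddy pry psubst ev]. ring. Qed.

Lemma ev_PZb_mul f x : ev (PM PZb f) x = (1 * ev (PM PX f) x + - Ci * ev (PM PY f) x)%C.
Proof. cbn [ev]. unfold PZb; cbn [ev]. ring. Qed.

Lemma ev_PZ_mul f x : ev (PM PZ f) x = (1 * ev (PM PX f) x + Ci * ev (PM PY f) x)%C.
Proof. cbn [ev]. unfold PZ; cbn [ev]. ring. Qed.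

(** The reflection terms cancel against those in x t1 f + y t2 f, so only the degree and the
    multiplicities remain. *)
Lemma tb_PZb a b z f x : hom z f -> ev (tb a b (PM PZb f)) x =
  (2 * (RtoC (IZR z) + 1 + (RtoC a + RtoC b)) * ev f x - x * ev (th a b f) x)%C.
Proof.
  intros Hf. assert (H := t_euler a b z f x Hf). assert (HD := C_decomp x).
  unfold tb, th; cbn [ev].
  rewrite (t1_comb b _ _ _ _ _ (ev_PZb_mul f)), (t2_comb a _ _ _ _ _ (ev_PZb_mul f)).
  rewrite t1_PX, t1_PY, t2_PX, t2_PY. assert (S := Ci_sqr).
  set (X := RtoC (fst x)) in *. set (Y := RtoC (snd x)) in *.
  set (A := ev (t1 b f) x) in *. set (B := ev (t2 a f) x) in *. set (F := ev f x) in *.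
  set (U := ev (ddx f) x) in *. set (V := ev (ddy f) x) in *.
  transitivity (2 * (1 + RtoC a + RtoC b) * F - 2 * (RtoC b * (X * U) + RtoC a * (Y * V)) +
    2 * (X * A + Y * B) - (X + Ci * Y) * (A + - Ci * B))%C.
  - transitivity (X * A + F + RtoC b * (2 * (F - X * U)) - (Ci * Ci) * (Y * B + F + RtoC a * (2 * (F - Y * V)))
      + Ci * X * B - Ci * Y * A)%C; [ring|].
    rewrite S. transitivity (2 * (1 + RtoC a + RtoC b) * F - 2 * (RtoC b * (X * U) + RtoC a * (Y * V)) +
    2 * (X * A + Y * B) - (X * A + Ci * Y * A - Ci * X * B - (- (1)) * Y * B))%C; [ring|].
    rewrite <- S. ring.
  - rewrite HD, H. ring.
Qed.

Lemma th_PZb a b f x : ev (th a b (PM PZb f)) x =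
  (Cconj x * ev (th a b f) x + 2 * RtoC b * ev (prx f) x - 2 * RtoC a * ev (pry f) x)%C.
Proof.
  assert (HX := ev_ddx f x). assert (HY := ev_ddy f x).
  assert (HD := Cconj_decomp x). unfold th; cbn [ev].
  rewrite (t1_comb b _ _ _ _ _ (ev_PZb_mul f)), (t2_comb a _ _ _ _ _ (ev_PZb_mul f)).
  rewrite t1_PX, t1_PY, t2_PX, t2_PY, <- HX, <- HY. assert (S := Ci_sqr).
  set (X := RtoC (fst x)) in *. set (Y := RtoC (snd x)) in *.
  set (A := ev (t1 b f) x) in *. set (B := ev (t2 a f) x) in *. set (F := ev f x) in *.
  set (U := ev (prx f) x) in *. set (V := ev (pry f) x) in *.
  transitivity ((X + - Ci * Y) * (A + - Ci * B) + (1 + Ci * Ci) * F + 2 * RtoC b * U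
    + (Ci * Ci) * (2 * RtoC a * V))%C; [ring|]. rewrite HD, S. ring.
Qed.

Lemma th_PZ' a b f x : ev (th a b (PM PZ f)) x =
  (x * ev (th a b f) x + 2 * ev f x + 2 * RtoC b * ev (prx f) x + 2 * RtoC a * ev (pry f) x)%C.
Proof.
  assert (HX := ev_ddx f x). assert (HY := ev_ddy f x).
  assert (HD := C_decomp x). unfold th; cbn [ev].
  rewrite (t1_comb b _ _ _ _ _ (ev_PZ_mul f)), (t2_comb a _ _ _ _ _ (ev_PZ_mul f)).
  rewrite t1_PX, t1_PY, t2_PX, t2_PY, <- HX, <- HY. assert (S := Ci_sqr).
  set (X := RtoC (fst x)) in *. set (Y := RtoC (snd x)) in *.
  set (A := ev (t1 b f) x) in *. set (B := ev (t2 a f) x) in *. set (F := ev f x) in *.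
  set (U := ev (prx f) x) in *. set (V := ev (pry f) x) in *.
  transitivity ((X + Ci * Y) * (A + - Ci * B) + (1 - Ci * Ci) * F + 2 * RtoC b * U
    - (Ci * Ci) * (2 * RtoC a * V))%C; [ring|]. rewrite HD, S. ring.
Qed.

Lemma ev_prx_prx p x : ev (prx (prx p)) x = ev p x.
Proof. rewrite !ev_prx. f_equal. destruct x; apply C_ext; simpl; ring. Qed.

Lemma ev_pry_pry p x : ev (pry (pry p)) x = ev p x.
Proof. rewrite !ev_pry, Cconj_conj. reflexivity. Qed.

Lemma ev_prx_ddx p : forall x, ev (prx (ddx p)) x = ev (ddx p) x.
Proof.
  apply ev_eq_offX. intros x Hx. apply RtoC_neq_0 in Hx.
  assert (H1 := ev_ddx p x). assert (H2 := ev_ddx p (- Cconj x)%C).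
  rewrite <- !ev_prx, ev_prx_prx in H2.
  change (fst (- Cconj x)%C) with (- fst x) in H2. rewrite RtoC_opp in H2.
  transitivity (- / RtoC (fst x) * (- RtoC (fst x) * ev (prx (ddx p)) x))%C; [field; auto|].
  rewrite <- H2. transitivity (/ RtoC (fst x) * (ev p x - ev (prx p) x))%C; [ring|].
  rewrite H1. field; auto.
Qed.

Lemma ev_pry_ddy p : forall x, ev (pry (ddy p)) x = ev (ddy p) x.
Proof.
  apply ev_eq_offY. intros x Hx. apply RtoC_neq_0 in Hx.
  assert (H1 := ev_ddy p x). assert (H2 := ev_ddy p (Cconj x)%C).
  rewrite <- !ev_pry, ev_pry_pry in H2.
  change (snd (Cconj x)%C) with (- snd x) in H2. rewrite RtoC_opp in H2.
  transitivity (- / RtoC (snd x) * (- RtoC (snd x) * ev (pry (ddy p)) x))%C; [field; auto|].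
  rewrite <- H2. transitivity (/ RtoC (snd x) * (ev p x - ev (pry p) x))%C; [ring|].
  rewrite H1. field; auto.
Qed.

Lemma t1_prx b f x : ev (t1 b (prx f)) x = (- ev (prx (t1 b f)) x)%C.
Proof.
  unfold t1; cbn [ev]. rewrite (ddx_unique (prx f) (PM (PC (- (1))%C) (ddx f))).
  - unfold prx at 1. rewrite ev_dx_psubst. fold (prx (dx f)) (prx (dy f)).
    change (prx (PA (dx f) (PM (PC (RtoC b)) (ddx f)))) with (PA (prx (dx f)) (PM (PC (RtoC b)) (prx (ddx f)))).
    cbn [dx dy ev]. rewrite ev_prx_ddx. ring.
  - intros y. rewrite ev_prx_prx. cbn [ev].
    transitivity (- (ev f y - ev (prx f) y))%C; [ring|]. rewrite ev_ddx; ring.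
Qed.

Lemma t2_pry a f x : ev (t2 a (pry f)) x = (- ev (pry (t2 a f)) x)%C.
Proof.
  unfold t2; cbn [ev]. rewrite (ddy_unique (pry f) (PM (PC (- (1))%C) (ddy f))).
  - unfold pry at 1. rewrite ev_dy_psubst. fold (pry (dx f)) (pry (dy f)).
    change (pry (PA (dy f) (PM (PC (RtoC a)) (ddy f)))) with (PA (pry (dy f)) (PM (PC (RtoC a)) (pry (ddy f)))).
    cbn [dx dy ev]. rewrite ev_pry_ddy. ring.
  - intros y. rewrite ev_pry_pry. cbn [ev].
    transitivity (- (ev f y - ev (pry f) y))%C; [ring|]. rewrite ev_ddy; ring.
Qed.

Lemma t2_prx a f x : ev (t2 a (prx f)) x = ev (prx (t2 a f)) x.
Proof.
  unfold t2; cbn [ev]. rewrite (ddy_unique (prx f) (prx (ddy f))).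
  - unfold prx at 1. rewrite ev_dy_psubst. fold (prx (dx f)) (prx (dy f)).
    change (prx (PA (dy f) (PM (PC (RtoC a)) (ddy f)))) with (PA (prx (dy f)) (PM (PC (RtoC a)) (prx (ddy f)))).
    cbn [dx dy ev]. ring.
  - intros y. rewrite ev_pry, !ev_prx. assert (H := ev_ddy f (- Cconj y)%C). rewrite ev_pry in H.
    change (snd (- Cconj y)%C) with (- - snd y) in H. rewrite Ropp_involutive in H. rewrite <- H.
    do 3 f_equal; destruct y; apply C_ext; simpl; ring.
Qed.

Lemma t1_pry b f x : ev (t1 b (pry f)) x = ev (pry (t1 b f)) x.
Proof.
  unfold t1; cbn [ev]. rewrite (ddx_unique (pry f) (pry (ddx f))).
  - unfold pry at 1. rewrite ev_dx_psubst. fold (pry (dx f)) (pry (dy f)).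
    change (pry (PA (dx f) (PM (PC (RtoC b)) (ddx f)))) with (PA (pry (dx f)) (PM (PC (RtoC b)) (pry (ddx f)))).
    cbn [dx dy ev]. ring.
  - intros y. rewrite ev_prx, !ev_pry. assert (H := ev_ddx f (Cconj y)%C). rewrite ev_prx in H.
    change (fst (Cconj y)%C) with (fst y) in H. rewrite <- H.
    do 3 f_equal; destruct y; apply C_ext; simpl; ring.
Qed.

(** The reflection x -> -x anticommutes with t1 and commutes with t2; up to sign it therefore
    exchanges [tb] and [th]. *)
Lemma tb_prx a b f x : ev (tb a b (prx f)) x = (- ev (prx (th a b f)) x)%C.
Proof.
  unfold tb; cbn [ev]. rewrite t1_prx, t2_prx, !ev_prx. unfold th; cbn [ev]. ring.
Qed.

Lemma tb_pry a b f x : ev (tb a b (pry f)) x = ev (pry (th a b f)) x.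
Proof.
  unfold tb; cbn [ev]. rewrite t1_pry, t2_pry, !ev_pry. unfold th; cbn [ev]. ring.
Qed.

(** Both sides reduce to the same combination of th f, z th (th f) and the two reflections of th f.
    The degree of th f, lower by one, accounts for the extra term 2 th f of [th_PZ']. *)
Lemma tb_th_comm_PZb a b z f x : hom z f ->
  ev (tb a b (th a b (PM PZb f))) x = ev (th a b (tb a b (PM PZb f))) x.
Proof.
  intros Hf.
  rewrite (tb_comb a b _ (PM PZb (th a b f)) (PA (PM (PC (2 * RtoC b)%C) (prx f)) (PM (PC (- (2) * RtoC a)%C) (pry f))) 1 1)
    by (intros; rewrite th_PZb; cbn [ev]; rewrite ev_PZb; ring).
  rewrite (tb_comb a b (PA _ _) (prx f) (pry f) (2 * RtoC b) (- (2) * RtoC a)%C) by (intros; reflexivity).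
  rewrite (th_comb a b _ f (PM PZ (th a b f)) (2 * (RtoC (IZR z) + 1 + (RtoC a + RtoC b)))%C (- (1))%C)
    by (intros; rewrite (tb_PZb a b z) by auto; cbn [ev]; rewrite ev_PZ; ring).
  rewrite (tb_PZb a b (z - 1)) by (apply hom_th; auto).
  rewrite tb_prx, tb_pry, th_PZ', minus_IZR, RtoC_minus. ring.
Qed.

Lemma ev_t1_pconj b p x : ev (t1 b (pconj p)) x = Cconj (ev (t1 b p) x).
Proof.
  unfold t1; cbn [ev]. rewrite Cplus_conj, Cmult_conj, Cconj_RtoC, ev_dx_pconj.
  rewrite (ddx_unique (pconj p) (pconj (ddx p))); [rewrite ev_pconj; reflexivity|].
  intros y. rewrite ev_prx, !ev_pconj, <- Cminus_conj, <- ev_prx, ev_ddx, Cmult_conj, Cconj_RtoC. auto.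
Qed.

Lemma ev_t2_pconj a p x : ev (t2 a (pconj p)) x = Cconj (ev (t2 a p) x).
Proof.
  unfold t2; cbn [ev]. rewrite Cplus_conj, Cmult_conj, Cconj_RtoC, ev_dy_pconj.
  rewrite (ddy_unique (pconj p) (pconj (ddy p))); [rewrite ev_pconj; reflexivity|].
  intros y. rewrite ev_pry, !ev_pconj, <- Cminus_conj, <- ev_pry, ev_ddy, Cmult_conj, Cconj_RtoC. auto.
Qed.

Lemma Cconj_Ci : Cconj Ci = (- Ci)%C.
Proof. apply C_ext; simpl; ring. Qed.

Lemma ev_tb_pconj a b p x : ev (tb a b (pconj p)) x = Cconj (ev (th a b p) x).
Proof.
  unfold tb, th; cbn [ev]. rewrite ev_t1_pconj, ev_t2_pconj, Cplus_conj, Cmult_conj, Copp_conj, Cconj_Ci.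
  ring.
Qed.

Lemma ev_th_pconj a b p x : ev (th a b (pconj p)) x = Cconj (ev (tb a b p) x).
Proof.
  unfold tb, th; cbn [ev]. rewrite ev_t1_pconj, ev_t2_pconj, Cplus_conj, Cmult_conj, Cconj_Ci. ring.
Qed.

Lemma tb_ext a b p q : (forall x, ev p x = ev q x) -> forall x, ev (tb a b p) x = ev (tb a b q) x.
Proof. intros H x. rewrite (tb_scal a b p q 1); [ring|]. intros; rewrite H; ring. Qed.

Lemma th_ext a b p q : (forall x, ev p x = ev q x) -> forall x, ev (th a b p) x = ev (th a b q) x.
Proof. intros H x. rewrite (th_scal a b p q 1); [ring|]. intros; rewrite H; ring. Qed.

Lemma tb_th_pconj a b p x : ev (tb a b (th a b (pconj p))) x = Cconj (ev (th a b (tb a b p)) x).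
Proof.
  rewrite <- ev_tb_pconj. apply tb_ext. intros y. rewrite ev_th_pconj, ev_pconj. reflexivity.
Qed.

Lemma th_tb_pconj a b p x : ev (th a b (tb a b (pconj p))) x = Cconj (ev (tb a b (th a b p)) x).
Proof.
  rewrite <- ev_th_pconj. apply th_ext. intros y. rewrite ev_tb_pconj, ev_pconj. reflexivity.
Qed.

Lemma tb_th_comm_PZ a b z f x : hom z f ->
  ev (tb a b (th a b (PM PZ f))) x = ev (th a b (tb a b (PM PZ f))) x.
Proof.
  intros Hf. set (g := PM PZb (pconj f)).
  assert (Eg : forall y, ev (PM PZ f) y = ev (pconj g) y).
  { intros y. rewrite ev_pconj. unfold g; cbn [ev].
    rewrite ev_pconj, Cmult_conj, Cconj_conj, ev_PZ, ev_PZb, Cconj_conj. reflexivity. }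
  rewrite (tb_ext a b _ (th a b (pconj g)) (th_ext a b _ _ Eg)), tb_th_pconj.
  rewrite (th_ext a b _ (tb a b (pconj g)) (tb_ext a b _ _ Eg)), th_tb_pconj.
  f_equal. symmetry. apply (tb_th_comm_PZb a b z). apply hom_pconj; auto.
Qed.

(** Polynomials z q1 + conj z q2 exhaust the positive degrees. The second kind is computed directly,
    the first follows from it by conjugation. *)
Lemma tb_th_comm a b z f x : hom z f -> ev (tb a b (th a b f)) x = ev (th a b (tb a b f)) x.
Proof.
  intros Hf. destruct (Z_lt_le_dec 0 z) as [Hz|Hz].
  - destruct (hom_zdecomp z f Hf Hz) as (q1 & q2 & H1 & H2 & Ef).
    assert (Ef' : forall y, ev f y = (1 * ev (PM PZ q1) y + 1 * ev (PM PZb q2) y)%C).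
    { intros y. rewrite Ef. cbn [ev]. rewrite ev_PZ, ev_PZb. ring. }
    rewrite (tb_comb a b _ _ _ _ _ (th_comb a b _ _ _ _ _ Ef')).
    rewrite (th_comb a b _ _ _ _ _ (tb_comb a b _ _ _ _ _ Ef')).
    rewrite (tb_th_comm_PZb a b _ q2 x H2), (tb_th_comm_PZ a b _ q1 x H1). reflexivity.
  - assert (H1 := hom_tb a b _ _ (hom_th a b _ _ Hf)). assert (H2 := hom_th a b _ _ (hom_tb a b _ _ Hf)).
    rewrite (hom_neg _ _ H1), (hom_neg _ _ H2) by lia. reflexivity.
Qed.

(** * Kernels for the group with two mirrors *)

(* [gam kappa n] is the constant with [T^n x^n = gam kappa n] for the rank-one Dunkl operator. *)
Fixpoint gam (kappa : R) (n : nat) : R :=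
  match n with
  | O => 1
  | S m => gam kappa m * (INR (S m) + (if Nat.even m then 2 * kappa else 0))
  end.

Lemma gam_pos kappa n : 0 <= kappa -> 0 < gam kappa n.
Proof.
  intros H. induction n as [|n IH]; cbn [gam]; [lra|].
  apply Rmult_lt_0_compat; auto. assert (0 < INR (S n)) by (apply lt_0_INR; lia).
  destruct (Nat.even n); lra.
Qed.

Lemma gam_neq_0 kappa n : 0 <= kappa -> RtoC (gam kappa n) <> RtoC 0.
Proof. intros H; apply RtoC_neq_0. assert (P := gam_pos kappa n H); lra. Qed.

(** The Dunkl analogue of the divided power v^n / n!: the rank-one operator lowers the index by one
    with coefficient 1. *)
Definition pe (kappa : R) (v : pol) (n : nat) : pol := PM (PC (/ RtoC (gam kappa n))%C) (ppow v n).

Lemma ev_ddx_ppow n x : ev (ddx (ppow PX (S n))) x =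
  (RtoC (if Nat.even n then 2 else 0) * RtoC (fst x) ^ n)%C.
Proof.
  induction n as [|n IH]; [simpl; ring|].
  change (ev (ddx (ppow PX (S (S n)))) x) with
    (ev (ddx PX) x * ev (ppow PX (S n)) x + ev (prx PX) x * ev (ddx (ppow PX (S n))) x)%C.
  rewrite IH, ev_ppow, Nat.even_succ, <- Nat.negb_even, !Cpow_S. cbn [ddx prx psubst ev].
  destruct (Nat.even n); simpl negb; cbv iota; ring.
Qed.

Lemma ev_ddy_ppow n x : ev (ddy (ppow PY (S n))) x =
  (RtoC (if Nat.even n then 2 else 0) * RtoC (snd x) ^ n)%C.
Proof.
  induction n as [|n IH]; [simpl; ring|].
  change (ev (ddy (ppow PY (S (S n)))) x) with
    (ev (ddy PY) x * ev (ppow PY (S n)) x + ev (pry PY) x * ev (ddy (ppow PY (S n))) x)%C.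
  rewrite IH, ev_ppow, Nat.even_succ, <- Nat.negb_even, !Cpow_S. cbn [ddy pry psubst ev].
  destruct (Nat.even n); simpl negb; cbv iota; ring.
Qed.

Lemma t1_pe_0 kappa x : ev (t1 kappa (pe kappa PX 0)) x = RtoC 0.
Proof. simpl; ring. Qed.

Lemma t2_pe_0 kappa x : ev (t2 kappa (pe kappa PY 0)) x = RtoC 0.
Proof. simpl; ring. Qed.

Lemma gam_S_C kappa n : RtoC (gam kappa (S n)) =
  (RtoC (gam kappa n) * (RtoC (INR (S n)) + RtoC kappa * RtoC (if Nat.even n then 2 else 0)))%C.
Proof.
  rewrite <- !RtoC_mult, <- RtoC_plus, <- RtoC_mult. f_equal. cbn [gam].
  destruct (Nat.even n); ring.
Qed.

Lemma t1_pe_S kappa n x : 0 <= kappa -> ev (t1 kappa (pe kappa PX (S n))) x = ev (pe kappa PX n) x.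
Proof.
  intros Hk. unfold t1, pe. cbn [dx ddx ev].
  rewrite ev_ddx_ppow, ev_dx_ppow, !ev_ppow. replace (S n - 1)%nat with n by lia. cbn [dx ev].
  change (ev (prx (PC (/ gam kappa (S n))%C)) x) with (/ RtoC (gam kappa (S n)))%C.
  assert (H0 := gam_neq_0 kappa n Hk). assert (H1 := gam_neq_0 kappa (S n) Hk).
  transitivity (/ RtoC (gam kappa (S n)) * (RtoC (INR (S n)) + RtoC kappa * RtoC (if Nat.even n then 2 else 0))
    * RtoC (fst x) ^ n)%C; [ring|].
  transitivity (/ RtoC (gam kappa n) * / RtoC (gam kappa (S n)) * (RtoC (gam kappa n) *
    (RtoC (INR (S n)) + RtoC kappa * RtoC (if Nat.even n then 2 else 0))) * RtoC (fst x) ^ n)%C;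
    [field; auto|].
  rewrite <- gam_S_C. field; auto.
Qed.

Lemma t2_pe_S kappa n x : 0 <= kappa -> ev (t2 kappa (pe kappa PY (S n))) x = ev (pe kappa PY n) x.
Proof.
  intros Hk. unfold t2, pe. cbn [dy ddy ev].
  rewrite ev_ddy_ppow, ev_dy_ppow, !ev_ppow. replace (S n - 1)%nat with n by lia. cbn [dy ev].
  change (ev (pry (PC (/ gam kappa (S n))%C)) x) with (/ RtoC (gam kappa (S n)))%C.
  assert (H0 := gam_neq_0 kappa n Hk). assert (H1 := gam_neq_0 kappa (S n) Hk).
  transitivity (/ RtoC (gam kappa (S n)) * (RtoC (INR (S n)) + RtoC kappa * RtoC (if Nat.even n then 2 else 0))
    * RtoC (snd x) ^ n)%C; [ring|].
  transitivity (/ RtoC (gam kappa n) * / RtoC (gam kappa (S n)) * (RtoC (gam kappa n) *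
    (RtoC (INR (S n)) + RtoC kappa * RtoC (if Nat.even n then 2 else 0))) * RtoC (snd x) ^ n)%C;
    [field; auto|].
  rewrite <- gam_S_C. field; auto.
Qed.

Lemma t1_mul_pY b p kappa j x :
  ev (t1 b (PM p (pe kappa PY j))) x = (ev (t1 b p) x * ev (pe kappa PY j) x)%C.
Proof.
  assert (Z : forall j, ev (dx (ppow PY j)) x = RtoC 0) by
    (intros i; rewrite ev_dx_ppow; simpl; ring).
  assert (Z' : forall j, ev (ddx (ppow PY j)) x = RtoC 0).
  { intros i; induction i as [|i IH]; cbn [ppow ddx ev]; [|rewrite IH]; ring. }
  unfold t1, pe. cbn [dx ddx ev]. rewrite Z, Z'. ring.
Qed.

Lemma t2_mul_pX a kappa i c q x : ev (t2 a (PM (PM (PC c) (pe kappa PX i)) q)) x =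
  (c * ev (pe kappa PX i) x * ev (t2 a q) x)%C.
Proof.
  assert (Z : forall j, ev (dy (ppow PX j)) x = RtoC 0) by
    (intros j; rewrite ev_dy_ppow; simpl; ring).
  assert (Z' : forall j, ev (ddy (ppow PX j)) x = RtoC 0).
  { intros j; induction j as [|j IH]; cbn [ppow ddy ev]; [|rewrite IH]; ring. }
  assert (P : ev (pry (pe kappa PX i)) x = ev (pe kappa PX i) x).
  { rewrite ev_pry. unfold pe; cbn [ev]. rewrite !ev_ppow. reflexivity. }
  unfold t2. cbn [dy ddy ev]. change (pry (PM (PC c) (pe kappa PX i))) with (PM (PC c) (pry (pe kappa PX i))).
  cbn [ev]. rewrite P. change (ev (pry (PC c)) x) with c.
  change (ev (dy (pe kappa PX i)) x) with (0 * ev (ppow PX i) x + / RtoC (gam kappa i) * ev (dy (ppow PX i)) x)%C.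
  change (ev (ddy (pe kappa PX i)) x) with (0 * ev (ppow PX i) x + / RtoC (gam kappa i) * ev (ddy (ppow PX i)) x)%C.
  rewrite Z, Z'. ring.
Qed.

(** The part of degree m of a product of two rank-one Dunkl exponentials, equivalently the image of
    (c1 x + c2 y)^m / m! under the intertwining operator. Hence t1 and t2 lower the index and
    multiply by c1 and c2. *)
Definition KK (a b : R) (m : nat) (c1 c2 : C) : pol :=
  psum (S m) (fun i => PM (PM (PC (c1 ^ i * c2 ^ (m - i))%C) (pe b PX i)) (pe a PY (m - i))).

Lemma t1_psum b n F x : ev (t1 b (psum n F)) x = csum n (fun i => ev (t1 b (F i)) x).
Proof.
  induction n as [|n IH]; [simpl; ring|]. cbn [psum csum].
  rewrite (t1_comb b _ (psum n F) (F n) 1 1), IH by (intros; cbn [ev]; ring). ring.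
Qed.

Lemma t2_psum b n F x : ev (t2 b (psum n F)) x = csum n (fun i => ev (t2 b (F i)) x).
Proof.
  induction n as [|n IH]; [simpl; ring|]. cbn [psum csum].
  rewrite (t2_comb b _ (psum n F) (F n) 1 1), IH by (intros; cbn [ev]; ring). ring.
Qed.

Lemma t1_cmul b c p x : ev (t1 b (PM (PC c) p)) x = (c * ev (t1 b p) x)%C.
Proof. unfold t1; cbn [dx ddx prx psubst ev]. change (ev (prx (PC c)) x) with c. ring. Qed.

Lemma t1_KK_S a b m c1 c2 x : 0 <= b ->
  ev (t1 b (KK a b (S m) c1 c2)) x = (c1 * ev (KK a b m c1 c2) x)%C.
Proof.
  intros Hb. unfold KK. rewrite t1_psum, ev_psum, csum_S_l, t1_mul_pY, t1_cmul, t1_pe_0, <- csum_mult.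
  rewrite Cmult_0_r, Cmult_0_l, Cplus_0_l. apply csum_ext; intros i _.
  rewrite t1_mul_pY, t1_cmul, t1_pe_S by auto. cbn [ev]. replace (S m - S i)%nat with (m - i)%nat by lia.
  rewrite Cpow_S. ring.
Qed.

Lemma t2_KK_S a b m c1 c2 x : 0 <= a ->
  ev (t2 a (KK a b (S m) c1 c2)) x = (c2 * ev (KK a b m c1 c2) x)%C.
Proof.
  intros Ha. unfold KK. rewrite t2_psum, ev_psum.
  change (csum (S (S m)) ?f) with (csum (S m) f + f (S m))%C. cbv beta.
  rewrite t2_mul_pX, Nat.sub_diag, t2_pe_0, <- csum_mult, Cmult_0_r, Cplus_0_r.
  apply csum_ext; intros i Hi.
  replace (S m - i)%nat with (S (m - i)) by lia. rewrite t2_mul_pX, t2_pe_S by auto. cbn [ev].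
  rewrite Cpow_S. ring.
Qed.

Lemma KK_0 a b c1 c2 x : ev (KK a b 0 c1 c2) x = RtoC 1.
Proof. unfold KK; simpl. field. Qed.

Lemma t1_KK_0 a b c1 c2 x : ev (t1 b (KK a b 0 c1 c2)) x = RtoC 0.
Proof.
  rewrite (t1_ext b _ (PC 1)); [simpl; ring|]. intros; apply KK_0.
Qed.

Lemma t2_KK_0 a b c1 c2 x : ev (t2 a (KK a b 0 c1 c2)) x = RtoC 0.
Proof.
  rewrite (t2_ext a _ (PC 1)); [simpl; ring|]. intros; apply KK_0.
Qed.

Lemma hom_KK a b m c1 c2 : hom (Z.of_nat m) (KK a b m c1 c2).
Proof.
  apply hom_psum; intros i Hi.
  eapply hom_mul; [apply hom_scal, hom_scal, (hom_ppow_nat _ i), hom_X|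
    apply hom_scal, (hom_ppow_nat _ (m - i)), hom_Y|lia].
Qed.

(** The image of z^q / q! under the intertwining operator, for which reason [tb] kills it and [th]
    lowers it. *)
Definition phi (a b : R) (q : nat) : pol := KK a b q 1 Ci.

Lemma hom_phi a b q : hom (Z.of_nat q) (phi a b q).
Proof. apply hom_KK. Qed.

Lemma t1_phi_S a b q x : 0 <= b -> ev (t1 b (phi a b (S q))) x = ev (phi a b q) x.
Proof. intros Hb. unfold phi. rewrite t1_KK_S by auto. ring. Qed.

Lemma t2_phi_S a b q x : 0 <= a -> ev (t2 a (phi a b (S q))) x = (Ci * ev (phi a b q) x)%C.
Proof. intros Ha. unfold phi. rewrite t2_KK_S by auto. ring. Qed.

Lemma tb_phi a b q x : 0 <= a -> 0 <= b -> ev (tb a b (phi a b q)) x = RtoC 0.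
Proof.
  intros Ha Hb. unfold tb; cbn [ev]. destruct q as [|q].
  - unfold phi. rewrite t1_KK_0, t2_KK_0. ring.
  - rewrite t1_phi_S, t2_phi_S by auto.
    transitivity ((1 + Ci * Ci) * ev (phi a b q) x)%C; [ring|]. rewrite Ci_sqr. ring.
Qed.

Lemma th_phi_S a b q x : 0 <= a -> 0 <= b ->
  ev (th a b (phi a b (S q))) x = (2 * ev (phi a b q) x)%C.
Proof.
  intros Ha Hb. unfold th; cbn [ev]. rewrite t1_phi_S, t2_phi_S by auto.
  transitivity ((1 - Ci * Ci) * ev (phi a b q) x)%C; [ring|]. rewrite Ci_sqr. ring.
Qed.

(** The coefficient of the pure power of z modulo multiples of conj z; it is multiplicative. *)
Definition lead (z : Z) (p : pol) (s : C) : Prop :=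
  exists p', hom (z - 1) p' /\ forall x, ev p x = (s * x ^ Z.to_nat z + Cconj x * ev p' x)%C.

Lemma lead_const c : lead 0 (PC c) c.
Proof. exists (PC 0). split; [constructor|]. intros; simpl; ring. Qed.

Lemma lead_X : lead 1 PX (/ 2)%C.
Proof.
  exists (PC (/ 2)%C). split; [apply hom_const|]. intros x. cbn [ev].
  change (RtoC (fst x)) with (RtoC (Re x)). rewrite re_alt. simpl. unfold Cdiv. ring.
Qed.

Lemma lead_Y : lead 1 PY (/ (2 * Ci))%C.
Proof.
  exists (PC (- / (2 * Ci))%C). split; [apply hom_const|]. intros x. cbn [ev].
  change (RtoC (snd x)) with (RtoC (Im x)). rewrite im_alt. simpl. unfold Cdiv. ring.
Qed.

Lemma lead_mul z1 z2 p q s t : (0 <= z1)%Z -> (0 <= z2)%Z -> hom z1 p -> hom z2 q ->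
  lead z1 p s -> lead z2 q t -> lead (z1 + z2) (PM p q) (s * t).
Proof.
  intros H1 H2 Hp Hq (p' & Hp' & Ep) (q' & Hq' & Eq).
  exists (PA (PM p' q) (PM (PM (PC s) (ppow PZ (Z.to_nat z1))) q')). split.
  - apply hom_add; [eapply hom_mul; eauto; lia|].
    eapply hom_mul; [apply hom_scal, hom_ppow_nat, hom_PZ|exact Hq'|lia].
  - intros x. cbn [ev]. rewrite ev_ppow, ev_PZ, Ep, Eq, Z2Nat.inj_add, Cpow_add_r by auto. ring.
Qed.

Lemma lead_pow p s n : hom 1 p -> lead 1 p s -> lead (Z.of_nat n) (ppow p n) (s ^ n)%C.
Proof.
  intros Hp Hl. induction n as [|n IH]; [apply lead_const|].
  replace (Z.of_nat (S n)) with (1 + Z.of_nat n)%Z by lia. rewrite Cpow_S. cbn [ppow].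
  apply lead_mul; auto; try lia. apply hom_ppow_nat; auto.
Qed.

Lemma lead_psum z n F s : (forall i, (i < n)%nat -> lead z (F i) (s i)) ->
  lead z (psum n F) (csum n s).
Proof.
  intros H. induction n as [|n IH].
  - exists (PC 0). split; [constructor|]. intros; simpl; ring.
  - destruct IH as (p & Hp & Ep); [intros; apply H; lia|].
    destruct (H n ltac:(lia)) as (q & Hq & Eq).
    exists (PA p q). split; [apply hom_add; auto|]. intros x. cbn [psum csum ev]. rewrite Ep, Eq. ring.
Qed.

Lemma lead_scal z p s c : lead z p s -> lead z (PM (PC c) p) (c * s).
Proof.
  intros (p' & Hp & Ep). exists (PM (PC c) p'). split; [apply hom_scal; auto|].
  intros x; cbn [ev]. rewrite Ep. ring.
Qed.

Lemma fsum_pos n f : (forall i, 0 < f i) -> 0 < fsum (S n) f.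
Proof.
  intros H. induction n as [|n IH].
  - simpl. specialize (H O). lra.
  - change (0 < fsum (S n) f + f (S n)). specialize (H (S n)). lra.
Qed.

(** The powers of i in [phi] cancel those of 1/(2i) contributed by y, so the coefficient of z^q is a
    sum of positive numbers. *)
Lemma lead_phi a b q : 0 <= a -> 0 <= b -> exists s, lead (Z.of_nat q) (phi a b q) s /\ s <> RtoC 0.
Proof.
  intros Ha Hb. eexists. split.
  - apply lead_psum. intros i Hi.
    replace (Z.of_nat q) with (Z.of_nat i + Z.of_nat (q - i))%Z by lia.
    apply lead_mul; try lia.
    + apply hom_scal, hom_scal, hom_ppow_nat, hom_X.
    + apply hom_scal, hom_ppow_nat, hom_Y.
    + apply lead_scal, lead_scal, lead_pow; [apply hom_X|apply lead_X].
    + apply lead_scal, lead_pow; [apply hom_Y|apply lead_Y].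
  - rewrite (csum_ext _ _ (fun i => RtoC (/ gam b i * / gam a (q - i) * / 2 ^ q))).
    + rewrite csum_RtoC. apply RtoC_neq_0, Rgt_not_eq, fsum_pos.
      intros i. repeat apply Rmult_lt_0_compat; apply Rinv_0_lt_compat;
        try apply gam_pos; auto. apply pow_lt; lra.
    + intros i Hi. cbv beta.
      assert (Hb1 := gam_neq_0 b i Hb). assert (Ha1 := gam_neq_0 a (q - i) Ha).
      rewrite !RtoC_mult.
      assert (H2q : 2 ^ q <> 0) by (apply pow_nonzero; lra).
      assert (Hg1 : gam b i <> 0) by (intros H; apply Hb1; rewrite H; auto).
      assert (Hg2 : gam a (q - i) <> 0) by (intros H; apply Ha1; rewrite H; auto).
      rewrite !RtoC_inv by auto.
      replace (RtoC (2 ^ q)%R) with (2 ^ i * 2 ^ (q - i))%C by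
        (rewrite <- Cpow_add_r, RtoC_pow; f_equal; lia).
      rewrite Cpow_1_l, (Cpow_inv 2), (Cpow_inv (2 * Ci)) by (apply Cmult_neq_0 || nz; nz).
      rewrite Cpow_mult_l.
      assert (H2 : forall n, (2 ^ n)%C <> RtoC 0) by (intros; apply Cpow_nz; nz).
      assert (HC : forall n, (Ci ^ n)%C <> RtoC 0) by (intros; apply Cpow_nz; nz).
      field. repeat split; auto.
Qed.

(** * Gegenbauer-type polynomials for the group with two mirrors *)

Fixpoint poch (x : R) (n : nat) : R := match n with O => 1 | S m => poch x m * (x + INR m) end.

(** Coefficients of the Gegenbauer polynomial of parameter lam + 1, except for the factor 1/(n -
    2i)!, which is carried by the divided powers inside [KP]. *)
Definition cc (lam : R) (n i : nat) : R :=
  (-1) ^ i * poch (lam + 1) (n - i) * 2 ^ n / (4 ^ i * INR (fact i)).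

Lemma cc_S_l lam n i : (i <= n)%nat -> cc lam (S n) i = 2 * (lam + 1 + INR n - INR i) * cc lam n i.
Proof.
  intros Hi. unfold cc. replace (S n - i)%nat with (S (n - i)) by lia. cbn [poch].
  rewrite minus_INR by auto. simpl (2 ^ S n). field. split; [apply INR_fact_neq_0|apply pow_nonzero; lra].
Qed.

Lemma cc_S_S lam n i : 2 * INR (S i) * cc lam (S n) (S i) = - cc lam n i.
Proof.
  unfold cc. replace (S n - S i)%nat with (n - i)%nat by lia.
  rewrite fact_simpl, mult_INR. simpl (_ ^ S _). field.
  repeat split; first [apply INR_fact_neq_0|apply not_0_INR; lia|apply pow_nonzero; lra].
Qed.

Definition KP (a b : R) (eta : C) (n i : nat) : pol :=
  if Nat.leb (2 * i) n then KK a b (n - 2 * i) (RtoC (fst eta)) (RtoC (snd eta)) else PC 0.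

(** [KP] with n lowered by one, and 0 where n - 1 would be a truncated subtraction. *)
Definition KL (a b : R) (eta : C) (n i : nat) : pol :=
  match n with O => PC 0 | S m => KP a b eta m i end.

Lemma hom_KP a b eta n i : hom (Z.of_nat n - 2 * Z.of_nat i) (KP a b eta n i).
Proof.
  unfold KP. destruct (Nat.leb_spec (2 * i) n) as [H|H]; [|apply hom_zero].
  replace (Z.of_nat n - 2 * Z.of_nat i)%Z with (Z.of_nat (n - 2 * i)) by lia. apply hom_KK.
Qed.

Lemma KP_SS a b eta n i : KP a b eta (S n) (S i) = KL a b eta n i.
Proof.
  unfold KL. destruct n as [|n]; unfold KP.
  - destruct (Nat.leb_spec (2 * S i) 1); auto; lia.
  - replace (S (S n) - 2 * S i)%nat with (n - 2 * i)%nat by lia.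
    destruct (Nat.leb_spec (2 * S i) (S (S n))), (Nat.leb_spec (2 * i) n); auto; lia.
Qed.

Lemma t1_KP a b eta n i x : 0 <= b ->
  ev (t1 b (KP a b eta n i)) x = (RtoC (fst eta) * ev (KL a b eta n i) x)%C.
Proof.
  intros Hb. unfold KL. destruct n as [|n]; unfold KP.
  - destruct (Nat.leb_spec (2 * i) 0); [rewrite t1_KK_0|]; simpl; ring.
  - destruct (Nat.leb_spec (2 * i) (S n)) as [H|H], (Nat.leb_spec (2 * i) n) as [H'|H']; try lia.
    + replace (S n - 2 * i)%nat with (S (n - 2 * i)) by lia. apply t1_KK_S; auto.
    + replace (S n - 2 * i)%nat with 0%nat by lia. rewrite t1_KK_0. simpl; ring.
    + simpl; ring.
Qed.

Lemma t2_KP a b eta n i x : 0 <= a ->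
  ev (t2 a (KP a b eta n i)) x = (RtoC (snd eta) * ev (KL a b eta n i) x)%C.
Proof.
  intros Ha. unfold KL. destruct n as [|n]; unfold KP.
  - destruct (Nat.leb_spec (2 * i) 0); [rewrite t2_KK_0|]; simpl; ring.
  - destruct (Nat.leb_spec (2 * i) (S n)) as [H|H], (Nat.leb_spec (2 * i) n) as [H'|H']; try lia.
    + replace (S n - 2 * i)%nat with (S (n - 2 * i)) by lia. apply t2_KK_S; auto.
    + replace (S n - 2 * i)%nat with 0%nat by lia. rewrite t2_KK_0. simpl; ring.
    + simpl; ring.
Qed.

Lemma tb_KP a b eta n i x : 0 <= a -> 0 <= b ->
  ev (tb a b (KP a b eta n i)) x = (eta * ev (KL a b eta n i) x)%C.
Proof.
  intros Ha Hb. unfold tb; cbn [ev]. rewrite t1_KP, t2_KP by auto. 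
  transitivity ((RtoC (fst eta) + Ci * RtoC (snd eta)) * ev (KL a b eta n i) x)%C; [ring|].
  rewrite C_decomp. reflexivity.
Qed.

Lemma th_KP a b eta n i x : 0 <= a -> 0 <= b ->
  ev (th a b (KP a b eta n i)) x = (Cconj eta * ev (KL a b eta n i) x)%C.
Proof.
  intros Ha Hb. unfold th; cbn [ev]. rewrite t1_KP, t2_KP by auto. rewrite <- (Cconj_decomp eta). ring.
Qed.

Lemma tb_PRho a b f x : ev (tb a b (PM PRho f)) x = (ev PRho x * ev (tb a b f) x + 2 * x * ev f x)%C.
Proof.
  assert (Q1 : ev (prx PRho) x = ev PRho x).
  { rewrite ev_prx, !ev_PRho. rewrite Copp_conj, Cconj_conj. ring. }
  assert (Q2 : ev (pry PRho) x = ev PRho x) by (rewrite ev_pry, !ev_PRho, Cconj_conj; ring).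
  assert (D1 : ev (dx PRho) x = (2 * RtoC (fst x))%C) by (simpl; ring).
  assert (S := Ci_sqr).
  assert (D2 : ev (dy PRho) x = (2 * RtoC (snd x))%C).
  { simpl. transitivity (- (2) * (Ci * Ci) * RtoC (snd x))%C; [ring|rewrite S; ring]. }
  assert (D3 : ev (ddx PRho) x = RtoC 0) by (simpl; ring).
  assert (D4 : ev (ddy PRho) x = RtoC 0) by (simpl; ring).
  assert (HD := C_decomp x).
  unfold tb, t1, t2.
  change (ddx (PM PRho f)) with (PA (PM (ddx PRho) f) (PM (prx PRho) (ddx f))).
  change (ddy (PM PRho f)) with (PA (PM (ddy PRho) f) (PM (pry PRho) (ddy f))).
  change (dx (PM PRho f)) with (PA (PM (dx PRho) f) (PM PRho (dx f))).
  change (dy (PM PRho f)) with (PA (PM (dy PRho) f) (PM PRho (dy f))).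
  cbn [ev]. change (ev PZ x * ev PZb x)%C with (ev PRho x).
  rewrite Q1, Q2, D1, D2, D3, D4. 
  transitivity (ev PRho x * (ev (dx f) x + RtoC b * ev (ddx f) x +
    Ci * (ev (dy f) x + RtoC a * ev (ddy f) x)) +
    2 * (RtoC (fst x) + Ci * RtoC (snd x)) * ev f x)%C; [ring|]. rewrite HD. ring.
Qed.

Lemma th_PRho a b f x :
  ev (th a b (PM PRho f)) x = (ev PRho x * ev (th a b f) x + 2 * Cconj x * ev f x)%C.
Proof.
  rewrite (th_ext a b _ (pconj (PM PRho (pconj f)))).
  - rewrite ev_th_pconj, tb_PRho, ev_tb_pconj, ev_pconj, !Cplus_conj, !Cmult_conj, !Cconj_conj, Cconj_RtoC.
    replace (Cconj (ev PRho x)) with (ev PRho x); [ring|].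
    rewrite ev_PRho, Cmult_conj, Cconj_conj. ring.
  - intros y. rewrite ev_pconj. cbn [ev]. rewrite Cmult_conj, ev_pconj, Cconj_conj.
    change (ev PZ y * ev PZb y)%C with (ev PRho y).
    rewrite ev_PRho, Cmult_conj, Cconj_conj. ring.
Qed.

Lemma tb_PRho_pow a b f i x : ev (tb a b (PM (ppow PRho i) f)) x =
  (ev PRho x ^ i * ev (tb a b f) x + 2 * RtoC (INR i) * x * ev PRho x ^ (i - 1) * ev f x)%C.
Proof.
  induction i as [|i IH].
  - rewrite (tb_scal a b _ f 1) by (intros; cbn [ppow ev]; ring). cbn [Cpow INR]. ring.
  - rewrite (tb_ext a b _ (PM PRho (PM (ppow PRho i) f))) by (intros; cbn [ppow ev]; ring).
    rewrite tb_PRho, IH. cbn [ev]. rewrite ev_ppow, S_INR, RtoC_plus, Cpow_S.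
    replace (S i - 1)%nat with i by lia. destruct i as [|i]; [cbn [Cpow INR]; ring|].
    replace (S i - 1)%nat with i by lia. rewrite Cpow_S. ring.
Qed.

Lemma th_PRho_pow a b f i x : ev (th a b (PM (ppow PRho i) f)) x =
  (ev PRho x ^ i * ev (th a b f) x + 2 * RtoC (INR i) * Cconj x * ev PRho x ^ (i - 1) * ev f x)%C.
Proof.
  induction i as [|i IH].
  - rewrite (th_scal a b _ f 1) by (intros; cbn [ppow ev]; ring). cbn [Cpow INR]. ring.
  - rewrite (th_ext a b _ (PM PRho (PM (ppow PRho i) f))) by (intros; cbn [ppow ev]; ring).
    rewrite th_PRho, IH. cbn [ev]. rewrite ev_ppow, S_INR, RtoC_plus, Cpow_S.
    replace (S i - 1)%nat with i by lia. destruct i as [|i]; [cbn [Cpow INR]; ring|].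
    replace (S i - 1)%nat with i by lia. rewrite Cpow_S. ring.
Qed.

Lemma tb_psum a b n F x : ev (tb a b (psum n F)) x = csum n (fun i => ev (tb a b (F i)) x).
Proof.
  induction n as [|n IH]; [simpl; ring|]. cbn [psum csum].
  rewrite (tb_comb a b _ (psum n F) (F n) 1 1), IH by (intros; cbn [ev]; ring). ring.
Qed.

Lemma th_psum a b n F x : ev (th a b (psum n F)) x = csum n (fun i => ev (th a b (F i)) x).
Proof.
  induction n as [|n IH]; [simpl; ring|]. cbn [psum csum].
  rewrite (th_comb a b _ (psum n F) (F n) 1 1), IH by (intros; cbn [ev]; ring). ring.
Qed.

(** The homogeneous Gegenbauer polynomial in x and eta with each power of the inner product replaced
    by its image under the intertwining operator. On unit vectors it becomes the coefficient of W^n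
    in the generating function. *)
Definition DD (a b : R) (eta : C) (n : nat) : pol :=
  psum (S n) (fun i => PM (PC (RtoC (cc (a + b) n i) * (eta * Cconj eta) ^ i)%C)
    (PM (ppow PRho i) (KP a b eta n i))).

(* The combination of [DD] lying in the kernel of [T_1 + i T_2] for the case [k = 1]. *)
Definition CC (a b : R) (eta : C) (n : nat) : pol :=
  match n with
  | O => DD a b eta 0
  | S m => PA (DD a b eta (S m)) (PM (PC (- eta)%C) (PM PZb (DD a b eta m)))
  end.

Lemma hom_DD a b eta n : hom (Z.of_nat n) (DD a b eta n).
Proof.
  apply hom_psum; intros i Hi. apply hom_scal.
  eapply hom_mul; [apply hom_ppow, hom_PRho|apply hom_KP|lia].
Qed.

Lemma hom_CC a b eta n : hom (Z.of_nat n) (CC a b eta n).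
Proof.
  destruct n as [|n]; [apply hom_DD|]. apply hom_add; [apply hom_DD|].
  apply hom_scal. eapply hom_mul; [apply hom_PZb|apply hom_DD|lia].
Qed.

(** By [tb_PZb] the right side is eta times the image of conj z DD_n under [tb], and this is what
    puts [CC] into the kernel. The recurrences [cc_S_l] and [cc_S_S] match the terms in
    [KP a b eta n i] and in [KL a b eta n i]. *)
Lemma tb_DD_S a b eta n x : 0 <= a -> 0 <= b -> ev (tb a b (DD a b eta (S n))) x =
  (eta * (2 * (RtoC (INR n) + 1 + (RtoC a + RtoC b)) * ev (DD a b eta n) x -
    x * ev (th a b (DD a b eta n)) x))%C.
Proof.
  intros Ha Hb. set (tau := (eta * Cconj eta)%C). set (rho := ev PRho x).
  (* The second sum collects the derivatives of the powers of |x|^2; its i-th term comes from the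
     exponent i + 1, hence the shift. *)
  transitivity (csum (S n) (fun i => RtoC (cc (a + b) (S n) i) * tau ^ i * (rho ^ i * (eta * ev (KP a b eta n i) x)))
    + csum (S n) (fun i => RtoC (2 * INR (S i) * cc (a + b) (S n) (S i)) * tau ^ S i * x * rho ^ i * ev (KL a b eta n i) x))%C.
  - unfold DD. rewrite tb_psum.
    rewrite (csum_ext _ _ (fun i => RtoC (cc (a + b) (S n) i) * tau ^ i * (rho ^ i * (eta * ev (KP a b eta n i) x)) +
      RtoC (2 * INR i * cc (a + b) (S n) i) * tau ^ i * x * rho ^ (i - 1) * ev (KP a b eta (S n) i) x)%C).
    2: { intros i _. rewrite (tb_scal a b _ (PM (ppow PRho i) (KP a b eta (S n) i))
           (RtoC (cc (a + b) (S n) i) * tau ^ i)%C) by reflexivity.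
         rewrite tb_PRho_pow, tb_KP by auto. fold rho. rewrite !RtoC_mult. unfold KL. ring. }
    rewrite csum_plus. f_equal.
    + change (csum (S (S n)) ?f) with (csum (S n) f + f (S n))%C. cbv beta.
      unfold KP at 2. destruct (Nat.leb_spec (2 * S n) n); [lia|]. cbn [ev]. ring.
    + rewrite csum_S_l.
      transitivity (0 + csum (S n) (fun i => RtoC (2 * INR (S i) * cc (a + b) (S n) (S i)) * tau ^ S i
        * x * rho ^ i * ev (KL a b eta n i) x))%C; [|ring].
      f_equal; [change (INR 0) with 0; rewrite Rmult_0_r, Rmult_0_l; ring|].
      apply csum_ext; intros i _. rewrite KP_SS.
      replace (S i - 1)%nat with i by lia. reflexivity.
  - unfold DD. rewrite th_psum, ev_psum.
    rewrite (csum_ext _ (fun i => ev (th a b _) x) (fun i => RtoC (cc (a + b) n i) * tau ^ i *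
      (rho ^ i * (Cconj eta * ev (KL a b eta n i) x) +
       2 * RtoC (INR i) * Cconj x * rho ^ (i - 1) * ev (KP a b eta n i) x))%C).
    2: { intros i _. rewrite (th_scal a b _ (PM (ppow PRho i) (KP a b eta n i))
           (RtoC (cc (a + b) n i) * tau ^ i)%C) by reflexivity.
         rewrite th_PRho_pow, th_KP by auto. reflexivity. }
    match goal with |- _ = (eta * (?u * ?s1 - x * ?s2))%C =>
      transitivity (eta * u * s1 + - eta * x * s2)%C; [|ring] end.
    rewrite <- !csum_mult, <- !csum_plus.
    apply csum_ext; intros i Hi. cbn [ev]. rewrite ev_ppow. fold rho tau.
    rewrite cc_S_l, cc_S_S by lia.
    assert (Er : (INR i * (x * Cconj x) * rho ^ (i - 1) = INR i * rho ^ i)%C).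
    { destruct i as [|i]; [cbn [INR]; ring|]. replace (S i - 1)%nat with i by lia.
      rewrite Cpow_S. unfold rho. rewrite ev_PRho. ring. }
    rewrite Cpow_S, !RtoC_mult, RtoC_minus, !RtoC_plus, RtoC_opp.
    transitivity (2 * (a + b + 1 + INR n - INR i) * cc (a + b) n i * tau ^ i * (rho ^ i * (eta * ev (KP a b eta n i) x)) -
      cc (a + b) n i * (tau * tau ^ i) * x * rho ^ i * ev (KL a b eta n i) x)%C; [ring|].
    transitivity (eta * (2 * (INR n + 1 + (a + b))) * (cc (a + b) n i * tau ^ i * (rho ^ i * ev (KP a b eta n i) x)) -
      x * cc (a + b) n i * tau ^ i * rho ^ i * (eta * Cconj eta) * ev (KL a b eta n i) x -
      eta * 2 * cc (a + b) n i * tau ^ i * (INR i * (x * Cconj x) * rho ^ (i - 1)) * ev (KP a b eta n i) x)%C; [|ring].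
    rewrite Er. fold tau. ring.
Qed.

Lemma tb_DD_0 a b eta x : ev (tb a b (DD a b eta 0)) x = RtoC 0.
Proof. apply (hom_neg (-1)%Z); [|lia]. apply (hom_tb a b 0). apply (hom_DD a b eta 0). Qed.

Lemma tb_CC a b eta n x : 0 <= a -> 0 <= b -> ev (tb a b (CC a b eta n)) x = RtoC 0.
Proof.
  intros Ha Hb. destruct n as [|n]; [apply tb_DD_0|]. unfold CC.
  rewrite (tb_comb a b _ (DD a b eta (S n)) (PM PZb (DD a b eta n)) 1 (- eta)%C) by
    (intros; cbn [ev]; ring).
  rewrite tb_DD_S, (tb_PZb a b (Z.of_nat n)), <- INR_IZR_INZ by (auto; apply hom_DD). ring.
Qed.

Lemma ev_DD_conj a b eta n x : Cconj (ev (DD a b eta n) x) = ev (DD a b eta n) x.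
Proof.
  unfold DD. rewrite ev_psum, csum_conj. apply csum_ext; intros i _. cbn [ev].
  rewrite ev_ppow, !Cmult_conj, !Cpow_conj, ev_PRho, !Cmult_conj, !Cconj_conj, Cconj_RtoC.
  assert (H : Cconj (ev (KP a b eta n i) x) = ev (KP a b eta n i) x).
  { unfold KP. destruct (Nat.leb (2 * i) n); [|apply Cconj_RtoC].
    unfold KK. rewrite ev_psum, csum_conj. apply csum_ext; intros j _. unfold pe; cbn [ev].
    rewrite !ev_ppow, !Cmult_conj, !Cpow_conj, <- !RtoC_pow. cbn [ev].
    assert (HR : forall r, Cconj (/ RtoC r)%C = (/ RtoC r)%C).
    { intros r. apply C_ext; simpl; try ring. unfold Rdiv; ring. }
    rewrite !HR, !Cconj_RtoC, <- !RtoC_pow, ?Cconj_RtoC. reflexivity. }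
  rewrite H. rewrite (Cmult_comm (Cconj eta)), (Cmult_comm (Cconj x)). reflexivity.
Qed.

(** * Harmonicity of the lifted polynomials *)

Lemma TB_comb k a b f p q u v : (forall x, ev f x = (u * ev p x + v * ev q x)%C) ->
  forall x, ev (TB k a b f) x = (u * ev (TB k a b p) x + v * ev (TB k a b q) x)%C.
Proof.
  intros H x. unfold TB; cbn [ev]. rewrite (T1_comb k a b f p q u v H), (T2_comb k a b f p q u v H). ring.
Qed.

Lemma TH_comb k a b f p q u v : (forall x, ev f x = (u * ev p x + v * ev q x)%C) ->
  forall x, ev (TH k a b f) x = (u * ev (TH k a b p) x + v * ev (TH k a b q) x)%C.
Proof.
  intros H x. unfold TH; cbn [ev]. rewrite (T1_comb k a b f p q u v H), (T2_comb k a b f p q u v H). ring.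
Qed.

Lemma TB_scal k a b f p u : (forall x, ev f x = (u * ev p x)%C) ->
  forall x, ev (TB k a b f) x = (u * ev (TB k a b p) x)%C.
Proof. intros H x. rewrite (TB_comb k a b f p p u 0); [ring|]. intros; rewrite H; ring. Qed.

Lemma TH_scal k a b f p u : (forall x, ev f x = (u * ev p x)%C) ->
  forall x, ev (TH k a b f) x = (u * ev (TH k a b p) x)%C.
Proof. intros H x. rewrite (TH_comb k a b f p p u 0); [ring|]. intros; rewrite H; ring. Qed.

Lemma ev_TH_pconj k a b p x : ev (TH k a b (pconj p)) x = Cconj (ev (TB k a b p) x).
Proof.
  unfold TB, TH; cbn [ev]. rewrite ev_T1_pconj, ev_T2_pconj, Cplus_conj, Cmult_conj, Cconj_Ci. ring.
Qed.

Lemma th_PZ a b z f x : hom z f -> ev (th a b (PM PZ f)) x =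
  (2 * (RtoC (IZR z) + 1 + (RtoC a + RtoC b)) * ev f x - Cconj x * ev (tb a b f) x)%C.
Proof.
  intros Hf. rewrite (th_ext a b _ (pconj (PM PZb (pconj f)))).
  - rewrite ev_th_pconj, (tb_PZb a b z) by (apply hom_pconj; auto).
    rewrite ev_th_pconj, ev_pconj, Cminus_conj, !Cmult_conj, !Cplus_conj, !Cconj_conj, !Cconj_RtoC.
    reflexivity.
  - intros y. rewrite ev_pconj. cbn [ev]. rewrite ev_pconj, Cmult_conj, Cconj_conj, ev_PZ, ev_PZb, Cconj_conj.
    reflexivity.
Qed.

Lemma Lap_zero_of k a b f : (forall x, ev (TH k a b (TB k a b f)) x = RtoC 0) ->
  (forall x, ev (TB k a b (TH k a b f)) x = RtoC 0) -> forall x, ev (Lap k a b f) x = RtoC 0.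
Proof.
  intros H1 H2 x. assert (H := Lap_TB_TH k a b f x). rewrite H1, H2 in H.
  transitivity (/ 2 * (2 * ev (Lap k a b f) x))%C; [field; nz|]. rewrite <- H. ring.
Qed.

Lemma TH_zero k a b f : (forall x, ev f x = RtoC 0) -> forall x, ev (TH k a b f) x = RtoC 0.
Proof. intros H x. rewrite (TH_scal k a b f f 0); [ring|]. intros; rewrite H; ring. Qed.

Lemma TB_TH_plift_S k a b l q g : (l < k)%nat -> hom q g ->
  (forall y, ev (tb a b g) y = RtoC 0) ->
  forall x, ev (TB k a b (TH k a b (plift (S l) k g))) x = RtoC 0.
Proof.
  intros Hl Hg Ht x.
  rewrite (TB_scal k a b _ (plift l k g)
    (2 * (RtoC (INR (S l)) + RtoC (INR k) * RtoC (IZR q) + RtoC (INR k) * (RtoC a + RtoC b)))%C).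
  - rewrite TB_plift, Ht by auto. ring.
  - intros y. apply TH_plift_S; auto.
Qed.

(** [TB] already kills the lift. In the other order, for l > 0 [TH] returns a multiple of the lift
    with exponent l - 1, killed again; for l = 0 it gives a lift of th g with exponent k - 1, and tb
    (th g) = th (tb g) = 0. *)
Lemma Lap_plift k a b l q g : (l < k)%nat -> hom q g ->
  (forall y, ev (tb a b g) y = RtoC 0) -> forall x, ev (Lap k a b (plift l k g)) x = RtoC 0.
Proof.
  intros Hl Hg Ht. apply Lap_zero_of.
  - apply TH_zero. intros x. rewrite TB_plift, Ht by auto. ring.
  - destruct l as [|l]; [|apply (TB_TH_plift_S k a b l q); auto; lia].
    intros x. rewrite (TB_scal k a b _ (plift (k - 1) k (th a b g)) (RtoC (INR k))).
    + rewrite TB_plift by lia. rewrite (tb_th_comm a b q) by auto.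
      rewrite (th_scal a b _ (PC 0) 0) by (intros; rewrite Ht; ring). ring.
    + intros y. rewrite TH_plift_0, ev_plift by lia. ring.
Qed.

(** The exponent l + 1 may equal k, which lies outside the range of [TB_plift]; that case is treated
    apart. *)
Lemma Lap_plift_S k a b l q g : (l < k)%nat -> hom q g ->
  (forall y, ev (tb a b g) y = RtoC 0) -> forall x, ev (Lap k a b (plift (S l) k g)) x = RtoC 0.
Proof.
  intros Hl Hg Ht. apply Lap_zero_of; [|apply (TB_TH_plift_S k a b l q); auto].
  destruct (Nat.eq_dec (S l) k) as [E|E].
  (* For l + 1 = k the function is a lift of Z g with exponent 0. Its image under [TB] is the
     conjugate of a lift with exponent l = k - 1, so [TH] acts on it as the conjugate of [TB]; there
     th (tb (Z g)) = tb (th (Z g)) is a multiple of tb g. *)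
  - set (g2 := tb a b (PM PZ g)). intros x.
    rewrite (TH_scal k a b _ (pconj (plift l k (pconj g2))) (RtoC (INR k))).
    + rewrite ev_TH_pconj, TB_plift by auto. rewrite ev_tb_pconj.
      unfold g2. rewrite <- (tb_th_comm a b (1 + q)) by (eapply hom_mul; [apply hom_PZ|exact Hg|lia]).
      rewrite (tb_scal a b _ g (2 * (RtoC (IZR q) + 1 + (RtoC a + RtoC b)))%C).
      * rewrite Ht, Cmult_0_r, Cconj_RtoC, Cmult_0_r, Cconj_RtoC. ring.
      * intros y. rewrite (th_PZ a b q) by auto. rewrite Ht. ring.
    + intros y.
      rewrite (TB_scal k a b _ (plift 0 k (PM PZ g)) 1).
      * rewrite TB_plift by lia. fold g2. rewrite ev_pconj, ev_plift, ev_pconj, Cmult_conj, Cconj_conj, Cpow_conj.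
        replace (k - 1)%nat with l by lia. simpl (y ^ 0)%C. ring.
      * intros u. rewrite !ev_plift. cbn [ev]. rewrite ev_PZ, E. simpl (u ^ 0)%C. ring.
  - apply TH_zero. intros x. rewrite TB_plift, Ht by lia. ring.
Qed.

(** * Integration on the circle and the reproducing property *)

Definition ccont (f : R -> C) : Prop :=
  (forall t, continuous (fun s => Re (f s)) t) /\ (forall t, continuous (fun s => Im (f s)) t).

Definition Cint (f : R -> C) : C :=
  (RInt (fun t => Re (f t)) 0 (2 * PI), RInt (fun t => Im (f t)) 0 (2 * PI)).

Lemma cont_ex_RInt (f : R -> R) a b : (forall t, continuous f t) -> ex_RInt f a b.
Proof. intros H. apply (ex_RInt_continuous (V := R_CompleteNormedModule)). auto. Qed.

Lemma cont_Rplus (f g : R -> R) t : continuous f t -> continuous g t -> continuous (fun s => f s + g s) t.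
Proof. apply (continuous_plus (V := R_NormedModule)). Qed.

Lemma cont_Rmult (f g : R -> R) t : continuous f t -> continuous g t -> continuous (fun s => f s * g s) t.
Proof. apply (continuous_mult (K := R_AbsRing)). Qed.

Lemma cont_Ropp (f : R -> R) t : continuous f t -> continuous (fun s => - f s) t.
Proof. apply (continuous_opp (V := R_NormedModule)). Qed.

Lemma cont_Rminus (f g : R -> R) t : continuous f t -> continuous g t -> continuous (fun s => f s - g s) t.
Proof. apply (continuous_minus (V := R_NormedModule)). Qed.

Lemma cont_comp (f g : R -> R) t : continuous f t -> continuous g (f t) -> continuous (fun s => g (f s)) t.
Proof. apply (continuous_comp f g). Qed.

Lemma cont_const (c : R) t : continuous (fun _ : R => c) t.
Proof. apply (continuous_const (U := R_UniformSpace) (V := R_UniformSpace)). Qed.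

Lemma ccont_plus f g : ccont f -> ccont g -> ccont (fun t => (f t + g t)%C).
Proof. intros [A B] [A' B']; split; intros t; simpl; apply cont_Rplus; auto. Qed.

Lemma ccont_mult f g : ccont f -> ccont g -> ccont (fun t => (f t * g t)%C).
Proof.
  intros [A B] [A' B']; split; intros t; simpl.
  - apply cont_Rminus; apply cont_Rmult; auto.
  - apply cont_Rplus; apply cont_Rmult; auto.
Qed.

Lemma ccont_const c : ccont (fun _ => c).
Proof. split; intros t; apply cont_const. Qed.

Lemma ccont_RtoC (f : R -> R) : (forall t, continuous f t) -> ccont (fun t => RtoC (f t)).
Proof. intros H; split; intros t; simpl; auto. apply cont_const. Qed.

Lemma ccont_comp f (g : R -> R) : ccont f -> (forall t, continuous g t) -> ccont (fun t => f (g t)).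
Proof.
  intros [A B] H; split; intros t.
  - apply (cont_comp g (fun s => Re (f s))); auto.
  - apply (cont_comp g (fun s => Im (f s))); auto.
Qed.

Lemma Cint_ext f g : (forall t, f t = g t) -> Cint f = Cint g.
Proof. intros H. unfold Cint. f_equal; apply RInt_ext; intros; rewrite H; auto. Qed.

Lemma Cint_plus f g : ccont f -> ccont g -> Cint (fun t => (f t + g t)%C) = (Cint f + Cint g)%C.
Proof.
  intros [A B] [A' B']. unfold Cint, Cplus; simpl. f_equal;
    apply (RInt_plus (V := R_CompleteNormedModule)); apply cont_ex_RInt; auto.
Qed.

Lemma Cint_scal c f : ccont f -> Cint (fun t => (c * f t)%C) = (c * Cint f)%C.
Proof.
  intros [A B].
  assert (HA := RInt_correct _ _ _ (cont_ex_RInt (fun t => Re (f t)) 0 (2 * PI) A)).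
  assert (HB := RInt_correct _ _ _ (cont_ex_RInt (fun t => Im (f t)) 0 (2 * PI) B)).
  unfold Cint. apply C_ext; simpl; apply is_RInt_unique.
  - exact (is_RInt_minus (V := R_NormedModule) _ _ _ _ _ _
      (is_RInt_scal _ _ _ (Re c) _ HA) (is_RInt_scal _ _ _ (Im c) _ HB)).
  - exact (is_RInt_plus (V := R_NormedModule) _ _ _ _ _ _
      (is_RInt_scal _ _ _ (Re c) _ HB) (is_RInt_scal _ _ _ (Im c) _ HA)).
Qed.

Lemma RInt_per_shift (f : R -> R) c : (forall t, continuous f t) ->
  (forall t, f (t + 2 * PI) = f t) -> RInt f c (c + 2 * PI) = RInt f 0 (2 * PI).
Proof.
  intros Hc Hp.
  assert (E : forall a b, ex_RInt f a b) by (intros; apply cont_ex_RInt; auto).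
  assert (S : RInt f (0 + 2 * PI) (c + 2 * PI) = RInt f 0 c).
  { replace (0 + 2 * PI) with (1 * 0 + 2 * PI) by ring.
    replace (c + 2 * PI) with (1 * c + 2 * PI) by ring.
    rewrite <- (RInt_comp_lin f 1 (2 * PI) 0 c) by apply E.
    apply RInt_ext; intros x _. unfold scal; simpl; unfold mult; simpl.
    rewrite Rmult_1_l, Rmult_1_l, Hp. reflexivity. }
  rewrite Rplus_0_l in S.
  rewrite <- (RInt_Chasles f c 0 (c + 2 * PI)) by apply E.
  rewrite <- (RInt_Chasles f 0 (2 * PI) (c + 2 * PI)) by apply E.
  rewrite S, <- (opp_RInt_swap f c 0) by apply E.
  unfold plus, opp; simpl. ring.
Qed.

Lemma RInt_per_comp (f : R -> R) c : (forall t, continuous f t) ->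
  (forall t, f (t + 2 * PI) = f t) -> RInt (fun t => f (t + c)) 0 (2 * PI) = RInt f 0 (2 * PI).
Proof.
  intros Hc Hp. rewrite <- (RInt_per_shift f c Hc Hp).
  transitivity (RInt f (1 * 0 + c) (1 * (2 * PI) + c)); [|f_equal; ring].
  rewrite <- (RInt_comp_lin f 1 c 0 (2 * PI)) by (apply cont_ex_RInt; auto).
  apply RInt_ext; intros x _. unfold scal; simpl; unfold mult; simpl. rewrite !Rmult_1_l. reflexivity.
Qed.

Lemma RInt_per_neg (f : R -> R) : (forall t, continuous f t) ->
  (forall t, f (t + 2 * PI) = f t) -> RInt (fun t => f (- t)) 0 (2 * PI) = RInt f 0 (2 * PI).
Proof.
  intros Hc Hp. rewrite <- (RInt_per_shift f (- (2 * PI)) Hc Hp).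
  replace (- (2 * PI) + 2 * PI) with 0 by ring.
  rewrite <- (opp_RInt_swap f) by (apply cont_ex_RInt; auto).
  transitivity (opp (RInt f (-1 * 0 + 0) (-1 * (2 * PI) + 0))); [|f_equal; f_equal; ring].
  rewrite <- (RInt_comp_lin f (-1) 0 0 (2 * PI)) by (apply cont_ex_RInt; auto).
  rewrite <- RInt_opp.
  - apply RInt_ext; intros x _. unfold scal, opp; simpl; unfold mult; simpl.
    replace (-1 * x + 0) with (- x) by ring. ring.
  - apply cont_ex_RInt. intros t.
    apply (cont_Rmult (fun _ => -1)); [apply cont_const|].
    apply (cont_comp (fun y => -1 * y + 0) f); auto.
    apply cont_Rplus; [apply cont_Rmult; [apply cont_const|apply continuous_id]|apply cont_const].
Qed.

(** While t runs over one period, kt runs over k of them; this transports integrals along z ->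
    z^k. *)
Lemma RInt_per_mul (f : R -> R) k : (1 <= k)%nat -> (forall t, continuous f t) ->
  (forall t, f (t + 2 * PI) = f t) -> RInt (fun t => f (INR k * t)) 0 (2 * PI) = RInt f 0 (2 * PI).
Proof.
  intros Hk Hc Hp. assert (HN : INR k <> 0) by (apply not_0_INR; lia).
  assert (E : forall a b, ex_RInt f a b) by (intros; apply cont_ex_RInt; auto).
  assert (S : forall n, RInt f 0 (INR n * (2 * PI)) = INR n * RInt f 0 (2 * PI)).
  { intros n; induction n as [|n IH].
    - simpl. rewrite !Rmult_0_l. apply (RInt_point (V := R_CompleteNormedModule)).
    - rewrite S_INR, Rmult_plus_distr_r, Rmult_1_l.
      rewrite <- (RInt_Chasles f 0 (INR n * (2 * PI))) by apply E.
      rewrite IH, RInt_per_shift by auto. unfold plus; simpl. ring. }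
  assert (L := RInt_comp_lin f (INR k) 0 0 (2 * PI) (E _ _)).
  rewrite Rmult_0_r, !Rplus_0_r, S in L.
  rewrite (RInt_ext _ (fun t => scal (INR k) (f (INR k * t)))) in L.
  2: { intros x _. rewrite Rplus_0_r. reflexivity. }
  rewrite (RInt_scal (V := R_CompleteNormedModule)) in L.
  - unfold scal in L; simpl in L; unfold mult in L; simpl in L.
    apply Rmult_eq_reg_l in L; auto.
  - apply cont_ex_RInt. intros t. apply (cont_comp (fun y => INR k * y) f); auto.
    apply cont_Rmult; [apply cont_const|apply continuous_id].
Qed.

Definition per (f : R -> C) : Prop := forall t, f (t + 2 * PI) = f t.

Lemma Cint_shift f c : ccont f -> per f -> Cint (fun t => f (t + c)) = Cint f.
Proof.
  intros [A B] Hp. unfold Cint. f_equal.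
  - apply (RInt_per_comp (fun t => Re (f t))); auto. intros; rewrite Hp; auto.
  - apply (RInt_per_comp (fun t => Im (f t))); auto. intros; rewrite Hp; auto.
Qed.

Lemma Cint_neg f : ccont f -> per f -> Cint (fun t => f (- t)) = Cint f.
Proof.
  intros [A B] Hp. unfold Cint. f_equal.
  - apply (RInt_per_neg (fun t => Re (f t))); auto. intros; rewrite Hp; auto.
  - apply (RInt_per_neg (fun t => Im (f t))); auto. intros; rewrite Hp; auto.
Qed.

Lemma Cint_mul f k : (1 <= k)%nat -> ccont f -> per f -> Cint (fun t => f (INR k * t)) = Cint f.
Proof.
  intros Hk [A B] Hp. unfold Cint. f_equal.
  - apply (RInt_per_mul (fun t => Re (f t))); auto. intros; rewrite Hp; auto.
  - apply (RInt_per_mul (fun t => Im (f t))); auto. intros; rewrite Hp; auto.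
Qed.

Lemma Cint_conj f : ccont f -> Cint (fun t => Cconj (f t)) = Cconj (Cint f).
Proof.
  intros [A B]. unfold Cint, Cconj; simpl. f_equal.
  apply (RInt_opp (V := R_CompleteNormedModule) (fun t => Im (f t))). apply cont_ex_RInt; auto.
Qed.

Lemma Cint_deriv_zero (F f : R -> C) : ccont f ->
  (forall t, is_derive (fun s => Re (F s)) t (Re (f t))) ->
  (forall t, is_derive (fun s => Im (F s)) t (Im (f t))) ->
  F (2 * PI) = F 0 -> Cint f = RtoC 0.
Proof.
  intros [A B] H1 H2 HF. unfold Cint. apply C_ext; simpl.
  - rewrite (is_RInt_unique (fun t => Re (f t)) 0 (2 * PI) (minus (Re (F (2 * PI))) (Re (F 0)))).
    + rewrite HF. unfold minus, plus, opp; simpl; ring.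
    + apply (is_RInt_derive (fun s => Re (F s))); auto.
  - rewrite (is_RInt_unique (fun t => Im (f t)) 0 (2 * PI) (minus (Im (F (2 * PI))) (Im (F 0)))).
    + rewrite HF. unfold minus, plus, opp; simpl; ring.
    + apply (is_RInt_derive (fun s => Im (F s))); auto.
Qed.

(* The weights [|x|^(2b)] enter only through these properties, so that [b = 0] with [w = 1] (a single
   class of reflections, [k] odd) is treated together with [b > 0]. *)
Definition wfun (b : R) (w : R -> R) : Prop :=
  0 <= b /\ (forall x, continuous w x) /\ (forall x, w (- x) = w x) /\ (forall x, 0 <= w x) /\
  (forall x, x <> 0 -> 0 < w x) /\ (forall x, is_derive (fun y => y * w y) x ((1 + 2 * b) * w x)).

Definition Wt (wy wx : R -> R) (t : R) : R := wy (sin t) * wx (cos t).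

Lemma cont_cos t : continuous cos t.
Proof. apply (is_derive_cont _ _ (- sin t)). auto_derive; auto; ring. Qed.

Lemma cont_sin t : continuous sin t.
Proof. apply (is_derive_cont _ _ (cos t)). auto_derive; auto; ring. Qed.

Lemma cont_Wt a b wy wx t : wfun a wy -> wfun b wx -> continuous (Wt wy wx) t.
Proof.
  intros (_ & Ca & _) (_ & Cb & _). apply cont_Rmult.
  - apply (cont_comp sin wy); [apply cont_sin|auto].
  - apply (cont_comp cos wx); [apply cont_cos|auto].
Qed.

Lemma is_derive_cos t : is_derive cos t (- sin t).
Proof. auto_derive; auto; ring. Qed.

Lemma is_derive_sin t : is_derive sin t (cos t).
Proof. auto_derive; auto; ring. Qed.

Lemma ccont_ev p : ccont (fun t => ev p (E t)).
Proof.
  split; intros t; eapply is_derive_cont;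
    destruct (ev_derive_curve p cos sin t _ _ (is_derive_cos t) (is_derive_sin t) _ eq_refl); eassumption.
Qed.

Lemma per_E t : E (t + 2 * PI) = E t.
Proof. rewrite E_plus, E_2PI. ring. Qed.

Lemma per_Wt wy wx t : Wt wy wx (t + 2 * PI) = Wt wy wx t.
Proof.
  unfold Wt. assert (H := per_E t). apply (f_equal fst) in H as H1. apply (f_equal snd) in H as H2.
  simpl in *. rewrite H1, H2. reflexivity.
Qed.

(** * The weighted integral for the group with two mirrors *)

Definition I1 (wy wx : R -> R) (p : pol) : C := Cint (fun t => (ev p (E t) * RtoC (Wt wy wx t))%C).

Lemma ccont_I1 a b wy wx p : wfun a wy -> wfun b wx -> ccont (fun t => (ev p (E t) * RtoC (Wt wy wx t))%C).
Proof.
  intros Ha Hb. apply ccont_mult; [apply ccont_ev|]. apply ccont_RtoC. intros; eapply cont_Wt; eauto.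
Qed.

Lemma per_I1 wy wx p : per (fun t => (ev p (E t) * RtoC (Wt wy wx t))%C).
Proof. intros t. cbv beta. rewrite per_E, per_Wt. reflexivity. Qed.

Lemma I1_ext wy wx p q : (forall t, ev p (E t) = ev q (E t)) -> I1 wy wx p = I1 wy wx q.
Proof. intros H. apply Cint_ext. intros t. rewrite H. reflexivity. Qed.

Lemma I1_comb a b wy wx f p q u v : wfun a wy -> wfun b wx ->
  (forall t, ev f (E t) = (u * ev p (E t) + v * ev q (E t))%C) ->
  I1 wy wx f = (u * I1 wy wx p + v * I1 wy wx q)%C.
Proof.
  intros Ha Hb H. unfold I1.
  assert (Hp := ccont_I1 a b wy wx p Ha Hb). assert (Hq := ccont_I1 a b wy wx q Ha Hb).
  rewrite <- !Cint_scal, <- Cint_plus; auto.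
  - apply Cint_ext. intros t. rewrite H. ring.
  - apply (ccont_mult (fun _ => u)); auto. apply ccont_const.
  - apply (ccont_mult (fun _ => v)); auto. apply ccont_const.
Qed.

Lemma I1_scal a b wy wx f p u : wfun a wy -> wfun b wx ->
  (forall t, ev f (E t) = (u * ev p (E t))%C) -> I1 wy wx f = (u * I1 wy wx p)%C.
Proof.
  intros Ha Hb H. rewrite (I1_comb a b wy wx f p p u 0); auto; [ring|].
  intros; rewrite H; ring.
Qed.

Lemma I1_zero a b wy wx f : wfun a wy -> wfun b wx ->
  (forall t, ev f (E t) = RtoC 0) -> I1 wy wx f = RtoC 0.
Proof.
  intros Ha Hb H. rewrite (I1_scal a b wy wx f f 0); auto; [ring|]. intros; rewrite H; ring.
Qed.

Lemma I1_pry a b wy wx p : wfun a wy -> wfun b wx -> I1 wy wx (pry p) = I1 wy wx p.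
Proof.
  intros Ha Hb. unfold I1. rewrite <- (Cint_neg (fun t => (ev p (E t) * RtoC (Wt wy wx t))%C)).
  - apply Cint_ext; intros t. rewrite ev_pry, E_conj. f_equal. f_equal.
    unfold Wt. rewrite sin_neg, cos_neg. destruct Ha as (_ & _ & He & _). rewrite He. reflexivity.
  - eapply ccont_I1; eauto.
  - apply per_I1.
Qed.

Lemma I1_prx a b wy wx p : wfun a wy -> wfun b wx -> I1 wy wx (prx p) = I1 wy wx p.
Proof.
  intros Ha Hb. set (f := fun t => (ev p (E t) * RtoC (Wt wy wx t))%C).
  assert (Cf : ccont f) by (eapply ccont_I1; eauto). assert (Pf : per f) by apply per_I1.
  unfold I1. fold f. rewrite <- (Cint_neg f Cf Pf).
  rewrite <- (Cint_shift (fun t => f (- t)) (- PI)).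
  - apply Cint_ext; intros t. unfold f. rewrite ev_prx, E_conj.
    replace (- (t + - PI)) with (- t + PI) by ring.
    rewrite E_plus, E_PI. replace (E (- t) * - (1))%C with (- E (- t))%C by ring.
    f_equal. f_equal. unfold Wt. rewrite neg_sin, neg_cos, sin_neg, cos_neg, Ropp_involutive.
    destruct Hb as (_ & _ & He & _). rewrite He. reflexivity.
  - apply (ccont_comp f Ropp); auto. intros t. apply cont_Ropp, continuous_id.
  - intros t. rewrite <- (Pf (- (t + 2 * PI))). f_equal. ring.
Qed.

(** The integrand is the derivative along the circle of sin cos wy(sin) wx(cos) e. The factors sin
    and cos make the product differentiable on the mirrors, where the weight itself need not be. *)
Lemma I1_core a b wy wx e : wfun a wy -> wfun b wx ->
  I1 wy wx (PA (PM (PC (RtoC (1 + 2 * a))) (PM PX (PM PX e)))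
    (PA (PM (PC (RtoC (- (1 + 2 * b)))) (PM PY (PM PY e)))
      (PM (PM PX PY) (PA (PM (PC (- (1))%C) (PM PY (dx e))) (PM PX (dy e)))))) = RtoC 0.
Proof.
  intros Ha Hb. set (F := fun t => (RtoC (sin t * wy (sin t)) * RtoC (cos t * wx (cos t)) * ev e (E t))%C).
  apply (Cint_deriv_zero F).
  - eapply ccont_I1; eauto.
  - intros t.
    destruct (ev_derive_curve e cos sin t _ _ (is_derive_cos t) (is_derive_sin t) _ eq_refl) as [D1 D2].
    destruct Ha as (_ & _ & _ & _ & _ & Da), Hb as (_ & _ & _ & _ & _ & Db).
    assert (S1 := is_derive_comp (fun y => y * wy y) sin t _ _ (Da (sin t)) (is_derive_sin t)).
    assert (S2 := is_derive_comp (fun y => y * wx y) cos t _ _ (Db (cos t)) (is_derive_cos t)).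
    eapply is_derive_ext; [|eapply is_derive_eq; [apply (is_derive_Rmult _ _ _ _ _ (is_derive_Rmult _ _ _ _ _ S1 S2) D1)|]].
    + intros s. unfold F. simpl. unfold Re, E; ring.
    + unfold Wt, scal; simpl; unfold mult; simpl. unfold Re, Im. fold (E t). cbn [ev E fst snd]. ring.
  - intros t.
    destruct (ev_derive_curve e cos sin t _ _ (is_derive_cos t) (is_derive_sin t) _ eq_refl) as [D1 D2].
    destruct Ha as (_ & _ & _ & _ & _ & Da), Hb as (_ & _ & _ & _ & _ & Db).
    assert (S1 := is_derive_comp (fun y => y * wy y) sin t _ _ (Da (sin t)) (is_derive_sin t)).
    assert (S2 := is_derive_comp (fun y => y * wx y) cos t _ _ (Db (cos t)) (is_derive_cos t)).
    eapply is_derive_ext; [|eapply is_derive_eq; [apply (is_derive_Rmult _ _ _ _ _ (is_derive_Rmult _ _ _ _ _ S1 S2) D2)|]].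
    + intros s. unfold F. simpl. unfold Im, E; ring.
    + unfold Wt, scal; simpl; unfold mult; simpl. unfold Re, Im. fold (E t). cbn [ev E fst snd]. ring.
  - unfold F. rewrite E_2PI, E_0, sin_2PI, cos_2PI, sin_0, cos_0. ring.
Qed.

Lemma circle_C t : (RtoC (fst (E t)) * RtoC (fst (E t)) + RtoC (snd (E t)) * RtoC (snd (E t)) = 1)%C.
Proof.
  rewrite <- !RtoC_mult, <- RtoC_plus. unfold E; simpl. f_equal.
  assert (H := sin2_cos2 t). unfold Rsqr in H. lra.
Qed.

Lemma RtoC2 : RtoC 2 = (1 + 1)%C.
Proof. rewrite <- RtoC_plus. f_equal; ring. Qed.

Lemma I1_sym_x a b wy wx f g : wfun a wy -> wfun b wx ->
  (forall t, (ev f (E t) + ev (prx f) (E t) = ev g (E t))%C) -> (2 * I1 wy wx f = I1 wy wx g)%C.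
Proof.
  intros Ha Hb H. rewrite (I1_comb a b wy wx g f (prx f) 1 1), (I1_prx a b); auto.
  - rewrite RtoC2; ring.
  - intros t. rewrite <- H. ring.
Qed.

Lemma I1_sym_y a b wy wx f g : wfun a wy -> wfun b wx ->
  (forall t, (ev f (E t) + ev (pry f) (E t) = ev g (E t))%C) -> (2 * I1 wy wx f = I1 wy wx g)%C.
Proof.
  intros Ha Hb H. rewrite (I1_comb a b wy wx g f (pry f) 1 1), (I1_pry a b); auto.
  - rewrite RtoC2; ring.
  - intros t. rewrite <- H. ring.
Qed.

(** The factor of the divergence theorem on the circle: the degree of x f, for f of degree z, plus
    the degree 2(a + b) of the weight. *)
Definition cdeg (a b : R) (z : Z) : C := (RtoC (IZR z) + 1 + 2 * (RtoC a + RtoC b))%C.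

Lemma C_cancel2 u v : (2 * u = 2 * v)%C -> u = v.
Proof.
  intros H. transitivity (/ 2 * (2 * u))%C; [field; nz|]. rewrite H. field; nz.
Qed.

Lemma C_sub_eq (u v : C) : (u - v = 0)%C -> u = v.
Proof. intros H. transitivity (u - v + v)%C; [ring|rewrite H; ring]. Qed.

(** Only the part of f odd in x contributes to either side. It is x e / 2 with e even in x, and this
    factor x is what allows integration by parts through [I1_core]. *)
Lemma I1_PX a b wy wx z f : wfun a wy -> wfun b wx -> hom z f ->
  (cdeg a b z * I1 wy wx (PM PX f) = I1 wy wx (t1 b f))%C.
Proof.
  intros Ha Hb Hf. set (e := ddx f).
  assert (He : hom (z - 1) e) by (apply hom_ddx; auto).
  assert (Ee : forall x, ev (prx e) x = ev e x) by (intros; apply ev_prx_ddx).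
  (* Since e is even in x it has no difference part, and [t1] acts on it as the plain derivative. *)
  assert (Z0 : forall x, (RtoC (fst x) * ev (ddx e) x = 0)%C).
  { intros x. rewrite <- ev_ddx, Ee. ring. }
  apply C_cancel2.
  transitivity (cdeg a b z * (2 * I1 wy wx (PM PX f)))%C; [ring|].
  rewrite (I1_sym_x a b wy wx (PM PX f) (PM PX (PM PX e)) Ha Hb).
  2: { intros t. cbn [ev]. unfold e. rewrite <- ev_ddx.
       change (ev (prx (PM PX f)) (E t)) with (- (1) * RtoC (fst (E t)) * ev (prx f) (E t))%C. ring. }
  set (r := PA (PM (PC (RtoC (1 + 2 * b))) e) (PM PX (dx e))).
  rewrite (I1_sym_x a b wy wx (t1 b f) r Ha Hb).
  2: { intros t. set (x := E t).
       assert (T : ev (prx (t1 b f)) x = (- ev (t1 b (prx f)) x)%C) by (rewrite t1_prx; ring).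
       rewrite T. transitivity (ev (t1 b (PM PX e)) x).
       - rewrite (t1_comb b (PM PX e) f (prx f) 1 (- (1))%C); [ring|].
         intros y. cbn [ev]. unfold e. rewrite <- ev_ddx. ring.
       - rewrite t1_PX. unfold r, t1; cbn [ev]. specialize (Z0 x).
         rewrite RtoC_plus, RtoC_mult.
         transitivity (RtoC (fst x) * ev (dx e) x + RtoC b * (RtoC (fst x) * ev (ddx e) x) + ev e x
           + RtoC b * (2 * (ev e x - RtoC (fst x) * ev (ddx e) x)))%C; [ring|].
         rewrite Z0. ring. }
  apply C_sub_eq. rewrite <- (I1_core a b wy wx e Ha Hb). symmetry.
  rewrite (I1_comb a b wy wx _ (PM PX (PM PX e)) r (cdeg a b z) (- (1))%C Ha Hb); [ring|].
  intros t. assert (HC := circle_C t). assert (HE := euler (z - 1) e (E t) He).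
  unfold r; cbn [ev]. unfold cdeg. rewrite minus_IZR, RtoC_minus in HE.
  set (X := RtoC (fst (E t))) in *. set (Y := RtoC (snd (E t))) in *.
  set (F := ev e (E t)) in *. set (U := ev (dx e) (E t)) in *. set (V := ev (dy e) (E t)) in *.
  assert (HY : (Y * Y = 1 - X * X)%C) by (rewrite <- HC; ring).
  assert (HV : (Y * V = (RtoC (IZR z) - 1) * F - X * U)%C) by (rewrite <- HE; ring).
  rewrite RtoC_opp, !RtoC_plus, !RtoC_mult.
  transitivity ((1 + 2 * a) * (X * X) * F - (1 + 2 * b) * (Y * Y) * F - (Y * Y) * (X * U) + X * X * (Y * V))%C;
    [ring|]. rewrite HV, HY. ring.
Qed.

Lemma I1_PY a b wy wx z f : wfun a wy -> wfun b wx -> hom z f ->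
  (cdeg a b z * I1 wy wx (PM PY f) = I1 wy wx (t2 a f))%C.
Proof.
  intros Ha Hb Hf. set (e := ddy f).
  assert (He : hom (z - 1) e) by (apply hom_ddy; auto).
  assert (Ee : forall x, ev (pry e) x = ev e x) by (intros; apply ev_pry_ddy).
  assert (Z0 : forall x, (RtoC (snd x) * ev (ddy e) x = 0)%C).
  { intros x. rewrite <- ev_ddy, Ee. ring. }
  apply C_cancel2.
  transitivity (cdeg a b z * (2 * I1 wy wx (PM PY f)))%C; [ring|].
  rewrite (I1_sym_y a b wy wx (PM PY f) (PM PY (PM PY e)) Ha Hb).
  2: { intros t. cbn [ev]. unfold e. rewrite <- ev_ddy.
       change (ev (pry (PM PY f)) (E t)) with (- (1) * RtoC (snd (E t)) * ev (pry f) (E t))%C. ring. }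
  set (r := PA (PM (PC (RtoC (1 + 2 * a))) e) (PM PY (dy e))).
  rewrite (I1_sym_y a b wy wx (t2 a f) r Ha Hb).
  2: { intros t. set (x := E t).
       assert (T : ev (pry (t2 a f)) x = (- ev (t2 a (pry f)) x)%C) by (rewrite t2_pry; ring).
       rewrite T. transitivity (ev (t2 a (PM PY e)) x).
       - rewrite (t2_comb a (PM PY e) f (pry f) 1 (- (1))%C); [ring|].
         intros y. cbn [ev]. unfold e. rewrite <- ev_ddy. ring.
       - rewrite t2_PY. unfold r, t2; cbn [ev]. specialize (Z0 x).
         rewrite RtoC_plus, RtoC_mult.
         transitivity (RtoC (snd x) * ev (dy e) x + RtoC a * (RtoC (snd x) * ev (ddy e) x) + ev e x
           + RtoC a * (2 * (ev e x - RtoC (snd x) * ev (ddy e) x)))%C; [ring|].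
         rewrite Z0. ring. }
  apply C_sub_eq. transitivity (- (0))%C; [|ring]. rewrite <- (I1_core a b wy wx e Ha Hb) at 1.
  rewrite (I1_comb a b wy wx (PA _ _) (PM PY (PM PY e)) r (- cdeg a b z)%C 1 Ha Hb); [ring|].
  intros t. assert (HC := circle_C t). assert (HE := euler (z - 1) e (E t) He).
  unfold r; cbn [ev]. unfold cdeg. rewrite minus_IZR, RtoC_minus in HE.
  set (X := RtoC (fst (E t))) in *. set (Y := RtoC (snd (E t))) in *.
  set (F := ev e (E t)) in *. set (U := ev (dx e) (E t)) in *. set (V := ev (dy e) (E t)) in *.
  assert (HY : (X * X = 1 - Y * Y)%C) by (rewrite <- HC; ring).
  assert (HV : (X * U = (RtoC (IZR z) - 1) * F - Y * V)%C) by (rewrite <- HE; ring).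
  rewrite RtoC_opp, !RtoC_plus, !RtoC_mult.
  transitivity ((1 + 2 * a) * (X * X) * F - (1 + 2 * b) * (Y * Y) * F - (Y * Y) * (X * U) + X * X * (Y * V))%C;
    [ring|]. rewrite HV, HY. ring.
Qed.

Lemma I1_odd_x a b wy wx f : wfun a wy -> wfun b wx ->
  (forall t, ev (prx f) (E t) = (- ev f (E t))%C) -> I1 wy wx f = RtoC 0.
Proof.
  intros Ha Hb H. apply C_cancel2. rewrite (I1_sym_x a b wy wx f (PC 0) Ha Hb).
  - rewrite (I1_zero a b) by auto. ring.
  - intros t. rewrite H. cbn [ev]. ring.
Qed.

Lemma I1_odd_y a b wy wx f : wfun a wy -> wfun b wx ->
  (forall t, ev (pry f) (E t) = (- ev f (E t))%C) -> I1 wy wx f = RtoC 0.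
Proof.
  intros Ha Hb H. apply C_cancel2. rewrite (I1_sym_y a b wy wx f (PC 0) Ha Hb).
  - rewrite (I1_zero a b) by auto. ring.
  - intros t. rewrite H. cbn [ev]. ring.
Qed.

(** The defect of the Leibniz rule for [t1] is -b x (ddx p) (ddx q), which is odd in x and
    integrates to 0. *)
Lemma I1_PX_mul a b wy wx z1 z2 p q : wfun a wy -> wfun b wx -> hom z1 p -> hom z2 q ->
  (cdeg a b (z1 + z2) * I1 wy wx (PM PX (PM p q)) =
   I1 wy wx (PM (t1 b p) q) + I1 wy wx (PM p (t1 b q)))%C.
Proof.
  intros Ha Hb Hp Hq. rewrite (I1_PX a b) by (auto; econstructor; eauto).
  set (o := PM PX (PM (ddx p) (ddx q))).
  assert (O : I1 wy wx o = RtoC 0).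
  { apply (I1_odd_x a b); auto. intros t. unfold o.
    change (ev (prx (PM PX (PM (ddx p) (ddx q)))) (E t)) with
      (- (1) * RtoC (fst (E t)) * (ev (prx (ddx p)) (E t) * ev (prx (ddx q)) (E t)))%C.
    rewrite !ev_prx_ddx. cbn [ev]. ring. }
  rewrite (I1_comb a b wy wx (t1 b (PM p q)) (PA (PM (t1 b p) q) (PM p (t1 b q))) o 1 (- RtoC b)%C) by
    (auto; intros t; assert (HX := ev_ddx p (E t)); unfold o, t1; cbn [dx ddx ev];
     (transitivity (ev (dx p) (E t) * ev q (E t) + ev p (E t) * ev (dx q) (E t) + b * (ev (ddx p) (E t) * ev q (E t)
       + (ev p (E t) - (ev p (E t) - ev (prx p) (E t))) * ev (ddx q) (E t)))%C; [ring|rewrite HX; ring])).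
  rewrite O. rewrite (I1_comb a b wy wx (PA _ _) (PM (t1 b p) q) (PM p (t1 b q)) 1 1) by
    (auto; intros; cbn [ev]; ring). ring.
Qed.

Lemma I1_PY_mul a b wy wx z1 z2 p q : wfun a wy -> wfun b wx -> hom z1 p -> hom z2 q ->
  (cdeg a b (z1 + z2) * I1 wy wx (PM PY (PM p q)) =
   I1 wy wx (PM (t2 a p) q) + I1 wy wx (PM p (t2 a q)))%C.
Proof.
  intros Ha Hb Hp Hq. rewrite (I1_PY a b) by (auto; econstructor; eauto).
  set (o := PM PY (PM (ddy p) (ddy q))).
  assert (O : I1 wy wx o = RtoC 0).
  { apply (I1_odd_y a b); auto. intros t. unfold o.
    change (ev (pry (PM PY (PM (ddy p) (ddy q)))) (E t)) with
      (- (1) * RtoC (snd (E t)) * (ev (pry (ddy p)) (E t) * ev (pry (ddy q)) (E t)))%C.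
    rewrite !ev_pry_ddy. cbn [ev]. ring. }
  rewrite (I1_comb a b wy wx (t2 a (PM p q)) (PA (PM (t2 a p) q) (PM p (t2 a q))) o 1 (- RtoC a)%C) by
    (auto; intros t; assert (HX := ev_ddy p (E t)); unfold o, t2; cbn [dy ddy ev];
     (transitivity (ev (dy p) (E t) * ev q (E t) + ev p (E t) * ev (dy q) (E t) + a * (ev (ddy p) (E t) * ev q (E t)
       + (ev p (E t) - (ev p (E t) - ev (pry p) (E t))) * ev (ddy q) (E t)))%C; [ring|rewrite HX; ring])).
  rewrite O. rewrite (I1_comb a b wy wx (PA _ _) (PM (t2 a p) q) (PM p (t2 a q)) 1 1) by
    (auto; intros; cbn [ev]; ring). ring.
Qed.

Lemma I1_PZ_mul a b wy wx z1 z2 p q : wfun a wy -> wfun b wx -> hom z1 p -> hom z2 q ->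
  (cdeg a b (z1 + z2) * I1 wy wx (PM PZ (PM p q)) =
   I1 wy wx (PM (tb a b p) q) + I1 wy wx (PM p (tb a b q)))%C.
Proof.
  intros Ha Hb Hp Hq.
  rewrite (I1_comb a b wy wx (PM PZ _) (PM PX (PM p q)) (PM PY (PM p q)) 1 Ci) by
    (auto; intros; cbn [ev]; unfold PZ; cbn [ev]; ring).
  transitivity (cdeg a b (z1 + z2) * I1 wy wx (PM PX (PM p q)) +
    Ci * (cdeg a b (z1 + z2) * I1 wy wx (PM PY (PM p q))))%C; [ring|].
  rewrite (I1_PX_mul a b), (I1_PY_mul a b) by auto.
  rewrite (I1_comb a b wy wx (PM (tb a b p) q) (PM (t1 b p) q) (PM (t2 a p) q) 1 Ci) by
    (auto; intros; unfold tb; cbn [ev]; ring).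
  rewrite (I1_comb a b wy wx (PM p (tb a b q)) (PM p (t1 b q)) (PM p (t2 a q)) 1 Ci) by
    (auto; intros; unfold tb; cbn [ev]; ring). ring.
Qed.

Lemma I1_PZb_mul a b wy wx z1 z2 p q : wfun a wy -> wfun b wx -> hom z1 p -> hom z2 q ->
  (cdeg a b (z1 + z2) * I1 wy wx (PM PZb (PM p q)) =
   I1 wy wx (PM (th a b p) q) + I1 wy wx (PM p (th a b q)))%C.
Proof.
  intros Ha Hb Hp Hq.
  rewrite (I1_comb a b wy wx (PM PZb _) (PM PX (PM p q)) (PM PY (PM p q)) 1 (- Ci)%C) by
    (auto; intros; cbn [ev]; unfold PZb; cbn [ev]; ring).
  transitivity (cdeg a b (z1 + z2) * I1 wy wx (PM PX (PM p q)) -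
    Ci * (cdeg a b (z1 + z2) * I1 wy wx (PM PY (PM p q))))%C; [ring|].
  rewrite (I1_PX_mul a b), (I1_PY_mul a b) by auto.
  rewrite (I1_comb a b wy wx (PM (th a b p) q) (PM (t1 b p) q) (PM (t2 a p) q) 1 (- Ci)%C) by
    (auto; intros; unfold th; cbn [ev]; ring).
  rewrite (I1_comb a b wy wx (PM p (th a b q)) (PM p (t1 b q)) (PM p (t2 a q)) 1 (- Ci)%C) by
    (auto; intros; unfold th; cbn [ev]; ring). ring.
Qed.

Lemma cdeg_neq_0 a b z : 0 <= a -> 0 <= b -> (0 <= z)%Z -> cdeg a b z <> RtoC 0.
Proof.
  intros Ha Hb Hz. unfold cdeg. rewrite <- !RtoC_plus, <- RtoC_mult, <- RtoC_plus.
  apply RtoC_neq_0. apply IZR_le in Hz. lra.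
Qed.

Lemma C_mult_zero c u : c <> RtoC 0 -> (c * u = 0)%C -> u = RtoC 0.
Proof. intros Hc H. transitivity (/ c * (c * u))%C; [field; auto|]. rewrite H. ring. Qed.

(** Integration by parts against z puts [tb] on one factor or on the other. *)
Lemma I1_ker_ker a b wy wx z1 z2 p q : wfun a wy -> wfun b wx -> hom z1 p -> hom z2 q ->
  (0 <= z1 + z2)%Z -> (forall y, ev (tb a b p) y = RtoC 0) -> (forall y, ev (tb a b q) y = RtoC 0) ->
  I1 wy wx (PM PZ (PM p q)) = RtoC 0.
Proof.
  intros Ha Hb Hp Hq Hz Tp Tq. apply (C_mult_zero (cdeg a b (z1 + z2))).
  - apply cdeg_neq_0; auto; [apply Ha|apply Hb].
  - rewrite (I1_PZ_mul a b) by auto.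
    rewrite !(I1_zero a b) by (auto; intros; cbn [ev]; rewrite ?Tp, ?Tq; ring). ring.
Qed.

(** With conj z as second factor and z conj z = 1 on the circle, [I1_PZ_mul] reads (q + 2 + 2(a +
    b)) I = 2 (1 + a + b) I for the integral I of phi_q, so q I = 0. *)
Lemma I1_phi_const a b wy wx q : wfun a wy -> wfun b wx -> (1 <= q)%nat -> I1 wy wx (phi a b q) = RtoC 0.
Proof.
  intros Ha Hb Hq. assert (Ha0 : 0 <= a) by apply Ha. assert (Hb0 : 0 <= b) by apply Hb.
  assert (H := I1_PZ_mul a b wy wx (Z.of_nat q) 1 (phi a b q) PZb Ha Hb (hom_phi a b q) hom_PZb).
  rewrite (I1_ext wy wx (PM PZ (PM (phi a b q) PZb)) (phi a b q)) in H.
  2: { intros t. cbn [ev]. rewrite ev_PZ, ev_PZb, E_conj.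
       transitivity (E (- t) * E t * ev (phi a b q) (E t))%C; [ring|]. rewrite E_neg_mult; ring. }
  rewrite (I1_zero a b wy wx (PM (tb a b (phi a b q)) PZb)) in H by
    (auto; intros; cbn [ev]; rewrite tb_phi by auto; ring).
  rewrite (I1_scal a b wy wx (PM (phi a b q) (tb a b PZb)) (phi a b q) (2 * (1 + (RtoC a + RtoC b)))%C) in H.
  2, 3: auto.
  2: { intros t. cbn [ev]. rewrite (tb_ext a b PZb (PM PZb (PC 1))) by (intros; cbn [ev]; ring).
       rewrite (tb_PZb a b 0) by apply hom_const.
       assert (Z0 : ev (th a b (PC 1)) (E t) = RtoC 0) by (simpl; ring).
       rewrite Z0. cbn [ev]. ring. }
  apply (C_mult_zero (RtoC (INR q))).
  - apply RtoC_neq_0, not_0_INR; lia.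
  - unfold cdeg in H. rewrite plus_IZR, <- INR_IZR_INZ, RtoC_plus in H.
    transitivity ((INR q + 1 + 1 + 2 * (a + b)) * I1 wy wx (phi a b q) -
      (0 + 2 * (1 + (a + b)) * I1 wy wx (phi a b q)))%C; [rewrite RtoC2; ring|]. rewrite H; ring.
Qed.

(** The pairing is bilinear, without conjugation. For F = z F1 + conj z F2, integration by parts
    trades z for [tb], which kills phi, and conj z for [th], which lowers phi by one index; each
    remaining factor has smaller degree than F and still lies below phi. *)
Lemma I1_phi_lower a b wy wx n : wfun a wy -> wfun b wx ->
  forall d q F, (d < Z.of_nat n)%Z -> hom d F -> (d < Z.of_nat q)%Z ->
  I1 wy wx (PM (phi a b q) F) = RtoC 0.
Proof.
  intros Ha Hb. assert (Ha0 : 0 <= a) by apply Ha. assert (Hb0 : 0 <= b) by apply Hb.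
  induction n as [|n IH]; intros d q F Hd HF Hdq.
  - apply (I1_zero a b); auto. intros t. cbn [ev]. rewrite (hom_neg d F) by (auto; lia). ring.
  - destruct (Z_lt_le_dec 0 d) as [Hpos|Hneg].
    + destruct (hom_zdecomp d F HF Hpos) as (F1 & F2 & H1 & H2 & EF).
      rewrite (I1_comb a b wy wx _ (PM PZ (PM (phi a b q) F1)) (PM PZb (PM (phi a b q) F2)) 1 1) by
        (auto; intros t; cbn [ev]; rewrite EF, ev_PZ, ev_PZb; ring).
      destruct q as [|q]; [lia|].
      assert (C1 : I1 wy wx (PM PZ (PM (phi a b (S q)) F1)) = RtoC 0).
      { apply (C_mult_zero (cdeg a b (Z.of_nat (S q) + (d - 1)))); [apply cdeg_neq_0; auto; lia|].
        rewrite (I1_PZ_mul a b) by (auto; apply hom_phi).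
        rewrite (I1_zero a b wy wx (PM (tb a b _) F1)) by
          (auto; intros; cbn [ev]; rewrite tb_phi by auto; ring).
        rewrite (IH (d - 1 - 1)%Z) by (try apply hom_tb; auto; lia). ring. }
      assert (C2 : I1 wy wx (PM PZb (PM (phi a b (S q)) F2)) = RtoC 0).
      { apply (C_mult_zero (cdeg a b (Z.of_nat (S q) + (d - 1)))); [apply cdeg_neq_0; auto; lia|].
        rewrite (I1_PZb_mul a b) by (auto; apply hom_phi).
        rewrite (I1_scal a b wy wx (PM (th a b _) F2) (PM (phi a b q) F2) 2) by
          (auto; intros; cbn [ev]; rewrite th_phi_S by auto; ring).
        rewrite (IH (d - 1)%Z q), (IH (d - 1 - 1)%Z (S q)) by (try apply hom_th; auto; lia). ring. }
      rewrite C1, C2. ring.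
    + destruct (Z.eq_dec d 0) as [->|Hn0].
      * destruct (hom_0_const F HF) as [c Hc].
        rewrite (I1_scal a b wy wx _ (phi a b q) c) by (auto; intros; cbn [ev]; rewrite Hc; ring).
        rewrite (I1_phi_const a b) by (auto; lia). ring.
      * apply (I1_zero a b); auto. intros t. cbn [ev]. rewrite (hom_neg d F) by (auto; lia). ring.
Qed.

Lemma I1_phi_PZ a b wy wx d q F : wfun a wy -> wfun b wx -> hom d F -> (d <= Z.of_nat q)%Z ->
  I1 wy wx (PM (phi a b q) (PM PZ F)) = RtoC 0.
Proof.
  intros Ha Hb HF Hd. assert (Ha0 : 0 <= a) by apply Ha. assert (Hb0 : 0 <= b) by apply Hb.
  destruct (Z_lt_le_dec d 0) as [Hneg|Hpos].
  - apply (I1_zero a b); auto. intros t. cbn [ev]. rewrite (hom_neg d F) by auto. ring.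
  - rewrite (I1_ext wy wx _ (PM PZ (PM (phi a b q) F))) by (intros; cbn [ev]; ring).
    apply (C_mult_zero (cdeg a b (Z.of_nat q + d))); [apply cdeg_neq_0; auto; lia|].
    rewrite (I1_PZ_mul a b) by (auto; apply hom_phi).
    rewrite (I1_zero a b wy wx (PM (tb a b _) F)) by
      (auto; intros; cbn [ev]; rewrite tb_phi by auto; ring).
    rewrite (I1_phi_lower a b wy wx (Z.to_nat (d - 1 + 1)) Ha Hb (d - 1)) by
      (try apply hom_tb; auto; lia). ring.
Qed.

(** Integration by parts moves x onto phi, where [t1] lowers the index; with [t1] on F the degree is
    too small to contribute. *)
Lemma I1_phi_step_x a b wy wx q F : wfun a wy -> wfun b wx -> hom (Z.of_nat q) F ->
  (2 * (RtoC (INR q) + 1 + (RtoC a + RtoC b)) * I1 wy wx (PM (phi a b (S q)) (PM PX F)) =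
   I1 wy wx (PM (phi a b q) F))%C.
Proof.
  intros Ha Hb HF. assert (Ha0 : 0 <= a) by apply Ha. assert (Hb0 : 0 <= b) by apply Hb.
  assert (H := I1_PX_mul a b wy wx (Z.of_nat (S q)) (Z.of_nat q) (phi a b (S q)) F Ha Hb (hom_phi _ _ _) HF).
  rewrite (I1_ext wy wx (PM PX _) (PM (phi a b (S q)) (PM PX F))) in H by (intros; cbn [ev]; ring).
  rewrite (I1_ext wy wx (PM (t1 b _) F) (PM (phi a b q) F)) in H by
    (intros; cbn [ev]; rewrite t1_phi_S by auto; ring).
  rewrite (I1_phi_lower a b wy wx (S q) Ha Hb (Z.of_nat q - 1) (S q) (t1 b F)) in H by (try apply hom_t1; auto; lia).
  transitivity (cdeg a b (Z.of_nat (S q) + Z.of_nat q) * I1 wy wx (PM (phi a b (S q)) (PM PX F)))%C.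
  - unfold cdeg. rewrite plus_IZR, <- !INR_IZR_INZ, S_INR, !RtoC_plus, RtoC2. ring.
  - rewrite H. ring.
Qed.

Lemma I1_phi_step_y a b wy wx q F : wfun a wy -> wfun b wx -> hom (Z.of_nat q) F ->
  (2 * (RtoC (INR q) + 1 + (RtoC a + RtoC b)) * I1 wy wx (PM (phi a b (S q)) (PM PY F)) =
   Ci * I1 wy wx (PM (phi a b q) F))%C.
Proof.
  intros Ha Hb HF. assert (Ha0 : 0 <= a) by apply Ha. assert (Hb0 : 0 <= b) by apply Hb.
  assert (H := I1_PY_mul a b wy wx (Z.of_nat (S q)) (Z.of_nat q) (phi a b (S q)) F Ha Hb (hom_phi _ _ _) HF).
  rewrite (I1_ext wy wx (PM PY _) (PM (phi a b (S q)) (PM PY F))) in H by (intros; cbn [ev]; ring).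
  rewrite (I1_scal a b wy wx (PM (t2 a _) F) (PM (phi a b q) F) Ci) in H by
    (auto; intros; cbn [ev]; rewrite t2_phi_S by auto; ring).
  rewrite (I1_phi_lower a b wy wx (S q) Ha Hb (Z.of_nat q - 1) (S q) (t2 a F)) in H by (try apply hom_t2; auto; lia).
  transitivity (cdeg a b (Z.of_nat (S q) + Z.of_nat q) * I1 wy wx (PM (phi a b (S q)) (PM PY F)))%C.
  - unfold cdeg. rewrite plus_IZR, <- !INR_IZR_INZ, S_INR, !RtoC_plus, RtoC2. ring.
  - rewrite H. ring.
Qed.

Definition pw (a b : R) (q : nat) : R := 2 ^ q * poch (a + b + 1) q.

Lemma pw_S a b q : RtoC (pw a b (S q)) = (2 * (RtoC (INR q) + 1 + (RtoC a + RtoC b)) * RtoC (pw a b q))%C.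
Proof.
  unfold pw. cbn [poch pow]. rewrite !RtoC_mult, !RtoC_plus. ring.
Qed.

Lemma I1_phi_mono a b wy wx i j : wfun a wy -> wfun b wx ->
  (RtoC (pw a b (i + j)) * I1 wy wx (PM (phi a b (i + j)) (PM (ppow PX i) (ppow PY j))) =
   Ci ^ j * I1 wy wx (PC 1))%C.
Proof.
  intros Ha Hb. induction i as [|i IH].
  - induction j as [|j IHj].
    + unfold pw; simpl poch; simpl pow.
      rewrite (I1_ext wy wx _ (PC 1)) by (intros; unfold phi; cbn [ev ppow]; simpl (0 + 0)%nat; rewrite KK_0; ring).
      rewrite Rmult_1_r. simpl; ring.
    + simpl (0 + _)%nat in *. rewrite pw_S, Cpow_S.
      rewrite (I1_ext wy wx _ (PM (phi a b (S j)) (PM PY (PM (ppow PX 0) (ppow PY j))))) by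
        (intros; cbn [ev ppow]; ring).
      transitivity (pw a b j * (2 * (INR j + 1 + (a + b)) *
        I1 wy wx (PM (phi a b (S j)) (PM PY (PM (ppow PX 0) (ppow PY j))))))%C; [ring|].
      rewrite (I1_phi_step_y a b) by (auto; (apply (hom_mul 0 (Z.of_nat j));
        [apply hom_const|apply hom_ppow_nat, hom_Y|lia])).
      transitivity (Ci * (pw a b j * I1 wy wx (PM (phi a b j) (PM (ppow PX 0) (ppow PY j)))))%C; [ring|].
      rewrite IHj. ring.
  - simpl (S i + j)%nat. rewrite pw_S.
    rewrite (I1_ext wy wx _ (PM (phi a b (S (i + j))) (PM PX (PM (ppow PX i) (ppow PY j))))) by
        (intros; cbn [ev ppow]; ring).
    transitivity (pw a b (i + j) * (2 * (INR (i + j) + 1 + (a + b)) *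
        I1 wy wx (PM (phi a b (S (i + j))) (PM PX (PM (ppow PX i) (ppow PY j))))))%C; [ring|].
    rewrite (I1_phi_step_x a b); auto.
    apply (hom_mul (Z.of_nat i) (Z.of_nat j)); [apply hom_ppow_nat, hom_X|apply hom_ppow_nat, hom_Y|lia].
Qed.

Lemma I1_psum a b wy wx n F : wfun a wy -> wfun b wx ->
  I1 wy wx (psum n F) = csum n (fun i => I1 wy wx (F i)).
Proof.
  intros Ha Hb. induction n as [|n IH]; cbn [psum csum].
  - apply (I1_zero a b); auto.
  - rewrite (I1_comb a b wy wx _ (psum n F) (F n) 1 1), IH by (auto; intros; cbn [ev]; ring). ring.
Qed.

Lemma I1_phi_KK a b wy wx q eta : wfun a wy -> wfun b wx ->
  (RtoC (pw a b q) * I1 wy wx (PM (phi a b q) (KK a b q (RtoC (fst eta)) (RtoC (snd eta)))) =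
   ev (phi a b q) eta * I1 wy wx (PC 1))%C.
Proof.
  intros Ha Hb. assert (Ha0 : 0 <= a) by apply Ha. assert (Hb0 : 0 <= b) by apply Hb.
  rewrite (I1_ext wy wx _ (psum (S q) (fun i => PM (phi a b q)
    (PM (PM (PC (RtoC (fst eta) ^ i * RtoC (snd eta) ^ (q - i))%C) (pe b PX i)) (pe a PY (q - i)))))).
  2: { intros t. unfold KK; cbn [ev]. rewrite !ev_psum, <- csum_mult. reflexivity. }
  rewrite (I1_psum a b) by auto. rewrite <- csum_mult. unfold phi at 2, KK.
  rewrite ev_psum, Cmult_comm, <- csum_mult. apply csum_ext; intros i Hi.
  rewrite (I1_scal a b wy wx _ (PM (phi a b q) (PM (ppow PX i) (ppow PY (q - i))))
    (RtoC (fst eta) ^ i * RtoC (snd eta) ^ (q - i) * / RtoC (gam b i) * / RtoC (gam a (q - i)))%C) by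
    (auto; intros; unfold pe; cbn [ev]; ring).
  assert (H := I1_phi_mono a b wy wx i (q - i) Ha Hb). replace (i + (q - i))%nat with q in H by lia.
  transitivity (RtoC (fst eta) ^ i * RtoC (snd eta) ^ (q - i) * / RtoC (gam b i) * / RtoC (gam a (q - i)) *
    (pw a b q * I1 wy wx (PM (phi a b q) (PM (ppow PX i) (ppow PY (q - i))))))%C; [ring|].
  rewrite H. unfold pe; cbn [ev]. rewrite !ev_ppow, Cpow_1_l. cbn [ev]. ring.
Qed.

(** On the circle the terms with i > 0 have lower degree and vanish against phi_q. The coefficient
    of the term i = 0 is exactly [pw], the normalisation in [I1_phi_KK]. *)
Lemma I1_phi_DD a b wy wx q eta : wfun a wy -> wfun b wx ->
  I1 wy wx (PM (phi a b q) (DD a b eta q)) = (ev (phi a b q) eta * I1 wy wx (PC 1))%C.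
Proof.
  intros Ha Hb.
  rewrite (I1_ext wy wx _ (psum (S q) (fun i => PM (phi a b q)
    (PM (PC (RtoC (cc (a + b) q i) * (eta * Cconj eta) ^ i)%C) (KP a b eta q i))))).
  2: { intros t. unfold DD; cbn [ev]. rewrite !ev_psum, <- csum_mult. apply csum_ext; intros i _.
       cbn [ev]. rewrite ev_ppow, ev_PRho, E_conj.
       replace (E t * E (- t))%C with (RtoC 1) by (rewrite Cmult_comm, E_neg_mult; auto).
       rewrite Cpow_1_l. ring. }
  rewrite (I1_psum a b) by auto.
  rewrite (csum_single (S q) _ 0); [|lia|].
  - rewrite <- I1_phi_KK by auto.
    rewrite (I1_scal a b wy wx _ (PM (phi a b q) (KP a b eta q 0)) (RtoC (cc (a + b) q 0))) by
      (auto; intros; cbn [ev Cpow]; ring).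
    f_equal.
    + f_equal. unfold cc, pw. rewrite Nat.sub_0_r. simpl. field.
    + unfold KP. simpl. rewrite Nat.sub_0_r. reflexivity.
  - intros i Hi Hn.
    rewrite (I1_scal a b wy wx _ (PM (phi a b q) (KP a b eta q i))
      (RtoC (cc (a + b) q i) * (eta * Cconj eta) ^ i)%C) by (auto; intros; cbn [ev]; ring).
    rewrite (I1_phi_lower a b wy wx q Ha Hb (Z.of_nat q - 2 * Z.of_nat i)) by (try apply hom_KP; lia).
    ring.
Qed.

(** Conjugation turns the correction term of [CC] into a multiple of z times a [DD] of lower degree,
    which [I1_phi_PZ] removes. *)
Lemma I1_phi_CC a b wy wx q eta : wfun a wy -> wfun b wx ->
  I1 wy wx (PM (phi a b q) (pconj (CC a b eta q))) = (ev (phi a b q) eta * I1 wy wx (PC 1))%C.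
Proof.
  intros Ha Hb. rewrite <- I1_phi_DD by auto. destruct q as [|q].
  - apply I1_ext; intros t. cbn [ev CC]. rewrite ev_pconj, ev_DD_conj. reflexivity.
  - rewrite (I1_comb a b wy wx _ (PM (phi a b (S q)) (DD a b eta (S q)))
      (PM (phi a b (S q)) (PM PZ (DD a b eta q))) 1 (- Cconj eta)%C).
    + rewrite (I1_phi_PZ a b wy wx (Z.of_nat q)) by (auto; (apply hom_DD || lia)). ring.
    + auto.
    + auto.
    + intros t. cbn [ev]. rewrite ev_pconj. cbn [CC ev].
      rewrite Cplus_conj, !Cmult_conj, !ev_DD_conj, Copp_conj, ev_PZ, ev_PZb, Cconj_conj. ring.
Qed.

(** * The reproducing kernels for general k *)

Definition Wk (k : nat) (wy wx : R -> R) (t : R) : R := Wt wy wx (INR k * t).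

Definition Ik (k : nat) (wy wx : R -> R) (p : pol) : C :=
  Cint (fun t => (ev p (E t) * RtoC (Wk k wy wx t))%C).

Lemma cont_Wk k a b wy wx t : wfun a wy -> wfun b wx -> continuous (Wk k wy wx) t.
Proof.
  intros Ha Hb. apply (cont_comp (fun t => INR k * t) (Wt wy wx)).
  - apply cont_Rmult; [apply cont_const|apply continuous_id].
  - eapply cont_Wt; eauto.
Qed.

Lemma ccont_Ik k a b wy wx p : wfun a wy -> wfun b wx ->
  ccont (fun t => (ev p (E t) * RtoC (Wk k wy wx t))%C).
Proof.
  intros Ha Hb. apply ccont_mult; [apply ccont_ev|]. apply ccont_RtoC. intros; eapply cont_Wk; eauto.
Qed.

Lemma Ik_ext k wy wx p q : (forall t, ev p (E t) = ev q (E t)) -> Ik k wy wx p = Ik k wy wx q.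
Proof. intros H. apply Cint_ext. intros t. rewrite H. reflexivity. Qed.

Lemma Ik_comb k a b wy wx f p q u v : wfun a wy -> wfun b wx ->
  (forall t, ev f (E t) = (u * ev p (E t) + v * ev q (E t))%C) ->
  Ik k wy wx f = (u * Ik k wy wx p + v * Ik k wy wx q)%C.
Proof.
  intros Ha Hb H. unfold Ik.
  assert (Hp := ccont_Ik k a b wy wx p Ha Hb). assert (Hq := ccont_Ik k a b wy wx q Ha Hb).
  rewrite <- !Cint_scal, <- Cint_plus; auto.
  - apply Cint_ext. intros t. rewrite H. ring.
  - apply (ccont_mult (fun _ => u)); auto. apply ccont_const.
  - apply (ccont_mult (fun _ => v)); auto. apply ccont_const.
Qed.

Lemma Ik_scal k a b wy wx f p u : wfun a wy -> wfun b wx ->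
  (forall t, ev f (E t) = (u * ev p (E t))%C) -> Ik k wy wx f = (u * Ik k wy wx p)%C.
Proof.
  intros Ha Hb H. rewrite (Ik_comb k a b wy wx f p p u 0); auto; [ring|].
  intros; rewrite H; ring.
Qed.

Lemma Ik_conj k a b wy wx p : wfun a wy -> wfun b wx ->
  Ik k wy wx (pconj p) = Cconj (Ik k wy wx p).
Proof.
  intros Ha Hb. unfold Ik. rewrite <- Cint_conj by (eapply ccont_Ik; eauto).
  apply Cint_ext; intros t. rewrite ev_pconj, Cmult_conj, Cconj_RtoC. reflexivity.
Qed.

Lemma Ik_comp k a b wy wx f p : wfun a wy -> wfun b wx -> (1 <= k)%nat ->
  (forall t, ev f (E t) = ev p (E (INR k * t))) -> Ik k wy wx f = I1 wy wx p.
Proof.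
  intros Ha Hb Hk H. unfold I1. rewrite <- (Cint_mul _ k Hk).
  - apply Cint_ext; intros t. rewrite H. reflexivity.
  - eapply ccont_I1; eauto.
  - apply per_I1.
Qed.

(** Rotation by 2 PI / k preserves the weight and all functions of z^k, while it multiplies this
    integrand by a number different from 1. *)
Lemma Ik_rot k a b wy wx f p j : wfun a wy -> wfun b wx -> (1 <= k)%nat ->
  (forall t, ev f (E t) = (E (INR j * t) * ev p (E (INR k * t)))%C) ->
  E (2 * PI * INR j / INR k) <> RtoC 1 -> Ik k wy wx f = RtoC 0.
Proof.
  intros Ha Hb Hk H Hne. assert (HN : INR k <> 0) by (apply not_0_INR; lia).
  set (g := fun t => (ev f (E t) * RtoC (Wk k wy wx t))%C).
  assert (Cg : ccont g) by (eapply ccont_Ik; eauto).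
  assert (Pg : per g).
  { intros t. unfold g. rewrite per_E. f_equal. f_equal. unfold Wk, Wt.
    replace (INR k * (t + 2 * PI)) with (INR k * t + 2 * PI * INR k) by ring.
    assert (Q : E (INR k * t + 2 * PI * INR k) = E (INR k * t)) by (rewrite E_plus, E_2PI_nat; ring).
    apply (f_equal fst) in Q as Q1. apply (f_equal snd) in Q as Q2. simpl in Q1, Q2. rewrite Q1, Q2; auto. }
  assert (S := Cint_shift g (2 * PI / INR k) Cg Pg).
  rewrite (Cint_ext _ (fun t => (E (2 * PI * INR j / INR k) * g t)%C)) in S.
  2: { intros t. unfold g. rewrite !H. unfold Wk.
       replace (INR k * (t + 2 * PI / INR k)) with (INR k * t + 2 * PI) by (field; auto).
       replace (INR j * (t + 2 * PI / INR k)) with (2 * PI * INR j / INR k + INR j * t) by (field; auto).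
       rewrite per_E, per_Wt, E_plus. ring. }
  rewrite Cint_scal in S by auto. unfold Ik. fold g.
  apply (C_mult_zero (E (2 * PI * INR j / INR k) - 1)%C).
  - intros Z. apply Hne. transitivity (E (2 * PI * INR j / INR k) - 1 + 1)%C; [ring|rewrite Z; ring].
  - transitivity (E (2 * PI * INR j / INR k) * Cint g - Cint g)%C; [ring|]. rewrite S. ring.
Qed.

Lemma E_rot_neq_1 k j : (0 < j < 2 * k)%nat -> j <> k -> E (2 * PI * INR j / INR k) <> RtoC 1.
Proof.
  intros Hj Hn. assert (HN : 0 < INR k) by (apply lt_0_INR; lia). assert (P := PI_RGT_0).
  destruct (le_lt_dec k j) as [L|L].
  - replace (2 * PI * INR j / INR k) with (2 * PI * INR (j - k) / INR k + 2 * PI) by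
      (rewrite minus_INR by lia; field; lra).
    rewrite per_E. apply E_neq_1.
    assert (0 < INR (j - k) < INR k) by (split; [apply lt_0_INR|apply lt_INR]; lia). split.
    + apply Rdiv_lt_0_compat; nra.
    + apply Rmult_lt_reg_r with (INR k); auto. unfold Rdiv. rewrite Rmult_assoc, Rinv_l; nra.
  - apply E_neq_1. assert (0 < INR j < INR k) by (split; [apply lt_0_INR|apply lt_INR]; lia). split.
    + apply Rdiv_lt_0_compat; nra.
    + apply Rmult_lt_reg_r with (INR k); auto. unfold Rdiv. rewrite Rmult_assoc, Rinv_l; nra.
Qed.

Definition KC (a b : R) (k : nat) (eta : C) (n : nat) : pol :=
  PM (PC (Cconj eta ^ (n mod k))%C) (plift (n mod k) k (CC a b (eta ^ k)%C (n / k))).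

(* The [n]-th reproducing kernel as a polynomial in its second variable. *)
Definition KN (a b : R) (k : nat) (eta : C) (n : nat) : pol :=
  match n with
  | O => KC a b k eta 0
  | S m => PA (KC a b k eta (S m)) (pconj (PM (PC (Cconj eta)) (PM PZ (KC a b k eta m))))
  end.

(** A generator of the harmonics of degree n + 1. The exponent of z runs over 1, ..., k rather than
    0, ..., k - 1, so that modulo |x|^2 no pure power of conj z occurs. *)
Definition psi (a b : R) (k n : nat) : pol := plift (S (n mod k)) k (phi a b (n / k)).

Lemma hom_KC a b k eta n : (1 <= k)%nat -> hom (Z.of_nat n) (KC a b k eta n).
Proof.
  intros Hk. apply hom_scal.
  replace (Z.of_nat n) with (Z.of_nat (n mod k) + Z.of_nat k * Z.of_nat (n / k))%Z.
  - apply hom_plift, hom_CC.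
  - assert (H := Nat.div_mod_eq n k). lia.
Qed.

Lemma hom_KN a b k eta n : (1 <= k)%nat -> hom (Z.of_nat n) (KN a b k eta n).
Proof.
  intros Hk. destruct n as [|n]; [apply (hom_KC a b k eta 0 Hk)|].
  apply hom_add; [apply hom_KC; auto|]. apply hom_pconj, hom_scal.
  eapply hom_mul; [apply hom_PZ|apply hom_KC; auto|lia].
Qed.

Lemma hom_psi a b k n : (1 <= k)%nat -> hom (Z.of_nat (S n)) (psi a b k n).
Proof.
  intros Hk. replace (Z.of_nat (S n)) with (Z.of_nat (S (n mod k)) + Z.of_nat k * Z.of_nat (n / k))%Z.
  - apply hom_plift, hom_phi.
  - assert (H := Nat.div_mod_eq n k). lia.
Qed.

Lemma Lap_psi a b k n x : (1 <= k)%nat -> 0 <= a -> 0 <= b -> ev (Lap k a b (psi a b k n)) x = RtoC 0.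
Proof.
  intros Hk Ha Hb. apply (Lap_plift_S k a b (n mod k) (Z.of_nat (n / k))).
  - apply Nat.mod_upper_bound; lia.
  - apply hom_phi.
  - intros; apply tb_phi; auto.
Qed.

Lemma Lap_scal k a b f p u : (forall x, ev f x = (u * ev p x)%C) ->
  forall x, ev (Lap k a b f) x = (u * ev (Lap k a b p) x)%C.
Proof. intros H x. rewrite (Lap_comb k a b f p p u 0); [ring|]. intros; rewrite H; ring. Qed.

Lemma Lap_KC a b k eta n x : (1 <= k)%nat -> 0 <= a -> 0 <= b -> ev (Lap k a b (KC a b k eta n)) x = RtoC 0.
Proof.
  intros Hk Ha Hb.
  rewrite (Lap_scal k a b _ (plift (n mod k) k (CC a b (eta ^ k)%C (n / k))) (Cconj eta ^ (n mod k))%C) by reflexivity.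
  rewrite (Lap_plift k a b (n mod k) (Z.of_nat (n / k))); [ring| | |].
  - apply Nat.mod_upper_bound; lia.
  - apply hom_CC.
  - intros; apply tb_CC; auto.
Qed.

Lemma Lap_KN a b k eta n x : (1 <= k)%nat -> 0 <= a -> 0 <= b -> ev (Lap k a b (KN a b k eta n)) x = RtoC 0.
Proof.
  intros Hk Ha Hb. destruct n as [|n]; [apply Lap_KC; auto|].
  cbn [KN]. rewrite (Lap_comb k a b _ (KC a b k eta (S n)) (pconj (PM (PC (Cconj eta)) (PM PZ (KC a b k eta n)))) 1 1) by
    (intros; cbn [ev]; ring).
  rewrite Lap_KC, ev_Lap_pconj by auto.
  rewrite (Lap_scal k a b _ (plift (S (n mod k)) k (CC a b (eta ^ k)%C (n / k))) (Cconj eta * Cconj eta ^ (n mod k))%C).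
  - rewrite (Lap_plift_S k a b (n mod k) (Z.of_nat (n / k))).
    + rewrite !Cmult_0_r, Cconj_RtoC. ring.
    + apply Nat.mod_upper_bound; lia.
    + apply hom_CC.
    + intros; apply tb_CC; auto.
  - intros y. cbn [ev]. unfold KC; cbn [ev]. rewrite !ev_plift, ev_PZ, Cpow_S. ring.
Qed.

Lemma div_mod_S n k : (1 <= k)%nat ->
  (S (n mod k) < k /\ S n mod k = S (n mod k) /\ S n / k = n / k)%nat \/
  (S (n mod k) = k /\ S n mod k = 0 /\ S n / k = S (n / k))%nat.
Proof.
  intros Hk. assert (H := Nat.div_mod_eq n k). assert (U := Nat.mod_upper_bound n k ltac:(lia)).
  destruct (Nat.eq_dec (S (n mod k)) k) as [L|L]; [right|left].
  - repeat split; auto.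
    + symmetry. apply (Nat.mod_unique (S n) k (S (n / k)) 0); lia.
    + symmetry. apply (Nat.div_unique (S n) k (S (n / k)) 0); lia.
  - repeat split; try lia.
    + symmetry. apply (Nat.mod_unique (S n) k (n / k) (S (n mod k))); lia.
    + symmetry. apply (Nat.div_unique (S n) k (n / k) (S (n mod k))); lia.
Qed.

Lemma unit_conj z : Cmod z = 1 -> (z * Cconj z = 1)%C.
Proof. intros H. rewrite <- Cmod2_conj, H. f_equal; ring. Qed.

Lemma unit_pow z k : Cmod z = 1 -> Cmod (z ^ k)%C = 1.
Proof. intros H. rewrite Cmod_pow, H, pow1. reflexivity. Qed.

(** If n and n + 1 have the same quotient by k, the two summands are conjugate to each other on the
    circle. Otherwise, with q = n / k, they add up to D_{q+1} - D_{q-1} (to D_1 for q = 0), and the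
    D are real. *)
Lemma KN_real a b k eta n x : (1 <= k)%nat -> Cmod eta = 1 -> Cmod x = 1 ->
  Cconj (ev (KN a b k eta n) x) = ev (KN a b k eta n) x.
Proof.
  intros Hk He Hx. destruct n as [|n].
  - cbn [KN]. unfold KC. rewrite Nat.mod_0_l, Nat.div_0_l by lia. cbn [ev CC].
    rewrite ev_plift. cbn [Cpow CC]. rewrite !Cmult_conj, ev_DD_conj, !Cconj_RtoC. reflexivity.
  - cbn [KN ev]. rewrite ev_pconj. cbn [ev]. unfold KC; cbn [ev]. rewrite !ev_plift, ev_PZ.
    assert (Ek := unit_conj _ (unit_pow eta k He)). assert (Xk := unit_conj _ (unit_pow x k Hx)).
    destruct (div_mod_S n k Hk) as [(H1 & H2 & H3)|(H1 & H2 & H3)]; rewrite H2, H3.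
    + set (A := ev (CC a b (eta ^ k)%C (n / k)) (x ^ k)%C). rewrite !Cpow_S.
      rewrite !Cplus_conj, !Cmult_conj, !Cpow_conj, !Cconj_conj. ring.
    + set (m := (n / k)%nat). assert (Ck : (Cconj eta * Cconj eta ^ (n mod k) = Cconj eta ^ k)%C).
      { rewrite <- Cpow_S. f_equal. exact H1. }
      assert (Xk' : (x * x ^ (n mod k) = x ^ k)%C) by (rewrite <- Cpow_S; f_equal; exact H1).
      replace (Cconj eta * (x * (Cconj eta ^ (n mod k) * (x ^ (n mod k) * ev (CC a b (eta ^ k)%C m) (x ^ k)%C))))%C
        with ((Cconj eta * Cconj eta ^ (n mod k)) * (x * x ^ (n mod k)) * ev (CC a b (eta ^ k)%C m) (x ^ k)%C)%C by ring.
      rewrite Ck, Xk', <- (Cpow_conj eta k). set (e := (eta ^ k)%C) in *. set (z := (x ^ k)%C) in *.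
      destruct m as [|m]; cbn [CC ev Cpow]; rewrite !ev_PZb.
      * repeat first [rewrite Cplus_conj|rewrite Cmult_conj|rewrite ev_DD_conj|rewrite Cconj_conj|
          rewrite Copp_conj|rewrite Cconj_RtoC]. ring.
      * assert (R : forall u v w : C, (1 * (1 * (u + - e * (Cconj z * v))) +
            Cconj (Cconj e * z * (v + - e * (Cconj z * w))) =
            u + e * Cconj z * (Cconj v - v) - (e * Cconj e) * (z * Cconj z) * Cconj w)%C).
        { intros u v w. rewrite !Cmult_conj, !Cplus_conj, !Cmult_conj, Copp_conj, !Cconj_conj. ring. }
        rewrite !R, ev_DD_conj, Ek, Xk, ev_DD_conj.
        repeat first [rewrite Cplus_conj|rewrite Cminus_conj|rewrite Cmult_conj|rewrite ev_DD_conj|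
          rewrite Cconj_conj|rewrite Cconj_RtoC]. ring.
Qed.

Lemma E_unit t : Cmod (E t) = 1.
Proof.
  unfold Cmod, E; simpl. rewrite !Rmult_1_r. assert (H := sin2_cos2 t). unfold Rsqr in H.
  replace (cos t * cos t + sin t * sin t) with 1 by lra. apply sqrt_1.
Qed.

Lemma ev_KC_0 a b k eta x : (1 <= k)%nat -> ev (KC a b k eta 0) x = RtoC 1.
Proof.
  intros Hk. unfold KC. rewrite Nat.mod_0_l, Nat.div_0_l by lia. cbn [ev]. rewrite ev_plift. cbn [Cpow CC].
  unfold DD; cbn [psum ev ppow Cpow]. unfold KP. simpl (Nat.leb _ _). cbv iota. simpl (0 - _)%nat. rewrite KK_0.
  replace (RtoC (cc (a + b) 0 0)) with (RtoC 1); [ring|]. unfold cc; simpl. f_equal. field.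
Qed.

(** Of the two summands of the kernel one is orthogonal to psi, and the other reproduces it through
    [I1_phi_CC]. *)
Lemma Ik_psi_KN a b k wy wx eta n : wfun a wy -> wfun b wx -> (1 <= k)%nat -> Cmod eta = 1 ->
  Ik k wy wx (PM (psi a b k n) (KN a b k eta (S n))) = (ev (psi a b k n) eta * I1 wy wx (PC 1))%C.
Proof.
  intros Ha Hb Hk He. cbn [KN].
  set (l := (n mod k)%nat). set (q := (n / k)%nat).
  set (B := pconj (PM (PC (Cconj eta)) (PM PZ (KC a b k eta n)))).
  rewrite (Ik_comb k a b wy wx _ (PM (psi a b k n) (KC a b k eta (S n))) (PM (psi a b k n) B) 1 1) by
    (auto; intros; cbn [ev]; ring).
  (* If l + 1 < k, the product is z^(2(l+1)) times a function of z^k, and rotation kills it unless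
     2(l+1) = k. In that case, and for l + 1 = k, it is Z phi CC with both factors in the kernel of
     [tb]. *)
  assert (H1 : Ik k wy wx (PM (psi a b k n) (KC a b k eta (S n))) = RtoC 0).
  { unfold psi, KC. fold l q.
    destruct (div_mod_S n k Hk) as [(L1 & L2 & L3)|(L1 & L2 & L3)]; rewrite L2, L3; fold l q.
    - fold l in L1, L2. rewrite (Ik_scal k a b wy wx _ (PM (plift (S l) k (phi a b q)) (plift (S l) k (CC a b (eta ^ k)%C q)))
        (Cconj eta ^ S l)%C) by (auto; intros; cbn [ev]; ring).
      assert (H0 : Ik k wy wx (PM (plift (S l) k (phi a b q)) (plift (S l) k (CC a b (eta ^ k)%C q))) = RtoC 0).
      { destruct (Nat.eq_dec (2 * S l) k) as [D|D].
        - rewrite (Ik_comp k a b wy wx _ (PM PZ (PM (phi a b q) (CC a b (eta ^ k)%C q)))); auto.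
          + apply (I1_ker_ker a b wy wx (Z.of_nat q) (Z.of_nat q)); auto using hom_phi, hom_CC; try lia.
            * intros; apply tb_phi; [apply Ha|apply Hb].
            * intros; apply tb_CC; [apply Ha|apply Hb].
          + intros t. cbn [ev]. rewrite !ev_plift, ev_PZ, <- E_pow, <- D.
            replace (2 * S l)%nat with (S l + S l)%nat by lia. rewrite Cpow_add_r. ring.
        - apply (Ik_rot k a b wy wx _ (PM (phi a b q) (CC a b (eta ^ k)%C q)) (2 * S l)); auto.
          + intros t. cbn [ev]. rewrite !ev_plift, <- !E_pow.
            replace (2 * S l)%nat with (S l + S l)%nat by lia. rewrite Cpow_add_r. ring.
          + apply E_rot_neq_1; auto. lia. }
      rewrite H0. ring.
    - fold l in L1, L2. rewrite (Ik_comp k a b wy wx _ (PM PZ (PM (phi a b q) (CC a b (eta ^ k)%C (S q))))); auto.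
      + apply (I1_ker_ker a b wy wx (Z.of_nat q) (Z.of_nat (S q))); auto using hom_phi, hom_CC; try lia.
        * intros; apply tb_phi; [apply Ha|apply Hb].
        * intros; apply tb_CC; [apply Ha|apply Hb].
      + intros t. cbn [ev]. rewrite !ev_plift, ev_PZ, L1, <- E_pow. cbn [Cpow]. ring. }
  (* On the circle z^(l+1) meets its conjugate and disappears; a function of z^k is left. *)
  assert (H2 : Ik k wy wx (PM (psi a b k n) B) = (ev (psi a b k n) eta * I1 wy wx (PC 1))%C).
  { rewrite (Ik_scal k a b wy wx _ (pcomp k (PM (phi a b q) (pconj (CC a b (eta ^ k)%C q)))) (eta ^ S l)%C); auto.
    - rewrite (Ik_comp k a b wy wx _ (PM (phi a b q) (pconj (CC a b (eta ^ k)%C q)))); auto.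
      + rewrite I1_phi_CC by auto. unfold psi. fold l q. rewrite ev_plift. ring.
      + intros t. rewrite ev_pcomp, E_pow. reflexivity.
    - intros t. unfold B, psi, KC. fold l q. cbn [ev].
      rewrite ev_pconj, ev_pcomp, !ev_plift. cbn [ev]. rewrite ev_plift, ev_PZ, ev_pconj.
      rewrite !Cmult_conj, !Cpow_conj, Cconj_conj, !Cpow_S.
      assert (U := unit_conj _ (E_unit t)). assert (U' := unit_conj _ (unit_pow _ l (E_unit t))).
      rewrite Cpow_conj in U'.
      transitivity ((E t * Cconj (E t)) * (E t ^ l * Cconj (E t) ^ l) * (eta * eta ^ l *
        (ev (phi a b q) (E t ^ k)%C * Cconj (ev (CC a b (eta ^ k)%C q) (E t ^ k)%C))))%C; [ring|].
      rewrite U, U'. ring. }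
  rewrite H1, H2. ring.
Qed.

Lemma Cint_RtoC (f : R -> R) : Cint (fun t => RtoC (f t)) = RtoC (RInt f 0 (2 * PI)).
Proof.
  unfold Cint, RtoC; simpl. f_equal.
  rewrite (RInt_const (V := R_CompleteNormedModule)). unfold scal; simpl; unfold mult; simpl. ring.
Qed.

Lemma RInt_Wt_pos a b wy wx : wfun a wy -> wfun b wx -> 0 < RInt (Wt wy wx) 0 (2 * PI).
Proof.
  intros Ha Hb. assert (P := PI_RGT_0).
  assert (Ex : forall u v, ex_RInt (Wt wy wx) u v).
  { intros; apply cont_ex_RInt; intros; eapply cont_Wt; eauto. }
  assert (Nn : forall t, 0 <= Wt wy wx t).
  { intros t. apply Rmult_le_pos; [apply Ha|apply Hb]. }
  rewrite <- (RInt_Chasles _ 0 (PI / 2) (2 * PI)) by apply Ex. unfold plus; simpl.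
  assert (0 < RInt (Wt wy wx) 0 (PI / 2)).
  { apply RInt_gt_0; [lra| |intros; eapply cont_Wt; eauto].
    intros t Ht. destruct Ha as (_ & _ & _ & _ & Pa & _), Hb as (_ & _ & _ & _ & Pb & _).
    apply Rmult_lt_0_compat; [apply Pa, Rgt_not_eq, sin_gt_0|apply Pb, Rgt_not_eq, cos_gt_0]; lra. }
  assert (0 <= RInt (Wt wy wx) (PI / 2) (2 * PI)) by (apply RInt_ge_0; auto; lra). lra.
Qed.

Lemma I1_one_neq_0 a b wy wx : wfun a wy -> wfun b wx -> I1 wy wx (PC 1) <> RtoC 0.
Proof.
  intros Ha Hb. unfold I1. rewrite (Cint_ext _ (fun t => RtoC (Wt wy wx t))) by
    (intros; cbn [ev]; ring).
  rewrite Cint_RtoC. apply RtoC_neq_0. assert (H := RInt_Wt_pos a b wy wx Ha Hb). lra.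
Qed.

Lemma circ_inner_Ik k a b wy wx ups p q f g : wfun a wy -> wfun b wx -> (1 <= k)%nat ->
  (forall t, ups (cos t, sin t) = Wk k wy wx t) ->
  (forall t, ev p (E t) = RtoC (f (E t))) -> (forall t, ev q (E t) = RtoC (g (E t))) ->
  RtoC (circ_inner ups f g) = (Ik k wy wx (PM p q) / I1 wy wx (PC 1))%C.
Proof.
  intros Ha Hb Hk Hu Hp Hq. unfold circ_inner.
  assert (D : RtoC (RInt (fun th => ups (cos th, sin th)) 0 (2 * PI)) = I1 wy wx (PC 1)).
  { rewrite <- Cint_RtoC, <- (Ik_comp k a b wy wx (PC 1) (PC 1)) by auto.
    apply Cint_ext; intros t. rewrite Hu; cbn [ev]; ring. }
  assert (D0 := I1_one_neq_0 a b wy wx Ha Hb).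
  rewrite RtoC_div by (intros H; apply D0; rewrite <- D, H; auto).
  rewrite D. f_equal. rewrite <- Cint_RtoC. apply Cint_ext; intros t.
  rewrite Hu. cbn [ev]. rewrite Hp, Hq, !RtoC_mult. reflexivity.
Qed.

(** The remainder in [lead] is a multiple of conj Z, and one factor z in front turns it into a
    multiple of |x|^2; hence the exponent [S i]. *)
Lemma hom_pow_div_PRho k l g : (1 <= k)%nat -> forall q, lead (Z.of_nat q) g l -> forall i,
  exists p', hom (Z.of_nat (S i + k * q) - 2) p' /\
  forall x, ev (plift (S i) k g) x = (l * x ^ (S i + k * q) + ev PRho x * ev p' x)%C.
Proof.
  intros Hk q (p & Hp & Ep) i. exists (PM (ppow PZ i) (PM (ppow PZb (k - 1)) (pcomp k p))). split.
  - eapply hom_mul; [apply hom_ppow_nat, hom_PZ|eapply hom_mul; [apply hom_ppow_nat, hom_PZb|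
      apply (hom_psubst (Z.of_nat k)); [exact Hp|apply hom_PReZ|apply hom_PImZ]|reflexivity]|nia].
  - intros x. rewrite ev_plift, Ep, Nat2Z.id. cbn [ev]. rewrite !ev_ppow, ev_pcomp, ev_PRho, ev_PZ, ev_PZb.
    rewrite Cpow_add_r, Cpow_mult_r, Cpow_conj.
    assert (S1 : (Cconj x ^ k = Cconj x * Cconj x ^ (k - 1))%C) by
      (rewrite <- Cpow_S; f_equal; lia). rewrite S1, Cpow_S. ring.
Qed.

(** Harmonics of positive degree are combinations of [psi] and its conjugate. Since [KN] is real on
    the circle, reproducing [psi] gives the conjugate as well. *)
Lemma KN_reproduces a b k wy wx eta n h : wfun a wy -> wfun b wx -> (1 <= k)%nat -> Cmod eta = 1 ->
  hom (Z.of_nat n) h -> (forall x, ev (Lap k a b h) x = RtoC 0) ->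
  (Ik k wy wx (PM h (KN a b k eta n)) / I1 wy wx (PC 1))%C = ev h eta.
Proof.
  intros Ha Hb Hk He Hh HL. assert (D0 := I1_one_neq_0 a b wy wx Ha Hb).
  assert (Ha0 : 0 <= a) by apply Ha. assert (Hb0 : 0 <= b) by apply Hb.
  assert (Ex : Ik k wy wx (PM h (KN a b k eta n)) = (ev h eta * I1 wy wx (PC 1))%C).
  2: { rewrite Ex. field. auto. }
  destruct n as [|n].
  - destruct (hom_0_const h Hh) as [c Hc].
    rewrite (Ik_scal k a b wy wx _ (PC 1) c) by
      (auto; intros; cbn [KN ev]; rewrite Hc, ev_KC_0 by auto; ring).
    rewrite Hc, (Ik_comp k a b wy wx (PC 1) (PC 1)) by auto. reflexivity.
  - destruct (lead_phi a b (n / k) Ha0 Hb0) as (s & Hs & Hs0).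
    destruct (hom_pow_div_PRho k s (phi a b (n / k)) Hk _ Hs (n mod k)) as (p' & Hp' & Ep').
    assert (En : (S (n mod k) + k * (n / k) = S n)%nat) by (assert (Q := Nat.div_mod_eq n k); lia).
    rewrite En in *.
    destruct (harmonic_span k a b n h (psi a b k n) p' s) as (u & v & Euv); auto.
    + apply hom_psi; auto.
    + intros; apply Lap_psi; auto.
    + rewrite (Ik_comb k a b wy wx _ (PM (psi a b k n) (KN a b k eta (S n)))
        (pconj (PM (psi a b k n) (KN a b k eta (S n)))) u v).
      * rewrite (Ik_conj k a b) by auto. rewrite !Ik_psi_KN by auto. rewrite Euv, Cmult_conj.
        assert (R : Cconj (I1 wy wx (PC 1)) = I1 wy wx (PC 1)).
        { unfold I1. rewrite (Cint_ext _ (fun t => RtoC (Wt wy wx t))) by (intros; cbn [ev]; ring).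
          rewrite Cint_RtoC, Cconj_RtoC. reflexivity. }
        rewrite R. ring.
      * auto.
      * auto.
      * intros t. rewrite ev_pconj.
        change (ev (PM h (KN a b k eta (S n))) (E t)) with (ev h (E t) * ev (KN a b k eta (S n)) (E t))%C.
        change (ev (PM (psi a b k n) (KN a b k eta (S n))) (E t)) with
          (ev (psi a b k n) (E t) * ev (KN a b k eta (S n)) (E t))%C.
        rewrite Cmult_conj, KN_real, Euv by (auto using E_unit). ring.
Qed.

(** The inner product of KN(om, .) with P(., eta) is computed twice: the property of P gives the
    value of the first function at eta, the property of [KN] the value of the second at om. *)
Lemma repr_kernel_eq N kap k a b wy wx ups j P om eta :
  class_sum N kap k a b -> wfun a wy -> wfun b wx -> (1 <= k)%nat ->
  (forall t, ups (cos t, sin t) = Wk k wy wx t) ->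
  is_repr_kernel N kap ups j P -> Cmod om = 1 -> Cmod eta = 1 ->
  RtoC (P om eta) = ev (KN a b k om j) eta.
Proof.
  intros HC Ha Hb Hk Hu [HP1 HP2] Hom Heta.
  assert (Ha0 : 0 <= a) by apply Ha. assert (Hb0 : 0 <= b) by apply Hb.
  destruct (HP1 eta Heta) as (c & Hc & Pc).
  destruct (Lap_dunkl_harmonic N kap k a b j (KN a b k om j) HC (hom_KN _ _ _ _ _ Hk)
    (fun x => Lap_KN a b k om j x Hk Ha0 Hb0)) as (d & Hd & Ed).
  assert (RK : forall x, Cmod x = 1 -> ev (KN a b k om j) x = RtoC (hpoly j d x)).
  { intros x Hx. rewrite Ed. assert (R := KN_real a b k om j x Hk Hom Hx).
    apply C_ext; [reflexivity|]. apply (f_equal Im) in R. rewrite im_conj in R.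
    change (Im (RtoC (Re (ev (KN a b k om j) x)))) with 0. lra. }
  rewrite RK, (HP2 d Hd eta Heta) by auto.
  rewrite (circ_inner_Ik k a b wy wx ups (KN a b k om j) (phpoly j c) _ _) by
    (auto; intros; first [apply RK, E_unit|rewrite ev_phpoly, Pc; auto using E_unit]).
  rewrite (Ik_ext k wy wx _ (PM (phpoly j c) (KN a b k om j))) by (intros; cbn [ev]; ring).
  rewrite KN_reproduces; auto.
  - rewrite ev_phpoly, Pc; auto.
  - apply hom_phpoly.
  - apply (dunkl_harmonic_Lap N kap); auto.
Qed.

(** * The multiplicities and weights of the two families of groups *)

Lemma fsum_double n f : fsum (2 * n) f = fsum n (fun j => f (2 * j)%nat) + fsum n (fun j => f (2 * j + 1)%nat).
Proof.
  induction n as [|n IH]; [simpl; ring|].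
  replace (2 * S n)%nat with (S (S (2 * n))) by lia. cbn [fsum]. rewrite IH.
  replace (2 * n + 1)%nat with (S (2 * n)) by lia. ring.
Qed.

Lemma fsum_mult c n f : fsum n (fun i => c * f i) = c * fsum n f.
Proof. induction n as [|n IH]; simpl; [|rewrite IH]; ring. Qed.

Lemma class_sum_I2k k a b : (1 <= k)%nat -> class_sum (2 * k) (kap_I2k a b) k a b.
Proof.
  intros Hk F. assert (HN : INR k <> 0) by (apply not_0_INR; lia).
  rewrite fsum_double, <- !fsum_mult. f_equal; apply fsum_ext; intros j _; unfold kap_I2k, mirror_angle.
  - replace (Nat.even (2 * j)) with true by (symmetry; apply Nat.even_spec; exists j; auto).
    f_equal. f_equal. unfold angA. rewrite !mult_INR. simpl. field; auto.
  - replace (Nat.even (2 * j + 1)) with false by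
      (rewrite Nat.add_1_r, Nat.even_succ, <- Nat.negb_even; symmetry; apply Bool.negb_false_iff;
       apply Nat.even_spec; exists j; auto).
    f_equal. f_equal. unfold angB. rewrite plus_INR, !mult_INR. simpl. field; auto.
Qed.

Lemma class_sum_Ik k a : class_sum k (kap_Ik a) k a 0.
Proof.
  intros F. rewrite Rmult_0_l, Rplus_0_r. apply (fsum_mult a k (fun j => F (angA k j))).
Qed.

Lemma wfun_one : wfun 0 (fun _ => 1).
Proof.
  refine (conj _ (conj _ (conj _ (conj _ (conj _ _))))); intros; try lra; try apply cont_const.
  auto_derive; auto; ring.
Qed.

Lemma powabs_0 a : powabs 0 a = 0.
Proof. unfold powabs. destruct (Req_EM_T 0 0); lra. Qed.

Lemma powabs_pos x a : x <> 0 -> powabs x a = Rpower (Rabs x) a.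
Proof. intros H; unfold powabs. destruct (Req_EM_T x 0); [contradiction|reflexivity]. Qed.

Lemma powabs_nonneg x a : 0 <= powabs x a.
Proof. unfold powabs. destruct (Req_EM_T x 0); [lra|apply Rlt_le, exp_pos]. Qed.

Lemma powabs_opp x a : powabs (- x) a = powabs x a.
Proof.
  destruct (Req_dec x 0) as [->|H]; [rewrite Ropp_0; auto|].
  rewrite !powabs_pos, Rabs_Ropp by lra. reflexivity.
Qed.

Lemma powabs_lt x a eps : 0 < a -> 0 < eps -> Rabs x < Rpower eps (/ a) -> powabs x a < eps.
Proof.
  intros Ha He Hx. destruct (Req_dec x 0) as [->|H]; [rewrite powabs_0; auto|].
  rewrite powabs_pos by auto. apply Rabs_pos_lt in H.
  replace eps with (Rpower (Rpower eps (/ a)) a).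
  - unfold Rpower. apply exp_increasing. apply Rmult_lt_compat_l; auto.
    apply ln_increasing; auto.
  - rewrite Rpower_mult, Rinv_l, Rpower_1; lra.
Qed.

Lemma powabs_cont_0 a : 0 < a -> continuous (fun x => powabs x a) 0.
Proof.
  intros Ha P [eps HP]. rewrite powabs_0 in HP.
  exists (mkposreal (Rpower eps (/ a)) (exp_pos _)). intros y Hy. apply HP.
  unfold ball in *; simpl in *. unfold AbsRing_ball, abs, minus, plus, opp in *; simpl in *.
  rewrite Ropp_0, Rplus_0_r in *. rewrite Rabs_pos_eq by apply powabs_nonneg.
  apply powabs_lt; auto. apply cond_pos.
Qed.

Lemma powabs_derive x a : x <> 0 -> is_derive (fun y => powabs y a) x (a * powabs x a / x).
Proof.
  intros Hx. rewrite powabs_pos by auto.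
  apply (is_derive_ext_loc (fun y => Rpower (Rabs y) a)).
  - apply (filter_imp (fun y => y <> 0)).
    + intros y Hy. rewrite powabs_pos; auto.
    + apply (locally_nonzero (fun y => y)); auto. apply continuous_id.
  - unfold Rpower. destruct (Rdichotomy _ _ Hx) as [H|H].
    + apply (is_derive_ext_loc (fun y => exp (a * ln (- y)))).
      * apply (filter_imp (fun y => y < 0)); [|apply (open_lt 0); auto].
        intros y Hy. rewrite Rabs_left; auto.
      * auto_derive; [lra|]. rewrite Rabs_left by auto. field; lra.
    + apply (is_derive_ext_loc (fun y => exp (a * ln y))).
      * apply (filter_imp (fun y => 0 < y)); [|apply (open_gt 0); auto].
        intros y Hy. rewrite Rabs_right; auto; lra.
      * auto_derive; [lra|]. rewrite Rabs_right by lra. field; lra.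
Qed.

Lemma wfun_powabs b : 0 < b -> wfun b (fun x => powabs x (2 * b)).
Proof.
  intros Hb. refine (conj _ (conj _ (conj _ (conj _ (conj _ _))))).
  - lra.
  - intros x. destruct (Req_dec x 0) as [->|H]; [apply powabs_cont_0; lra|].
    eapply is_derive_cont. apply powabs_derive; auto.
  - intros; apply powabs_opp.
  - intros; apply powabs_nonneg.
  - intros x H. rewrite powabs_pos by auto. apply exp_pos.
  - intros x. destruct (Req_dec x 0) as [->|H].
    (* At 0 the difference quotient of y |y|^(2b) is |h|^(2b), which tends to 0 for every b > 0. *)
    + rewrite powabs_0, Rmult_0_r. apply is_derive_Reals. intros eps He.
      assert (Hp : 0 < Rpower eps (/ (2 * b))) by apply exp_pos.
      exists (mkposreal _ Hp). intros h Hh Hlt. simpl in Hlt.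
      rewrite Rplus_0_l, Rmult_0_l. replace ((h * powabs h (2 * b) - 0) / h - 0) with (powabs h (2 * b))
        by (field; auto).
      rewrite Rabs_pos_eq by apply powabs_nonneg. apply powabs_lt; auto; lra.
    + apply (is_derive_eq _ _ (1 * powabs x (2 * b) + x * (2 * b * powabs x (2 * b) / x))).
      * apply (is_derive_Rmult (fun y => y) (fun y => powabs y (2 * b))); [apply (is_derive_id x)|].
        apply powabs_derive; auto.
      * match goal with |- ?l = ?r => change (@eq R l r) end. field; auto.
Qed.

Lemma ups_I2k_E k a b t : ups_I2k k a b (cos t, sin t) =
  Wk k (fun y => powabs y (2 * a)) (fun x => powabs x (2 * b)) t.
Proof.
  unfold ups_I2k, Wk, Wt. change (cos t, sin t) with (E t). rewrite E_pow. reflexivity.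
Qed.

Lemma ups_Ik_E k a t : ups_Ik k a (cos t, sin t) = Wk k (fun y => powabs y (2 * a)) (fun _ => 1) t.
Proof.
  unfold ups_Ik, Wk, Wt. change (cos t, sin t) with (E t). rewrite E_pow, Rmult_1_r. reflexivity.
Qed.

(** * Series and termwise integration *)

Lemma is_series_tail_le (a : nat -> R) s N : (forall n, 0 <= a n) -> is_series a s -> sum_n a N <= s.
Proof.
  intros Hp Hs. apply (is_lim_seq_le_loc (fun _ => sum_n a N) (sum_n a) (sum_n a N) s).
  - exists N. intros n Hn. induction Hn as [|m Hm IH]; [lra|].
    rewrite sum_Sn. unfold plus; simpl. specialize (Hp (S m)). lra.
  - apply is_lim_seq_const.
  - exact Hs.
Qed.

Lemma Rabs_sum_n_le (a m : nat -> R) N : (forall n, (n <= N)%nat -> Rabs (a n) <= m n) ->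
  Rabs (sum_n a N) <= sum_n m N.
Proof.
  intros H. induction N as [|N IH].
  - rewrite !sum_O. apply H; auto.
  - rewrite !sum_Sn. unfold plus; simpl. eapply Rle_trans; [apply Rabs_triang|].
    apply Rplus_le_compat; auto.
Qed.

Lemma is_series_minus_sum (a : nat -> R) s N :
  is_series a s -> is_series (fun n => a (S N + n)%nat) (s - sum_n a N).
Proof.
  intros H. apply (is_series_incr_n a (S N) (s - sum_n a N)); [lia|].
  change (is_series a ((s - sum_n a N) + sum_n a N)).
  replace (s - sum_n a N + sum_n a N) with s by (unfold Rminus; rewrite Rplus_assoc, Rplus_opp_l, Rplus_0_r; reflexivity).
  exact H.
Qed.

Lemma is_series_Rabs_le (a m : nat -> R) s t :
  (forall n, Rabs (a n) <= m n) -> is_series a s -> is_series m t -> Rabs s <= t.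
Proof.
  intros H Ha Hm.
  apply (is_lim_seq_le (fun n => Rabs (sum_n a n)) (sum_n m) (Rabs s) t).
  - intros n; apply Rabs_sum_n_le; auto.
  - apply (is_lim_seq_abs _ s). exact Ha.
  - exact Hm.
Qed.

Lemma is_series_tail_bound (a m : nat -> R) s t N :
  (forall n, Rabs (a n) <= m n) -> is_series a s -> is_series m t ->
  Rabs (s - sum_n a N) <= t - sum_n m N.
Proof.
  intros H Ha Hm. apply (is_series_Rabs_le (fun n => a (S N + n)%nat) (fun n => m (S N + n)%nat)).
  - auto.
  - apply is_series_minus_sum; auto.
  - apply is_series_minus_sum; auto.
Qed.

Lemma filterlim_sum_n {T} (F : (T -> Prop) -> Prop) {FF : Filter F} (a : T -> nat -> R) (l : nat -> R) N :
  (forall n, filterlim (fun t => a t n) F (locally (l n))) ->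
  filterlim (fun t => sum_n (a t) N) F (locally (sum_n l N)).
Proof.
  intros H. induction N as [|N IH].
  - rewrite sum_O. eapply filterlim_ext; [|apply H]. intros t; rewrite sum_O; auto.
  - rewrite sum_Sn. eapply filterlim_ext; [intros t; symmetry; apply sum_Sn|].
    eapply filterlim_comp_2; [apply IH|apply H|]. apply (filterlim_plus (V := R_NormedModule) (sum_n l N) (l (S N))).
Qed.

Lemma ball_R (x e y : R) : ball x e y <-> Rabs (y - x) < e.
Proof. reflexivity. Qed.

(** Dominated convergence for series along an arbitrary proper filter. It is used with an index
    tending to infinity, for diagonal summation, and with the pair of end points of an improper
    integral. *)
Lemma tannery {T} (F : (T -> Prop) -> Prop) {FF : ProperFilter F} (a : T -> nat -> R)
  (l m : nat -> R) (S : T -> R) : ex_series m ->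
  F (fun t => (forall n, Rabs (a t n) <= m n) /\ is_series (a t) (S t)) ->
  (forall n, filterlim (fun t => a t n) F (locally (l n))) ->
  exists s, is_series l s /\ filterlim S F (locally s) /\ (forall n, Rabs (l n) <= m n).
Proof.
  intros [t0 Hm] Ha Hl.
  assert (Hlm : forall n, Rabs (l n) <= m n).
  { intros n. apply (filterlim_le (F := F) (fun t => Rabs (a t n)) (fun _ => m n) (Rabs (l n)) (m n)).
    - apply (filter_imp _ _ (fun t H => proj1 H n) Ha).
    - apply (filterlim_comp _ _ _ (fun t => a t n) Rabs _ (locally (l n))); auto.
      apply (continuous_Rabs (l n)).
    - apply filterlim_const. }
  assert (Es : ex_series l).
  { apply (ex_series_le (K := R_AbsRing) (V := R_CompleteNormedModule) l m); [exact Hlm|exists t0; auto]. }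
  destruct Es as [s Hs]. exists s. repeat split; auto.
  intros P [eps HP]. unfold filtermap.
  assert (He : 0 < eps / 3) by (assert (Q := cond_pos eps); lra).
  destruct (Hm (ball t0 (eps / 3))) as [N HN]; [exists (mkposreal _ He); auto|].
  specialize (HN N (Nat.le_refl N)). change (Rabs (sum_n m N - t0) < eps / 3) in HN.
  assert (HL : F (fun t => ball (sum_n l N) (eps / 3) (sum_n (a t) N))).
  { apply (filterlim_sum_n F a l N Hl). exists (mkposreal _ He); auto. }
  generalize (filter_and _ _ Ha HL). apply filter_imp. intros t [[H1 H2] H3].
  apply HP. apply ball_R. change (Rabs (sum_n (a t) N - sum_n l N) < eps / 3) in H3.
  assert (T1 := is_series_tail_bound (a t) m (S t) t0 N H1 H2 Hm).
  assert (T2 := is_series_tail_bound l m s t0 N Hlm Hs Hm).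
  assert (T3 : t0 - sum_n m N < eps / 3).
  { rewrite Rabs_minus_sym in HN. apply Rle_lt_trans with (2 := HN). apply Rle_abs. }
  replace (S t - s) with ((S t - sum_n (a t) N) - (s - sum_n l N) + (sum_n (a t) N - sum_n l N)) by ring.
  eapply Rle_lt_trans; [apply Rabs_triang|].
  assert (T4 : Rabs ((S t - sum_n (a t) N) - (s - sum_n l N)) <= Rabs (S t - sum_n (a t) N) + Rabs (s - sum_n l N)).
  { unfold Rminus at 1. eapply Rle_trans; [apply Rabs_triang|]. rewrite Rabs_Ropp. lra. }
  lra.
Qed.

Lemma sum_n_ext_le (a b : nat -> R) N : (forall n, (n <= N)%nat -> a n = b n) -> sum_n a N = sum_n b N.
Proof. intros H. apply sum_n_ext_loc; auto. Qed.

Lemma sum_n_diag (b : nat -> nat -> R) Q :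
  sum_n (fun q => sum_n (fun n => b n (q - n)%nat) q) Q = sum_n (fun n => sum_n (b n) (Q - n)) Q.
Proof.
  induction Q as [|Q IH].
  - rewrite !sum_O. reflexivity.
  - rewrite sum_Sn, IH, (sum_Sn (fun n => sum_n (b n) (S Q - n))), (sum_Sn (fun n => b n (S Q - n)%nat)).
    rewrite Nat.sub_diag, sum_O, plus_assoc. f_equal. rewrite <- sum_n_plus.
    apply sum_n_ext_le. intros n Hn. replace (S Q - n)%nat with (S (Q - n)) by lia.
    rewrite sum_Sn. reflexivity.
Qed.

Lemma is_series_fin (a : nat -> R) N : (forall n, (N < n)%nat -> a n = 0) -> is_series a (sum_n a N).
Proof.
  intros H. change (is_lim_seq (sum_n a) (Finite (sum_n a N))).
  apply (is_lim_seq_ext_loc (fun _ => sum_n a N)); [|apply is_lim_seq_const].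
  exists N. intros n Hn. induction Hn as [|m Hm IH]; auto.
  rewrite sum_Sn, <- IH, H by lia. unfold plus; simpl. rewrite Rplus_0_r; reflexivity.
Qed.

(** Summation of a double series by rows and by diagonals agrees if the row sums of a majorant
    converge. *)
Lemma is_series_diag (b B : nat -> nat -> R) (r Br : nat -> R) :
  (forall n i, Rabs (b n i) <= B n i) -> (forall n, is_series (B n) (Br n)) -> ex_series Br ->
  (forall n, is_series (b n) (r n)) ->
  exists s, is_series r s /\ is_series (fun q => sum_n (fun n => b n (q - n)%nat) q) s.
Proof.
  intros Hb HB HBr Hr.
  (* A partial sum of the diagonal series runs over a triangle, that is over rows cut at Q - n. As Q
     grows each row tends to its sum and stays below [Br n]. *)
  set (a := fun Q n => if Nat.leb n Q then sum_n (b n) (Q - n) else 0).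
  assert (HBp : forall n i, 0 <= B n i) by (intros; eapply Rle_trans; [apply Rabs_pos|apply Hb]).
  destruct (tannery eventually a r Br (fun Q => sum_n (fun n => sum_n (b n) (Q - n)) Q)) as (s & H1 & H2 & _).
  - auto.
  - apply filter_forall. intros Q. split.
    + intros n. unfold a. destruct (Nat.leb_spec n Q).
      * eapply Rle_trans; [apply (Rabs_sum_n_le _ (B n)); auto|]. apply is_series_tail_le; auto.
      * rewrite Rabs_R0. eapply Rle_trans; [apply (HBp n 0%nat)|].
        assert (H0 := is_series_tail_le (B n) (Br n) 0 (HBp n) (HB n)). rewrite sum_O in H0. exact H0.
    + rewrite (sum_n_ext_le _ (a Q)).
      * apply is_series_fin. intros n Hn. unfold a. destruct (Nat.leb_spec n Q); auto; lia.
      * intros n Hn. unfold a. destruct (Nat.leb_spec n Q); auto; lia.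
  - intros n. apply (filterlim_ext_loc (fun Q => sum_n (b n) (Q - n))).
    + exists n. intros Q HQ. unfold a. destruct (Nat.leb_spec n Q); auto; lia.
    + apply (filterlim_comp _ _ _ (fun Q => (Q - n)%nat) (sum_n (b n)) _ eventually); [|apply Hr].
      intros P [N HN]. exists (N + n)%nat. intros Q HQ. apply HN. lia.
  - exists s. split; auto. eapply filterlim_ext; [|exact H2]. intros Q. cbv beta. symmetry. apply sum_n_diag.
Qed.

Definition Cser (a : nat -> C) (s : C) : Prop :=
  is_series (fun n => Re (a n)) (Re s) /\ is_series (fun n => Im (a n)) (Im s).

Lemma Cser_unique a s t : Cser a s -> Cser a t -> s = t.
Proof.
  intros [A B] [A' B']. apply C_ext.
  - rewrite <- (is_series_unique _ _ A), <- (is_series_unique _ _ A'). reflexivity.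
  - rewrite <- (is_series_unique _ _ B), <- (is_series_unique _ _ B'). reflexivity.
Qed.

Lemma Cser_ext a b s : (forall n, a n = b n) -> Cser a s -> Cser b s.
Proof.
  intros H [A B]. split; eapply is_series_ext; eauto; intros n; cbv beta; rewrite H; auto.
Qed.

Lemma Cser_plus a b s t : Cser a s -> Cser b t -> Cser (fun n => (a n + b n)%C) (s + t)%C.
Proof. intros [A B] [A' B']. split; simpl; apply (is_series_plus (V := R_NormedModule)); auto. Qed.

Lemma Cser_scal c a s : Cser a s -> Cser (fun n => (c * a n)%C) (c * s)%C.
Proof.
  intros [A B]. split; simpl.
  - apply (is_series_minus (V := R_NormedModule) (fun n => Re c * Re (a n)) (fun n => Im c * Im (a n)));
      apply (is_series_scal (K := R_AbsRing) (V := R_NormedModule)); auto.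
  - apply (is_series_plus (V := R_NormedModule) (fun n => Re c * Im (a n)) (fun n => Im c * Re (a n)));
      apply (is_series_scal (K := R_AbsRing) (V := R_NormedModule)); auto.
Qed.

Lemma Im_le_Cmod z : Rabs (Im z) <= Cmod z.
Proof. eapply Rle_trans; [|apply Rmax_Cmod]. apply Rmax_r. Qed.

Lemma Cser_dom a m : (forall n, Cmod (a n) <= m n) -> ex_series m -> exists s, Cser a s.
Proof.
  intros H Hm.
  assert (A : ex_series (fun n => Re (a n))).
  { apply (ex_series_le (K := R_AbsRing) (V := R_CompleteNormedModule) _ m); auto.
    intros n; eapply Rle_trans; [apply re_le_Cmod|apply H]. }
  assert (B : ex_series (fun n => Im (a n))).
  { apply (ex_series_le (K := R_AbsRing) (V := R_CompleteNormedModule) _ m); auto.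
    intros n; eapply Rle_trans; [apply Im_le_Cmod|apply H]. }
  destruct A as [u A], B as [v B]. exists (u, v). split; auto.
Qed.

Lemma Re_sum_n (a : nat -> C) N : Re (csum (S N) a) = sum_n (fun n => Re (a n)) N.
Proof.
  induction N as [|N IH].
  - rewrite sum_O. simpl. unfold Re; ring.
  - rewrite sum_Sn, <- IH. reflexivity.
Qed.

Lemma Im_sum_n (a : nat -> C) N : Im (csum (S N) a) = sum_n (fun n => Im (a n)) N.
Proof.
  induction N as [|N IH].
  - rewrite sum_O. simpl. unfold Im; ring.
  - rewrite sum_Sn, <- IH. reflexivity.
Qed.

Lemma Cser_diag (b : nat -> nat -> C) (B : nat -> nat -> R) (r : nat -> C) (Br : nat -> R) :
  (forall n i, Cmod (b n i) <= B n i) -> (forall n, is_series (B n) (Br n)) -> ex_series Br ->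
  (forall n, Cser (b n) (r n)) ->
  exists s, Cser r s /\ Cser (fun q => csum (S q) (fun n => b n (q - n)%nat)) s.
Proof.
  intros Hb HB HBr Hr.
  destruct (is_series_diag (fun n i => Re (b n i)) B (fun n => Re (r n)) Br) as (u & U1 & U2); auto.
  { intros; eapply Rle_trans; [apply re_le_Cmod|apply Hb]. }
  { intros n; apply Hr. }
  destruct (is_series_diag (fun n i => Im (b n i)) B (fun n => Im (r n)) Br) as (v & V1 & V2); auto.
  { intros; eapply Rle_trans; [apply Im_le_Cmod|apply Hb]. }
  { intros n; apply Hr. }
  exists (u, v). split; split; auto.
  - eapply is_series_ext; [|exact U2]. intros q. symmetry. apply Re_sum_n.
  - eapply is_series_ext; [|exact V2]. intros q. symmetry. apply Im_sum_n.
Qed.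

(** * Termwise integration over compact and improper intervals *)

Lemma is_RInt_gen_filterlim (f : R -> R) Fa Fb {FA : Filter Fa} {FB : Filter Fb} l :
  filter_prod Fa Fb (fun ab => ex_RInt f (fst ab) (snd ab)) ->
  filterlim (fun ab => RInt f (fst ab) (snd ab)) (filter_prod Fa Fb) (locally l) ->
  is_RInt_gen f Fa Fb l.
Proof.
  intros Hex H P HP. specialize (H P HP). unfold filtermap in H. unfold filtermapi.
  generalize (filter_and _ _ Hex H). apply filter_imp. intros ab [H1 H2].
  exists (RInt f (fst ab) (snd ab)). split; auto. apply (RInt_correct (V := R_CompleteNormedModule)); auto.
Qed.

Lemma filterlim_is_RInt_gen (f : R -> R) Fa Fb {FA : Filter Fa} {FB : Filter Fb} l :
  is_RInt_gen f Fa Fb l ->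
  filterlim (fun ab => RInt f (fst ab) (snd ab)) (filter_prod Fa Fb) (locally l).
Proof.
  intros H P HP. specialize (H P HP). unfold filtermapi in H. unfold filtermap.
  revert H. apply filter_imp. intros ab (y & H1 & H2). rewrite (is_RInt_unique _ _ _ _ H1). exact H2.
Qed.

Lemma RInt_series (f : nat -> R -> R) (g : R -> R) (m : nat -> R) x y : x <= y ->
  (forall n, ex_RInt (f n) x y) -> ex_series m ->
  (forall n t, x <= t <= y -> Rabs (f n t) <= m n) ->
  (forall t, x <= t <= y -> is_series (fun n => f n t) (g t)) ->
  ex_RInt g x y /\ is_series (fun n => RInt (f n) x y) (RInt g x y).
Proof.
  intros Hxy Hex [M HM] Hm Hg.
  (* The passage to the limit asks for uniform convergence on the whole line; clamping the argument
     to [x, y] provides it. *)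
  set (c := fun t => Rmax x (Rmin y t)).
  assert (Hc : forall t, x <= c t <= y).
  { intros t. unfold c. split; [apply Rmax_l|]. apply Rmax_lub; auto. apply Rmin_l. }
  assert (Hc' : forall t, x <= t <= y -> c t = t).
  { intros t Ht. unfold c. rewrite Rmin_right, Rmax_right; lra. }
  assert (Hsum : forall N, is_RInt (fun t => sum_n (fun n => f n (c t)) N) x y (sum_n (fun n => RInt (f n) x y) N)).
  { intros N. apply (is_RInt_ext (fun t => sum_n (fun n => f n t) N)).
    - intros t Ht. rewrite Rmin_left, Rmax_right in Ht by auto. apply sum_n_ext. intros n. rewrite Hc'; lra.
    - induction N as [|N IH].
      + rewrite sum_O. eapply is_RInt_ext; [|apply (RInt_correct (V := R_CompleteNormedModule)), Hex]. intros; rewrite sum_O; auto.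
      + rewrite sum_Sn. eapply is_RInt_ext; [|apply (is_RInt_plus (V := R_NormedModule)); [exact IH|apply (RInt_correct (V := R_CompleteNormedModule)), Hex]].
        intros; rewrite sum_Sn; auto. }
  destruct (filterlim_RInt (V := R_CompleteNormedModule) (fun N t => sum_n (fun n => f n (c t)) N) x y eventually _
    (fun t => g (c t)) (fun N => sum_n (fun n => RInt (f n) x y) N) Hsum) as (If & L1 & L2).
  - intros P [eps HP]. destruct (HM (ball M eps)) as [N HN]; [exists eps; auto|].
    exists N. intros n Hn. apply HP. intros t. apply ball_R.
    specialize (HN n Hn). change (Rabs (sum_n m n - M) < eps) in HN.
    rewrite Rabs_minus_sym. eapply Rle_lt_trans; [apply (is_series_tail_bound _ m _ M n)|].
    + intros i; apply Hm; auto.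
    + apply Hg; auto.
    + exact HM.
    + rewrite Rabs_minus_sym in HN. eapply Rle_lt_trans; [apply Rle_abs|exact HN].
  - assert (L3 : is_RInt g x y If).
    { eapply is_RInt_ext; [|exact L2]. intros t Ht. rewrite Rmin_left, Rmax_right in Ht by auto.
      cbv beta. rewrite Hc'; lra. }
    split; [exists If; auto|]. rewrite (is_RInt_unique _ _ _ _ L3). exact L1.
Qed.

(** Tannery's theorem with the end points as parameter. [D] selects the admissible pairs; the
    pointwise majorant may depend on the pair, but the bounds [M] on the integrals may not.
    Integrands unbounded at the ends are thus covered. *)
Lemma RInt_gen_series (f : nat -> R -> R) (g : R -> R) (M I : nat -> R) Fa Fb
  {FA : ProperFilter Fa} {FB : ProperFilter Fb} (D : R -> R -> Prop) :
  filter_prod Fa Fb (fun ab => D (fst ab) (snd ab)) ->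
  (forall x y, D x y -> x <= y /\ (forall n, ex_RInt (f n) x y) /\
     (exists m : nat -> R, ex_series m /\ forall n t, x <= t <= y -> Rabs (f n t) <= m n) /\
     (forall t, x <= t <= y -> is_series (fun n => f n t) (g t)) /\
     (forall n, Rabs (RInt (f n) x y) <= M n)) ->
  ex_series M -> (forall n, is_RInt_gen (f n) Fa Fb (I n)) ->
  exists s, is_series I s /\ is_RInt_gen g Fa Fb s.
Proof.
  intros HD H HM HI.
  assert (K : forall x y, D x y -> ex_RInt g x y /\ is_series (fun n => RInt (f n) x y) (RInt g x y)).
  { intros x y Hxy. destruct (H x y Hxy) as (H1 & H2 & (m & H3 & H4) & H5 & H6).
    apply (RInt_series f g m); auto. }
  destruct (tannery (filter_prod Fa Fb) (fun ab n => RInt (f n) (fst ab) (snd ab)) I M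
    (fun ab => RInt g (fst ab) (snd ab))) as (s & S1 & S2 & _); auto.
  - revert HD. apply filter_imp. intros ab Hab. split; [|apply K; auto]. intros n. apply (H _ _ Hab).
  - intros n. apply filterlim_is_RInt_gen; try typeclasses eauto. apply HI.
  - exists s. split; auto. apply is_RInt_gen_filterlim; try typeclasses eauto; auto.
    revert HD. apply filter_imp. intros ab Hab. apply K; auto.
Qed.

Definition CRInt_gen (f : R -> C) Fa Fb (l : C) : Prop :=
  is_RInt_gen (fun t => Re (f t)) Fa Fb (Re l) /\ is_RInt_gen (fun t => Im (f t)) Fa Fb (Im l).

Lemma CRInt_gen_is (f : R -> C) Fa Fb {FA : Filter Fa} {FB : Filter Fb} l :
  CRInt_gen f Fa Fb l -> is_RInt_gen (V := C_R_NormedModule) f Fa Fb l.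
Proof.
  intros [A B] P [eps HP]. unfold filtermapi.
  assert (A' := A (ball (Re l) eps) (ex_intro _ eps (fun y Hy => Hy))).
  assert (B' := B (ball (Im l) eps) (ex_intro _ eps (fun y Hy => Hy))).
  unfold filtermapi in A', B'. generalize (filter_and _ _ A' B'). apply filter_imp.
  intros ab [(u & U1 & U2) (v & V1 & V2)]. exists (u, v). split.
  - apply (is_RInt_fct_extend_pair (U := R_NormedModule) (V := R_NormedModule)); auto.
  - apply HP. split; auto.
Qed.

Lemma CRInt_gen_ext (f g : R -> C) Fa Fb {FA : Filter Fa} {FB : Filter Fb} l :
  filter_prod Fa Fb (fun ab => forall x, Rmin (fst ab) (snd ab) < x < Rmax (fst ab) (snd ab) -> f x = g x) ->
  CRInt_gen f Fa Fb l -> CRInt_gen g Fa Fb l.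
Proof.
  intros H [A B]. split.
  - eapply is_RInt_gen_ext; [|exact A]. revert H. apply filter_imp. intros ab Hab x Hx. rewrite Hab; auto.
  - eapply is_RInt_gen_ext; [|exact B]. revert H. apply filter_imp. intros ab Hab x Hx. rewrite Hab; auto.
Qed.

Lemma CRInt_gen_plus f g Fa Fb {FA : Filter Fa} {FB : Filter Fb} l m :
  CRInt_gen f Fa Fb l -> CRInt_gen g Fa Fb m -> CRInt_gen (fun t => (f t + g t)%C) Fa Fb (l + m)%C.
Proof. intros [A B] [A' B']. split; apply (is_RInt_gen_plus (V := R_NormedModule)); auto. Qed.

Lemma CRInt_gen_scal c f Fa Fb {FA : Filter Fa} {FB : Filter Fb} l :
  CRInt_gen f Fa Fb l -> CRInt_gen (fun t => (c * f t)%C) Fa Fb (c * l)%C.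
Proof.
  intros [A B]. split.
  - apply (is_RInt_gen_minus (V := R_NormedModule) (fun t => Re c * Re (f t)) (fun t => Im c * Im (f t)));
      apply (is_RInt_gen_scal (V := R_NormedModule)); auto.
  - apply (is_RInt_gen_plus (V := R_NormedModule) (fun t => Re c * Im (f t)) (fun t => Im c * Re (f t)));
      apply (is_RInt_gen_scal (V := R_NormedModule)); auto.
Qed.

(** The bound by [M] passes through a real majorant of the modulus, so that it serves both
    components. *)
Lemma CRInt_gen_series (f : nat -> R -> C) (g : R -> C) (M : nat -> R) (I : nat -> C) Fa Fb
  {FA : ProperFilter Fa} {FB : ProperFilter Fb} (D : R -> R -> Prop) :
  filter_prod Fa Fb (fun ab => D (fst ab) (snd ab)) ->
  (forall x y, D x y -> x <= y /\
     (forall n, ex_RInt (fun t => Re (f n t)) x y /\ ex_RInt (fun t => Im (f n t)) x y) /\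
     (exists m : nat -> R, ex_series m /\ forall n t, x <= t <= y -> Cmod (f n t) <= m n) /\
     (forall t, x <= t <= y -> Cser (fun n => f n t) (g t)) /\
     (forall n, exists h : R -> R, ex_RInt h x y /\ (forall t, x <= t <= y -> Cmod (f n t) <= h t) /\ RInt h x y <= M n)) ->
  ex_series M -> (forall n, CRInt_gen (f n) Fa Fb (I n)) ->
  exists s, Cser I s /\ CRInt_gen g Fa Fb s.
Proof.
  intros HD H HM HI.
  assert (B : forall (p : C -> R) x y n, (forall z, Rabs (p z) <= Cmod z) -> D x y ->
    ex_RInt (fun t => p (f n t)) x y -> Rabs (RInt (fun t => p (f n t)) x y) <= M n).
  { intros p x y n Hp Hxy Hex. destruct (H x y Hxy) as (H1 & _ & _ & _ & H2).
    destruct (H2 n) as (h & Eh & Bh & Mh).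
    apply Rle_trans with (2 := Mh).
    apply (norm_RInt_le (V := R_NormedModule) (fun t => p (f n t)) h x y); auto.
    - intros t Ht. eapply Rle_trans; [apply Hp|apply Bh; auto].
    - apply (RInt_correct (V := R_CompleteNormedModule)); auto.
    - apply (RInt_correct (V := R_CompleteNormedModule)); auto. }
  destruct (RInt_gen_series (fun n t => Re (f n t)) (fun t => Re (g t)) M (fun n => Re (I n)) Fa Fb D) as (u & U1 & U2); auto.
  { intros x y Hxy. destruct (H x y Hxy) as (H1 & H2 & (m & H3 & H4) & H5 & H6). refine (conj H1 (conj _ (conj _ (conj _ _)))).
    - intros n; exact (proj1 (H2 n)).
    - exists m. split; auto. intros; eapply Rle_trans; [apply re_le_Cmod|apply H4; auto].
    - intros t Ht; exact (proj1 (H5 t Ht)).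
    - intros n. apply (B Re); [apply re_le_Cmod|exact Hxy|exact (proj1 (H2 n))]. }
  { intros n; exact (proj1 (HI n)). }
  destruct (RInt_gen_series (fun n t => Im (f n t)) (fun t => Im (g t)) M (fun n => Im (I n)) Fa Fb D) as (v & V1 & V2); auto.
  { intros x y Hxy. destruct (H x y Hxy) as (H1 & H2 & (m & H3 & H4) & H5 & H6). refine (conj H1 (conj _ (conj _ (conj _ _)))).
    - intros n; exact (proj2 (H2 n)).
    - exists m. split; auto. intros; eapply Rle_trans; [apply Im_le_Cmod|apply H4; auto].
    - intros t Ht; exact (proj2 (H5 t Ht)).
    - intros n. apply (B Im); [apply Im_le_Cmod|exact Hxy|exact (proj2 (H2 n))]. }
  { intros n; exact (proj2 (HI n)). }
  exists (u, v). split; split; auto.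
Qed.

(** * The Gamma function and the moments of the measures mu *)

Lemma ball_Rabs (x e y : R) : ball x e y -> Rabs (y - x) < e.
Proof. exact (fun H => H). Qed.

Lemma ev_right0_infty (P : R * R -> Prop) :
  (forall x y, 0 < x < 1 -> 1 < y -> P (x, y)) -> filter_prod (at_right 0) (Rbar_locally p_infty) P.
Proof.
  intros H. apply (Filter_prod _ _ _ (fun x => 0 < x < 1) (fun y => 1 < y)).
  - exists (mkposreal 1 Rlt_0_1). intros y Hy H0. apply ball_Rabs in Hy; cbn [pos] in Hy.
    rewrite Rminus_0_r, Rabs_pos_eq in Hy; lra.
  - exists 1; auto.
  - auto.
Qed.

Lemma ev_pt0_infty (P : R * R -> Prop) :
  (forall y, 1 < y -> P (0, y)) -> filter_prod (at_point 0) (Rbar_locally p_infty) P.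
Proof.
  intros H. apply (Filter_prod _ _ _ (fun x => x = 0) (fun y => 1 < y)).
  - reflexivity.
  - exists 1; auto.
  - intros x y -> Hy; auto.
Qed.

Lemma ev_m1_1 (P : R * R -> Prop) :
  (forall x y, -1 < x < 0 -> 0 < y < 1 -> P (x, y)) -> filter_prod (at_right (-1)) (at_left 1) P.
Proof.
  intros H. apply (Filter_prod _ _ _ (fun x => -1 < x < 0) (fun y => 0 < y < 1)).
  - exists (mkposreal 1 Rlt_0_1). intros y Hy H0. apply ball_Rabs in Hy; cbn [pos] in Hy.
    rewrite Rabs_pos_eq in Hy; lra.
  - exists (mkposreal 1 Rlt_0_1). intros y Hy H0. apply ball_Rabs in Hy; cbn [pos] in Hy.
    rewrite Rabs_left in Hy; lra.
  - auto.
Qed.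

Lemma is_RInt_gen_eq (f : R -> R) Fa Fb (l m : R) : is_RInt_gen f Fa Fb l -> l = m -> is_RInt_gen f Fa Fb m.
Proof. intros H <-; exact H. Qed.

Lemma is_RInt_gen_deriv (F f : R -> R) Fa Fb {FA : Filter Fa} {FB : Filter Fb} (la lb : R) :
  filter_prod Fa Fb (fun ab => forall x, Rmin (fst ab) (snd ab) <= x <= Rmax (fst ab) (snd ab) ->
    is_derive F x (f x) /\ continuous f x) ->
  filterlim F Fa (locally la) -> filterlim F Fb (locally lb) -> is_RInt_gen f Fa Fb (lb - la).
Proof.
  intros H HA HB.
  assert (K : filter_prod Fa Fb (fun ab => is_RInt f (fst ab) (snd ab) (F (snd ab) - F (fst ab)))).
  { revert H. apply filter_imp. intros ab Hab. apply (is_RInt_derive F f); intros x Hx; apply Hab; auto. }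
  apply is_RInt_gen_filterlim; auto.
  - revert K. apply filter_imp. intros ab Hab. eexists; exact Hab.
  - apply (filterlim_ext_loc (fun ab => F (snd ab) - F (fst ab))).
    + revert K. apply filter_imp. intros ab Hab. symmetry. apply is_RInt_unique; auto.
    + apply (filterlim_comp_2 (F := filter_prod Fa Fb) (G := locally lb) (H := locally (- la))
        (fun ab => F (snd ab)) (fun ab => - F (fst ab)) Rplus).
      * exact (filterlim_comp _ _ _ (fun ab : R * R => snd ab) F _ _ _ filterlim_snd HB).
      * apply (filterlim_comp _ _ _ (fun ab : R * R => fst ab) (fun x => - F x) _ Fa _ filterlim_fst).
        apply (filterlim_comp _ _ _ F Ropp _ _ _ HA). apply (filterlim_opp (V := R_NormedModule) la).
      * apply (filterlim_plus (V := R_NormedModule) lb (- la)).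
Qed.

Lemma is_RInt_gen_nonneg (f : R -> R) Fa Fb {FA : ProperFilter Fa} {FB : ProperFilter Fb} l :
  filter_prod Fa Fb (fun ab => fst ab <= snd ab /\ forall x, fst ab < x < snd ab -> 0 <= f x) ->
  is_RInt_gen f Fa Fb l -> 0 <= l.
Proof.
  intros H Hf.
  assert (Hex : filter_prod Fa Fb (fun ab => ex_RInt f (fst ab) (snd ab))).
  { assert (K := Hf (fun _ => True) (filter_true)). unfold filtermapi in K.
    revert K. apply filter_imp. intros ab (y & Hy & _). exists y; auto. }
  assert (Hl := filterlim_is_RInt_gen f Fa Fb l Hf).
  apply (filterlim_le (F := filter_prod Fa Fb) (fun _ => 0) (fun ab => RInt f (fst ab) (snd ab)) 0 l); auto.
  - generalize (filter_and _ _ H Hex). apply filter_imp. intros ab [[H1 H2] H3].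
    apply RInt_ge_0; auto.
  - apply filterlim_const.
Qed.

Lemma RInt_gen_R_unique (f : R -> R) Fa Fb {FA : ProperFilter Fa} {FB : ProperFilter Fb} l :
  is_RInt_gen f Fa Fb l -> RInt_gen f Fa Fb = l.
Proof. apply (is_RInt_gen_unique (V := R_CompleteNormedModule)). Qed.

Lemma rpow0_pos t p : 0 < t -> rpow0 t p = Rpower t p.
Proof. intros H. unfold rpow0. destruct (Rlt_dec 0 t); [reflexivity|contradiction]. Qed.

Lemma rpow0_npos t p : t <= 0 -> rpow0 t p = 0.
Proof. intros H. unfold rpow0. destruct (Rlt_dec 0 t); [lra|reflexivity]. Qed.

Lemma rpow0_nonneg t p : 0 <= rpow0 t p.
Proof. unfold rpow0. destruct (Rlt_dec 0 t); [apply Rlt_le, exp_pos|lra]. Qed.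

Lemma rpow0_lt t p eps : 0 < p -> 0 < eps -> t < Rpower eps (/ p) -> rpow0 t p < eps.
Proof.
  intros Hp He Ht. destruct (Rlt_le_dec 0 t) as [H|H]; [|rewrite rpow0_npos; auto].
  rewrite rpow0_pos by auto. replace eps with (Rpower (Rpower eps (/ p)) p).
  - unfold Rpower. apply exp_increasing, Rmult_lt_compat_l, ln_increasing; auto.
  - rewrite Rpower_mult, Rinv_l, Rpower_1; lra.
Qed.

Lemma is_derive_Rpower t p : 0 < t -> is_derive (fun t => Rpower t p) t (p * Rpower t (p - 1)).
Proof.
  intros H. unfold Rpower. auto_derive; auto.
  replace ((p - 1) * ln t) with (p * ln t + - ln t) by ring.
  rewrite exp_plus, exp_Ropp, exp_ln by auto. field; lra.
Qed.

Lemma rpow0_cont p t : 0 < p -> continuous (fun t => rpow0 t p) t.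
Proof.
  intros Hp. destruct (Rtotal_order t 0) as [H|[->|H]].
  - apply (continuous_ext_loc _ (fun _ => 0)); [|apply cont_const].
    apply (filter_imp (fun s => s < 0)); [|apply (open_lt 0); auto].
    intros s Hs. rewrite rpow0_npos; lra.
  - intros P [eps HP]. rewrite rpow0_npos in HP by lra.
    exists (mkposreal (Rpower eps (/ p)) (exp_pos _)). intros y Hy. apply HP.
    apply ball_R. apply ball_Rabs in Hy; cbn [pos] in Hy. rewrite Rminus_0_r in *.
    rewrite Rabs_pos_eq by apply rpow0_nonneg.
    apply rpow0_lt; auto; [apply cond_pos|]. eapply Rle_lt_trans; [apply Rle_abs|exact Hy].
  - apply (continuous_ext_loc _ (fun s => Rpower s p)).
    + apply (filter_imp (fun s => 0 < s)); [|apply (open_gt 0); auto].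
      intros s Hs. rewrite rpow0_pos; auto.
    + eapply is_derive_cont, is_derive_Rpower; auto.
Qed.

Lemma cont_exp t : continuous exp t.
Proof. apply (is_derive_cont _ _ (exp t)). auto_derive; auto; ring. Qed.

(** The integrand of Gamma (p + 1). For p > 0 it is continuous on the whole line, so no end point is
    singular; Gamma p is reached from it by parts. *)
Definition gint (p t : R) : R := rpow0 t p * exp (- t).

Lemma gint_cont p t : 0 < p -> continuous (gint p) t.
Proof.
  intros Hp. apply cont_Rmult; [apply rpow0_cont; auto|].
  apply (cont_comp Ropp exp); [apply cont_Ropp, continuous_id|apply cont_exp].
Qed.

Lemma gint_nonneg p t : 0 <= gint p t.
Proof. apply Rmult_le_pos; [apply rpow0_nonneg|apply Rlt_le, exp_pos]. Qed.

Lemma ln_le_sub u : 0 < u -> ln u <= u - 1.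
Proof.
  intros H. assert (K := exp_ineq1_le (ln u)). rewrite exp_ln in K by auto. lra.
Qed.

(** From ln u <= u - 1 at u = x t / p, multiplied by p. *)
Lemma rpow0_le_exp p x t : 0 < p -> 0 < x ->
  rpow0 t p <= exp (p * ln (p / x)) * exp (x * t) \/ t <= 0.
Proof.
  intros Hp Hx. destruct (Rle_lt_dec t 0) as [H|H]; auto. left.
  rewrite rpow0_pos by auto. unfold Rpower. rewrite <- exp_plus. 
  assert (K : ln t <= ln (p / x) + x * t / p).
  { assert (0 < p / x) by (apply Rdiv_lt_0_compat; auto).
    assert (E : t = (p / x) * (t * x / p)) by (field; lra).
    rewrite E at 1. assert (0 < t * x / p) by (apply Rdiv_lt_0_compat; auto; apply Rmult_lt_0_compat; auto).
    rewrite ln_mult by auto. assert (L := ln_le_sub (t * x / p) H1).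
    replace (x * t / p) with (t * x / p) by (field; lra). lra. }
  assert (L : p * ln t <= p * ln (p / x) + x * t).
  { apply Rle_trans with (p * (ln (p / x) + x * t / p)).
    - apply Rmult_le_compat_l; lra.
    - right. field. lra. }
  destruct L as [L|L]; [left; apply exp_increasing; auto|right; rewrite L; auto].
Qed.

Lemma rpow0_exp_bound p x t : 0 < p -> 0 < x -> 0 <= t ->
  rpow0 t p <= exp (p * ln (p / x)) * exp (x * t).
Proof.
  intros Hp Hx Ht. destruct (rpow0_le_exp p x t Hp Hx) as [H|H]; auto.
  rewrite rpow0_npos by auto. apply Rmult_le_pos; apply Rlt_le, exp_pos.
Qed.

Lemma RInt_monotone_limit (f : R -> R) B : (forall t, continuous f t) -> (forall t, 0 <= f t) ->
  (forall T, 0 <= T -> RInt f 0 T <= B) ->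
  exists l, is_RInt_gen f (at_point 0) (Rbar_locally p_infty) l.
Proof.
  intros Hc Hp HB.
  assert (Ex : forall a b, ex_RInt f a b) by (intros; apply cont_ex_RInt; auto).
  destruct (completeness (fun v => exists T, 0 <= T /\ v = RInt f 0 T)) as [l [L1 L2]].
  - exists B. intros v (T & HT & ->). auto.
  - exists (RInt f 0 0), 0. split; auto; lra.
  - exists l. apply is_RInt_gen_filterlim; try typeclasses eauto.
    + apply filter_forall. intros; apply Ex.
    + intros P [eps HP]. unfold filtermap.
      assert (HT : exists T, 0 <= T /\ l - eps < RInt f 0 T).
      { apply Classical_Prop.NNPP. intros N. assert (K : l <= l - eps).
        { apply L2. intros v (T & HT & ->). apply Rnot_lt_le. intros H. apply N. exists T; auto. }
        assert (Q := cond_pos eps). lra. }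
      destruct HT as (T & HT & Hl).
      apply (Filter_prod _ _ _ (fun x => x = 0) (fun y => T < y)); [reflexivity|exists T; auto|].
      intros x y -> Hy. apply HP. apply ball_R. simpl.
      assert (K : RInt f 0 y <= l) by (apply L1; exists y; split; auto; lra).
      assert (K2 : RInt f 0 T <= RInt f 0 y).
      { rewrite <- (RInt_Chasles f 0 T y) by apply Ex. unfold plus; simpl.
        assert (0 <= RInt f T y) by (apply RInt_ge_0; auto; lra). lra. }
      rewrite Rabs_left1; lra.
Qed.

Lemma RInt_exp_neg x T : 0 < x -> 0 <= T -> RInt (fun t => exp (- (x * t))) 0 T <= / x.
Proof.
  intros Hx HT.
  rewrite (is_RInt_unique (fun t => exp (- (x * t))) 0 T (minus (- / x * exp (- (x * T))) (- / x * exp (- (x * 0))))).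
  - unfold minus, plus, opp; simpl. rewrite Rmult_0_r, Ropp_0, exp_0.
    assert (0 < / x * exp (- (x * T))) by (apply Rmult_lt_0_compat; [apply Rinv_0_lt_compat; auto|apply exp_pos]).
    lra.
  - apply (is_RInt_derive (fun t => - / x * exp (- (x * t))) (fun t => exp (- (x * t)))).
    + intros t _. auto_derive; auto. field; lra.
    + intros t _. apply (cont_comp (fun s => - (x * s)) exp); [|apply cont_exp].
      apply cont_Ropp, cont_Rmult; [apply cont_const|apply continuous_id].
Qed.

Lemma gint_ex p : 0 < p -> exists l, is_RInt_gen (gint p) (at_point 0) (Rbar_locally p_infty) l.
Proof.
  intros Hp. set (C0 := exp (p * ln (p / (/ 2)))).
  assert (HC : 0 < C0) by apply exp_pos.
  apply (RInt_monotone_limit _ (C0 * (/ (/ 2)))).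
  - intros; apply gint_cont; auto.
  - apply gint_nonneg.
  - intros T HT. apply Rle_trans with (RInt (fun t => scal C0 (exp (- (/ 2 * t)))) 0 T).
    + apply RInt_le; auto.
      * apply cont_ex_RInt; intros; apply gint_cont; auto.
      * apply (ex_RInt_scal (V := R_NormedModule)), cont_ex_RInt. intros t.
        apply (cont_comp (fun s => - (/ 2 * s)) exp); [|apply cont_exp].
        apply cont_Ropp, cont_Rmult; [apply cont_const|apply continuous_id].
      * intros t Ht. unfold gint, scal; simpl; unfold mult; simpl.
        assert (K := rpow0_exp_bound p (/ 2) t Hp ltac:(lra) ltac:(lra)). fold C0 in K.
        replace (exp (- (/ 2 * t))) with (exp (/ 2 * t) * exp (- t)) by (rewrite <- exp_plus; f_equal; field).
        rewrite <- Rmult_assoc. apply Rmult_le_compat_r; [apply Rlt_le, exp_pos|exact K].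
    + rewrite (RInt_scal (V := R_CompleteNormedModule)).
      * unfold scal; simpl; unfold mult; simpl. apply Rmult_le_compat_l; [lra|apply RInt_exp_neg; lra].
      * apply cont_ex_RInt. intros t.
        apply (cont_comp (fun s => - (/ 2 * s)) exp); [|apply cont_exp].
        apply cont_Ropp, cont_Rmult; [apply cont_const|apply continuous_id].
Qed.

(** [Gamma] approaches its lower end from the right, whereas the Laplace transform starts at the
    point itself. For a continuous integrand the values agree. *)
Lemma filterlim_RInt_lower (f : R -> R) Fa {FA : Filter Fa} a l : (forall t, continuous f t) ->
  filterlim (fun x => x) Fa (locally a) ->
  is_RInt_gen f (at_point a) (Rbar_locally p_infty) l -> is_RInt_gen f Fa (Rbar_locally p_infty) l.
Proof.
  intros Hc Ha H. assert (Ex : forall a b, ex_RInt f a b) by (intros; apply cont_ex_RInt; auto).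
  replace l with (plus 0 l) by (unfold plus; simpl; ring).
  apply (is_RInt_gen_Chasles f a 0 l); auto.
  apply is_RInt_gen_filterlim; try typeclasses eauto; [apply filter_forall; intros; apply Ex|].
  intros P HP. unfold filtermap.
  assert (K : continuous (fun x => RInt f x a) a).
  { apply (is_derive_cont (fun x => RInt f x a) a (- f a)).
    apply (is_derive_RInt' f (fun x => RInt f x a) a a).
    - apply filter_forall. intros. apply (RInt_correct (V := R_CompleteNormedModule)), Ex.
    - apply Hc. }
  assert (K' : locally (RInt f a a) P) by (rewrite (RInt_point (V := R_CompleteNormedModule)); exact HP).
  apply (Filter_prod _ _ _ (fun x => P (RInt f x a)) (fun y => y = a)).
  - apply (Ha _ (K P K')).
  - reflexivity.
  - intros x y Hx ->. exact Hx.
Qed.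

Lemma at_right_id a : filterlim (fun x : R => x) (at_right a) (locally a).
Proof. intros P HP. unfold filtermap. apply filter_le_within. exact HP. Qed.

Lemma at_left_id a : filterlim (fun x : R => x) (at_left a) (locally a).
Proof. intros P HP. unfold filtermap. apply filter_le_within. exact HP. Qed.

Lemma Gamma_S_is p : 0 < p -> is_RInt_gen (gint p) (at_point 0) (Rbar_locally p_infty) (Gamma (p + 1)).
Proof.
  intros Hp. destruct (gint_ex p Hp) as [l Hl].
  replace (Gamma (p + 1)) with l; auto. symmetry. unfold Gamma.
  apply RInt_gen_R_unique; try typeclasses eauto.
  apply (is_RInt_gen_ext (gint p)).
  - apply ev_right0_infty. intros x y Hx Hy t Ht. simpl in Ht. rewrite Rmin_left in Ht by lra.
    unfold gint. rewrite rpow0_pos by lra. do 2 f_equal. ring.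
  - apply (filterlim_RInt_lower _ _ 0); auto; [|apply at_right_id]. intros; apply gint_cont; auto.
Qed.

Lemma gint_lim_infty p : 0 < p -> filterlim (gint p) (Rbar_locally p_infty) (locally 0).
Proof.
  intros Hp. set (C0 := exp (p * ln (p / (/ 2)))).
  assert (L : is_lim (fun t => C0 * exp (- (/ 2 * t))) p_infty 0).
  { replace (Finite 0) with (Rbar_mult C0 0) by (simpl; f_equal; ring).
    apply is_lim_scal_l. apply is_lim_comp with m_infty; [apply is_lim_exp_m| |].
    - replace m_infty with (Rbar_opp p_infty) by reflexivity. apply is_lim_opp.
      replace p_infty with (Rbar_mult (/ 2) p_infty) at 2.
      + apply is_lim_scal_l, is_lim_id.
      + simpl. destruct (Rle_dec 0 (/ 2)) as [H|H]; [|exfalso; lra].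
        destruct (Rle_lt_or_eq_dec 0 (/ 2) H); [reflexivity|exfalso; lra].
    - exists 0. intros; discriminate. }
  apply (is_lim_le_le_loc (fun _ => 0) (fun t => C0 * exp (- (/ 2 * t))) (gint p) p_infty 0);
    [|apply is_lim_const|exact L].
  exists 0. intros t Ht. split; [apply gint_nonneg|].
  unfold gint. assert (K := rpow0_exp_bound p (/ 2) t Hp ltac:(lra) ltac:(lra)). fold C0 in K.
  replace (exp (- (/ 2 * t))) with (exp (/ 2 * t) * exp (- t)) by (rewrite <- exp_plus; f_equal; field).
  rewrite <- Rmult_assoc. apply Rmult_le_compat_r; [apply Rlt_le, exp_pos|exact K].
Qed.

(** The derivative of t^p e^(-t) integrates to 0; adding the integral of t^p e^(-t) and dividing by
    p isolates t^(p-1) e^(-t). *)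
Lemma Gamma_is_aux p : 0 < p ->
  is_RInt_gen (fun t => Rpower t (p - 1) * exp (- t)) (at_right 0) (Rbar_locally p_infty) (/ p * Gamma (p + 1)).
Proof.
  intros Hp.
  assert (H1 : is_RInt_gen (gint p) (at_right 0) (Rbar_locally p_infty) (Gamma (p + 1))).
  { apply (filterlim_RInt_lower _ _ 0); [intros; apply gint_cont; auto|apply at_right_id|].
    apply Gamma_S_is; auto. }
  assert (H2 : is_RInt_gen (fun t => p * (Rpower t (p - 1) * exp (- t)) - Rpower t p * exp (- t))
     (at_right 0) (Rbar_locally p_infty) (0 - 0)).
  { refine (is_RInt_gen_deriv (gint p) _ _ _ _ _ _ _ _).
    - apply ev_right0_infty. intros x y Hx Hy t Ht. simpl in Ht. rewrite Rmin_left in Ht by lra.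
      assert (H0 : 0 < t) by lra. split.
      + apply (is_derive_ext_loc (fun t => Rpower t p * exp (- t))).
        * apply (filter_imp (fun s => 0 < s)); [|apply (open_gt 0); auto].
          intros s Hs. unfold gint. rewrite rpow0_pos; auto.
        * apply (is_derive_eq _ _ (p * Rpower t (p - 1) * exp (- t) + Rpower t p * - exp (- t))).
          -- apply (is_derive_Rmult (fun t => Rpower t p) (fun t => exp (- t)));
               [apply is_derive_Rpower; auto|]. auto_derive; auto; ring.
          -- match goal with |- ?l = ?r => change (@eq R l r) end. ring.
      + assert (Ce : continuous (fun s => exp (- s)) t).
        { apply (cont_comp Ropp exp); [apply cont_Ropp, continuous_id|apply cont_exp]. }
        apply cont_Rminus; [apply cont_Rmult; [apply cont_const|]|]; apply cont_Rmult; auto;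
          eapply is_derive_cont, is_derive_Rpower; auto.
    - assert (K := gint_cont p 0 Hp). unfold continuous in K.
      replace (gint p 0) with 0 in K by (unfold gint; rewrite rpow0_npos; lra).
      intros P HP. unfold filtermap. apply filter_le_within. apply K; auto.
    - apply gint_lim_infty; auto. }
  assert (H3 := is_RInt_gen_plus _ _ _ _ H1 H2).
  assert (H4 := is_RInt_gen_scal _ (/ p) _ H3).
  eapply is_RInt_gen_eq; [eapply is_RInt_gen_ext; [|exact H4]|].
  - apply ev_right0_infty. intros x y Hx Hy t Ht. simpl in Ht. rewrite Rmin_left in Ht by lra.
    unfold gint, scal, plus; simpl; unfold mult; simpl. rewrite rpow0_pos by lra. field; lra.
  - unfold scal, plus; simpl; unfold mult; simpl. field; lra.
Qed.

Lemma Gamma_S p : 0 < p -> Gamma (p + 1) = p * Gamma p.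
Proof.
  intros Hp. assert (H := RInt_gen_R_unique _ _ _ _ (Gamma_is_aux p Hp)). fold (Gamma p) in H.
  rewrite H. field; lra.
Qed.

Lemma Gamma_is p : 0 < p ->
  is_RInt_gen (fun t => Rpower t (p - 1) * exp (- t)) (at_right 0) (Rbar_locally p_infty) (Gamma p).
Proof.
  intros Hp. eapply is_RInt_gen_eq; [apply Gamma_is_aux; auto|]. rewrite Gamma_S by auto. field; lra.
Qed.

Ltac eqR := match goal with |- @eq _ ?l ?r => change (@eq R l r) end.

Lemma cont_pow n t : continuous (fun w => w ^ n) t.
Proof. eapply is_derive_cont. auto_derive; auto. Qed.

Lemma cont_ex_RInt_gen_m1_1 (f : R -> R) : (forall t, continuous f t) ->
  is_RInt_gen f (at_right (-1)) (at_left 1) (RInt f (-1) 1).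
Proof.
  intros Hc. assert (Ex : forall a b, ex_RInt f a b) by (intros; apply cont_ex_RInt; auto).
  assert (D : forall t, is_derive (fun x => RInt f 0 x) t (f t)).
  { intros t. apply (is_derive_RInt f (fun x => RInt f 0 x) 0 t); auto.
    apply filter_forall. intros. apply (RInt_correct (V := R_CompleteNormedModule)), Ex. }
  assert (Ct : forall t, filterlim (fun x => RInt f 0 x) (locally t) (locally (RInt f 0 t))).
  { intros t. apply (is_derive_cont _ _ _ (D t)). }
  eapply is_RInt_gen_eq.
  - refine (is_RInt_gen_deriv (fun x => RInt f 0 x) f _ _ (RInt f 0 (-1)) (RInt f 0 1) _ _ _).
    + apply filter_forall. intros; split; auto.
    + intros P HP. apply (at_right_id (-1)). apply (Ct (-1)); auto.
    + intros P HP. apply (at_left_id 1). apply (Ct 1); auto.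
  - rewrite <- (RInt_Chasles f 0 (-1) 1) by apply Ex. unfold plus; simpl. ring.
Qed.

(** * The integrals of w^n (1 - w^2)^(g-1) *)

Definition fb (g : R) (n : nat) (w : R) : R := w ^ n * Rpower (1 - w ^ 2) (g - 1).

Definition Kf (g : R) (n : nat) (w : R) : R := w ^ n * rpow0 (1 - w ^ 2) g.

Definition KI (g : R) (n : nat) : R := RInt (Kf g n) (-1) 1.

(** The integral of [fb g n], whose integrand is singular at the ends for g < 1. It is defined by
    what integration by parts of w^(n+1) (1 - w^2)^g gives in terms of [KI], where the integrand is
    continuous. *)
Definition JI (g : R) (n : nat) : R := (2 * g + INR n + 1) / (2 * g) * KI g n.

Lemma Kf_cont g n t : 0 < g -> continuous (Kf g n) t.
Proof.
  intros Hg. apply cont_Rmult; [apply cont_pow|].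
  apply (cont_comp (fun w => 1 - w ^ 2) (fun y => rpow0 y g)).
  - apply cont_Rminus; [apply cont_const|apply cont_pow].
  - apply rpow0_cont; auto.
Qed.

Lemma KI_is g n : 0 < g -> is_RInt_gen (Kf g n) (at_right (-1)) (at_left 1) (KI g n).
Proof. intros Hg. apply cont_ex_RInt_gen_m1_1. intros; apply Kf_cont; auto. Qed.

Lemma one_minus_sq_pos w : -1 < w < 1 -> 0 < 1 - w ^ 2.
Proof. intros H. nra. Qed.

Lemma is_derive_Kf g n w : -1 < w < 1 -> is_derive (Kf g n) w
  ((INR n * w ^ (n - 1)) * Rpower (1 - w ^ 2) g + w ^ n * (- 2 * g * w * Rpower (1 - w ^ 2) (g - 1))).
Proof.
  intros Hw. assert (Hp := one_minus_sq_pos w Hw).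
  apply (is_derive_ext_loc (fun w => w ^ n * Rpower (1 - w ^ 2) g)).
  - apply (filter_imp (fun s => -1 < s < 1)).
    + intros s Hs. unfold Kf. rewrite rpow0_pos; auto. apply one_minus_sq_pos; auto.
    + apply (filter_and (fun s => -1 < s) (fun s => s < 1)); [apply (open_gt (-1))|apply (open_lt 1)]; lra.
  - apply (is_derive_Rmult (fun w => w ^ n) (fun w => Rpower (1 - w ^ 2) g)).
    + auto_derive; auto. rewrite Rmult_1_l. destruct n; simpl; [ring|]. rewrite Nat.sub_0_r. ring.
    + apply (is_derive_eq _ _ (-2 * w * (g * Rpower (1 - w ^ 2) (g - 1)))).
      * apply (is_derive_comp (fun y => Rpower y g) (fun w => 1 - w ^ 2)).
        -- apply is_derive_Rpower; auto.
        -- auto_derive; auto; ring.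
      * eqR; ring.
Qed.

Lemma Rpower_pred y g : 0 < y -> Rpower y g = y * Rpower y (g - 1).
Proof.
  intros Hy. rewrite <- (Rpower_1 y) at 2 by auto. rewrite <- Rpower_plus. f_equal; ring.
Qed.

Lemma Rpower_sq_cont g w : -1 < w < 1 -> continuous (fun w => Rpower (1 - w ^ 2) g) w.
Proof.
  intros Hw. assert (Hp := one_minus_sq_pos w Hw).
  eapply is_derive_cont. apply (is_derive_comp (fun y => Rpower y g) (fun w => 1 - w ^ 2)).
  - apply is_derive_Rpower; auto.
  - auto_derive; auto.
Qed.

Lemma Kf_deriv_gen g n : 0 < g -> is_RInt_gen (fun w => (INR n * w ^ (n - 1)) * Rpower (1 - w ^ 2) g
    + w ^ n * (- 2 * g * w * Rpower (1 - w ^ 2) (g - 1))) (at_right (-1)) (at_left 1) 0.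
Proof.
  intros Hg. eapply is_RInt_gen_eq.
  - refine (is_RInt_gen_deriv (Kf g n) _ _ _ 0 0 _ _ _).
    + apply ev_m1_1. intros x y Hx Hy t Ht. simpl in Ht. rewrite Rmin_left, Rmax_right in Ht by lra.
      assert (H : -1 < t < 1) by lra. split; [apply is_derive_Kf; auto|].
      apply cont_Rplus; apply cont_Rmult.
      * apply cont_Rmult; [apply cont_const|apply cont_pow].
      * apply Rpower_sq_cont; auto.
      * apply cont_pow.
      * apply cont_Rmult; [|apply Rpower_sq_cont; auto].
        apply cont_Rmult; [apply cont_const|apply continuous_id].
    + assert (K := Kf_cont g n (-1) Hg). unfold continuous in K.
      replace (Kf g n (-1)) with 0 in K by (unfold Kf; rewrite rpow0_npos; lra).
      intros P HP. apply (at_right_id (-1)). apply K; auto.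
    + assert (K := Kf_cont g n 1 Hg). unfold continuous in K.
      replace (Kf g n 1) with 0 in K by (unfold Kf; rewrite rpow0_npos; lra).
      intros P HP. apply (at_left_id 1). apply K; auto.
  - ring.
Qed.

Lemma RInt_gen_m1_1_ext (f h : R -> R) (l m : R) : (forall w, -1 < w < 1 -> f w = h w) -> l = m ->
  is_RInt_gen f (at_right (-1)) (at_left 1) l -> is_RInt_gen h (at_right (-1)) (at_left 1) m.
Proof.
  intros H <- Hf. eapply is_RInt_gen_ext; [|exact Hf].
  apply ev_m1_1. intros x y Hx Hy t Ht. simpl in Ht. rewrite Rmin_left, Rmax_right in Ht by lra.
  apply H; lra.
Qed.

Lemma RInt_gen_m1_1_unique (f : R -> R) (l m : R) :
  is_RInt_gen f (at_right (-1)) (at_left 1) l -> is_RInt_gen f (at_right (-1)) (at_left 1) m -> l = m.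
Proof.
  intros H1 H2. transitivity (RInt_gen f (at_right (-1)) (at_left 1)); [symmetry|];
    apply RInt_gen_R_unique; auto; typeclasses eauto.
Qed.

Lemma JI_is g n : 0 < g -> is_RInt_gen (fb g n) (at_right (-1)) (at_left 1) (JI g n).
Proof.
  intros Hg. assert (H1 := is_RInt_gen_scal _ ((2 * g + INR n + 1) / (2 * g)) _ (KI_is g n Hg)).
  assert (H2 := is_RInt_gen_scal _ (/ (2 * g)) _ (Kf_deriv_gen g (S n) Hg)).
  assert (H3 := is_RInt_gen_minus _ _ _ _ H1 H2).
  eapply RInt_gen_m1_1_ext; [| |exact H3].
  - intros w Hw. assert (Hp := one_minus_sq_pos w Hw).
    unfold fb, Kf, minus, scal, plus, opp; simpl; unfold mult; simpl.
    rewrite rpow0_pos by auto. fold (w ^ 2). rewrite (Rpower_pred _ g) by auto.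
    rewrite Nat.sub_0_r. set (Q := Rpower _ _). change (match n with 0%nat => 1 | S _ => INR n + 1 end) with (INR (S n)).
    rewrite S_INR. field; lra.
  - unfold JI, minus, scal, plus, opp; simpl; unfold mult; simpl. ring.
Qed.

Lemma JI_sub g n : 0 < g -> JI g (S (S n)) = JI g n - KI g n.
Proof.
  intros Hg. apply (RInt_gen_m1_1_unique (fb g (S (S n)))); [apply JI_is; auto|].
  assert (H := is_RInt_gen_minus _ _ _ _ (JI_is g n Hg) (KI_is g n Hg)).
  eapply RInt_gen_m1_1_ext; [| |exact H].
  - intros w Hw. assert (Hp := one_minus_sq_pos w Hw).
    unfold fb, Kf, minus, plus, opp; simpl. rewrite rpow0_pos by auto.
    fold (w ^ 2). rewrite (Rpower_pred _ g) by auto. simpl. ring.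
  - reflexivity.
Qed.

Lemma JI_rec g n : 0 < g -> JI g (S (S n)) = (INR n + 1) / (2 * g + INR n + 1) * JI g n.
Proof.
  intros Hg. rewrite JI_sub by auto. unfold JI. assert (P := pos_INR n). field. lra.
Qed.

Lemma JI_1 g : 0 < g -> JI g 1 = 0.
Proof.
  intros Hg. apply (RInt_gen_m1_1_unique (fb g 1)); [apply JI_is; auto|].
  assert (H := is_RInt_gen_scal _ (- / (2 * g)) _ (Kf_deriv_gen g 0 Hg)).
  eapply RInt_gen_m1_1_ext; [| |exact H].
  - intros w Hw. unfold fb, scal; simpl; unfold mult; simpl. field; lra.
  - unfold scal; simpl; unfold mult; simpl. ring.
Qed.

Lemma JI_odd g j : 0 < g -> JI g (2 * j + 1) = 0.
Proof.
  intros Hg. induction j as [|j IH]; [apply JI_1; auto|].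
  replace (2 * S j + 1)%nat with (S (S (2 * j + 1))) by lia. rewrite JI_rec, IH by auto. ring.
Qed.

Lemma JI_shift g : 0 < g -> JI (g + 1) 0 = KI g 0.
Proof.
  intros Hg. apply (RInt_gen_m1_1_unique (fb (g + 1) 0)); [apply JI_is; lra|].
  eapply RInt_gen_m1_1_ext; [| |apply (KI_is g 0 Hg)]; [|reflexivity].
  intros w Hw. assert (Hp := one_minus_sq_pos w Hw). unfold fb, Kf. rewrite rpow0_pos by auto.
  do 2 f_equal. ring.
Qed.

Lemma JI_step g : 0 < g -> JI (g + 1) 0 = g / (g + 1 / 2) * JI g 0.
Proof. intros Hg. rewrite JI_shift by auto. unfold JI. simpl INR. field. lra. Qed.

Lemma KI_pos g : 0 < g -> 0 < KI g 0.
Proof.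
  intros Hg. unfold KI. apply RInt_gt_0; [lra| |intros; apply Kf_cont; auto].
  intros w Hw. unfold Kf. rewrite rpow0_pos by (apply one_minus_sq_pos; auto). simpl.
  rewrite Rmult_1_l. apply exp_pos.
Qed.

Lemma JI_pos g : 0 < g -> 0 < JI g 0.
Proof.
  intros Hg. unfold JI. apply Rmult_lt_0_compat; [|apply KI_pos; auto].
  simpl INR. apply Rdiv_lt_0_compat; lra.
Qed.

Lemma JI_antitone g h : 0 < g -> g <= h -> JI h 0 <= JI g 0.
Proof.
  intros Hg Hh. assert (H := is_RInt_gen_minus _ _ _ _ (JI_is g 0 Hg) (JI_is h 0 ltac:(lra))).
  enough (0 <= minus (JI g 0) (JI h 0)) by (unfold minus, plus, opp in H0; simpl in H0; lra).
  refine (is_RInt_gen_nonneg _ _ _ _ _ H).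
  apply ev_m1_1. intros x y Hx Hy. simpl. split; [lra|]. intros w Hw.
  assert (Hp := one_minus_sq_pos w ltac:(lra)).
  unfold fb, minus, plus, opp; simpl. fold (w ^ 2).
  assert (Rpower (1 - w ^ 2) (h - 1) <= Rpower (1 - w ^ 2) (g - 1)); [|simpl in *; lra].
  unfold Rpower.
  assert (L : ln (1 - w ^ 2) <= 0) by (rewrite <- ln_1; apply ln_le; [auto|nra]).
  assert (M : (h - 1) * ln (1 - w ^ 2) <= (g - 1) * ln (1 - w ^ 2)) by nra.
  destruct M as [M|M]; [left; apply exp_increasing; auto|right; rewrite M; auto].
Qed.

Lemma Gamma_pos p : 0 < p -> 0 < Gamma p.
Proof.
  intros Hp. assert (H1 := Gamma_S_is p Hp).
  assert (H : 0 < Gamma (p + 1)).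
  { set (d := RInt (gint p) 0 1).
    assert (Ex : forall a b, ex_RInt (gint p) a b) by (intros; apply cont_ex_RInt; intros; apply gint_cont; auto).
    assert (Hd : 0 < d).
    { apply RInt_gt_0; [lra| |intros; apply gint_cont; auto].
      intros t Ht. unfold gint. rewrite rpow0_pos by lra. apply Rmult_lt_0_compat; apply exp_pos. }
    assert (L := filterlim_is_RInt_gen _ _ _ _ H1).
    apply Rlt_le_trans with (1 := Hd).
    apply (filterlim_le (F := filter_prod (at_point 0) (Rbar_locally p_infty)) (fun _ => d)
      (fun ab => RInt (gint p) (fst ab) (snd ab)) d (Gamma (p + 1))); auto; [|apply filterlim_const].
    apply ev_pt0_infty. intros y Hy. simpl. unfold d. rewrite <- (RInt_Chasles (gint p) 0 1 y) by apply Ex.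
    assert (0 <= RInt (gint p) 1 y) by (apply RInt_ge_0; [lra|apply Ex|intros; apply gint_nonneg]).
    unfold plus; simpl. lra. }
  rewrite Gamma_S in H by auto. apply Rmult_lt_reg_l with p; auto. rewrite Rmult_0_r; auto.
Qed.

Lemma Gamma_1 : Gamma 1 = 1.
Proof.
  unfold Gamma. apply RInt_gen_R_unique; try typeclasses eauto.
  assert (H : is_RInt_gen (fun t => exp (- t)) (at_right 0) (Rbar_locally p_infty) (0 - -1)).
  { refine (is_RInt_gen_deriv (fun t => - exp (- t)) _ _ _ _ _ _ _ _).
    - apply filter_forall. intros ab x _. split; [auto_derive; auto; ring|].
      apply (cont_comp Ropp exp); [apply cont_Ropp, continuous_id|apply cont_exp].
    - assert (K : continuous (fun t => - exp (- t)) 0).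
      { apply cont_Ropp, (cont_comp Ropp exp); [apply cont_Ropp, continuous_id|apply cont_exp]. }
      unfold continuous in K. rewrite Ropp_0, exp_0 in K.
      intros P HP. apply (at_right_id 0), K; auto.
    - assert (L : is_lim (fun t => - exp (- t)) p_infty 0).
      { replace (Finite 0) with (Rbar_opp 0) by (simpl; f_equal; ring). apply is_lim_opp.
        apply is_lim_comp with m_infty; [apply is_lim_exp_m| |].
        - replace m_infty with (Rbar_opp p_infty) by reflexivity. apply is_lim_opp, is_lim_id.
        - exists 0. intros; discriminate. }
      exact L. }
  eapply is_RInt_gen_eq; [eapply is_RInt_gen_ext; [|exact H]|ring].
  apply ev_right0_infty. intros x y Hx Hy t Ht. simpl in Ht. rewrite Rmin_left in Ht by lra.
  replace (1 - 1) with 0 by ring. rewrite Rpower_O by lra. eqR; ring.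
Qed.

(* Chebyshev's inequality for the increasing functions [t^d] and [t^(1/2)], in the form
   [int (t^d - c^d)(t^(1/2) - c^(1/2)) t^(x-1) e^(-t) dt >= 0] with [c^(1/2) = Gamma (x+1/2) / Gamma x]. *)
Lemma Gamma_chebyshev x d : 0 < x -> 0 < d ->
  Gamma (x + d) * Gamma (x + 1 / 2) <= Gamma (x + d + 1 / 2) * Gamma x.
Proof.
  intros Hx Hd. set (q := Gamma (x + 1 / 2) / Gamma x).
  assert (Gx := Gamma_pos x Hx). assert (Gx2 := Gamma_pos (x + 1 / 2) ltac:(lra)).
  assert (Hq : 0 < q) by (apply Rdiv_lt_0_compat; auto).
  set (c := q * q). assert (Hc : 0 < c) by (apply Rmult_lt_0_compat; auto).
  assert (Ec : Rpower c (1 / 2) = q).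
  { unfold c. rewrite <- Rpower_mult_distr by auto. rewrite <- Rpower_plus.
    replace (1 / 2 + 1 / 2) with 1 by field. apply Rpower_1; auto. }
  set (e := Rpower c d).
  assert (H1 := Gamma_is (x + d + 1 / 2) ltac:(lra)). assert (H2 := Gamma_is (x + d) ltac:(lra)).
  assert (H3 := Gamma_is (x + 1 / 2) ltac:(lra)). assert (H4 := Gamma_is x Hx).
  assert (H := is_RInt_gen_plus _ _ _ _
    (is_RInt_gen_minus _ _ _ _ H1 (is_RInt_gen_scal _ q _ H2))
    (is_RInt_gen_scal _ (- e) _ (is_RInt_gen_minus _ _ _ _ H3 (is_RInt_gen_scal _ q _ H4)))).
  assert (K : 0 <= plus (minus (Gamma (x + d + 1 / 2)) (scal q (Gamma (x + d))))
      (scal (- e) (minus (Gamma (x + 1 / 2)) (scal q (Gamma x))))).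
  { refine (is_RInt_gen_nonneg _ _ _ _ _ H).
    apply ev_right0_infty. intros u v Hu Hv. simpl. split; [lra|]. intros t Ht.
    assert (Ht0 : 0 < t) by lra.
    unfold minus, plus, opp, scal; simpl; unfold mult; simpl.
    replace (x + d + 1 / 2 - 1) with (x - 1 + d + 1 / 2) by ring.
    replace (x + d - 1) with (x - 1 + d) by ring. replace (x + 1 / 2 - 1) with (x - 1 + 1 / 2) by ring.
    rewrite !Rpower_plus. set (A := Rpower t (x - 1)). set (B := Rpower t d). set (S := Rpower t (1 / 2)).
    replace (_ + _) with (A * exp (- t) * ((B - e) * (S - q))) by ring.
    apply Rmult_le_pos; [apply Rmult_le_pos; apply Rlt_le, exp_pos|].
    assert (M : forall p, 0 < p -> t <= c -> Rpower t p <= Rpower c p).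
    { intros p Hp Htc. unfold Rpower.
      assert (L : p * ln t <= p * ln c) by (apply Rmult_le_compat_l; [lra|apply ln_le; auto]).
      destruct L as [L|L]; [left; apply exp_increasing; auto|right; rewrite L; auto]. }
    assert (M' : forall p, 0 < p -> c <= t -> Rpower c p <= Rpower t p).
    { intros p Hp Htc. unfold Rpower.
      assert (L : p * ln c <= p * ln t) by (apply Rmult_le_compat_l; [lra|apply ln_le; auto]).
      destruct L as [L|L]; [left; apply exp_increasing; auto|right; rewrite L; auto]. }
    destruct (Rle_lt_dec t c) as [L|L].
    - assert (B <= e) by (apply M; auto). assert (S <= q) by (rewrite <- Ec; apply M; lra). nra.
    - assert (e <= B) by (apply M'; lra). assert (q <= S) by (rewrite <- Ec; apply M'; lra). nra. }
  unfold minus, plus, opp, scal in K; simpl in K; unfold mult in K; simpl in K.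
  assert (Eq : q * Gamma x = Gamma (x + 1 / 2)) by (unfold q; field; lra). rewrite Eq in K.
  assert (K' : q * Gamma (x + d) <= Gamma (x + d + 1 / 2)) by lra.
  apply (Rmult_le_compat_r (Gamma x)) in K'; [|lra].
  replace (q * Gamma (x + d) * Gamma x) with (Gamma (x + d) * (q * Gamma x)) in K' by ring.
  rewrite Eq in K'. exact K'.
Qed.

(** Gamma (1/2) times this function is [Beta (1/2) x]. *)
Definition hG (x : R) : R := Gamma x / Gamma (x + 1 / 2).

Lemma hG_pos x : 0 < x -> 0 < hG x.
Proof. intros H. apply Rdiv_lt_0_compat; apply Gamma_pos; lra. Qed.

Lemma hG_antitone x y : 0 < x -> x <= y -> hG y <= hG x.
Proof.
  intros Hx [H|<-]; [|lra]. assert (K := Gamma_chebyshev x (y - x) Hx ltac:(lra)).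
  replace (x + (y - x)) with y in K by ring. unfold hG.
  assert (G1 := Gamma_pos (x + 1 / 2) ltac:(lra)). assert (G2 := Gamma_pos (y + 1 / 2) ltac:(lra)).
  apply Rmult_le_reg_r with (Gamma (x + 1 / 2) * Gamma (y + 1 / 2)); [apply Rmult_lt_0_compat; auto|].
  replace (Gamma y / Gamma (y + 1 / 2) * (Gamma (x + 1 / 2) * Gamma (y + 1 / 2))) with
    (Gamma y * Gamma (x + 1 / 2)) by (field; lra).
  replace (Gamma x / Gamma (x + 1 / 2) * (Gamma (x + 1 / 2) * Gamma (y + 1 / 2))) with
    (Gamma (y + 1 / 2) * Gamma x) by (field; lra). exact K.
Qed.

Lemma hG_step x : 0 < x -> hG (x + 1) = x / (x + 1 / 2) * hG x.
Proof.
  intros Hx. unfold hG. replace (x + 1 + 1 / 2) with (x + 1 / 2 + 1) by ring.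
  rewrite !Gamma_S by lra. assert (G2 := Gamma_pos (x + 1 / 2) ltac:(lra)). field. lra.
Qed.

(* [rhoJ] has period 1, and as a quotient of two antitone functions of slow variation it is constant;
   this evaluates [c_mu] without the Beta integral. *)
Definition rhoJ (x : R) : R := JI x 0 / hG x.

Lemma rhoJ_pos x : 0 < x -> 0 < rhoJ x.
Proof. intros H. apply Rdiv_lt_0_compat; [apply JI_pos|apply hG_pos]; auto. Qed.

Lemma rhoJ_step x : 0 < x -> rhoJ (x + 1) = rhoJ x.
Proof.
  intros Hx. unfold rhoJ. rewrite JI_step, hG_step by auto.
  assert (P := hG_pos x Hx). field. lra.
Qed.

Lemma rhoJ_nat x n : 0 < x -> rhoJ (x + INR n) = rhoJ x.
Proof.
  intros Hx. induction n as [|n IH]; [simpl; f_equal; ring|].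
  rewrite S_INR, <- Rplus_assoc, rhoJ_step, IH; auto. assert (P := pos_INR n); lra.
Qed.

(** [JI] and [hG] are antitone, [rhoJ] has the value [rhoJ 1] at m and m + 1, and between these
    points [hG] drops only by the factor m / (m + 1/2). *)
Lemma rhoJ_bound x m : (1 <= m)%nat -> INR m <= x <= INR m + 1 ->
  rhoJ x * INR m <= rhoJ 1 * (INR m + 1 / 2) /\ rhoJ 1 * INR m <= rhoJ x * (INR m + 1 / 2).
Proof.
  intros Hm [H1 H2]. assert (HM : 1 <= INR m) by (apply (le_INR 1); auto).
  assert (R1 : rhoJ (INR m) = rhoJ 1).
  { replace (INR m) with (1 + INR (m - 1)) by (rewrite minus_INR by auto; simpl; ring). apply rhoJ_nat; lra. }
  assert (R2 : rhoJ (INR m + 1) = rhoJ 1) by (rewrite rhoJ_step; lra).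
  assert (S := hG_step (INR m) ltac:(lra)).
  assert (P0 := hG_pos x ltac:(lra)). assert (P1 := hG_pos (INR m) ltac:(lra)).
  assert (P2 := hG_pos (INR m + 1) ltac:(lra)).
  assert (J1 := JI_antitone (INR m) x ltac:(lra) H1). assert (J2 := JI_antitone x (INR m + 1) ltac:(lra) H2).
  assert (h1 := hG_antitone (INR m) x ltac:(lra) H1). assert (h2 := hG_antitone x (INR m + 1) ltac:(lra) H2).
  assert (E1 : JI (INR m) 0 = rhoJ 1 * hG (INR m)) by (rewrite <- R1; unfold rhoJ; field; lra).
  assert (E2 : JI (INR m + 1) 0 = rhoJ 1 * hG (INR m + 1)) by (rewrite <- R2; unfold rhoJ; field; lra).
  assert (E3 : JI x 0 = rhoJ x * hG x) by (unfold rhoJ; field; lra).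
  assert (Rp := rhoJ_pos 1 ltac:(lra)). assert (Rx := rhoJ_pos x ltac:(lra)).
  assert (S' : hG (INR m + 1) * (INR m + 1 / 2) = INR m * hG (INR m)) by (rewrite S; field; lra).
  set (M := INR m) in *. rewrite E1, E3 in J1. rewrite E2, E3 in J2. split.
  - apply Rmult_le_reg_r with (hG M); auto.
    apply Rle_trans with (rhoJ x * (hG (M + 1) * (M + 1 / 2))); [rewrite S'; right; ring|].
    apply Rle_trans with (rhoJ x * hG x * (M + 1 / 2)).
    + rewrite <- Rmult_assoc. apply Rmult_le_compat_r; [lra|]. apply Rmult_le_compat_l; lra.
    + apply Rle_trans with (rhoJ 1 * hG M * (M + 1 / 2)); [apply Rmult_le_compat_r; lra|right; ring].
  - apply Rmult_le_reg_r with (hG M); auto.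
    apply Rle_trans with (rhoJ 1 * (hG (M + 1) * (M + 1 / 2))); [rewrite S'; right; ring|].
    apply Rle_trans with (rhoJ x * hG x * (M + 1 / 2)).
    + rewrite <- Rmult_assoc. apply Rmult_le_compat_r; lra.
    + replace (rhoJ x * (M + 1 / 2) * hG M) with (rhoJ x * hG M * (M + 1 / 2)) by ring.
      apply Rmult_le_compat_r; [lra|]. apply Rmult_le_compat_l; lra.
Qed.

Lemma rhoJ_const x : 0 < x -> rhoJ x = rhoJ 1.
Proof.
  intros Hx.
  (* Shifting x by n preserves [rhoJ] and moves it to an interval [m, m + 1] with m >= n, where the
     bounds differ by O(1/n). *)
  assert (B : forall n, (1 <= n)%nat -> Rabs (rhoJ x - rhoJ 1) * INR n <= (rhoJ x + rhoJ 1) / 2).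
  { intros n Hn.
    destruct (nfloor_ex (x + INR n)) as [m Hm]; [assert (P := pos_INR n); lra|].
    assert (Hmn : (n <= m)%nat).
    { apply INR_le. destruct (Compare_dec.le_lt_dec n m) as [L|L]; [apply le_INR; auto|].
      apply (le_INR (S m)) in L. rewrite S_INR in L. lra. }
    destruct (rhoJ_bound (x + INR n) m ltac:(lia) ltac:(lra)) as [H1 H2].
    rewrite rhoJ_nat in * by auto. apply le_INR in Hmn. assert (P := pos_INR n).
    assert (Rp := rhoJ_pos 1 ltac:(lra)). assert (Rx := rhoJ_pos x ltac:(lra)).
    apply Rle_trans with (Rabs (rhoJ x - rhoJ 1) * INR m).
    - apply Rmult_le_compat_l; [apply Rabs_pos|auto].
    - unfold Rabs. destruct (Rcase_abs (rhoJ x - rhoJ 1)); lra. }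
  destruct (Req_dec (rhoJ x) (rhoJ 1)) as [E|N]; auto. exfalso.
  assert (HD : 0 < Rabs (rhoJ x - rhoJ 1)) by (apply Rabs_pos_lt; lra).
  set (D := Rabs (rhoJ x - rhoJ 1)) in *. set (S := (rhoJ x + rhoJ 1) / 2) in *.
  destruct (INR_unbounded (S / D)) as [n Hn].
  specialize (B (Datatypes.S n) ltac:(lia)). rewrite S_INR in B.
  apply (Rmult_lt_compat_r D) in Hn; auto. unfold Rdiv in Hn. rewrite Rmult_assoc, Rinv_l in Hn by lra. nra.
Qed.

Lemma JI_1_0 : JI 1 0 = 2.
Proof.
  apply (RInt_gen_m1_1_unique (fb 1 0)); [apply JI_is; lra|].
  assert (H := cont_ex_RInt_gen_m1_1 (fun _ => 1) (fun t => cont_const 1 t)).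
  eapply RInt_gen_m1_1_ext; [| |exact H].
  - intros w Hw. unfold fb. replace (1 - 1) with 0 by ring.
    rewrite Rpower_O by (apply one_minus_sq_pos; auto). simpl; ring.
  - rewrite (RInt_const (V := R_CompleteNormedModule)). unfold scal; simpl; unfold mult; simpl. ring.
Qed.

(** Since [rhoJ] is constant, one value fixes the normalisation; at g = 1 the integral is 2. *)
Lemma c_mu_JI g : 0 < g -> c_mu g = / JI g 0.
Proof.
  intros Hg. unfold c_mu. f_equal. assert (H := rhoJ_const g Hg). unfold rhoJ in H.
  assert (Ph := hG_pos g Hg). assert (P1 := hG_pos 1 ltac:(lra)).
  assert (Gh := Gamma_pos (1 / 2) ltac:(lra)).
  assert (E1 : hG 1 = 2 / Gamma (1 / 2)).
  { unfold hG. rewrite Gamma_1. replace (1 + 1 / 2) with (1 / 2 + 1) by ring. rewrite Gamma_S by lra. field; lra. }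
  assert (E2 : JI g 0 = Gamma (1 / 2) * hG g).
  { transitivity (JI g 0 / hG g * hG g); [field; lra|]. rewrite H, JI_1_0, E1. field; lra. }
  rewrite E2. unfold Beta, hG. replace (1 / 2 + g) with (g + 1 / 2) by ring.
  assert (G2 := Gamma_pos (g + 1 / 2) ltac:(lra)). field. lra.
Qed.

Definition mom (g : R) (n : nat) : R := INR (fact n) / gam g n.

Lemma mom_S g n : 0 <= g -> mom g (S n) = mom g n * (INR n + 1) / (INR n + 1 + (if Nat.even n then 2 * g else 0)).
Proof.
  intros Hg. unfold mom. cbn [gam]. rewrite fact_simpl, mult_INR, S_INR.
  assert (P := gam_pos g n Hg). assert (Q := pos_INR n).
  destruct (Nat.even n); field; lra.
Qed.

(** The factor 1 + w of the density replaces each odd moment by the next even integral. This is why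
    [gam] gains the extra 2g only on leaving an even index. *)
Lemma mom_even_odd g j : 0 < g ->
  mom g (2 * j) = JI g (2 * j) / JI g 0 /\ mom g (2 * j + 1) = JI g (2 * j + 2) / JI g 0.
Proof.
  intros Hg. assert (PJ := JI_pos g Hg).
  assert (Step : forall j, mom g (2 * j) = JI g (2 * j) / JI g 0 ->
    mom g (2 * j + 1) = JI g (2 * j + 2) / JI g 0).
  { intros i Hi. replace (2 * i + 1)%nat with (S (2 * i)) by lia.
    replace (2 * i + 2)%nat with (S (S (2 * i))) by lia.
    rewrite mom_S, JI_rec, Hi by lra.
    replace (Nat.even (2 * i)) with true by (symmetry; apply Nat.even_spec; exists i; auto).
    assert (Q := pos_INR (2 * i)). field. lra. }
  induction j as [|j [IH1 IH2]].
  - assert (B : mom g (2 * 0) = JI g (2 * 0) / JI g 0).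
    { unfold mom. simpl (2 * 0)%nat. cbn [gam fact]. simpl INR. field; lra. }
    split; auto.
  - assert (B : mom g (2 * S j) = JI g (2 * S j) / JI g 0).
    { replace (2 * S j)%nat with (S (2 * j + 1)) by lia. rewrite mom_S, IH2 by lra.
      replace (S (2 * j + 1)) with (2 * j + 2)%nat by lia.
      replace (Nat.even (2 * j + 1)) with false.
      - assert (Q := pos_INR (2 * j + 1)). field. lra.
      - rewrite Nat.add_1_r, Nat.even_succ, <- Nat.negb_even. symmetry. apply Bool.negb_false_iff.
        apply Nat.even_spec; exists j; auto. }
    split; auto.
Qed.

Definition wmu (g w : R) : R := c_mu g * (1 + w) * Rpower (1 - w ^ 2) (g - 1).

Lemma wmu_moment g n : 0 < g ->
  is_RInt_gen (fun w => wmu g w * w ^ n) (at_right (-1)) (at_left 1) (mom g n).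
Proof.
  intros Hg. assert (PJ := JI_pos g Hg).
  assert (H := is_RInt_gen_scal _ (/ JI g 0) _ (is_RInt_gen_plus _ _ _ _ (JI_is g n Hg) (JI_is g (S n) Hg))).
  eapply RInt_gen_m1_1_ext; [| |exact H].
  - intros w Hw. unfold wmu, fb, scal, plus; simpl; unfold mult; simpl. rewrite c_mu_JI by auto. ring.
  - unfold scal, plus; simpl; unfold mult; simpl.
    destruct (Nat.Even_or_Odd n) as [[j ->]|[j ->]]; destruct (mom_even_odd g j Hg) as [E1 E2].
    + rewrite E1. replace (S (2 * j)) with (2 * j + 1)%nat by lia. rewrite JI_odd by auto. field; lra.
    + rewrite E2. replace (S (2 * j + 1)) with (2 * j + 2)%nat by lia. rewrite JI_odd by auto. field; lra.
Qed.

Lemma wmu_nonneg g w : 0 < g -> -1 < w -> 0 <= wmu g w.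
Proof.
  intros Hg Hw. unfold wmu. rewrite c_mu_JI by auto. assert (P := JI_pos g Hg).
  apply Rmult_le_pos; [apply Rmult_le_pos; [apply Rlt_le, Rinv_0_lt_compat; auto|lra]|apply Rlt_le, exp_pos].
Qed.

(** * Complex powers and the binomial series *)

Lemma Cexp_plus z w : Cexp (z + w) = (Cexp z * Cexp w)%C.
Proof.
  destruct z as [a b], w as [c d]. unfold Cexp, Cplus, Cmult; cbn [fst snd Re Im].
  rewrite exp_plus, cos_plus, sin_plus. f_equal; ring.
Qed.

Lemma Cexp_0 : Cexp 0 = RtoC 1.
Proof. unfold Cexp, RtoC; cbn [fst snd Re Im]. rewrite exp_0, cos_0, sin_0. f_equal; ring. Qed.

Lemma Cmod_Cexp z : Cmod (Cexp z) = exp (Re z).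
Proof.
  unfold Cmod, Cexp; cbn [fst snd Re Im]. assert (H := sin2_cos2 (Im z)). unfold Rsqr in H.
  replace ((exp (Re z) * cos (Im z)) ^ 2 + (exp (Re z) * sin (Im z)) ^ 2) with
    (exp (Re z) * exp (Re z) * (sin (Im z) * sin (Im z) + cos (Im z) * cos (Im z))) by ring.
  rewrite H, Rmult_1_r. apply sqrt_square, Rlt_le, exp_pos.
Qed.

Lemma Cexp_neq_0 z : Cexp z <> RtoC 0.
Proof. apply Cmod_gt_0. rewrite Cmod_Cexp. apply exp_pos. Qed.

Lemma Cexp_opp z : Cexp (- z) = (/ Cexp z)%C.
Proof.
  assert (H := Cexp_plus z (- z)). replace (z + - z)%C with (RtoC 0) in H by ring. rewrite Cexp_0 in H.
  assert (N := Cexp_neq_0 z). transitivity (/ Cexp z * (Cexp z * Cexp (- z)))%C; [field; auto|].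
  rewrite <- H. ring.
Qed.

Lemma Cexp_RtoC x : Cexp (RtoC x) = RtoC (exp x).
Proof. unfold Cexp, RtoC; cbn [fst snd Re Im]. rewrite cos_0, sin_0. f_equal; ring. Qed.

Lemma Cmod_sqr z : Cmod z * Cmod z = Re z * Re z + Im z * Im z.
Proof.
  unfold Cmod, Re, Im. rewrite sqrt_sqrt; [ring|]. nra.
Qed.

Lemma Re_div_Cmod z : z <> RtoC 0 -> -1 <= Re z / Cmod z <= 1.
Proof.
  intros H. apply Cmod_gt_0 in H. assert (S := Cmod_sqr z).
  assert (- Cmod z <= Re z <= Cmod z) by nra.
  split; apply Rmult_le_reg_r with (Cmod z); auto; unfold Rdiv; rewrite Rmult_assoc, Rinv_l by lra; lra.
Qed.

Lemma Cexp_Clog z : z <> RtoC 0 -> Cexp (Clog z) = z.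
Proof.
  intros H. assert (B := Re_div_Cmod z H). assert (P := H). apply Cmod_gt_0 in P.
  assert (S := Cmod_sqr z).
  assert (Q : Cmod z * sqrt (1 - (Re z / Cmod z)²) = Rabs (Im z)).
  { rewrite <- (sqrt_square (Cmod z)) at 1 by lra. rewrite <- sqrt_mult_alt by nra.
    rewrite <- sqrt_Rsqr_abs. f_equal. unfold Rsqr. rewrite S.
    transitivity (Cmod z * Cmod z - Re z * Re z); [rewrite <- S; field; lra|rewrite S; ring]. }
  unfold Cexp, Clog, Carg; cbn [fst snd Re Im]. rewrite exp_ln by auto.
  destruct (Rle_dec 0 (Im z)) as [L|L].
  - rewrite cos_acos, sin_acos by lra. rewrite Q, Rabs_pos_eq by auto.
    apply C_ext; cbn [Re Im fst snd]; [|auto]. field; lra.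
  - rewrite cos_neg, sin_neg, cos_acos, sin_acos by lra.
    apply C_ext; cbn [Re Im fst snd]; [field; lra|].
    rewrite Ropp_mult_distr_r_reverse, Q, Rabs_left by lra. ring.
Qed.

Lemma Clog_unique z L : Cexp L = z -> - PI < Im L < PI -> Clog z = L.
Proof.
  intros <- B. unfold Clog, Carg. rewrite Cmod_Cexp, ln_exp.
  apply C_ext; [reflexivity|]. cbn [Im snd Re Cexp fst].
  assert (E := exp_pos (Re L)).
  replace (exp (Re L) * cos (Im L) / exp (Re L)) with (cos (Im L)) by (field; lra).
  destruct (Rle_dec 0 (exp (Re L) * sin (Im L))) as [S|S].
  - apply acos_cos. split; [|lra]. destruct (Rle_lt_dec 0 (Im L)) as [|N]; auto. exfalso.
    assert (P : 0 < sin (- Im L)) by (apply sin_gt_0; lra). rewrite sin_neg in P. nra.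
  - destruct (Rle_lt_dec 0 (Im L)) as [N|N].
    + exfalso. apply S, Rmult_le_pos; [lra|]. apply sin_ge_0; lra.
    + rewrite <- cos_neg, acos_cos; lra.
Qed.

Lemma Carg_bound z : z <> RtoC 0 -> - PI <= Carg z <= PI.
Proof.
  intros H. unfold Carg. assert (P := PI_RGT_0). assert (B := acos_bound (Re z / Cmod z)).
  destruct (Rle_dec 0 (Im z)); lra.
Qed.

Lemma Carg_Re_pos z : 0 < Re z -> - (PI / 2) < Carg z < PI / 2.
Proof.
  intros H. assert (N : z <> RtoC 0) by (intros ->; simpl in H; lra).
  assert (B := Carg_bound z N). assert (E := f_equal Re (Cexp_Clog z N)). cbn in E.
  assert (P := exp_pos (ln (Cmod z))). assert (Q : 0 < cos (Carg z)) by nra. assert (PP := PI_RGT_0).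
  split; apply Rnot_le_lt; intros L.
  - assert (K := cos_le_0 (Carg z + 2 * PI) ltac:(lra) ltac:(lra)).
    rewrite cos_plus, cos_2PI, sin_2PI in K. lra.
  - assert (K := cos_le_0 (Carg z) ltac:(lra) ltac:(lra)). lra.
Qed.

(** Both arguments lie strictly between -PI/2 and PI/2, so their sum stays in the principal
    range. *)
Lemma Clog_mult z w : 0 < Re z -> 0 < Re w -> Clog (z * w) = (Clog z + Clog w)%C.
Proof.
  intros Hz Hw. apply Clog_unique.
  - rewrite Cexp_plus, !Cexp_Clog; auto; intros ->; simpl in *; lra.
  - assert (A := Carg_Re_pos z Hz). assert (B := Carg_Re_pos w Hw). cbn. lra.
Qed.

Lemma Cpowr_eq z a : z <> RtoC 0 -> Cpowr z a = Cexp (RtoC a * Clog z).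
Proof.
  intros H. unfold Cpowr. apply Cmod_gt_0 in H. destruct (Req_EM_T (Cmod z) 0); [lra|auto].
Qed.

Lemma Re_pos_neq_0 z : 0 < Re z -> z <> RtoC 0.
Proof. intros H ->; simpl in H; lra. Qed.

Lemma Cpowr_mult z w a : 0 < Re z -> 0 < Re w -> Cpowr (z * w) a = (Cpowr z a * Cpowr w a)%C.
Proof.
  intros Hz Hw. assert (Nz := Re_pos_neq_0 z Hz). assert (Nw := Re_pos_neq_0 w Hw).
  rewrite !Cpowr_eq; auto using Cmult_neq_0. rewrite Clog_mult by auto. rewrite <- Cexp_plus. f_equal. ring.
Qed.

Lemma Cpowr_plus z a c : z <> RtoC 0 -> Cpowr z (a + c) = (Cpowr z a * Cpowr z c)%C.
Proof.
  intros H. rewrite !Cpowr_eq by auto. rewrite <- Cexp_plus, RtoC_plus. f_equal. ring.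
Qed.

Lemma Cpowr_1 z : z <> RtoC 0 -> Cpowr z 1 = z.
Proof. intros H. rewrite Cpowr_eq, Cmult_1_l by auto. apply Cexp_Clog; auto. Qed.

Lemma Cpowr_INR z n : z <> RtoC 0 -> Cpowr z (INR n) = (z ^ n)%C.
Proof.
  intros H. induction n as [|n IH].
  - rewrite Cpowr_eq by auto. simpl INR. rewrite Cmult_0_l, Cexp_0. reflexivity.
  - rewrite S_INR, Cpowr_plus, IH, Cpowr_1 by auto. cbn [Cpow]. ring.
Qed.

Lemma Cpowr_neq_0 z a : z <> RtoC 0 -> Cpowr z a <> RtoC 0.
Proof. intros H. rewrite Cpowr_eq by auto. apply Cexp_neq_0. Qed.

Lemma Clog_RtoC x : 0 < x -> Clog (RtoC x) = RtoC (ln x).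
Proof.
  intros H. apply Clog_unique; [rewrite Cexp_RtoC, exp_ln; auto|]. assert (P := PI_RGT_0). cbn. lra.
Qed.

Lemma Cpowr_RtoC x a : 0 < x -> Cpowr (RtoC x) a = RtoC (Rpower x a).
Proof.
  intros H. rewrite Cpowr_eq by (apply RtoC_neq_0; lra). rewrite Clog_RtoC, <- RtoC_mult by auto.
  apply Cexp_RtoC.
Qed.

Lemma Cpowr_half_sqr z : z <> RtoC 0 -> (Cpowr z (1 / 2) * Cpowr z (1 / 2))%C = z.
Proof. intros H. rewrite <- Cpowr_plus by auto. replace (1 / 2 + 1 / 2) with 1 by field. apply Cpowr_1; auto. Qed.

Lemma Cpowr_half_Re z : z <> RtoC 0 -> 0 <= Re (Cpowr z (1 / 2)).
Proof.
  intros H. rewrite Cpowr_eq by auto. cbn [Cexp Re fst]. apply Rmult_le_pos; [apply Rlt_le, exp_pos|].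
  rewrite Im_scal. assert (B := Carg_bound z H). cbn [Clog Im snd]. apply cos_ge_0; lra.
Qed.

(** On the right half-plane the principal logarithm is smooth, which the [acos] in [Carg] hides on
    the real axis; this form can be differentiated. *)
Lemma Clog_atan z : 0 < Re z -> Clog z = (ln (Re z * Re z + Im z * Im z) / 2, atan (Im z / Re z)).
Proof.
  intros H. assert (P : 0 < Re z * Re z + Im z * Im z) by nra.
  set (q := Im z / Re z). assert (Q : 0 < 1 + q²) by (assert (T := Rle_0_sqr q); lra).
  assert (S : exp (ln (Re z * Re z + Im z * Im z) / 2) = Re z * sqrt (1 + q²)).
  { rewrite <- Rpower_sqrt by auto. replace (Re z) with (exp (ln (Re z))) at 3 by (apply exp_ln; auto).
    unfold Rpower. rewrite <- exp_plus. f_equal.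
    replace (Re z * Re z + Im z * Im z) with (Re z * Re z * (1 + q²)) by (unfold q, Rsqr; field; lra).
    rewrite !ln_mult by nra. field. }
  assert (R0 := sqrt_lt_R0 _ Q).
  apply Clog_unique.
  - unfold Cexp; cbn [Re Im fst snd]. fold (Re z) (Im z). fold q. rewrite cos_atan, sin_atan.
    rewrite S. apply C_ext; cbn [Re Im fst snd]; fold (Re z) (Im z).
    + field. lra.
    + unfold q at 2. field. lra.
  - assert (B := atan_bound q). assert (PP := PI_RGT_0). cbn [Im snd]. lra.
Qed.

Definition Cder (f : R -> C) (t : R) (d : C) : Prop :=
  is_derive (fun t => Re (f t)) t (Re d) /\ is_derive (fun t => Im (f t)) t (Im d).

Lemma Cder_mult f g t d e : Cder f t d -> Cder g t e ->
  Cder (fun t => (f t * g t)%C) t (d * g t + f t * e)%C.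
Proof.
  intros [F1 F2] [G1 G2]. split.
  - eapply is_derive_eq; [apply (is_derive_minus (fun t => Re (f t) * Re (g t)) (fun t => Im (f t) * Im (g t)));
      apply is_derive_Rmult; eassumption|]. unfold minus, plus, opp; simpl; unfold Re, Im; ring.
  - eapply is_derive_eq; [apply (is_derive_plus (fun t => Re (f t) * Im (g t)) (fun t => Im (f t) * Re (g t)));
      apply is_derive_Rmult; eassumption|]. unfold minus, plus, opp; simpl; unfold Re, Im; ring.
Qed.

Lemma Cder_eq f t d e : Cder f t d -> d = e -> Cder f t e.
Proof. intros H <-; exact H. Qed.

Lemma Cder_scal c f t d : Cder f t d -> Cder (fun t => (c * f t)%C) t (c * d)%C.
Proof.
  intros H. eapply Cder_eq; [apply (Cder_mult (fun _ => c) f t 0); [|exact H]|].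
  - split; apply (is_derive_const (V := R_NormedModule)).
  - ring.
Qed.

Lemma Cder_exp f t d : Cder f t d -> Cder (fun t => Cexp (f t)) t (d * Cexp (f t))%C.
Proof.
  intros [F1 F2].
  assert (X : is_derive (fun t => exp (Re (f t))) t (Re d * exp (Re (f t)))).
  { apply (is_derive_comp exp (fun t => Re (f t))); auto. apply is_derive_exp. }
  split; cbn [Re Im fst snd Cexp].
  - eapply is_derive_eq; [apply (is_derive_Rmult _ (fun t => cos (Im (f t))) _ _ (Im d * - sin (Im (f t))) X)|].
    + apply (is_derive_comp cos (fun t => Im (f t))); auto. apply is_derive_cos.
    + unfold Cmult, Cexp, Re, Im; simpl; ring.
  - eapply is_derive_eq; [apply (is_derive_Rmult _ (fun t => sin (Im (f t))) _ _ (Im d * cos (Im (f t))) X)|].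
    + apply (is_derive_comp sin (fun t => Im (f t))); auto. apply is_derive_sin.
    + unfold Cmult, Cexp, Re, Im; simpl; ring.
Qed.

Lemma Cder_const f a b : a < b -> (forall t, a <= t <= b -> Cder f t 0) -> f a = f b.
Proof.
  intros H D. apply C_ext.
  - apply (eq_is_derive (fun t => Re (f t))); auto. intros t Ht. apply D; auto.
  - apply (eq_is_derive (fun t => Im (f t))); auto. intros t Ht. apply D; auto.
Qed.

(** * The binomial series of (1 - y)^(-e) *)

Definition bin (e : R) (n : nat) : R := poch e n / INR (fact n).

Lemma bin_0 e : bin e 0 = 1.
Proof. unfold bin; simpl; field. Qed.

Lemma bin_S e n : INR (S n) * bin e (S n) = (e + INR n) * bin e n.
Proof.
  unfold bin. cbn [poch]. rewrite fact_simpl, mult_INR. assert (H := INR_fact_neq_0 n).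
  assert (K : INR (S n) <> 0) by (apply not_0_INR; lia). field; auto.
Qed.

Lemma poch_pos e n : 0 < e -> 0 < poch e n.
Proof.
  intros H. induction n as [|n IH]; cbn [poch]; [lra|]. apply Rmult_lt_0_compat; auto.
  assert (P := pos_INR n). lra.
Qed.

Lemma bin_pos e n : 0 < e -> 0 < bin e n.
Proof. intros H. apply Rdiv_lt_0_compat; [apply poch_pos; auto|apply INR_fact_lt_0]. Qed.

Lemma eventually_decreasing_bounded (x : nat -> R) N : (forall n, 0 <= x n) ->
  (forall n, (N <= n)%nat -> x (S n) <= x n) -> exists M, forall n, x n <= M.
Proof.
  intros Hp Hd. exists (sum_n x N). 
  assert (B : forall i K, (i <= K)%nat -> x i <= sum_n x K).
  { intros i K; induction K as [|K IH]; intros Hi.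
    - replace i with 0%nat by lia. rewrite sum_O. lra.
    - rewrite sum_Sn. unfold plus; simpl. destruct (Nat.eq_dec i (S K)) as [->|D].
      + assert (0 <= sum_n x K); [|lra]. apply Rle_trans with (x 0%nat); auto.
        clear - Hp. induction K as [|K IH]; [rewrite sum_O; lra|]. rewrite sum_Sn; unfold plus; simpl.
        assert (P := Hp (S K)). lra.
      + assert (P := Hp (S K)). specialize (IH ltac:(lia)). lra. }
  assert (D : forall i, x (N + i)%nat <= x N).
  { induction i as [|i IH]; [rewrite Nat.add_0_r; lra|]. rewrite Nat.add_succ_r.
    eapply Rle_trans; [apply Hd; lia|auto]. }
  intros n. destruct (Nat.le_gt_cases n N) as [L|L]; [apply B; auto|].
  replace n with (N + (n - N))%nat by lia. eapply Rle_trans; [apply D|apply B; auto].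
Qed.

(** The ratio of consecutive terms, (e + n) th / (n + 1), is at most 1 once n exceeds e th / (1 -
    th). *)
Lemma bin_pow_bounded e th : 0 < e -> 0 <= th < 1 -> exists M, forall n, bin e n * th ^ n <= M.
Proof.
  intros He Ht. destruct (INR_unbounded (e * th / (1 - th))) as [N HN].
  apply (eventually_decreasing_bounded _ N).
  - intros n. apply Rmult_le_pos; [apply Rlt_le, bin_pos; auto|apply pow_le; lra].
  - intros n Hn. apply le_INR in Hn. assert (Q := pos_INR n).
    assert (P : 0 <= bin e n * th ^ n) by (apply Rmult_le_pos; [apply Rlt_le, bin_pos; auto|apply pow_le; lra]).
    assert (K : (e + INR n) * th <= INR n + 1).
    { apply (Rmult_lt_compat_r (1 - th)) in HN; [|lra]. unfold Rdiv in HN.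
      rewrite Rmult_assoc, Rinv_l in HN by lra. nra. }
    apply Rmult_le_reg_l with (INR n + 1); [lra|]. rewrite <- S_INR at 1.
    rewrite <- Rmult_assoc, bin_S. simpl pow.
    replace ((e + INR n) * bin e n * (th * th ^ n)) with ((e + INR n) * th * (bin e n * th ^ n)) by ring.
    apply Rmult_le_compat_r; auto.
Qed.

Lemma Cser_decr_1 (a : nat -> C) s : a 0%nat = RtoC 0 -> Cser (fun n => a (S n)) s -> Cser a s.
Proof.
  intros H0 [H1 H2]. split; apply is_series_decr_1; rewrite H0; unfold plus, opp; simpl;
    rewrite Ropp_0, Rplus_0_r; auto.
Qed.

Definition bc (e : R) (y : C) (n : nat) : C := (RtoC (bin e n) * y ^ n)%C.

Definition bf (e : R) (y : C) (t : R) : C := (PSeries (fun n => Re (bc e y n)) t, PSeries (fun n => Im (bc e y n)) t).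

Definition bd (e : R) (y : C) (t : R) : C :=
  (PSeries (PS_derive (fun n => Re (bc e y n))) t, PSeries (PS_derive (fun n => Im (bc e y n))) t).

Lemma bin_radius e y (a : nat -> R) : 0 < e -> Cmod y < 1 -> (forall n, Rabs (a n) <= Cmod (bc e y n)) ->
  forall t, 0 <= t <= 1 -> Rbar_lt (Rabs t) (CV_radius a).
Proof.
  (* This r exceeds 1 while r |y| < 1, so the closed segment from 0 to 1 lies inside the disc of
     convergence. *)
  intros He Hy Ha t Ht. assert (Hy0 := Cmod_ge_0 y). set (r := 2 / (1 + Cmod y)).
  assert (Hr : 1 < r). { unfold r. apply Rmult_lt_reg_r with (1 + Cmod y); [lra|]. 
    unfold Rdiv. rewrite Rmult_assoc, Rinv_l; lra. }
  assert (Hr1 : Cmod y * r < 1). { unfold r. apply Rmult_lt_reg_r with (1 + Cmod y); [lra|].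
    unfold Rdiv. rewrite !Rmult_assoc, Rinv_l; lra. }
  destruct (bin_pow_bounded e (Cmod y * r) He) as [M HM]; [split; auto; apply Rmult_le_pos; lra|].
  destruct (CV_radius_bounded a) as [Hub _].
  apply Rbar_lt_le_trans with r; [simpl; rewrite Rabs_pos_eq; lra|].
  apply Hub. exists M. intros n. rewrite Rabs_mult, (Rabs_pos_eq (r ^ n)) by (apply pow_le; lra).
  eapply Rle_trans; [|apply (HM n)]. rewrite Rpow_mult_distr, <- Rmult_assoc.
  apply Rmult_le_compat_r; [apply pow_le; lra|]. eapply Rle_trans; [apply Ha|].
  unfold bc. rewrite Cmod_mult, Cmod_R, Cmod_pow, Rabs_pos_eq by (apply Rlt_le, bin_pos; auto). lra.
Qed.

Lemma bin_radius_Re e y t : 0 < e -> Cmod y < 1 -> 0 <= t <= 1 -> Rbar_lt (Rabs t) (CV_radius (fun n => Re (bc e y n))).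
Proof. intros He Hy Ht. apply (bin_radius e y); auto. intros n. apply re_le_Cmod. Qed.

Lemma bin_radius_Im e y t : 0 < e -> Cmod y < 1 -> 0 <= t <= 1 -> Rbar_lt (Rabs t) (CV_radius (fun n => Im (bc e y n))).
Proof. intros He Hy Ht. apply (bin_radius e y); auto. intros n. apply Im_le_Cmod. Qed.

Lemma is_series_PSeries a t : Rbar_lt (Rabs t) (CV_radius a) -> is_series (fun n => t ^ n * a n) (PSeries a t).
Proof.
  intros H. apply (is_series_ext (fun n => a n * t ^ n)); [intros n; apply Rmult_comm|].
  apply is_pseries_R, PSeries_correct, CV_radius_inside, H.
Qed.

Lemma binomial_ser e y t : 0 < e -> Cmod y < 1 -> 0 <= t <= 1 ->
  Cser (fun n => (RtoC (t ^ n) * bc e y n)%C) (bf e y t).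
Proof.
  intros He Hy Ht. split; (eapply is_series_ext; [intros n; symmetry; first [apply Re_scal|apply Im_scal]|]);
    apply is_series_PSeries; auto using bin_radius_Re, bin_radius_Im.
Qed.

Lemma binomial_der_ser e y t : 0 < e -> Cmod y < 1 -> 0 <= t <= 1 ->
  Cser (fun n => (RtoC (t ^ n) * (RtoC (INR (S n)) * bc e y (S n)))%C) (bd e y t).
Proof.
  intros He Hy Ht.
  split; [apply (is_series_ext (fun n => t ^ n * PS_derive (fun n => Re (bc e y n)) n));
      [intros n; rewrite !Re_scal; reflexivity|]
    |apply (is_series_ext (fun n => t ^ n * PS_derive (fun n => Im (bc e y n)) n));
      [intros n; rewrite !Im_scal; reflexivity|]];
  apply is_series_PSeries; rewrite CV_radius_derive; auto using bin_radius_Re, bin_radius_Im.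
Qed.

(* Together with [Cder_log_ray]: the series times [Cexp (e Clog (1 - t y))] has derivative 0. *)
Lemma binomial_ode e y t : 0 < e -> Cmod y < 1 -> 0 <= t <= 1 -> ((1 - RtoC t * y) * bd e y t)%C = (RtoC e * y * bf e y t)%C.
Proof.
  intros He Hy Ht. assert (D := binomial_der_ser e y t He Hy Ht).
  assert (S1 : Cser (fun n => (RtoC (t ^ n) * (RtoC (INR n) * bc e y n))%C) (RtoC t * bd e y t)%C).
  { apply Cser_decr_1; [simpl INR; ring|]. eapply Cser_ext; [|apply (Cser_scal (RtoC t) _ _ D)].
    intros n. cbn [pow]. rewrite RtoC_mult. ring. }
  assert (S2 := Cser_scal y _ _ (Cser_plus _ _ _ _ (Cser_scal (RtoC e) _ _ (binomial_ser e y t He Hy Ht)) S1)).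
  assert (U : bd e y t = (y * (RtoC e * bf e y t + RtoC t * bd e y t))%C).
  { apply (Cser_unique _ _ _ D). eapply Cser_ext; [|exact S2]. intros n.
    unfold bc. rewrite Cpow_S.
    transitivity (RtoC (t ^ n) * y * y ^ n * (RtoC (INR (S n)) * RtoC (bin e (S n))))%C; [|ring].
    rewrite <- RtoC_mult, bin_S, RtoC_mult, RtoC_plus. ring. }
  transitivity (bd e y t - RtoC t * y * bd e y t)%C; [ring|]. rewrite U at 1. ring.
Qed.

Lemma ray_Re_pos e y t : 0 < e -> Cmod y < 1 -> 0 <= t <= 1 -> 0 < Re (1 - RtoC t * y).
Proof.
  intros He Hy Ht. assert (B := Rle_trans _ _ _ (Rle_abs _) (re_le_Cmod y)).
  assert (Q : Re (1 - RtoC t * y) = 1 - t * Re y).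
  { unfold Cminus, Re. destruct y; simpl. ring. }
  rewrite Q. assert (t * Re y <= t * Cmod y) by (apply Rmult_le_compat_l; lra).
  assert (H0 := Cmod_ge_0 y). nra.
Qed.

Lemma Cder_log_ray e y t : 0 < e -> Cmod y < 1 -> 0 <= t <= 1 -> Cder (fun t => Clog (1 - RtoC t * y)) t (- y / (1 - RtoC t * y))%C.
Proof.
  intros He Hy Ht. assert (P := ray_Re_pos e y t He Hy Ht). destruct y as [u v] eqn:Ey.
  assert (Q1 : forall t, Re (1 - RtoC t * (u, v)) = 1 - t * u) by (intros s; unfold Cminus, Re; simpl; ring).
  assert (Q2 : forall t, Im (1 - RtoC t * (u, v)) = - t * v) by (intros s; unfold Cminus, Im; simpl; ring).
  rewrite Q1 in P.
  assert (L : locally t (fun s => 0 < 1 - s * u)).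
  { assert (K : continuous (fun s => 1 - s * u) t).
    { apply cont_Rminus; [apply cont_const|apply cont_Rmult; [apply continuous_id|apply cont_const]]. }
    apply K. apply (open_gt 0); auto. }
  assert (X : (- (u, v) / (1 - RtoC t * (u, v)))%C =
    ((- u * (1 - t * u) + t * v * v) / ((1 - t * u) ^ 2 + (t * v) ^ 2),
     (- v * (1 - t * u) - t * u * v) / ((1 - t * u) ^ 2 + (t * v) ^ 2))).
  { assert (0 < (1 - t * u) ^ 2 + (t * v) ^ 2) by nra.
    unfold Cdiv, Cinv, Cmult, Cminus, Cplus, Copp, RtoC; cbn [fst snd].
    f_equal; field; repeat split; nra. }
  rewrite X. assert (0 < (1 - t * u) ^ 2 + (t * v) ^ 2) by nra.
  split; cbn [Re Im fst snd].
  - apply (is_derive_ext_loc (fun t => ln ((1 - t * u) * (1 - t * u) + (t * v) * (t * v)) / 2)).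
    + revert L. apply filter_imp. intros s Hs. rewrite Clog_atan, Q1, Q2 by (rewrite Q1; auto).
      cbn [Re fst]. do 2 f_equal. ring.
    + auto_derive; [nra|]. field. nra.
  - apply (is_derive_ext_loc (fun t => atan (- t * v / (1 - t * u)))).
    + revert L. apply filter_imp. intros s Hs. rewrite Clog_atan, Q1, Q2 by (rewrite Q1; auto).
      reflexivity.
    + auto_derive; [lra|]. field. repeat split; nra.
Qed.

Lemma binomial_Cder e y t : 0 < e -> Cmod y < 1 -> 0 <= t <= 1 -> Cder (bf e y) t (bd e y t).
Proof.
  intros He Hy Ht. split; apply is_derive_PSeries; auto using bin_radius_Re, bin_radius_Im.
Qed.

Lemma binomial_value e y : 0 < e -> Cmod y < 1 -> Cser (bc e y) (/ Cpowr (1 - y) e)%C.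
Proof.
  intros He Hy. assert (S1 := binomial_ser e y 1 He Hy ltac:(lra)).
  assert (N : forall t, 0 <= t <= 1 -> (1 - RtoC t * y)%C <> RtoC 0).
  { intros t Ht. apply Re_pos_neq_0, (ray_Re_pos e); auto. }
  assert (K : (bf e y 0 * Cexp (RtoC e * Clog (1 - RtoC 0 * y)) = bf e y 1 * Cexp (RtoC e * Clog (1 - RtoC 1 * y)))%C).
  { apply (Cder_const (fun t => (bf e y t * Cexp (RtoC e * Clog (1 - RtoC t * y)))%C)); [lra|].
    intros t Ht. eapply Cder_eq.
    - apply Cder_mult; [apply binomial_Cder; auto|]. apply Cder_exp, Cder_scal, (Cder_log_ray e); auto.
    - assert (O := binomial_ode e y t He Hy Ht). assert (M := N t Ht).
      transitivity ((/ (1 - RtoC t * y)) * ((1 - RtoC t * y) * bd e y t - RtoC e * y * bf e y t) *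
        Cexp (RtoC e * Clog (1 - RtoC t * y)))%C; [field; auto|]. rewrite O. ring. }
  assert (E0 : bf e y 0 = RtoC 1).
  { unfold bf. rewrite !PSeries_0. unfold bc. rewrite bin_0. apply C_ext; simpl; ring. }
  rewrite E0 in K. replace (1 - RtoC 0 * y)%C with (RtoC 1) in K by ring.
  rewrite (Clog_RtoC 1), ln_1, Cmult_0_r, Cexp_0 in K by lra.
  specialize (N 1 ltac:(lra)). rewrite <- Cpowr_eq in K by auto.
  replace (1 - RtoC 1 * y)%C with (1 - y)%C in * by ring.
  assert (F1 : bf e y 1 = (/ Cpowr (1 - y) e)%C).
  { assert (M := Cpowr_neq_0 (1 - y) e N).
    transitivity (bf e y 1 * Cpowr (1 - y) e * / Cpowr (1 - y) e)%C; [field; auto|]. rewrite <- K. ring. }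
  rewrite <- F1. eapply Cser_ext; [|exact S1]. intros n. cbv beta; rewrite pow1. ring.
Qed.

(** * Laplace transforms of powers and of Bessel functions *)

Lemma is_series_exp x : is_series (fun n => x ^ n / INR (fact n)) (exp x).
Proof.
  apply (is_series_ext (fun n => / INR (fact n) * x ^ n)); [intros n; apply Rmult_comm|].
  apply is_pseries_R, is_exp_Reals.
Qed.

Lemma is_series_term_le (a : nat -> R) s n : (forall n, 0 <= a n) -> is_series a s -> a n <= s.
Proof.
  intros Hp Hs. apply Rle_trans with (sum_n a n); [|apply is_series_tail_le; auto].
  assert (N : forall k, 0 <= sum_n a k).
  { induction k as [|k IH]; [rewrite sum_O; auto|]. rewrite sum_Sn; unfold plus; simpl.
    assert (P := Hp (S k)). lra. }
  destruct n as [|n]; [rewrite sum_O; lra|]. rewrite sum_Sn; unfold plus; simpl. assert (P := N n). lra.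
Qed.

Definition ec (z : C) (n : nat) : C := (RtoC (/ INR (fact n)) * z ^ n)%C.

Lemma Cmod_ec z n : Cmod (ec z n) = Cmod z ^ n / INR (fact n).
Proof.
  unfold ec. rewrite Cmod_mult, Cmod_R, Cmod_pow, Rabs_pos_eq; [apply Rmult_comm|].
  apply Rlt_le, Rinv_0_lt_compat, INR_fact_lt_0.
Qed.

Lemma exp_radius z (a : nat -> R) : (forall n, Rabs (a n) <= Cmod (ec z n)) ->
  forall t, 0 <= t <= 1 -> Rbar_lt (Rabs t) (CV_radius a).
Proof.
  intros Ha t Ht. destruct (CV_radius_bounded a) as [Hub _].
  apply Rbar_lt_le_trans with 2; [simpl; rewrite Rabs_pos_eq; lra|].
  apply Hub. exists (exp (Cmod z * 2)). intros n.
  assert (H0 := Cmod_ge_0 z).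
  eapply Rle_trans; [|apply (is_series_term_le _ _ n) with (2 := is_series_exp (Cmod z * 2))].
  - rewrite Rabs_mult, (Rabs_pos_eq (2 ^ n)), Rpow_mult_distr by (apply pow_le; lra).
    eapply Rle_trans; [apply Rmult_le_compat_r; [apply pow_le; lra|apply Ha]|].
    rewrite Cmod_ec. right. unfold Rdiv. ring.
  - intros k. apply Rmult_le_pos; [apply pow_le; lra|apply Rlt_le, Rinv_0_lt_compat, INR_fact_lt_0].
Qed.

(** As for the binomial series: along the ray from 0 to z the series multiplied by e^(-tz) has
    derivative 0. *)
Lemma Cexp_series z : Cser (ec z) (Cexp z).
Proof.
  set (f := fun t => (PSeries (fun n => Re (ec z n)) t, PSeries (fun n => Im (ec z n)) t) : C).
  set (f' := fun t => (PSeries (PS_derive (fun n => Re (ec z n))) t, PSeries (PS_derive (fun n => Im (ec z n))) t) : C).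
  assert (R1 : forall t, 0 <= t <= 1 -> Rbar_lt (Rabs t) (CV_radius (fun n => Re (ec z n)))).
  { apply (exp_radius z). intros; apply re_le_Cmod. }
  assert (R2 : forall t, 0 <= t <= 1 -> Rbar_lt (Rabs t) (CV_radius (fun n => Im (ec z n)))).
  { apply (exp_radius z). intros; apply Im_le_Cmod. }
  assert (S0 : forall t, 0 <= t <= 1 -> Cser (fun n => (RtoC (t ^ n) * ec z n)%C) (f t)).
  { intros t Ht. split; (eapply is_series_ext; [intros n; symmetry; first [apply Re_scal|apply Im_scal]|]);
      apply is_series_PSeries; auto. }
  assert (S1 : forall t, 0 <= t <= 1 -> f' t = (z * f t)%C).
  { intros t Ht. apply (Cser_unique (fun n => (RtoC (t ^ n) * (RtoC (INR (S n)) * ec z (S n)))%C)).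
    - split; [apply (is_series_ext (fun n => t ^ n * PS_derive (fun n => Re (ec z n)) n));
          [intros n; rewrite !Re_scal; reflexivity|]
        |apply (is_series_ext (fun n => t ^ n * PS_derive (fun n => Im (ec z n)) n));
          [intros n; rewrite !Im_scal; reflexivity|]];
        apply is_series_PSeries; rewrite CV_radius_derive; auto.
    - eapply Cser_ext; [|apply (Cser_scal z _ _ (S0 t Ht))]. intros n. unfold ec.
      rewrite fact_simpl, mult_INR, Rinv_mult, RtoC_mult, Cpow_S.
      transitivity (RtoC (t ^ n) * z * RtoC (/ INR (fact n)) * z ^ n * (RtoC (INR (S n)) * RtoC (/ INR (S n))))%C; [|ring].
      rewrite <- (RtoC_mult (INR (S n))), Rinv_r by (apply not_0_INR; lia). ring. }
  assert (K : (f 0 * Cexp (RtoC 0 * - z) = f 1 * Cexp (RtoC 1 * - z))%C).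
  { apply (Cder_const (fun t => (f t * Cexp (RtoC t * - z))%C)); [lra|]. intros t Ht.
    eapply Cder_eq.
    - apply (Cder_mult f _ t (f' t)).
      + split; apply is_derive_PSeries; auto.
      + apply (Cder_exp (fun t => (RtoC t * - z)%C) t (- z)%C).
        split.
        * apply (is_derive_ext (fun t => t * Re (- z))); [intros; symmetry; apply Re_scal|]. generalize (Re (- z)); intros c.
          auto_derive; auto; eqR; ring.
        * apply (is_derive_ext (fun t => t * Im (- z))); [intros; symmetry; apply Im_scal|]. generalize (Im (- z)); intros c.
          auto_derive; auto; eqR; ring.
    - rewrite S1 by auto. ring. }
  assert (E0 : f 0 = RtoC 1).
  { unfold f. rewrite !PSeries_0. unfold ec. simpl. apply C_ext; simpl; field. }
  rewrite E0, Cmult_0_l, Cexp_0, !Cmult_1_l, Cexp_opp in K.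
  assert (N := Cexp_neq_0 z).
  assert (F1 : f 1 = Cexp z).
  { transitivity (f 1 * / Cexp z * Cexp z)%C; [field; auto|]. rewrite <- K. ring. }
  rewrite <- F1. eapply Cser_ext; [|exact (S0 1 ltac:(lra))]. intros n. cbv beta. rewrite pow1. ring.
Qed.

Lemma RInt_le_gen0 (f : R -> R) l Y : (forall t, continuous f t) -> (forall t, 0 <= f t) -> 0 <= Y ->
  is_RInt_gen f (at_point 0) (Rbar_locally p_infty) l -> RInt f 0 Y <= l.
Proof.
  intros Hc Hp HY H. assert (L := filterlim_is_RInt_gen _ _ _ _ H).
  assert (Ex : forall a b, ex_RInt f a b) by (intros; apply cont_ex_RInt; auto).
  apply (filterlim_le (F := filter_prod (at_point 0) (Rbar_locally p_infty)) (fun _ => RInt f 0 Y)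
      (fun ab => RInt f (fst ab) (snd ab)) (RInt f 0 Y) l); auto; [|apply filterlim_const].
  apply (Filter_prod _ _ _ (fun x => x = 0) (fun y => Y < y)); [reflexivity|exists Y; auto|].
  intros x y -> Hy. simpl. rewrite <- (RInt_Chasles f 0 Y y) by apply Ex.
  assert (0 <= RInt f Y y) by (apply RInt_ge_0; auto; lra). unfold plus; simpl; lra.
Qed.

Lemma rpow0_scale x t p : 0 < x -> rpow0 (x * t) p = Rpower x p * rpow0 t p.
Proof.
  intros Hx. unfold rpow0. destruct (Rlt_dec 0 t) as [H|H]; destruct (Rlt_dec 0 (x * t)) as [K|K]; try nra.
  rewrite Rpower_mult_distr; auto.
Qed.

Lemma rpow0_plus_nat t p n : 0 < p -> 0 <= t -> rpow0 t p * t ^ n = rpow0 t (p + INR n).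
Proof.
  intros Hp [H|<-].
  - rewrite !rpow0_pos, Rpower_plus, Rpower_pow; auto.
  - rewrite !rpow0_npos by lra. ring.
Qed.

Lemma Laplace_pow_real x p : 0 < x -> 0 < p ->
  is_RInt_gen (fun t => exp (- (x * t)) * rpow0 t p) (at_point 0) (Rbar_locally p_infty)
    (Gamma (p + 1) / Rpower x (p + 1)).
Proof.
  intros Hx Hp. assert (P := exp_pos (p * ln x)). fold (Rpower x p) in P.
  assert (E : Rpower x (p + 1) = Rpower x p * x) by (rewrite Rpower_plus, Rpower_1; auto).
  apply (is_RInt_gen_ext (fun t => scal (/ Rpower x (p + 1)) (x * gint p (x * t)))).
  { apply filter_forall. intros ab t _. unfold gint, scal; simpl; unfold mult; simpl.
    rewrite rpow0_scale, E by auto. field. lra. }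
  replace (Gamma (p + 1) / Rpower x (p + 1)) with (scal (/ Rpower x (p + 1)) (Gamma (p + 1))) by
    (unfold scal; simpl; unfold mult; simpl; unfold Rdiv; ring).
  refine (is_RInt_gen_scal (Fa := at_point 0) (Fb := Rbar_locally p_infty) (V := R_NormedModule)
    (fun t => x * gint p (x * t)) (/ Rpower x (p + 1)) (Gamma (p + 1)) _).
  assert (Cx : forall t, continuous (fun t => x * gint p (x * t)) t).
  { intros t. apply cont_Rmult; [apply cont_const|]. apply (cont_comp (fun t => x * t) (gint p)).
    - apply cont_Rmult; [apply cont_const|apply continuous_id].
    - apply gint_cont; auto. }
  assert (L := filterlim_is_RInt_gen _ _ _ _ (Gamma_S_is p Hp)).
  apply (is_RInt_gen_filterlim _ (at_point 0) (Rbar_locally p_infty)).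
  - apply filter_forall. intros ab. apply cont_ex_RInt; auto.
  - intros Q HQ. specialize (L Q HQ). destruct L as [A B HA [M HM] L].
    apply (Filter_prod _ _ _ (fun a => a = 0) (fun b => M / x < b)); [reflexivity|exists (M / x); auto|].
    intros a b -> Hb. simpl.
    assert (K : RInt (fun t => x * gint p (x * t)) 0 b = RInt (gint p) 0 (x * b)).
    { transitivity (RInt (gint p) (x * 0 + 0) (x * b + 0)); [|f_equal; ring].
      rewrite <- (RInt_comp_lin (V := R_CompleteNormedModule)).
      - apply RInt_ext. intros t _. unfold scal; simpl; unfold mult; simpl. rewrite Rplus_0_r. reflexivity.
      - apply cont_ex_RInt. intros; apply gint_cont; auto. }
    rewrite K. apply (L 0 (x * b)); auto. apply HM.
    apply (Rmult_lt_compat_l x) in Hb; auto. unfold Rdiv in Hb. rewrite (Rmult_comm M), <- Rmult_assoc, Rinv_r in Hb; lra.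
Qed.

Lemma Gamma_poch p n : 0 < p -> Gamma (p + INR n) = poch p n * Gamma p.
Proof.
  intros Hp. induction n as [|n IH]; [simpl; rewrite Rplus_0_r; ring|].
  rewrite S_INR, <- Rplus_assoc, Gamma_S, IH by (assert (P := pos_INR n); lra). cbn [poch]. ring.
Qed.

Definition lint (s : C) (p t : R) : C := (Cexp (- (s * RtoC t)) * RtoC (rpow0 t p))%C.

Lemma cont_lint s p t : 0 < p ->
  continuous (fun t => Re (lint s p t)) t /\ continuous (fun t => Im (lint s p t)) t.
Proof.
  intros Hp. destruct s as [u v].
  assert (R1 : forall t, Re (lint (u, v) p t) = exp (- u * t) * cos (- v * t) * rpow0 t p).
  { intros x. unfold lint. rewrite Cmult_comm, Re_scal. unfold Cexp, Cmult, Copp, RtoC; cbn [Re Im fst snd].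
    replace (- (u * x - v * 0)) with (- u * x) by ring. replace (- (u * 0 + v * x)) with (- v * x) by ring. ring. }
  assert (R2 : forall t, Im (lint (u, v) p t) = exp (- u * t) * sin (- v * t) * rpow0 t p).
  { intros x. unfold lint. rewrite Cmult_comm, Im_scal. unfold Cexp, Cmult, Copp, RtoC; cbn [Re Im fst snd].
    replace (- (u * x - v * 0)) with (- u * x) by ring. replace (- (u * 0 + v * x)) with (- v * x) by ring. ring. }
  assert (L : forall c t, continuous (fun t => c * t) t) by
    (intros; apply cont_Rmult; [apply cont_const|apply continuous_id]).
  split; (eapply continuous_ext; [intros x; symmetry; first [apply R1|apply R2]|]);
    (apply cont_Rmult; [apply cont_Rmult|apply rpow0_cont; auto]).
  - apply (cont_comp (fun t => - u * t) exp); [apply L|apply cont_exp].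
  - apply (cont_comp (fun t => - v * t) cos); [apply L|apply cont_cos].
  - apply (cont_comp (fun t => - u * t) exp); [apply L|apply cont_exp].
  - apply (cont_comp (fun t => - v * t) sin); [apply L|apply cont_sin].
Qed.

Lemma Cmod_lint s p t : Cmod (lint s p t) = exp (- (Re s * t)) * rpow0 t p.
Proof.
  unfold lint. rewrite Cmod_mult, Cmod_Cexp, Cmod_R, Rabs_pos_eq by apply rpow0_nonneg.
  do 2 f_equal. unfold Cmult, Copp, RtoC, Re; simpl; ring.
Qed.

Lemma Laplace_pow_real_C x p : 0 < x -> 0 < p ->
  CRInt_gen (lint (RtoC x) p) (at_point 0) (Rbar_locally p_infty) (RtoC (Gamma (p + 1)) / Cpowr (RtoC x) (p + 1))%C.
Proof.
  intros Hx Hp. assert (P := exp_pos ((p + 1) * ln x)). fold (Rpower x (p + 1)) in P.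
  rewrite Cpowr_RtoC, <- RtoC_div by lra.
  assert (E : forall t, lint (RtoC x) p t = RtoC (exp (- (x * t)) * rpow0 t p)).
  { intros t. unfold lint. rewrite <- RtoC_mult, <- RtoC_opp, Cexp_RtoC, <- RtoC_mult. reflexivity. }
  split.
  - apply (is_RInt_gen_ext (fun t => exp (- (x * t)) * rpow0 t p)); [|apply Laplace_pow_real; auto].
    apply filter_forall. intros ab t _. rewrite E. reflexivity.
  - apply (is_RInt_gen_ext (fun t => scal 0 (exp (- (x * t)) * rpow0 t p))).
    + apply filter_forall. intros ab t _. rewrite E. unfold scal; simpl; unfold mult; simpl. ring.
    + assert (H := is_RInt_gen_scal _ 0 _ (Laplace_pow_real x p Hx Hp)).
      eapply is_RInt_gen_eq; [exact H|]. unfold scal; simpl; unfold mult; simpl. ring.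
Qed.

Lemma ex_RInt_lint s p a b : 0 < p ->
  ex_RInt (fun t => Re (lint s p t)) a b /\ ex_RInt (fun t => Im (lint s p t)) a b.
Proof. intros Hp. split; apply cont_ex_RInt; intros t; [exact (proj1 (cont_lint s p t Hp))|exact (proj2 (cont_lint s p t Hp))]. Qed.

Lemma ex_RInt_Cscal c (f : R -> C) a b :
  ex_RInt (fun t => Re (f t)) a b /\ ex_RInt (fun t => Im (f t)) a b ->
  ex_RInt (fun t => Re (c * f t)%C) a b /\ ex_RInt (fun t => Im (c * f t)%C) a b.
Proof.
  intros [H1 H2]. split.
  - apply (ex_RInt_ext (fun t => minus (scal (Re c) (Re (f t))) (scal (Im c) (Im (f t))))).
    + intros t _. reflexivity.
    + apply (ex_RInt_minus (V := R_NormedModule)); apply (ex_RInt_scal (V := R_NormedModule)); auto.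
  - apply (ex_RInt_ext (fun t => plus (scal (Re c) (Im (f t))) (scal (Im c) (Re (f t))))).
    + intros t _. reflexivity.
    + apply (ex_RInt_plus (V := R_NormedModule)); apply (ex_RInt_scal (V := R_NormedModule)); auto.
Qed.

Lemma lint_plus_nat s p n t : 0 < p -> 0 <= t -> lint s (p + INR n) t = (lint s p t * RtoC (t ^ n))%C.
Proof. intros Hp Ht. unfold lint. rewrite <- rpow0_plus_nat, RtoC_mult by auto. ring. Qed.

Lemma cont_elint x p t : 0 < p -> continuous (fun t => exp (- (x * t)) * rpow0 t p) t.
Proof.
  intros Hp. apply cont_Rmult; [|apply rpow0_cont; auto].
  apply (cont_comp (fun t => - (x * t)) exp); [|apply cont_exp].
  apply cont_Ropp, cont_Rmult; [apply cont_const|apply continuous_id].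
Qed.

Lemma elint_nonneg x p t : 0 <= exp (- (x * t)) * rpow0 t p.
Proof. apply Rmult_le_pos; [apply Rlt_le, exp_pos|apply rpow0_nonneg]. Qed.

Lemma RInt_elint_le x p Y : 0 < x -> 0 < p -> 0 <= Y ->
  RInt (fun t => exp (- (x * t)) * rpow0 t p) 0 Y <= Gamma (p + 1) / Rpower x (p + 1).
Proof.
  intros Hx Hp HY. apply RInt_le_gen0; auto.
  - intros t; apply cont_elint; auto.
  - intros t; apply elint_nonneg.
  - apply Laplace_pow_real; auto.
Qed.

(** Termwise transform of t^p times a power series, dominated by the transforms of the absolute
    values at the real point Re s. The exponents [q n] admit series in t as well as in t^2. *)
Lemma Laplace_series (c : nat -> C) (q : nat -> nat) (g : R -> C) (s : C) (p : R) (I : nat -> C) :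
  0 < p -> 0 < Re s ->
  ex_series (fun n => Cmod (c n) * (Gamma (p + INR (q n) + 1) / Rpower (Re s) (p + INR (q n) + 1))) ->
  (forall Y, exists m : nat -> R, ex_series m /\ forall n t, 0 <= t <= Y -> Cmod (c n) * t ^ q n <= m n) ->
  (forall t, 0 <= t -> Cser (fun n => (c n * RtoC (t ^ q n))%C) (g t)) ->
  (forall n, CRInt_gen (lint s (p + INR (q n))) (at_point 0) (Rbar_locally p_infty) (I n)) ->
  exists S, Cser (fun n => (c n * I n)%C) S /\
    CRInt_gen (fun t => (lint s p t * g t)%C) (at_point 0) (Rbar_locally p_infty) S.
Proof.
  intros Hp Hs HM Hm Hg HI. assert (Hq : forall n, 0 < p + INR (q n)) by (intros n; assert (P := pos_INR (q n)); lra).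
  refine (CRInt_gen_series (fun n t => (c n * lint s (p + INR (q n)) t)%C) _
    (fun n => Cmod (c n) * (Gamma (p + INR (q n) + 1) / Rpower (Re s) (p + INR (q n) + 1))) _
    (at_point 0) (Rbar_locally p_infty) (fun a b => a = 0 /\ 0 <= b) _ _ HM _).
  - apply ev_pt0_infty. intros y Hy. simpl. split; auto; lra.
  - intros x Y [-> HY]. split; [auto|split; [|split; [|split]]].
    + intros n. apply ex_RInt_Cscal, ex_RInt_lint; auto.
    + destruct (Hm Y) as (m & Em & Bm).
      exists (fun n => (1 + rpow0 Y p) * m n). split.
      { apply (ex_series_scal (V := R_NormedModule) (1 + rpow0 Y p) m); auto. }
      intros n t Ht. rewrite lint_plus_nat by (auto; lra).
      rewrite !Cmod_mult, Cmod_lint, Cmod_R, (Rabs_pos_eq (t ^ q n)) by (apply pow_le; lra).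
      assert (E1 : exp (- (Re s * t)) <= 1).
      { rewrite <- exp_0. destruct (proj1 Ht) as [T|T].
        - left; apply exp_increasing. nra.
        - rewrite <- T, Rmult_0_r, Ropp_0. lra. }
      assert (E2 : rpow0 t p <= rpow0 Y p).
      { unfold rpow0. destruct (Rlt_dec 0 t) as [T|T]; [|apply (rpow0_nonneg Y p)].
        destruct (Rlt_dec 0 Y); [|lra]. unfold Rpower.
        assert (L : p * ln t <= p * ln Y) by (apply Rmult_le_compat_l; [lra|apply ln_le; lra]).
        destruct L as [L|L]; [left; apply exp_increasing; auto|right; rewrite L; auto]. }
      assert (E3 := rpow0_nonneg t p). assert (E4 := Cmod_ge_0 (c n)).
      assert (E5 : 0 <= t ^ q n) by (apply pow_le; lra). specialize (Bm n t Ht).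
      assert (E6 := exp_pos (- (Re s * t))).
      replace (Cmod (c n) * (exp (- (Re s * t)) * rpow0 t p * t ^ q n)) with
        (exp (- (Re s * t)) * rpow0 t p * (Cmod (c n) * t ^ q n)) by ring.
      apply Rmult_le_compat; [apply Rmult_le_pos; lra|apply Rmult_le_pos; lra|nra|auto].
    + intros t Ht. eapply Cser_ext; [|apply (Cser_scal (lint s p t) _ _ (Hg t ltac:(lra)))].
      intros n. cbv beta. rewrite lint_plus_nat by (auto; lra). ring.
    + intros n. exists (fun t => Cmod (c n) * (exp (- (Re s * t)) * rpow0 t (p + INR (q n)))). split; [|split].
      * apply cont_ex_RInt. intros t. apply cont_Rmult; [apply cont_const|apply cont_elint; auto].
      * intros t Ht. rewrite Cmod_mult, Cmod_lint. lra.
      * assert (B := RInt_elint_le (Re s) (p + INR (q n)) Y Hs (Hq n) HY).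
        rewrite (RInt_scal (V := R_CompleteNormedModule) (fun t => exp (- (Re s * t)) * rpow0 t (p + INR (q n)))).
        -- unfold scal; simpl; unfold mult; simpl. apply Rmult_le_compat_l; [apply Cmod_ge_0|exact B].
        -- apply cont_ex_RInt. intros t; apply cont_elint; auto.
  - intros n. apply CRInt_gen_scal; [typeclasses eauto|typeclasses eauto|apply HI].
Qed.

Lemma is_series_bin e th : 0 < e -> 0 <= th < 1 -> is_series (fun n => bin e n * th ^ n) (Rpower (1 - th) (- e)).
Proof.
  intros He Ht. assert (B := binomial_value e (RtoC th) He).
  rewrite Cmod_R, Rabs_pos_eq in B by lra. destruct (B ltac:(lra)) as [B1 _]. clear B.
  rewrite <- RtoC_minus, Cpowr_RtoC, <- RtoC_inv in B1 by (try (assert (P := exp_pos (e * ln (1 - th))); unfold Rpower); lra).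
  cbn [Re fst RtoC] in B1. rewrite Rpower_Ropp.
  eapply is_series_ext; [|exact B1]. intros n. unfold bc. rewrite <- RtoC_pow, <- RtoC_mult. reflexivity.
Qed.

(* Expand [e^(-st)] about a real point [x] with [|x - s| < x]; the terms then sum to the binomial series. *)
Lemma Laplace_pow s p : 0 < Re s -> 0 < p ->
  CRInt_gen (lint s p) (at_point 0) (Rbar_locally p_infty) (RtoC (Gamma (p + 1)) / Cpowr s (p + 1))%C.
Proof.
  intros Hs Hp.
  (* For this x one has x Re s = |s|^2, hence |x - s|^2 = x^2 - |s|^2 < x^2. *)
  set (x := (Re s * Re s + Im s * Im s) / Re s). 
  assert (Ex : x * Re s = Re s * Re s + Im s * Im s) by (unfold x; field; lra).
  assert (Hx : 0 < x) by nra.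
  set (h := (RtoC x - s)%C).
  assert (Hh : Cmod h < x).
  { assert (S := Cmod_sqr h). assert (P := Cmod_ge_0 h). unfold h in S at 3 4 5 6.
    unfold Cminus, Cplus, Copp, RtoC, Re, Im in S; simpl in S. fold (Re s) (Im s) in S.
    assert (Cmod h * Cmod h < x * x) by nra. nra. }
  assert (H0 := Cmod_ge_0 h). assert (Nx : RtoC x <> RtoC 0) by (apply RtoC_neq_0; lra).
  set (th := Cmod h / x).
  assert (Hth : 0 <= th < 1).
  { split; [apply Rle_mult_inv_pos; auto|]. apply Rmult_lt_reg_r with x; auto.
    unfold th, Rdiv. rewrite Rmult_assoc, Rinv_l; lra. }
  assert (Gn : forall n, Gamma (p + INR n + 1) = poch (p + 1) n * Gamma (p + 1)).
  { intros n. replace (p + INR n + 1) with (p + 1 + INR n) by ring. apply Gamma_poch. lra. }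
  destruct (Laplace_series (fun n => (RtoC (/ INR (fact n)) * h ^ n)%C) (fun n => n)
    (fun t => Cexp (h * RtoC t)) (RtoC x) p (fun n => RtoC (Gamma (p + INR n + 1)) / Cpowr (RtoC x) (p + INR n + 1))%C)
    as (S & S1 & S2).
  - auto.
  - auto.
  - apply (ex_series_ext (fun n => Gamma (p + 1) / Rpower x (p + 1) * (bin (p + 1) n * th ^ n))).
    + intros n. cbn [Re fst RtoC]. rewrite Cmod_mult, Cmod_R, Cmod_pow, Rabs_pos_eq by
        (apply Rlt_le, Rinv_0_lt_compat, INR_fact_lt_0).
      rewrite Gn. replace (p + INR n + 1) with (p + 1 + INR n) by ring.
      rewrite (Rpower_plus (p + 1)), Rpower_pow by auto. unfold bin, th, Rdiv. rewrite Rpow_mult_distr, pow_inv, Rinv_mult. eqR; ring.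
    + apply (ex_series_scal (V := R_NormedModule)). eexists. apply is_series_bin; auto; lra.
  - intros Y. exists (fun n => (Cmod h * Rmax 0 Y) ^ n / INR (fact n)). split; [eexists; apply is_series_exp|].
    intros n t Ht. rewrite Cmod_mult, Cmod_R, Cmod_pow, Rabs_pos_eq by
        (apply Rlt_le, Rinv_0_lt_compat, INR_fact_lt_0).
    rewrite Rmax_right by lra. unfold Rdiv. rewrite Rpow_mult_distr.
    replace (/ INR (fact n) * Cmod h ^ n * t ^ n) with (Cmod h ^ n * t ^ n * / INR (fact n)) by ring.
    apply Rmult_le_compat_r; [apply Rlt_le, Rinv_0_lt_compat, INR_fact_lt_0|].
    apply Rmult_le_compat_l; [apply pow_le; auto|apply pow_incr; auto].
  - intros t Ht. eapply Cser_ext; [|apply Cexp_series]. intros n. unfold ec. rewrite Cpow_mult_l, RtoC_pow. ring.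
  - intros n. apply Laplace_pow_real_C; auto. assert (P := pos_INR n). lra.
  - assert (Es : S = (RtoC (Gamma (p + 1)) / Cpowr s (p + 1))%C).
    { assert (B : Cmod (h / RtoC x) < 1).
      { rewrite Cmod_div, Cmod_R, Rabs_pos_eq by (auto; lra). apply Hth. }
      assert (Ns := Re_pos_neq_0 s Hs).
      assert (Q : (1 - h / RtoC x = s / RtoC x)%C) by (unfold h; field; auto).
      assert (Rq : 0 < Re (s / RtoC x)).
      { unfold Cdiv. rewrite Cmult_comm, <- RtoC_inv, Re_scal by lra.
        apply Rmult_lt_0_compat; auto. apply Rinv_0_lt_compat; auto. }
      assert (E : Cpowr s (p + 1) = (Cpowr (RtoC x) (p + 1) * Cpowr (s / RtoC x) (p + 1))%C).
      { rewrite <- Cpowr_mult by auto. f_equal. field; auto. }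
      assert (N1 := Cpowr_neq_0 (RtoC x) (p + 1) Nx). assert (N2 := Cpowr_neq_0 _ (p + 1) (Re_pos_neq_0 _ Rq)).
      assert (V := binomial_value (p + 1) (h / RtoC x) ltac:(lra) B). rewrite Q in V.
      rewrite E. apply (Cser_unique _ _ _ S1).
      replace (RtoC (Gamma (p + 1)) / (Cpowr (RtoC x) (p + 1) * Cpowr (s / RtoC x) (p + 1)))%C with
        (RtoC (Gamma (p + 1)) / Cpowr (RtoC x) (p + 1) * / Cpowr (s / RtoC x) (p + 1))%C by (field; auto).
      eapply Cser_ext; [|apply (Cser_scal _ _ _ V)]. intros n. cbv beta.
      rewrite Gn. replace (p + INR n + 1) with (p + 1 + INR n) by ring.
      rewrite (Cpowr_plus _ (p + 1)), Cpowr_INR by auto. unfold bc, bin, Rdiv. rewrite !RtoC_mult.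
      unfold Cdiv. rewrite Cpow_mult_l, Cpow_inv by auto. assert (Nn := Cpow_nz (RtoC x) n Nx). field; auto. }
    rewrite <- Es. refine (CRInt_gen_ext _ _ _ _ _ _ S2).
    apply filter_forall. intros ab t _. unfold lint.
    replace (- (s * RtoC t))%C with (- (RtoC x * RtoC t) + h * RtoC t)%C by (unfold h; ring).
    rewrite Cexp_plus. ring.
Qed.

(* The [q]-th forward difference at 0 divided by [q!]. *)
Definition nd (q : nat) (f : nat -> R) : R :=
  fsum (S q) (fun n => (-1) ^ (q - n) / (INR (fact n) * INR (fact (q - n))) * f n).

Lemma fsum_S_l n f : fsum (S n) f = f O + fsum n (fun i => f (S i)).
Proof.
  induction n as [|n IH]; [simpl; ring|].
  change (fsum (S (S n)) f) with (fsum (S n) f + f (S n)). rewrite IH. simpl. ring.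
Qed.

Lemma fsum_plus n f g : fsum n (fun i => f i + g i) = fsum n f + fsum n g.
Proof. induction n as [|n IH]; simpl; [|rewrite IH]; ring. Qed.

Lemma inv_fact_S n : INR (S n) * / INR (fact (S n)) = / INR (fact n).
Proof.
  rewrite fact_simpl, mult_INR. assert (H := INR_fact_neq_0 n).
  assert (K : INR (S n) <> 0) by (apply not_0_INR; lia). field; auto.
Qed.

Lemma nd_S q f : INR (S q) * nd (S q) f = nd q (fun n => f (S n) - f n).
Proof.
  unfold nd. rewrite <- fsum_mult.
  transitivity (fsum (S (S q)) (fun n =>
      INR n * ((-1) ^ (S q - n) / (INR (fact n) * INR (fact (S q - n))) * f n)) +
    fsum (S (S q)) (fun n =>
      INR (S q - n) * ((-1) ^ (S q - n) / (INR (fact n) * INR (fact (S q - n))) * f n))).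
  { rewrite <- fsum_plus. apply fsum_ext. intros n Hn. rewrite minus_INR by lia. ring. }
  rewrite fsum_S_l. change (fsum (S (S q)) (fun n =>
      INR (S q - n) * ((-1) ^ (S q - n) / (INR (fact n) * INR (fact (S q - n))) * f n))) with
    (fsum (S q) (fun n =>
      INR (S q - n) * ((-1) ^ (S q - n) / (INR (fact n) * INR (fact (S q - n))) * f n)) +
     INR (S q - S q) * ((-1) ^ (S q - S q) / (INR (fact (S q)) * INR (fact (S q - S q))) * f (S q))).
  rewrite Nat.sub_diag. simpl (INR 0). rewrite !Rmult_0_l, Rplus_0_l, Rplus_0_r, <- fsum_plus.
  apply fsum_ext. intros n Hn. replace (S q - S n)%nat with (q - n)%nat by lia.
  replace (S q - n)%nat with (S (q - n)) by lia.
  unfold Rdiv. rewrite !Rinv_mult.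
  transitivity ((-1) ^ (q - n) * (INR (S n) * / INR (fact (S n))) * / INR (fact (q - n)) * f (S n) -
    (-1) ^ (q - n) * (INR (S (q - n)) * / INR (fact (S (q - n)))) * / INR (fact n) * f n);
    [simpl pow; ring|]. rewrite !inv_fact_S. ring.
Qed.

Lemma nd_scal q c f : nd q (fun n => c * f n) = c * nd q f.
Proof. unfold nd. rewrite <- fsum_mult. apply fsum_ext. intros; ring. Qed.

Lemma nd_ext q f g : (forall n, f n = g n) -> nd q f = nd q g.
Proof. intros H. apply fsum_ext. intros n _. rewrite H. reflexivity. Qed.

Lemma poch_S_l x n : poch x (S n) = x * poch (x + 1) n.
Proof.
  induction n as [|n IH]; [simpl; ring|]. change (poch x (S (S n))) with (poch x (S n) * (x + INR (S n))).
  rewrite IH, S_INR. cbn [poch]. ring.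
Qed.

Lemma poch_plus x n m : poch x (n + m) = poch x n * poch (x + INR n) m.
Proof.
  induction m as [|m IH]; [rewrite Nat.add_0_r; simpl; ring|].
  rewrite Nat.add_succ_r. cbn [poch]. rewrite IH, plus_INR. ring.
Qed.

(** As a function of n, (n + y)_q is a monic polynomial of degree q. One difference turns (n +
    y)_(q+1) into (q + 1) (n + y + 1)_q. *)
Lemma nd_poch q y : nd q (fun n => poch (INR n + y) q) = 1.
Proof.
  revert y. induction q as [|q IH]; intros y; [unfold nd; simpl; field|].
  apply Rmult_eq_reg_l with (INR (S q)); [|apply not_0_INR; lia].
  rewrite nd_S, (nd_ext _ _ (fun n => INR (S q) * poch (INR n + (y + 1)) q)).
  - rewrite nd_scal, IH. reflexivity.
  - intros n. rewrite (poch_S_l (INR n + y)). cbn [poch]. rewrite !S_INR.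
    replace (INR n + 1 + y) with (INR n + (y + 1)) by ring. replace (INR n + y + 1) with (INR n + (y + 1)) by ring.
    ring.
Qed.

Lemma bin_le e n : 0 < e -> bin e n <= 2 ^ n * Rpower (1 - 1 / 2) (- e).
Proof.
  intros He. assert (S := is_series_bin e (1 / 2) He ltac:(lra)).
  apply (is_series_term_le _ _ n) in S.
  - apply Rmult_le_reg_r with ((1 / 2) ^ n); [apply pow_lt; lra|]. eapply Rle_trans; [exact S|].
    right. assert (K : 2 ^ n * (1 / 2) ^ n = 1) by (rewrite <- Rpow_mult_distr; replace (2 * (1 / 2)) with 1 by field; apply pow1).
    transitivity (2 ^ n * (1 / 2) ^ n * Rpower (1 - 1 / 2) (- e)); [rewrite K|]; ring.
  - intros k. apply Rmult_le_pos; [apply Rlt_le, bin_pos; auto|apply pow_le; lra].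
Qed.

(** The growth of the central binomial coefficients, read off from a single term of the binomial
    series at 1/2. It determines how small x has to be in [bessel_sum]. *)
Lemma bin_central_le nu m : 0 < nu ->
  bin (INR m + nu + 1) m <= 4 ^ m * Rpower (1 - 1 / 2) (- (nu + 1)).
Proof.
  intros Hn. assert (P := pos_INR m). eapply Rle_trans; [apply bin_le; lra|].
  right. replace (- (INR m + nu + 1)) with (- INR m + - (nu + 1)) by ring.
  rewrite Rpower_plus, (Rpower_Ropp _ (INR m)), Rpower_pow, <- pow_inv by lra.
  replace (/ (1 - 1 / 2)) with 2 by field. replace (4 ^ m) with (2 ^ m * 2 ^ m) by (rewrite <- Rpow_mult_distr; f_equal; ring).
  ring.
Qed.

Lemma Cser_geom x : Cmod x < 1 -> Cser (fun n => (x ^ n)%C) (/ (1 - x))%C.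
Proof.
  intros H. assert (V := binomial_value 1 x Rlt_0_1 H).
  rewrite Cpowr_1 in V.
  - eapply Cser_ext; [|exact V]. intros n. unfold bc.
    replace (bin 1 n) with 1; [ring|]. induction n as [|n IH]; [rewrite bin_0; auto|].
    apply Rmult_eq_reg_l with (INR (S n)); [|apply not_0_INR; lia]. rewrite bin_S, <- IH, S_INR. ring.
  - intros E. assert (K : x = RtoC 1) by (replace x with (1 - (1 - x))%C by ring; rewrite E; ring).
    rewrite K, Cmod_1 in H. lra.
Qed.

Lemma Cmod_Re_pos x : Cmod x < 1 -> 0 < Re (1 + x).
Proof.
  intros H. assert (B := re_le_Cmod x). unfold Cplus, RtoC; cbn [Re fst].
  apply Rabs_le_between in B. unfold Re in *. lra.
Qed.

(* Expand the powers of [1 + x]: the coefficient of [x^q] is [nd_poch], that is 1. *)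
Lemma bessel_sum nu x : 0 < nu -> Cmod x <= / 16 ->
  Cser (fun m => (RtoC (bin (INR m + nu + 1) m) * x ^ m * / Cpowr (1 + x) (nu + INR (2 * m) + 1))%C) (/ (1 - x))%C.
Proof.
  intros Hn Hx. assert (H0 := Cmod_ge_0 x). assert (Hm1 : Cmod (- x) = Cmod x) by apply Cmod_opp.
  set (e := fun m => nu + INR (2 * m) + 1).
  assert (He : forall m, 0 < e m) by (intros m; unfold e; assert (P := pos_INR (2 * m)); lra).
  assert (Hc : forall m, 0 < bin (INR m + nu + 1) m) by (intros m; apply bin_pos; assert (P := pos_INR m); lra).
  destruct (Cser_diag (fun m i => (RtoC (bin (INR m + nu + 1) m) * x ^ m * bc (e m) (- x) i)%C)
    (fun m i => bin (INR m + nu + 1) m * Cmod x ^ m * (bin (e m) i * Cmod x ^ i))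
    (fun m => (RtoC (bin (INR m + nu + 1) m) * x ^ m * / Cpowr (1 + x) (e m))%C)
    (fun m => bin (INR m + nu + 1) m * Cmod x ^ m * Rpower (1 - Cmod x) (- e m))) as (S & S1 & S2).
  - intros m i. unfold bc. rewrite !Cmod_mult, !Cmod_pow, !Cmod_R, Hm1, !Rabs_pos_eq by (apply Rlt_le; auto using bin_pos).
    lra.
  - intros m. apply (is_series_scal (V := R_NormedModule)). apply is_series_bin; auto. lra.
  - set (K := Rpower (1 - 1 / 2) (- (nu + 1)) * Rpower (1 - Cmod x) (- (nu + 1))).
    (* The majorant is geometric with ratio 4 |x| / (1 - |x|)^2, below 1 for |x| <= 1/16. *)
    set (y := / (1 - Cmod x)).
    assert (Hy : 0 < y <= 16 / 15).
    { unfold y. split; [apply Rinv_0_lt_compat; lra|]. replace (16 / 15) with (/ (15 / 16)) by field.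
      apply Rinv_le_contravar; lra. }
    apply (ex_series_le (V := R_CompleteNormedModule) _ (fun m => K * (4 * Cmod x * (y * y)) ^ m)).
    + intros m. assert (Pw := exp_pos (- e m * ln (1 - Cmod x))). fold (Rpower (1 - Cmod x) (- e m)) in Pw.
      unfold norm; simpl. unfold abs; simpl.
      rewrite Rabs_pos_eq by (apply Rmult_le_pos; [apply Rmult_le_pos; [apply Rlt_le; auto|apply pow_le; auto]|lra]).
      assert (E : Rpower (1 - Cmod x) (- e m) = Rpower (1 - Cmod x) (- (nu + 1)) * (y * y) ^ m).
      { unfold e. replace (- (nu + INR (2 * m) + 1)) with (- (nu + 1) + - INR (2 * m)) by ring.
        rewrite Rpower_plus, (Rpower_Ropp _ (INR _)), Rpower_pow, <- pow_inv by lra. fold y.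
        rewrite pow_mult. do 2 f_equal. ring. }
      rewrite E. assert (B := bin_central_le nu m Hn). unfold K. rewrite !Rpow_mult_distr.
      assert (P1 : 0 <= Cmod x ^ m * (Rpower (1 - Cmod x) (- (nu + 1)) * (y ^ m * y ^ m))).
      { apply Rmult_le_pos; [apply pow_le; auto|]. apply Rmult_le_pos; [apply Rlt_le, exp_pos|].
        apply Rmult_le_pos; apply pow_le; lra. }
      apply (Rmult_le_compat_r _ _ _ P1) in B. lra.
    + apply (ex_series_scal (V := R_NormedModule) K (fun m => (4 * Cmod x * (y * y)) ^ m)). apply ex_series_geom.
      rewrite Rabs_pos_eq by (apply Rmult_le_pos; nra). nra.
  - intros m. apply Cser_scal. replace (1 + x)%C with (1 - - x)%C by ring. apply binomial_value; auto.
    rewrite Hm1; lra.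
  - assert (E : S = (/ (1 - x))%C); [|rewrite <- E; exact S1].
    apply (Cser_unique _ _ _ S2). eapply Cser_ext; [|apply Cser_geom; lra]. intros q. cbv beta.
    rewrite (csum_ext _ _ (fun n => (x ^ q * RtoC ((-1) ^ (q - n) / (INR (fact n) * INR (fact (q - n))) *
      poch (INR n + (nu + 1)) q))%C)).
    + rewrite csum_mult, csum_RtoC. change (fsum (Datatypes.S q) _) with (nd q (fun n => poch (INR n + (nu + 1)) q)).
      rewrite nd_poch. ring.
    + intros n Hnq. unfold bc. 
      assert (Ep : poch (INR n + (nu + 1)) q = poch (INR n + (nu + 1)) n * poch (e n) (q - n)).
      (* [e n] = 2n + nu + 1 is the factor following the last one of (n + nu + 1)_n, so the two
         Pochhammer symbols join. *)
      { replace q with (n + (q - n))%nat at 1 by lia. rewrite poch_plus. do 2 f_equal. unfold e.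
        rewrite mult_INR. simpl. ring. }
      rewrite Ep. unfold bin. replace (INR n + nu + 1) with (INR n + (nu + 1)) by ring.
      replace (- x)%C with (RtoC (-1) * x)%C by (apply C_ext; simpl; ring).
      rewrite Cpow_mult_l, <- RtoC_pow.
      replace (x ^ q)%C with (x ^ n * x ^ (q - n))%C by (rewrite <- Cpow_add_r; f_equal; lia).
      assert (F1 := INR_fact_neq_0 n). assert (F2 := INR_fact_neq_0 (q - n)).
      replace ((-1) ^ (q - n) / (INR (fact n) * INR (fact (q - n))) *
        (poch (INR n + (nu + 1)) n * poch (e n) (q - n))) with
        (poch (INR n + (nu + 1)) n / INR (fact n) * (poch (e n) (q - n) / INR (fact (q - n))) * (-1) ^ (q - n))
        by (field; auto).
      rewrite !RtoC_mult. ring.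
Qed.

Ltac normR := match goal with |- norm ?x <= ?y => change (Rabs x <= y) end.

(** With [Rs] and [ws] below, the quantities r, R and w of the theorem. *)
Definition rs (b : R) (s : C) : C := Cpowr (s * s + RtoC (b * b)) (1 / 2).

Definition Rs (b : R) (s : C) : C := (s + rs b s)%C.

Definition ws (b : R) (s : C) : C := (- (Ci * RtoC b) / Rs b s)%C.

Lemma Cmod_triang_rev z w : Cmod z - Cmod w <= Cmod (z + w).
Proof.
  assert (H := Cmod_triangle (z + w) (- w)). rewrite Cmod_opp in H.
  replace (z + w + - w)%C with z in H by ring. lra.
Qed.

Lemma rs_sqr b s : 0 < b -> b < Re s -> (rs b s * rs b s)%C = (s * s + RtoC (b * b))%C.
Proof.
  intros Hb Hs. apply Cpowr_half_sqr. apply Cmod_gt_0.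
  eapply Rlt_le_trans; [|apply Cmod_triang_rev]. rewrite Cmod_mult, Cmod_R, Rabs_pos_eq by nra.
  assert (B := Rle_trans _ _ _ (Rle_abs _) (re_le_Cmod s)). nra.
Qed.

Lemma rs_Re b s : 0 < b -> b < Re s -> 0 <= Re (rs b s).
Proof.
  intros Hb Hs. apply Cpowr_half_Re. apply Cmod_gt_0.
  eapply Rlt_le_trans; [|apply Cmod_triang_rev]. rewrite Cmod_mult, Cmod_R, Rabs_pos_eq by nra.
  assert (B := Rle_trans _ _ _ (Rle_abs _) (re_le_Cmod s)). nra.
Qed.

Lemma rs_neq_0 b s : 0 < b -> b < Re s -> rs b s <> RtoC 0.
Proof.
  intros Hb Hs E. assert (H := rs_sqr b s Hb Hs). rewrite E, Cmult_0_l in H.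
  assert (K : Cmod (s * s + RtoC (b * b)) = 0) by (rewrite <- H; apply Cmod_0).
  assert (T := Cmod_triang_rev (s * s) (RtoC (b * b))). rewrite K, Cmod_mult, Cmod_R, Rabs_pos_eq in T by nra.
  assert (B := Rle_trans _ _ _ (Rle_abs _) (re_le_Cmod s)). nra.
Qed.

Lemma Rs_Re b s : 0 < b -> b < Re s -> Re s <= Re (Rs b s).
Proof. intros Hb Hs. assert (H := rs_Re b s Hb Hs). unfold Rs, Cplus, Re in *; cbn [fst]. lra. Qed.

Lemma Rs_neq_0 b s : 0 < b -> b < Re s -> Rs b s <> RtoC 0.
Proof. intros Hb Hs. apply Re_pos_neq_0. assert (H := Rs_Re b s Hb Hs). lra. Qed.

Lemma Cmod_ws b s : 0 < b -> b < Re s -> Cmod (ws b s) <= b / Re s.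
Proof.
  intros Hb Hs. assert (N := Rs_neq_0 b s Hb Hs). unfold ws. rewrite Cmod_div by auto.
  rewrite Cmod_opp, Cmod_mult, Cmod_R, Rabs_pos_eq by lra.
  replace (Cmod Ci) with 1 by (unfold Cmod, Ci; cbn [fst snd]; replace (0 ^ 2 + 1 ^ 2) with 1 by ring; symmetry; apply sqrt_1).
  rewrite Rmult_1_l. apply Rmult_le_compat_l; [lra|]. apply Rinv_le_contravar; [lra|].
  assert (H := Rs_Re b s Hb Hs). assert (B := Rle_trans _ _ _ (Rle_abs _) (re_le_Cmod (Rs b s))). lra.
Qed.

Lemma ws_sqr b s : 0 < b -> b < Re s -> (ws b s * ws b s)%C = (- RtoC (b * b) / (Rs b s * Rs b s))%C.
Proof.
  intros Hb Hs. assert (N := Rs_neq_0 b s Hb Hs). unfold ws. rewrite RtoC_mult.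
  transitivity ((Ci * Ci) * RtoC b * RtoC b / (Rs b s * Rs b s))%C; [field; auto|]. rewrite Ci_sqr. field; auto.
Qed.

(** Both identities come from w^2 = -b^2 / R^2 and b^2 = (r - s)(r + s). *)
Lemma one_plus_ws b s : 0 < b -> b < Re s ->
  (1 + ws b s * ws b s)%C = (2 * s / Rs b s)%C /\ (1 - ws b s * ws b s)%C = (2 * rs b s / Rs b s)%C.
Proof.
  intros Hb Hs. assert (N := Rs_neq_0 b s Hb Hs). rewrite ws_sqr by auto.
  assert (E : RtoC (b * b) = ((rs b s - s) * Rs b s)%C).
  { unfold Rs. transitivity (rs b s * rs b s - s * s)%C; [rewrite rs_sqr by auto; ring|ring]. }
  rewrite E. split.
  - transitivity ((Rs b s + s - rs b s) / Rs b s)%C; [field; auto|]. f_equal. unfold Rs. ring.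
  - transitivity ((Rs b s - s + rs b s) / Rs b s)%C; [field; auto|]. f_equal. unfold Rs. ring.
Qed.

Definition bj (nu : R) (m : nat) : R := (-1) ^ m / (INR (fact m) * Gamma (INR m + nu + 1)).

Lemma Gamma_ge nu m : 0 < nu -> INR (fact m) * Gamma (nu + 1) <= Gamma (INR m + nu + 1).
Proof.
  intros Hn. replace (INR m + nu + 1) with (nu + 1 + INR m) by ring. rewrite Gamma_poch by lra.
  assert (P := Gamma_pos (nu + 1) ltac:(lra)). apply Rmult_le_compat_r; [lra|].
  induction m as [|m IH]; [simpl; lra|]. cbn [poch]. rewrite fact_simpl, mult_INR, S_INR, Rmult_comm.
  assert (Q := pos_INR m). assert (F := INR_fact_lt_0 m). apply Rmult_le_compat; lra.
Qed.

Lemma bj_abs nu m : 0 < nu -> Rabs (bj nu m) <= / INR (fact m) * / INR (fact m) * / Gamma (nu + 1).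
Proof.
  intros Hn. assert (P := Gamma_pos (nu + 1) ltac:(lra)). assert (F := INR_fact_lt_0 m).
  assert (G := Gamma_ge nu m Hn). unfold bj, Rdiv. rewrite Rabs_mult, pow_1_abs, Rmult_1_l.
  assert (L : 0 < INR (fact m) * Gamma (nu + 1)) by (apply Rmult_lt_0_compat; auto).
  rewrite Rabs_pos_eq by (apply Rlt_le, Rinv_0_lt_compat, Rmult_lt_0_compat; lra).
  rewrite <- !Rinv_mult, Rmult_assoc. apply Rinv_le_contravar.
  - apply Rmult_lt_0_compat; auto.
  - apply Rmult_le_compat_l; lra.
Qed.

Lemma inv_fact_le_1 m : 0 < / INR (fact m) <= 1.
Proof.
  assert (F := INR_fact_lt_0 m). split; [apply Rinv_0_lt_compat; auto|].
  rewrite <- Rinv_1. apply Rinv_le_contravar; [lra|]. apply (le_INR 1). assert (H := lt_O_fact m). lia.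
Qed.

Lemma ex_series_bj nu y : 0 < nu -> ex_series (fun m => bj nu m * y ^ (2 * m)).
Proof.
  intros Hn. assert (P := Gamma_pos (nu + 1) ltac:(lra)).
  apply (ex_series_le (V := R_CompleteNormedModule) _ (fun m => / Gamma (nu + 1) * ((y * y) ^ m / INR (fact m)))).
  - intros m. normR. rewrite Rabs_mult, pow_mult.
    replace (y ^ 2) with (y * y) by ring. rewrite (Rabs_pos_eq ((y * y) ^ m)) by (apply pow_le, Rle_0_sqr).
    assert (B := bj_abs nu m Hn). assert (Q : 0 <= (y * y) ^ m) by (apply pow_le, Rle_0_sqr).
    assert (F := inv_fact_le_1 m). assert (IG : 0 < / Gamma (nu + 1)) by (apply Rinv_0_lt_compat; auto).
    apply Rle_trans with (/ INR (fact m) * / Gamma (nu + 1) * (y * y) ^ m); [|right; unfold Rdiv; ring].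
    apply Rmult_le_compat_r; auto. eapply Rle_trans; [exact B|]. apply Rmult_le_compat_r; [lra|]. nra.
  - apply (ex_series_scal (V := R_NormedModule)). eexists; apply is_series_exp.
Qed.

Lemma besselJ_eq nu x : 0 < nu ->
  besselJ nu x = rpow0 (x / 2) nu * Series (fun m => bj nu m * (x / 2) ^ (2 * m)).
Proof.
  intros Hn. unfold besselJ. rewrite <- Series_scal_l. apply Series_ext. intros m. unfold bj. ring.
Qed.

Lemma rpow0_half b t nu : 0 < b -> rpow0 (b * t / 2) nu = Rpower (b / 2) nu * rpow0 t nu.
Proof. intros Hb. replace (b * t / 2) with (b / 2 * t) by field. apply rpow0_scale; lra. Qed.

Lemma Gamma_central nu m : 0 < nu ->
  Gamma (nu + INR (2 * m) + 1) = bin (INR m + nu + 1) m * (INR (fact m) * Gamma (INR m + nu + 1)).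
Proof.
  intros Hn. assert (Q := pos_INR m). replace (nu + INR (2 * m) + 1) with (INR m + nu + 1 + INR m) by
    (rewrite mult_INR; simpl; ring). rewrite Gamma_poch by lra. unfold bin.
  assert (F := INR_fact_neq_0 m). field; auto.
Qed.

(* With [x = w^2]: [1 + x = 2s/R] and [1 - x = 2r/R], so the termwise transform is [bessel_sum]. *)
Lemma Laplace_bessel nu b s : 0 < nu -> 0 < b -> 4 * b <= Re s ->
  CRInt_gen (fun t => (Cexp (- (s * RtoC t)) * RtoC (besselJ nu (b * t)))%C) (at_point 0) (Rbar_locally p_infty)
    (RtoC (Rpower b nu) / (rs b s * Cpowr (Rs b s) nu))%C.
Proof.
  intros Hn Hb Hs0. assert (Hs : b < Re s) by lra.
  set (K := Rpower (b / 2) nu). assert (PK : 0 < K) by apply exp_pos.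
  set (x := (ws b s * ws b s)%C).
  (* |w| <= b / Re s <= 1/4, so its square lies in the region covered by [bessel_sum]. *)
  assert (Hx : Cmod x <= / 16).
  { unfold x. rewrite Cmod_mult. assert (W := Cmod_ws b s Hb Hs). assert (W0 := Cmod_ge_0 (ws b s)).
    assert (b / Re s <= 1 / 4).
    { apply Rmult_le_reg_r with (Re s); [lra|]. unfold Rdiv. rewrite Rmult_assoc, Rinv_l; lra. }
    nra. }
  assert (GP : forall m, 0 < INR (fact m) * Gamma (INR m + nu + 1)).
  { intros m. apply Rmult_lt_0_compat; [apply INR_fact_lt_0|apply Gamma_pos]. assert (Q := pos_INR m). lra. }
  assert (Ab : forall m, Cmod (RtoC (K * (bj nu m * (b / 2) ^ (2 * m)))) = K * (Rabs (bj nu m) * (b / 2) ^ (2 * m))).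
  { intros m. rewrite Cmod_R, !Rabs_mult, (Rabs_pos_eq K), (Rabs_pos_eq ((b / 2) ^ _)) by (try apply pow_le; lra). reflexivity. }
  destruct (Laplace_series (fun m => RtoC (K * (bj nu m * (b / 2) ^ (2 * m)))) (fun m => (2 * m)%nat)
    (fun t => RtoC (K * Series (fun m => bj nu m * (b * t / 2) ^ (2 * m)))) s nu
    (fun m => RtoC (Gamma (nu + INR (2 * m) + 1)) / Cpowr s (nu + INR (2 * m) + 1))%C) as (S & S1 & S2).
  - auto.
  - lra.
  (* The Gamma factors of the Bessel coefficient and of the transform combine to a central binomial
     number of size 4^m, absorbed by the 4^(-m) of (b/2)^(2m). There remains the ratio (b / Re
     s)^2. *)
  - set (K2 := K * / Rpower (Re s) (nu + 1) * Rpower (1 - 1 / 2) (- (nu + 1))).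
    apply (ex_series_le (V := R_CompleteNormedModule) _ (fun m => K2 * ((b / Re s) * (b / Re s)) ^ m)).
    + intros m. assert (PG := Gamma_central nu m Hn). assert (Pp := exp_pos ((nu + INR (2 * m) + 1) * ln (Re s))).
      fold (Rpower (Re s) (nu + INR (2 * m) + 1)) in Pp.
      assert (E : K * (Rabs (bj nu m) * (b / 2) ^ (2 * m)) *
          (Gamma (nu + INR (2 * m) + 1) / Rpower (Re s) (nu + INR (2 * m) + 1)) =
          K * / Rpower (Re s) (nu + 1) * bin (INR m + nu + 1) m * (/ 4) ^ m * ((b / Re s) * (b / Re s)) ^ m).
      { rewrite PG. unfold bj, Rdiv. rewrite Rabs_mult, pow_1_abs, Rmult_1_l.
        rewrite Rabs_pos_eq by (apply Rlt_le, Rinv_0_lt_compat, GP).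
        replace (nu + INR (2 * m) + 1) with (nu + 1 + INR (2 * m)) by ring.
        rewrite Rpower_plus, Rpower_pow, !pow_mult, Rinv_mult by lra.
        replace ((b * / Re s * (b * / Re s)) ^ m) with (b ^ m * b ^ m * / ((Re s ^ 2) ^ m)).
        - replace (((b * / 2) ^ 2) ^ m) with (b ^ m * b ^ m * (/ 4) ^ m).
          + assert (G := GP m). assert (Rpower (Re s) (nu + 1) <> 0) by (apply Rgt_not_eq, exp_pos).
            assert ((Re s ^ 2) ^ m <> 0) by (apply pow_nonzero, pow_nonzero; lra). assert (G1 := INR_fact_neq_0 m).
            assert (Gamma (INR m + nu + 1) <> 0) by (intros Z; rewrite Z, Rmult_0_r in G; lra).
            field. repeat split; auto.
          + rewrite <- !Rpow_mult_distr. f_equal. field.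
        - rewrite <- pow_inv, <- !Rpow_mult_distr. f_equal. field. lra. }
      rewrite Ab, E. normR.
      assert (B := bin_central_le nu m Hn). assert (B0 : 0 < bin (INR m + nu + 1) m) by (apply bin_pos; assert (Q := pos_INR m); lra).
      assert (PR : 0 < / Rpower (Re s) (nu + 1)) by (apply Rinv_0_lt_compat, exp_pos).
      assert (P4 : 0 < (/ 4) ^ m) by (apply pow_lt; lra).
      assert (Pq : 0 <= (b / Re s * (b / Re s)) ^ m) by (apply pow_le, Rle_0_sqr).
      rewrite Rabs_pos_eq by (repeat first [assumption|apply Rlt_le; assumption|apply Rmult_le_pos]).
      apply Rmult_le_compat_r; auto. unfold K2. rewrite Rmult_assoc. apply Rmult_le_compat_l; [apply Rmult_le_pos; lra|].
      apply (Rmult_le_compat_r _ _ _ (Rlt_le _ _ P4)) in B. eapply Rle_trans; [exact B|]. right.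
      transitivity (4 ^ m * (/ 4) ^ m * Rpower (1 - 1 / 2) (- (nu + 1))); [ring|].
      rewrite <- Rpow_mult_distr. replace (4 * / 4) with 1 by field. rewrite pow1. ring.
    + apply (ex_series_scal (V := R_NormedModule) K2 (fun m => (b / Re s * (b / Re s)) ^ m)). apply ex_series_geom.
      assert (0 < b / Re s < 1).
      { split; [apply Rdiv_lt_0_compat; lra|]. apply Rmult_lt_reg_r with (Re s); [lra|].
        unfold Rdiv. rewrite Rmult_assoc, Rinv_l; lra. }
      rewrite Rabs_pos_eq; nra.
  - intros Y. assert (PG := Gamma_pos (nu + 1) ltac:(lra)).
    exists (fun m => K * / Gamma (nu + 1) * ((b / 2 * Y * (b / 2 * Y)) ^ m / INR (fact m))). split.
    + apply (ex_series_scal (V := R_NormedModule) (K * / Gamma (nu + 1)) (fun m => (b / 2 * Y * (b / 2 * Y)) ^ m / INR (fact m))).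
      eexists; apply is_series_exp.
    + intros m t Ht. rewrite Ab. assert (B := bj_abs nu m Hn). assert (F := inv_fact_le_1 m).
      assert (IG : 0 < / Gamma (nu + 1)) by (apply Rinv_0_lt_compat; auto).
      assert (T : (b / 2) ^ (2 * m) * t ^ (2 * m) <= (b / 2 * Y * (b / 2 * Y)) ^ m).
      { rewrite <- Rpow_mult_distr, pow_mult. apply pow_incr. split; [apply pow2_ge_0|].
        assert (0 <= b / 2 * t <= b / 2 * Y) by nra. simpl. nra. }
      assert (T0 : 0 <= (b / 2) ^ (2 * m) * t ^ (2 * m)) by (apply Rmult_le_pos; apply pow_le; lra).
      apply Rle_trans with (K * (/ INR (fact m) * / Gamma (nu + 1)) * ((b / 2) ^ (2 * m) * t ^ (2 * m))).
      * replace (K * (Rabs (bj nu m) * (b / 2) ^ (2 * m)) * t ^ (2 * m)) with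
          (K * Rabs (bj nu m) * ((b / 2) ^ (2 * m) * t ^ (2 * m))) by ring.
        apply Rmult_le_compat_r; auto. apply Rmult_le_compat_l; [lra|]. eapply Rle_trans; [exact B|].
        apply Rmult_le_compat_r; [lra|]. nra.
      * unfold Rdiv. replace (K * / Gamma (nu + 1) * ((b * / 2 * Y * (b * / 2 * Y)) ^ m * / INR (fact m))) with
          (K * (/ INR (fact m) * / Gamma (nu + 1)) * (b / 2 * Y * (b / 2 * Y)) ^ m) by (unfold Rdiv; ring).
        apply Rmult_le_compat_l; auto. apply Rmult_le_pos; [lra|]. apply Rmult_le_pos; lra.
  - intros t Ht.
    assert (H := is_series_scal_l K _ _ (Series_correct _ (ex_series_bj nu (b * t / 2) Hn))).
    split.
    + eapply is_series_ext; [|exact H]. intros m. rewrite <- RtoC_mult. cbn [Re fst RtoC].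
      replace (b * t / 2) with (b / 2 * t) by field. rewrite Rpow_mult_distr. eqR. unfold scal; cbn -[pow Nat.mul bj]; unfold mult; cbn -[pow Nat.mul bj]. ring.
    + apply (is_series_ext (fun _ => 0)); [intros m; rewrite <- RtoC_mult; reflexivity|].
      assert (Z := is_series_fin (fun _ => 0) 0 (fun _ _ => eq_refl)). rewrite sum_O in Z. exact Z.
  - intros m. apply Laplace_pow; [lra|]. assert (Q := pos_INR (2 * m)). lra.
  - assert (E : S = (RtoC (Rpower b nu) / (rs b s * Cpowr (Rs b s) nu))%C).
    { assert (NR := Rs_neq_0 b s Hb Hs). assert (Nr := rs_neq_0 b s Hb Hs). assert (RR := Rs_Re b s Hb Hs).
      destruct (one_plus_ws b s Hb Hs) as [E1 E2]. fold x in E1, E2.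
      (* s = h (1 + x), so powers of s split into powers of h and of 1 + x, both in the right
         half-plane. *)
      set (h := (Rs b s / 2)%C).
      assert (Eh : Rs b s = (RtoC 2 * h)%C) by (unfold h; field).
      assert (Hh : 0 < Re h).
      { unfold h, Cdiv. rewrite Cmult_comm, <- RtoC_inv, Re_scal by lra. lra. }
      assert (Nh := Re_pos_neq_0 h Hh).
      assert (Hx1 : 0 < Re (1 + x)) by (apply Cmod_Re_pos; lra). assert (Nx := Re_pos_neq_0 _ Hx1).
      assert (Es : s = (h * (1 + x))%C) by (rewrite E1; unfold h; field; auto).
      assert (N1 := Cpowr_neq_0 h nu Nh). assert (P2 := exp_pos (nu * ln 2)). fold (Rpower 2 nu) in P2.
      assert (ER : Cpowr (Rs b s) nu = (RtoC (Rpower 2 nu) * Cpowr h nu)%C).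
      { rewrite Eh, Cpowr_mult by (auto; simpl; lra). rewrite Cpowr_RtoC by lra. reflexivity. }
      assert (EK : Rpower b nu = Rpower 2 nu * K).
      { unfold K. rewrite Rpower_mult_distr by lra. f_equal. field. }
      assert (N2 : RtoC (Rpower 2 nu) <> RtoC 0) by (apply RtoC_neq_0; lra).
      assert (V := Cser_scal (RtoC K / (h * Cpowr h nu))%C _ _ (bessel_sum nu x Hn Hx)).
      assert (EV : (RtoC K / (h * Cpowr h nu) * / (1 - x))%C = (RtoC (Rpower b nu) / (rs b s * Cpowr (Rs b s) nu))%C).
      { rewrite E2, ER, EK, RtoC_mult, Eh. field. repeat split; auto. }
      rewrite <- EV. apply (Cser_unique _ _ _ S1). eapply Cser_ext; [|exact V]. intros m. cbv beta.
      assert (N3 := Cpowr_neq_0 (1 + x) (nu + INR (2 * m) + 1) Nx).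
      assert (Ep : Cpowr s (nu + INR (2 * m) + 1) = (h * Cpowr h nu * h ^ (2 * m) * Cpowr (1 + x) (nu + INR (2 * m) + 1))%C).
      { rewrite Es, Cpowr_mult by auto. f_equal.
        rewrite Cpowr_plus, Cpowr_1, Cpowr_plus, Cpowr_INR by auto. ring. }
      assert (N4 := Cpow_nz h (2 * m) Nh).
      (* x h^2 = w^2 R^2 / 4 = -b^2 / 4 accounts for the signs and the powers of b/2 in the Bessel
         series. *)
      assert (Ex : (x ^ m * h ^ (2 * m))%C = RtoC ((-1) ^ m * (b / 2) ^ (2 * m))).
      { transitivity ((x * h ^ 2) ^ m)%C; [rewrite Cpow_mult_l, Cpow_mult_r; reflexivity|].
        rewrite pow_mult, <- Rpow_mult_distr, RtoC_pow. f_equal.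
        unfold x. rewrite ws_sqr by auto. rewrite Eh, !RtoC_mult, RtoC_pow, RtoC_div by lra.
        cbn [Cpow]. transitivity (- (RtoC b * RtoC b) / 4)%C; [field; auto|].
        replace (RtoC (-1)) with (- (1))%C by (apply C_ext; simpl; ring). field. }
      rewrite Ep, Gamma_central by auto. assert (G := GP m).
      unfold bj. rewrite !RtoC_mult, RtoC_div, !RtoC_mult by lra. rewrite !RtoC_mult in Ex.
      assert (N5 : RtoC (INR (fact m)) <> RtoC 0) by (apply RtoC_neq_0, INR_fact_neq_0).
      assert (N6 : RtoC (Gamma (INR m + nu + 1)) <> RtoC 0).
      { apply RtoC_neq_0, Rgt_not_eq, Gamma_pos. assert (Q := pos_INR m). lra. }
      transitivity (RtoC K / (h * Cpowr h nu * h ^ (2 * m)) * RtoC (bin (INR m + nu + 1) m) *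
        (x ^ m * h ^ (2 * m)) * / Cpowr (1 + x) (nu + INR (2 * m) + 1))%C; [field; auto|].
      rewrite Ex. field. repeat split; auto. }
    rewrite <- E. refine (CRInt_gen_ext _ _ _ _ _ _ S2).
    apply filter_forall. intros ab t _. unfold lint. rewrite besselJ_eq, rpow0_half by auto. fold K.
    rewrite !RtoC_mult. ring.
Qed.

(** * Generating functions of the kernels *)

Definition dpow (c : C) (n : nat) : C := (RtoC (/ INR (fact n)) * c ^ n)%C.

Lemma dpow_S c n : (RtoC (INR (S n)) * dpow c (S n) = c * dpow c n)%C.
Proof.
  unfold dpow. rewrite Cpow_S.
  transitivity (c * c ^ n * (RtoC (INR (S n)) * RtoC (/ INR (fact (S n)))))%C; [ring|].
  rewrite <- RtoC_mult, inv_fact_S. ring.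
Qed.

(** Multiplication by n + 1 = l + (n + 1 - l) lowers one of the two factors in each term and reduces
    the identity to the one for n. *)
Lemma dpow_binomial x y n : csum (S n) (fun l => (dpow x l * dpow y (n - l))%C) = dpow (x + y) n.
Proof.
  induction n as [|n IH]; [unfold dpow; simpl; rewrite Rinv_1; ring|].
  assert (N : RtoC (INR (S n)) <> RtoC 0) by (apply RtoC_neq_0, not_0_INR; lia).
  enough (E : (RtoC (INR (S n)) * csum (S (S n)) (fun l => dpow x l * dpow y (S n - l)) =
    RtoC (INR (S n)) * dpow (x + y) (S n))%C).
  { transitivity (/ RtoC (INR (S n)) * (RtoC (INR (S n)) * csum (S (S n)) (fun l => dpow x l * dpow y (S n - l))))%C;
      [field; auto|]. rewrite E. field; auto. }
  rewrite dpow_S, <- IH, <- csum_mult.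
  rewrite (csum_ext _ _ (fun l => (RtoC (INR l) * dpow x l * dpow y (S n - l) +
    RtoC (INR (S n - l)) * (dpow x l * dpow y (S n - l)))%C)).
  2: { intros l Hl. rewrite minus_INR, RtoC_minus by lia. ring. }
  rewrite csum_plus, csum_S_l.
  change (csum (S (S n)) (fun l => (RtoC (INR (S n - l)) * (dpow x l * dpow y (S n - l)))%C)) with
    (csum (S n) (fun l => (RtoC (INR (S n - l)) * (dpow x l * dpow y (S n - l)))%C) +
     RtoC (INR (S n - S n)) * (dpow x (S n) * dpow y (S n - S n)))%C.
  rewrite Nat.sub_diag. simpl (INR 0). rewrite !Cmult_0_l, Cplus_0_l, Cplus_0_r, <- csum_plus, <- csum_mult.
  apply csum_ext. intros l Hl. rewrite dpow_S.
  replace (S n - S l)%nat with (n - l)%nat by lia. replace (S n - l)%nat with (S (n - l)) by lia.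
  transitivity (x * dpow x l * dpow y (n - l) + dpow x l * (RtoC (INR (S (n - l))) * dpow y (S (n - l))))%C; [ring|].
  rewrite dpow_S. ring.
Qed.

Definition rpw (x : R) (n : nat) : R := x ^ n / INR (fact n).

Lemma dpow_RtoC x n : dpow (RtoC x) n = RtoC (rpw x n).
Proof. unfold dpow, rpw, Rdiv. rewrite <- RtoC_pow, <- RtoC_mult. f_equal; ring. Qed.

Lemma rpw_binomial x y n : fsum (S n) (fun l => rpw x l * rpw y (n - l)) = rpw (x + y) n.
Proof.
  apply RtoC_inj. rewrite <- csum_RtoC, <- dpow_RtoC, RtoC_plus, <- dpow_binomial.
  apply csum_ext. intros l _. rewrite !dpow_RtoC, RtoC_mult. reflexivity.
Qed.

Lemma Cmod_dpow c n : Cmod (dpow c n) = rpw (Cmod c) n.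
Proof. exact (Cmod_ec c n). Qed.

Lemma rpw_nonneg x n : 0 <= x -> 0 <= rpw x n.
Proof. intros H. apply Rmult_le_pos; [apply pow_le; auto|]. apply Rlt_le, Rinv_0_lt_compat, INR_fact_lt_0. Qed.

Lemma rpw_mono x y n : 0 <= x <= y -> rpw x n <= rpw y n.
Proof.
  intros H. apply Rmult_le_compat_r; [apply Rlt_le, Rinv_0_lt_compat, INR_fact_lt_0|]. apply pow_incr; auto.
Qed.

Lemma Cmod_csum n f : Cmod (csum n f) <= fsum n (fun i => Cmod (f i)).
Proof.
  induction n as [|n IH]; cbn [csum fsum]; [rewrite Cmod_0; lra|].
  eapply Rle_trans; [apply Cmod_triangle|]. lra.
Qed.

Lemma fsum_le n f g : (forall i, (i < n)%nat -> f i <= g i) -> fsum n f <= fsum n g.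
Proof.
  induction n as [|n IH]; intros H; cbn [fsum]; [lra|]. apply Rplus_le_compat; [apply IH; auto|auto].
Qed.

(** The divided power x^n / n! multiplied by the n-th moment n!/gamma_n. *)
Definition gpow (g : R) (x : C) (n : nat) : C := (RtoC (/ gam g n) * x ^ n)%C.

Lemma gam_ge g n : 0 <= g -> INR (fact n) <= gam g n.
Proof.
  intros Hg. induction n as [|n IH]; [simpl; lra|]. cbn [gam]. rewrite fact_simpl, mult_INR, Rmult_comm.
  assert (F := INR_fact_lt_0 n). assert (P := pos_INR (S n)).
  apply Rmult_le_compat; auto; try lra. destruct (Nat.even n); lra.
Qed.

Lemma Cmod_gpow g x n : 0 <= g -> Cmod (gpow g x n) <= rpw (Cmod x) n.
Proof.
  intros Hg. unfold gpow, rpw, Rdiv. assert (P := gam_pos g n Hg).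
  rewrite Cmod_mult, Cmod_R, Cmod_pow, Rabs_pos_eq by (apply Rlt_le, Rinv_0_lt_compat; auto).
  rewrite Rmult_comm. apply Rmult_le_compat_l; [apply pow_le, Cmod_ge_0|].
  apply Rinv_le_contravar; [apply INR_fact_lt_0|apply gam_ge; auto].
Qed.

(** By the moment formula [Pm] is the mean of dpow (x u + c) n over u, and [P2] below that of dpow
    (x u + y v + c) n over u and v. *)
Definition Pm (g : R) (x : C) (n : nat) (c : C) : C := csum (S n) (fun l => (gpow g x l * dpow c (n - l))%C).

Definition P2 (a b : R) (x y : C) (n : nat) (c : C) : C := csum (S n) (fun l => (gpow a x l * Pm b y (n - l) c)%C).

Definition Kx (a b : R) (x y : C) (m : nat) : C := csum (S m) (fun l => (gpow a x l * gpow b y (m - l))%C).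

Lemma Cmod_conv n (f g : nat -> C) x y : (forall l, Cmod (f l) <= rpw x l) -> (forall l, Cmod (g l) <= rpw y l) ->
  Cmod (csum (S n) (fun l => (f l * g (n - l)%nat)%C)) <= rpw (x + y) n.
Proof.
  intros Hf Hg. eapply Rle_trans; [apply Cmod_csum|]. rewrite <- rpw_binomial. apply fsum_le.
  intros l _. rewrite Cmod_mult. apply Rmult_le_compat; auto using Cmod_ge_0.
Qed.

Lemma Cmod_Pm g x n c : 0 <= g -> Cmod (Pm g x n c) <= rpw (Cmod x + Cmod c) n.
Proof.
  intros Hg. apply (Cmod_conv n (gpow g x) (dpow c)); intros l; [apply Cmod_gpow; auto|right; apply Cmod_dpow].
Qed.

Lemma Cmod_Kx a b x y n : 0 <= a -> 0 <= b -> Cmod (Kx a b x y n) <= rpw (Cmod x + Cmod y) n.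
Proof. intros Ha Hb. apply (Cmod_conv n (gpow a x) (gpow b y)); intros l; apply Cmod_gpow; auto. Qed.

Lemma csum_diag (b : nat -> nat -> C) Q :
  csum (S Q) (fun q => csum (S q) (fun n => b n (q - n)%nat)) = csum (S Q) (fun n => csum (S (Q - n)) (b n)).
Proof.
  apply C_ext.
  - rewrite !Re_sum_n, (sum_n_ext _ _ _ (fun q => Re_sum_n _ q)), (sum_n_ext _ _ _ (fun n => Re_sum_n (b n) (Q - n))).
    apply (sum_n_diag (fun n i => Re (b n i))).
  - rewrite !Im_sum_n, (sum_n_ext _ _ _ (fun q => Im_sum_n _ q)), (sum_n_ext _ _ _ (fun n => Im_sum_n (b n) (Q - n))).
    apply (sum_n_diag (fun n i => Im (b n i))).
Qed.

Lemma csum_rev n f : csum (S n) f = csum (S n) (fun i => f (n - i)%nat).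
Proof.
  induction n as [|n IH]; [reflexivity|].
  rewrite (csum_S_l (S n) (fun i => f (S n - i)%nat)). change (csum (S (S n)) f) with (csum (S n) f + f (S n))%C.
  rewrite IH, Nat.sub_0_r, Cplus_comm. reflexivity.
Qed.

Lemma P2_eq a b x y n c : P2 a b x y n c = csum (S n) (fun i => (Kx a b x y (n - i) * dpow c i)%C).
Proof.
  rewrite csum_rev. unfold P2.
  transitivity (csum (S n) (fun l => csum (S (n - l)) (fun i => gpow a x l * gpow b y i * dpow c (n - l - i))))%C.
  { apply csum_ext. intros l _. unfold Pm. rewrite <- csum_mult. apply csum_ext. intros; ring. }
  rewrite <- (csum_diag (fun l i => gpow a x l * gpow b y i * dpow c (n - l - i))%C).
  apply csum_ext. intros m Hm. unfold Kx. rewrite Cmult_comm, <- csum_mult. replace (n - (n - m))%nat with m by lia.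
  apply csum_ext. intros l Hl. replace (n - l - (m - l))%nat with (n - m)%nat by lia. ring.
Qed.

Lemma Cser_fin (a : nat -> C) N : (forall n, (N < n)%nat -> a n = RtoC 0) -> Cser a (csum (S N) a).
Proof.
  intros H. split; [rewrite Re_sum_n|rewrite Im_sum_n]; apply is_series_fin; intros n Hn; rewrite H; auto.
Qed.

Lemma sum_n_fsum (f : nat -> R) n : sum_n f n = fsum (S n) f.
Proof.
  induction n as [|n IH]; [rewrite sum_O; cbn [fsum]; eqR; ring|]. rewrite sum_Sn, IH. reflexivity.
Qed.

(** The n-th term of the series contributes to W^(n+i) for i <= n only. With i = q - n, the test
    keeps the truncated subtraction in the index of [Kx] from adding spurious terms. *)
Definition dq (a b : R) (x y : C) (q : nat) : C :=
  csum (S q) (fun n => if Nat.leb (q - n) n then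
    (RtoC (poch (a + b + 1) n) * (Kx a b x y (n - (q - n)) * RtoC ((-1) ^ (q - n) / INR (fact (q - n)))))%C else RtoC 0).

(** The argument -W of [P2] mixes the powers of W; expanding in it and regrouping by total degree
    gives [dq]. Absolute convergence follows from |W| (2 + |W|) < 1, which holds for |W| <= 1/8. *)
Lemma gen_series a b x y W : 0 <= a -> 0 <= b -> Cmod x + Cmod y <= 2 -> Cmod W <= 1 / 8 ->
  exists S, Cser (fun n => (RtoC (poch (a + b + 1) n) * W ^ n * P2 a b x y n (- W))%C) S /\
    Cser (fun q => (W ^ q * dq a b x y q)%C) S.
Proof.
  intros Ha Hb Hxy HW. assert (W0 := Cmod_ge_0 W). set (e := a + b + 1). assert (He : 0 < e) by (unfold e; lra).
  assert (Hp := fun n => poch_pos e n He).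
  set (B := fun n i => if Nat.leb i n then poch e n * Cmod W ^ n * (rpw 2 (n - i) * rpw (Cmod W) i) else 0).
  set (bb := fun n i => if Nat.leb i n then (RtoC (poch e n) * W ^ n * (Kx a b x y (n - i) * dpow (- W) i))%C else RtoC 0).
  destruct (Cser_diag bb B (fun n => (RtoC (poch e n) * W ^ n * P2 a b x y n (- W))%C)
    (fun n => bin e n * (Cmod W * (2 + Cmod W)) ^ n)) as (S & S1 & S2).
  - intros n i. unfold bb, B. destruct (Nat.leb i n); [|rewrite Cmod_0; lra].
    rewrite !Cmod_mult, Cmod_R, Cmod_pow, Rabs_pos_eq by (apply Rlt_le; auto).
    apply Rmult_le_compat_l; [apply Rmult_le_pos; [apply Rlt_le; auto|apply pow_le; auto]|].
    rewrite Cmod_dpow, Cmod_opp. apply Rmult_le_compat_r; [apply rpw_nonneg; auto|].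
    eapply Rle_trans; [apply Cmod_Kx; auto|]. apply rpw_mono. split; auto.
    apply Rplus_le_le_0_compat; apply Cmod_ge_0.
  - intros n. assert (F : is_series (B n) (sum_n (B n) n)).
    { apply is_series_fin. intros i Hi. unfold B. destruct (Nat.leb_spec i n); [lia|auto]. }
    replace (bin e n * (Cmod W * (2 + Cmod W)) ^ n) with (sum_n (B n) n); auto.
    rewrite sum_n_fsum. rewrite (fsum_ext _ _ (fun i => poch e n * Cmod W ^ n * (rpw (Cmod W) i * rpw 2 (n - i)))).
    + rewrite fsum_mult, rpw_binomial. unfold bin, rpw. rewrite Rpow_mult_distr. rewrite (Rplus_comm 2).
      eqR; field. apply INR_fact_neq_0.
    + intros i Hi. unfold B. destruct (Nat.leb_spec i n); [ring|lia].
  - eexists. apply is_series_bin; auto. nra.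
  - intros n. assert (F : Cser (bb n) (csum (Datatypes.S n) (bb n))).
    { apply Cser_fin. intros i Hi. unfold bb. destruct (Nat.leb_spec i n); [lia|auto]. }
    rewrite P2_eq, <- csum_mult. rewrite (csum_ext _ _ (bb n)); auto.
    intros i Hi. unfold bb. destruct (Nat.leb_spec i n); [ring|lia].
  - exists S. split; auto. eapply Cser_ext; [|exact S2]. intros q. cbv beta. unfold dq. rewrite <- csum_mult.
    apply csum_ext. intros n Hn. unfold bb, e. destruct (Nat.leb_spec (q - n) n); [|ring].
    replace (W ^ q)%C with (W ^ n * W ^ (q - n))%C by (rewrite <- Cpow_add_r; f_equal; lia).
    unfold dpow, Rdiv. replace (- W)%C with (RtoC (-1) * W)%C by (apply C_ext; simpl; ring).
    rewrite Cpow_mult_l, <- RtoC_pow, RtoC_mult. ring.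
Qed.

Lemma KK_Kx a b m (o h : C) : 0 <= a -> 0 <= b ->
  Kx a b (RtoC (2 * (snd o * snd h))) (RtoC (2 * (fst o * fst h))) m =
  (RtoC (2 ^ m) * ev (KK a b m (RtoC (fst o)) (RtoC (snd o))) h)%C.
Proof.
  intros Ha Hb. unfold KK. rewrite ev_psum, <- csum_mult. unfold Kx. rewrite csum_rev.
  apply csum_ext. intros i Hi.
  replace (m - (m - i))%nat with i by lia. unfold gpow, pe. cbn [ev]. rewrite !ev_ppow. cbn [ev].
  replace (2 ^ m) with (2 ^ i * 2 ^ (m - i)) by (rewrite <- pow_add; f_equal; lia).
  assert (Ga := gam_pos a (m - i) Ha). assert (Gb := gam_pos b i Hb).
  rewrite !RtoC_inv by lra. rewrite <- !RtoC_pow, !Rpow_mult_distr, !RtoC_mult. ring.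
Qed.

(** On unit vectors the powers of |x|^2 and |eta|^2 in [DD] are 1. The arguments are twice products
    of coordinates, which supplies the factor 2^(q-2i) of the Gegenbauer coefficients. *)
Lemma dq_DD a b o h q : 0 <= a -> 0 <= b -> Cmod o = 1 -> Cmod h = 1 ->
  dq a b (RtoC (2 * (snd o * snd h))) (RtoC (2 * (fst o * fst h))) q = ev (DD a b o q) h.
Proof.
  intros Ha Hb Ho Hh. unfold dq, DD. rewrite ev_psum, csum_rev. apply csum_ext. intros i Hi.
  replace (q - (q - i))%nat with i by lia. cbn [ev]. rewrite ev_ppow, ev_PRho, !unit_conj by auto.
  assert (P1 : forall j, (RtoC 1 ^ j)%C = RtoC 1) by (intros j; rewrite <- RtoC_pow, pow1; reflexivity).
  rewrite !P1. unfold KP.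
  destruct (Nat.leb_spec i (q - i)); destruct (Nat.leb_spec (2 * i) q); try lia; [|cbn [ev]; ring].
  rewrite KK_Kx by auto. replace (q - i - i)%nat with (q - 2 * i)%nat by lia.
  assert (F := INR_fact_neq_0 i). assert (F4 : 4 ^ i <> 0) by (apply pow_nonzero; lra).
  replace (cc (a + b) q i) with (poch (a + b + 1) (q - i) * 2 ^ (q - 2 * i) * ((-1) ^ i / INR (fact i))).
  - rewrite !RtoC_mult. ring.
  - unfold cc. replace (2 ^ q) with (2 ^ (q - 2 * i) * 4 ^ i); [field; auto|].
    replace 4 with (2 ^ 2) by ring. rewrite <- pow_mult, <- pow_add. f_equal. lia.
Qed.

(** * Integration of series against the measures mu *)

Lemma wmu_cont g w : -1 < w < 1 -> continuous (wmu g) w.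
Proof.
  intros Hw. apply cont_Rmult; [|apply Rpower_sq_cont; auto].
  apply cont_Rmult; [apply cont_const|]. apply cont_Rplus; [apply cont_const|apply continuous_id].
Qed.

Lemma wmu_bounded g x y : -1 < x -> x <= y -> y < 1 -> exists M, forall t, x <= t <= y -> wmu g t <= M.
Proof.
  intros Hx Hxy Hy. destruct (continuity_ab_maj (wmu g) x y Hxy) as [m [Hm _]].
  - intros c Hc. apply continuity_pt_filterlim, wmu_cont. lra.
  - exists (wmu g m). auto.
Qed.

Lemma ex_RInt_wmu g (f : R -> R) x y : -1 < x -> x <= y -> y < 1 -> (forall t, continuous f t) ->
  ex_RInt (fun t => wmu g t * f t) x y.
Proof.
  intros Hx Hxy Hy Hf. apply (ex_RInt_continuous (V := R_CompleteNormedModule)).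
  intros t Ht. rewrite Rmin_left, Rmax_right in Ht by lra. apply cont_Rmult; auto. apply wmu_cont. lra.
Qed.

(** The density is nonnegative and its total mass is the moment of order 0. *)
Lemma RInt_wmu_le_1 g x y : 0 < g -> -1 < x < 0 -> 0 < y < 1 -> RInt (wmu g) x y <= 1.
Proof.
  intros Hg Hx Hy.
  assert (H : is_RInt_gen (wmu g) (at_right (-1)) (at_left 1) 1).
  { eapply RInt_gen_m1_1_ext; [| |apply (wmu_moment g 0 Hg)].
    - intros w _. simpl. ring.
    - unfold mom. simpl. field. }
  assert (L := filterlim_is_RInt_gen _ _ _ _ H).
  assert (Ex : forall u v, -1 < u -> u <= v -> v < 1 -> ex_RInt (wmu g) u v).
  { intros u v H1 H2 H3. apply (ex_RInt_ext (fun t => wmu g t * 1)); [intros; eqR; ring|].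
    apply ex_RInt_wmu; auto. intros; apply cont_const. }
  assert (Pos : forall u v, -1 < u -> u <= v -> v < 1 -> 0 <= RInt (wmu g) u v).
  { intros u v H1 H2 H3. apply RInt_ge_0; auto. intros t Ht. apply wmu_nonneg; lra. }
  apply (filterlim_le (F := filter_prod (at_right (-1)) (at_left 1)) (fun _ => RInt (wmu g) x y)
      (fun ab => RInt (wmu g) (fst ab) (snd ab)) (RInt (wmu g) x y) 1); auto; [|apply filterlim_const].
  apply (Filter_prod _ _ _ (fun u => -1 < u < x) (fun v => y < v < 1)).
  - assert (P : 0 < x + 1) by lra. exists (mkposreal _ P). intros z Hz Hz1. apply ball_Rabs in Hz. simpl in Hz.
    apply Rabs_def2 in Hz. lra.
  - assert (P : 0 < 1 - y) by lra. exists (mkposreal _ P). intros z Hz Hz1. apply ball_Rabs in Hz. simpl in Hz.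
    apply Rabs_def2 in Hz. lra.
  - intros u v Hu Hv. simpl. rewrite <- (RInt_Chasles (wmu g) u x v), <- (RInt_Chasles (wmu g) x y v) by (apply Ex; lra).
    unfold plus; simpl. assert (P1 := Pos u x ltac:(lra) ltac:(lra) ltac:(lra)).
    assert (P2 := Pos y v ltac:(lra) ltac:(lra) ltac:(lra)). lra.
Qed.

(** The density may be unbounded at the ends. On a compact subinterval it is bounded, which gives
    the pointwise majorant, and its mass never exceeds 1, which gives the uniform bound on the
    integrals. *)
Lemma mu_series g (p : nat -> R -> C) (G : R -> C) (M : nat -> R) (I : nat -> C) :
  0 < g -> (forall n, ccont (p n)) -> (forall n u, -1 <= u <= 1 -> Cmod (p n u) <= M n) -> ex_series M ->
  (forall u, -1 <= u <= 1 -> Cser (fun n => p n u) (G u)) ->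
  (forall n, CRInt_gen (fun u => (RtoC (wmu g u) * p n u)%C) (at_right (-1)) (at_left 1) (I n)) ->
  exists S, Cser I S /\ CRInt_gen (fun u => (RtoC (wmu g u) * G u)%C) (at_right (-1)) (at_left 1) S.
Proof.
  intros Hg Hc Hb HM HG HI.
  assert (M0 : forall n, 0 <= M n).
  { intros n. eapply Rle_trans; [apply Cmod_ge_0|apply (Hb n 0); lra]. }
  refine (CRInt_gen_series (fun n u => (RtoC (wmu g u) * p n u)%C) _ M I
    (at_right (-1)) (at_left 1) (fun x y => -1 < x < 0 /\ 0 < y < 1) _ _ HM HI).
  - apply ev_m1_1. intros x y Hx Hy. split; auto.
  - intros x y [Hx Hy]. split; [lra|split; [|split; [|split]]].
    + intros n. split.
      * apply (ex_RInt_ext (fun t => wmu g t * Re (p n t))); [intros; symmetry; apply Re_scal|].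
        apply ex_RInt_wmu; try lra. exact (proj1 (Hc n)).
      * apply (ex_RInt_ext (fun t => wmu g t * Im (p n t))); [intros; symmetry; apply Im_scal|].
        apply ex_RInt_wmu; try lra. exact (proj2 (Hc n)).
    + destruct (wmu_bounded g x y) as [K HK]; try lra. exists (fun n => K * M n). split.
      * apply (ex_series_scal (V := R_NormedModule) K M); auto.
      * intros n t Ht. rewrite Cmod_mult, Cmod_R, Rabs_pos_eq by (apply wmu_nonneg; lra).
        apply Rmult_le_compat; auto using Cmod_ge_0; [apply wmu_nonneg; lra|apply Hb; lra].
    + intros t Ht. apply Cser_scal, HG. lra.
    + intros n. exists (fun t => wmu g t * M n). split; [|split].
      * apply ex_RInt_wmu; try lra. intros; apply cont_const.
      * intros t Ht. rewrite Cmod_mult, Cmod_R, Rabs_pos_eq by (apply wmu_nonneg; lra).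
        apply Rmult_le_compat_l; [apply wmu_nonneg; lra|apply Hb; lra].
      * rewrite (RInt_ext _ (fun t => scal (M n) (wmu g t))) by (intros; apply Rmult_comm).
        rewrite (RInt_scal (V := R_CompleteNormedModule)).
        -- assert (B := RInt_wmu_le_1 g x y Hg Hx Hy). specialize (M0 n). unfold scal; simpl; unfold mult; simpl. nra.
        -- apply (ex_RInt_ext (fun t => wmu g t * 1)); [intros; eqR; ring|]. apply ex_RInt_wmu; try lra.
           intros; apply cont_const.
Qed.

Lemma CRInt_gen_m1_1_ext (f h : R -> C) l : (forall t, -1 < t < 1 -> f t = h t) ->
  CRInt_gen f (at_right (-1)) (at_left 1) l -> CRInt_gen h (at_right (-1)) (at_left 1) l.
Proof.
  intros H [H1 H2]. split; [eapply RInt_gen_m1_1_ext; [|reflexivity|exact H1]|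
    eapply RInt_gen_m1_1_ext; [|reflexivity|exact H2]]; intros w Hw; cbv beta; rewrite H; auto.
Qed.

Lemma CRInt_gen_csum n (f : nat -> R -> C) (I : nat -> C) :
  (forall l, CRInt_gen (f l) (at_right (-1)) (at_left 1) (I l)) ->
  CRInt_gen (fun t => csum (S n) (fun l => f l t)) (at_right (-1)) (at_left 1) (csum (S n) I).
Proof.
  intros H. induction n as [|n IH].
  - cbn [csum]. replace (0 + I 0%nat)%C with (I 0%nat) by ring.
    refine (CRInt_gen_m1_1_ext _ _ _ _ (H 0%nat)). intros; ring.
  - exact (CRInt_gen_plus _ _ _ _ _ _ IH (H (S n))).
Qed.

Lemma CRInt_gen_moment g n : 0 < g ->
  CRInt_gen (fun u => RtoC (wmu g u * u ^ n)) (at_right (-1)) (at_left 1) (RtoC (mom g n)).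
Proof.
  intros Hg. split; [apply wmu_moment; auto|].
  refine (RInt_gen_m1_1_ext _ _ _ _ _ _ (is_RInt_gen_scal _ 0 _ (wmu_moment g n Hg)));
    intros; unfold scal; simpl; unfold mult; simpl; ring.
Qed.

Lemma mom_gam g n : 0 <= g -> RtoC (/ gam g n) = (RtoC (mom g n) * RtoC (/ INR (fact n)))%C.
Proof.
  intros Hg. rewrite <- RtoC_mult. f_equal. unfold mom. assert (P := gam_pos g n Hg).
  assert (F := INR_fact_neq_0 n). field. lra.
Qed.

Lemma mu_dpow g x c n : 0 < g ->
  CRInt_gen (fun u => (RtoC (wmu g u) * dpow (x * RtoC u + c) n)%C) (at_right (-1)) (at_left 1) (Pm g x n c).
Proof.
  intros Hg. unfold Pm.
  refine (CRInt_gen_m1_1_ext _ _ _ _ (CRInt_gen_csum n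
    (fun l u => (RtoC (/ INR (fact l)) * x ^ l * dpow c (n - l) * RtoC (wmu g u * u ^ l))%C) _ _)).
  - intros u _. cbv beta. rewrite <- dpow_binomial, <- csum_mult. apply csum_ext. intros l _.
    unfold dpow at 2. rewrite Cpow_mult_l, !RtoC_mult, RtoC_pow. ring.
  - intros l. cbv beta. unfold gpow. rewrite mom_gam by lra.
    replace (RtoC (mom g l) * RtoC (/ INR (fact l)) * x ^ l * dpow c (n - l))%C with
      (RtoC (/ INR (fact l)) * x ^ l * dpow c (n - l) * RtoC (mom g l))%C by ring.
    refine (CRInt_gen_scal _ _ _ _ _ _). apply CRInt_gen_moment; auto.
Qed.

Lemma ccont_csum n (f : nat -> R -> C) : (forall l, ccont (f l)) -> ccont (fun t => csum n (fun l => f l t)).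
Proof.
  intros H. induction n as [|n IH]; [exact (ccont_const 0)|]. exact (ccont_plus _ _ IH (H n)).
Qed.

Lemma ccont_pow f n : ccont f -> ccont (fun t => (f t ^ n)%C).
Proof. intros H. induction n as [|n IH]; [exact (ccont_const 1)|]. exact (ccont_mult _ _ H IH). Qed.

Lemma ccont_dpow x c n : ccont (fun u => dpow (x * RtoC u + c) n).
Proof.
  apply ccont_mult; [apply ccont_const|]. apply ccont_pow, ccont_plus; [|apply ccont_const].
  apply ccont_mult; [apply ccont_const|]. apply ccont_RtoC. intros; apply continuous_id.
Qed.

Lemma Cmod_affine x c u : -1 <= u <= 1 -> Cmod (x * RtoC u + c) <= Cmod x + Cmod c.
Proof.
  intros Hu. eapply Rle_trans; [apply Cmod_triangle|]. rewrite Cmod_mult, Cmod_R.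
  assert (H := Cmod_ge_0 x). assert (Rabs u <= 1) by (apply Rabs_le; lra). nra.
Qed.

(** The binomial series of (1 - W (x u + c))^(-e) has the terms (e)_n W^n dpow (x u + c) n, and it
    is dominated for all u in [-1, 1] under the stated bound. *)
Lemma mu_inner g e x c W : 0 < g -> 0 < e -> Cmod W * (Cmod x + Cmod c) < 1 ->
  exists S, Cser (fun n => (RtoC (poch e n) * W ^ n * Pm g x n c)%C) S /\
  CRInt_gen (fun u => (RtoC (wmu g u) * / Cpowr (1 - W * (x * RtoC u + c)) e)%C) (at_right (-1)) (at_left 1) S.
Proof.
  intros Hg He Hb. assert (H1 := Cmod_ge_0 x). assert (H2 := Cmod_ge_0 c). assert (H3 := Cmod_ge_0 W).
  apply (mu_series g (fun n u => (RtoC (poch e n) * W ^ n * dpow (x * RtoC u + c) n)%C) _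
    (fun n => bin e n * (Cmod W * (Cmod x + Cmod c)) ^ n)); auto.
  - intros n. apply ccont_mult; [apply ccont_const|apply ccont_dpow].
  - intros n u Hu. rewrite !Cmod_mult, Cmod_R, Cmod_pow, Cmod_dpow, Rabs_pos_eq by (apply Rlt_le, poch_pos; auto).
    assert (Ha := Cmod_affine x c u Hu).
    apply Rle_trans with (poch e n * Cmod W ^ n * rpw (Cmod x + Cmod c) n).
    + apply Rmult_le_compat_l; [apply Rmult_le_pos; [apply Rlt_le, poch_pos; auto|apply pow_le; auto]|].
      apply rpw_mono. split; auto. apply Cmod_ge_0.
    + right. unfold bin, rpw, Rdiv. rewrite Rpow_mult_distr. ring.
  - eexists. apply is_series_bin; auto. split; auto. apply Rmult_le_pos; lra.
  - intros u Hu. assert (Ha := Cmod_affine x c u Hu).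
    eapply Cser_ext; [|apply (binomial_value e (W * (x * RtoC u + c))); auto].
    + intros n. unfold bc, bin, dpow, Rdiv. rewrite RtoC_mult, Cpow_mult_l. ring.
    + rewrite Cmod_mult. eapply Rle_lt_trans; [|exact Hb]. apply Rmult_le_compat_l; auto.
  - intros n. refine (CRInt_gen_m1_1_ext _ _ _ _ (CRInt_gen_scal (RtoC (poch e n) * W ^ n)%C _ _ _ _ (mu_dpow g x c n Hg))).
    intros; ring.
Qed.

(** The second integration acts on the series produced by the first, in which v occurs only in the
    last argument of [Pm], a polynomial in v. *)
Lemma mu_outer a b e x y c W (G : R -> C) : 0 < a -> 0 < b -> 0 < e -> Cmod W * (Cmod x + (Cmod y + Cmod c)) < 1 ->
  (forall v, -1 <= v <= 1 ->
    Cser (fun n => (RtoC (poch e n) * W ^ n * Pm a x n (y * RtoC v + c))%C) (G v)) ->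
  exists S, Cser (fun n => (RtoC (poch e n) * W ^ n * P2 a b x y n c)%C) S /\
  CRInt_gen (fun v => (RtoC (wmu b v) * G v)%C) (at_right (-1)) (at_left 1) S.
Proof.
  intros Ha Hb He Hbd HG. assert (H1 := Cmod_ge_0 x). assert (H2 := Cmod_ge_0 c). assert (H3 := Cmod_ge_0 W).
  assert (H4 := Cmod_ge_0 y).
  apply (mu_series b (fun n v => (RtoC (poch e n) * W ^ n * Pm a x n (y * RtoC v + c))%C) _
    (fun n => bin e n * (Cmod W * (Cmod x + (Cmod y + Cmod c))) ^ n)); auto.
  - intros n. apply ccont_mult; [apply ccont_const|]. apply ccont_csum. intros l.
    apply ccont_mult; [apply ccont_const|apply ccont_dpow].
  - intros n u Hu. rewrite !Cmod_mult, Cmod_R, Cmod_pow, Rabs_pos_eq by (apply Rlt_le, poch_pos; auto).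
    assert (Hy := Cmod_affine y c u Hu).
    apply Rle_trans with (poch e n * Cmod W ^ n * rpw (Cmod x + (Cmod y + Cmod c)) n).
    + apply Rmult_le_compat_l; [apply Rmult_le_pos; [apply Rlt_le, poch_pos; auto|apply pow_le; auto]|].
      eapply Rle_trans; [apply Cmod_Pm; lra|]. apply rpw_mono.
      assert (H5 := Cmod_ge_0 (y * RtoC u + c)). lra.
    + right. unfold bin, rpw, Rdiv. rewrite Rpow_mult_distr. ring.
  - eexists. apply is_series_bin; auto. split; auto. apply Rmult_le_pos; lra.
  - intros n. unfold P2. 
    refine (CRInt_gen_m1_1_ext _ _ _ _ (CRInt_gen_scal (RtoC (poch e n) * W ^ n)%C _ _ _ _
      (CRInt_gen_csum n (fun l v => (gpow a x l * (RtoC (wmu b v) * dpow (y * RtoC v + c) (n - l)))%C) _ _))).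
    + intros v _. unfold Pm. rewrite <- !csum_mult. apply csum_ext. intros; ring.
    + intros l. refine (CRInt_gen_scal _ _ _ _ _ _). apply mu_dpow; auto.
Qed.

Lemma int_mu_eq g h l : CRInt_gen (fun w => (RtoC (wmu g w) * h w)%C) (at_right (-1)) (at_left 1) l ->
  int_mu g h = l.
Proof.
  intros H. unfold int_mu.
  apply (is_RInt_gen_unique (V := C_R_CompleteNormedModule)).
  apply CRInt_gen_is; [typeclasses eauto|typeclasses eauto|exact H].
Qed.

(** For b = 0 the numbers [gam] are factorials, so the second mean degenerates to evaluation at v =
    1. *)
Lemma Pm_eq_P2 a x y n c : P2 a 0 x y n c = Pm a x n (y + c).
Proof.
  unfold P2. apply csum_ext. intros l _. f_equal. unfold Pm. rewrite <- dpow_binomial. apply csum_ext.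
  intros i _. f_equal. unfold gpow, dpow. do 3 f_equal. 
  induction i as [|i IH]; [reflexivity|]. cbn [gam]. rewrite IH, fact_simpl, mult_INR.
  destruct (Nat.even i); ring.
Qed.

Lemma Cmod_le_Re_Im z : Cmod z <= Rabs (Re z) + Rabs (Im z).
Proof.
  rewrite <- (C_decomp z) at 1. eapply Rle_trans; [apply Cmod_triangle|].
  rewrite Cmod_mult, !Cmod_R. replace (Cmod Ci) with 1.
  - unfold Re, Im. lra.
  - unfold Cmod, Ci; cbn [fst snd]; replace (0 ^ 2 + 1 ^ 2) with 1 by ring; symmetry; apply sqrt_1.
Qed.

Lemma is_series_bounded (a : nat -> R) s : is_series a s -> exists M, forall n, Rabs (a n) <= M.
Proof.
  intros H. destruct (maj_by_pos a) as (M & _ & HM); [|exists M; exact HM].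
  exists 0. apply is_lim_seq_Reals. apply ex_series_lim_0. exists s; exact H.
Qed.

Lemma Cser_bounded a s : Cser a s -> exists M, forall n, Cmod (a n) <= M.
Proof.
  intros [H1 H2]. destruct (is_series_bounded _ _ H1) as [M1 B1]. destruct (is_series_bounded _ _ H2) as [M2 B2].
  exists (M1 + M2). intros n. eapply Rle_trans; [apply Cmod_le_Re_Im|]. specialize (B1 n). specialize (B2 n).
  apply Rplus_le_compat; auto.
Qed.

(** * From series in w^k to series in w *)

Definition shift (a : nat -> C) (n : nat) : C := match n with O => RtoC 0 | S m => a m end.

Lemma Cser_shift a s : Cser a s -> Cser (shift a) s.
Proof. intros H. apply Cser_decr_1; auto. Qed.

Definition sparse (k : nat) (g : nat -> C) (n : nat) : C := if Nat.eqb (n mod k) 0 then g (n / k)%nat else RtoC 0.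

Lemma csum_sparse k g N : (1 <= k)%nat -> csum (S N) (sparse k g) = csum (S (N / k)) g.
Proof.
  intros Hk. induction N as [|N IH].
  - rewrite Nat.div_0_l by lia. cbn [csum]. unfold sparse. rewrite Nat.mod_0_l, Nat.div_0_l by lia. reflexivity.
  - change (csum (S (S N)) (sparse k g)) with (csum (S N) (sparse k g) + sparse k g (S N))%C. rewrite IH.
    unfold sparse. destruct (div_mod_S N k Hk) as [(L1 & L2 & L3)|(L1 & L2 & L3)]; rewrite L2, L3; simpl; ring.
Qed.

Lemma filterlim_div k : (1 <= k)%nat -> filterlim (fun n => (n / k)%nat) eventually eventually.
Proof.
  intros Hk P [N HN]. exists (k * N)%nat. intros n Hn. apply HN. apply Nat.div_le_lower_bound; lia.
Qed.

Lemma Cser_sparse k g s : (1 <= k)%nat -> Cser g s -> Cser (sparse k g) s.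
Proof.
  intros Hk [H1 H2]. split.
  - apply (filterlim_ext (fun N => sum_n (fun n => Re (g n)) (N / k))).
    + intros N. rewrite <- !Re_sum_n, csum_sparse; auto.
    + apply (filterlim_comp _ _ _ (fun n => (n / k)%nat) (sum_n (fun n => Re (g n))) eventually eventually); auto.
      apply filterlim_div; auto.
  - apply (filterlim_ext (fun N => sum_n (fun n => Im (g n)) (N / k))).
    + intros N. rewrite <- !Im_sum_n, csum_sparse; auto.
    + apply (filterlim_comp _ _ _ (fun n => (n / k)%nat) (sum_n (fun n => Im (g n))) eventually eventually); auto.
      apply filterlim_div; auto.
Qed.

(** The form taken by the value of [KC] at eta for n = kq + l in terms of the numbers D_q; [shift]
    supplies 0 in place of D_{-1}. *)
Definition twist (k : nat) (D : nat -> C) (zeta Z' : C) (n : nat) : C :=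
  (zeta ^ (n mod k) * (D (n / k)%nat - Z' * shift D (n / k)))%C.

Lemma one_minus_neq_0 z : Cmod z < 1 -> (1 - z)%C <> RtoC 0.
Proof.
  intros H E. assert (K : z = RtoC 1) by (replace z with (1 - (1 - z))%C by ring; rewrite E; ring).
  rewrite K, Cmod_1 in H. lra.
Qed.

(* Multiplying by [1 - w zeta] leaves only the exponents divisible by [k]. *)
Lemma twist_series k D M zeta Z' w S : (1 <= k)%nat -> (forall q, Cmod (D q) <= M * 8 ^ q) ->
  Cmod zeta = 1 -> Cmod Z' = 1 -> Cmod w <= 1 / 16 -> Cser (fun q => ((w ^ k) ^ q * D q)%C) S ->
  Cser (fun n => (w ^ n * twist k D zeta Z' n)%C)
    ((1 - w ^ k * zeta ^ k) * (1 - w ^ k * Z') / (1 - w * zeta) * S)%C.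
Proof.
  intros Hk HD Hz HZ Hw HS. assert (W0 := Cmod_ge_0 w).
  assert (M0 : 0 <= M) by (specialize (HD 0%nat); assert (P := Cmod_ge_0 (D 0%nat)); simpl in HD; lra).
  assert (Bsh : forall q, Cmod (shift D q) <= M * 8 ^ q).
  { intros [|q]; cbn [shift].
    - rewrite Cmod_0. simpl. lra.
    - eapply Rle_trans; [apply HD|]. apply Rmult_le_compat_l; auto. apply Rle_pow; [lra|lia]. }
  (* The index n / k is at most n, so 8^n bounds the growth, against |w|^n <= 16^(-n). *)
  destruct (Cser_dom (fun n => (w ^ n * twist k D zeta Z' n)%C) (fun n => 2 * M * (1 / 2) ^ n)) as [U HU].
  { intros n. unfold twist. rewrite !Cmod_mult, !Cmod_pow, Hz, pow1, Rmult_1_l.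
    assert (B : Cmod (D (n / k)%nat - Z' * shift D (n / k)) <= 2 * M * 8 ^ n).
    { unfold Cminus. eapply Rle_trans; [apply Cmod_triangle|]. rewrite Cmod_opp, Cmod_mult, HZ, Rmult_1_l.
      assert (P : 8 ^ (n / k) <= 8 ^ n) by (apply Rle_pow; [lra|apply Nat.Div0.div_le_upper_bound; nia]).
      assert (P1 := HD (n / k)%nat). assert (P2 := Bsh (n / k)%nat). nra. }
    apply Rle_trans with ((1 / 16) ^ n * (2 * M * 8 ^ n)).
    - apply Rmult_le_compat; auto using Cmod_ge_0; [apply pow_le; auto|apply pow_incr; auto].
    - right. replace (1 / 2) with (1 / 16 * 8) by field. rewrite Rpow_mult_distr. ring. }
  { apply (ex_series_scal (V := R_NormedModule) (2 * M) (fun n => (1 / 2) ^ n)). apply ex_series_geom.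
    rewrite Rabs_pos_eq; lra. }
  set (a := fun n => (w ^ n * twist k D zeta Z' n)%C) in *.
  set (c := fun q => ((w ^ k) ^ q * (D q - Z' * shift D q))%C).
  assert (Hc : Cser c (S + - (w ^ k * Z') * S)%C).
  { eapply Cser_ext; [|apply (Cser_plus _ _ _ _ HS (Cser_scal (- (w ^ k * Z'))%C _ _ (Cser_shift _ _ HS)))].
    intros [|q]; unfold c; cbn [shift Cpow]; ring. }
  assert (Hg := Cser_sparse k _ _ Hk (Cser_plus _ _ _ _ Hc (Cser_scal (- (w ^ k * zeta ^ k))%C _ _ (Cser_shift _ _ Hc)))).
  assert (Ha := Cser_plus _ _ _ _ HU (Cser_scal (- (w * zeta))%C _ _ (Cser_shift _ _ HU))).
  assert (E : (U + - (w * zeta) * U = (S + - (w ^ k * Z') * S) + - (w ^ k * zeta ^ k) * (S + - (w ^ k * Z') * S))%C).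
  { apply (Cser_unique _ _ _ Ha). eapply Cser_ext; [|exact Hg]. intros [|m].
    - unfold sparse, a, twist, c. rewrite Nat.mod_0_l, Nat.div_0_l by lia. cbn [Nat.eqb shift Cpow]. ring.
    - unfold sparse, a, twist. cbn [shift]. assert (Q := Nat.div_mod_eq m k).
      destruct (div_mod_S m k Hk) as [(L1 & L2 & L3)|(L1 & L2 & L3)]; rewrite L2, L3; cbn [Nat.eqb shift Cpow].
      + ring.
      + unfold c. cbn [shift].
        assert (E1 : ((w ^ k) ^ Datatypes.S (m / k) = w * w ^ m)%C).
        { rewrite <- Cpow_mult_r, <- Cpow_S. f_equal. nia. }
        assert (E2 : (w ^ k * (w ^ k) ^ (m / k) = w * w ^ m)%C) by (rewrite <- E1; reflexivity).
        assert (E3 : (zeta ^ k = zeta * zeta ^ (m mod k))%C) by (rewrite <- Cpow_S; f_equal; lia).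
        rewrite E1. 
        transitivity (w * w ^ m * (D (Datatypes.S (m / k)) - Z' * D (m / k)%nat) -
          (w ^ k * (w ^ k) ^ (m / k)) * zeta ^ k * (D (m / k)%nat - Z' * shift D (m / k)))%C; [ring|].
        rewrite E2, E3. ring. }
  assert (N : (1 - w * zeta)%C <> RtoC 0) by (apply one_minus_neq_0; rewrite Cmod_mult, Hz; lra).
  replace ((1 - w ^ k * zeta ^ k) * (1 - w ^ k * Z') / (1 - w * zeta) * S)%C with U; auto.
  transitivity ((U + - (w * zeta) * U) / (1 - w * zeta))%C; [field; auto|]. rewrite E. field; auto.
Qed.

(** From 2 |x y| <= x^2 + y^2 in each coordinate. *)
Lemma unit_cross o h : Cmod o = 1 -> Cmod h = 1 ->
  Cmod (RtoC (2 * (snd o * snd h))) + Cmod (RtoC (2 * (fst o * fst h))) <= 2.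
Proof.
  intros Ho Hh. assert (So := Cmod_sqr o). assert (Sh := Cmod_sqr h). rewrite Ho in So. rewrite Hh in Sh.
  unfold Re, Im in So, Sh. rewrite !Cmod_R.
  assert (B : forall x y, Rabs (2 * (x * y)) <= x * x + y * y).
  { intros x y. assert (P1 := Rle_0_sqr (x - y)). assert (P2 := Rle_0_sqr (x + y)). unfold Rsqr in *.
    apply Rabs_le. lra. }
  assert (B1 := B (snd o) (snd h)). assert (B2 := B (fst o) (fst h)). lra.
Qed.

(* The growth bound comes for free from convergence of [gen_series] at [W = 1/8]. *)
Lemma DD_bound a b o h : 0 <= a -> 0 <= b -> Cmod o = 1 -> Cmod h = 1 ->
  exists M, forall q, Cmod (ev (DD a b o q) h) <= M * 8 ^ q.
Proof.
  intros Ha Hb Ho Hh.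
  destruct (gen_series a b (RtoC (2 * (snd o * snd h))) (RtoC (2 * (fst o * fst h))) (RtoC (1 / 8)) Ha Hb)
    as (S & _ & S2).
  - apply unit_cross; auto.
  - rewrite Cmod_R, Rabs_pos_eq; lra.
  - destruct (Cser_bounded _ _ S2) as [M HM]. exists M. intros q. specialize (HM q).
    rewrite dq_DD, Cmod_mult, Cmod_pow, Cmod_R, Rabs_pos_eq in HM by (auto; lra).
    assert (P : (1 / 8) ^ q * 8 ^ q = 1) by (rewrite <- Rpow_mult_distr; replace (1 / 8 * 8) with 1 by field; apply pow1).
    assert (P8 : 0 < 8 ^ q) by (apply pow_lt; lra).
    apply (Rmult_le_compat_r (8 ^ q)) in HM; [|lra].
    replace (Cmod (ev (DD a b o q) h)) with ((1 / 8) ^ q * 8 ^ q * Cmod (ev (DD a b o q) h)) by (rewrite P; ring). lra.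
Qed.

(** With z = conj om eta the kernel is a twisted coefficient for z plus conj z times the conjugate
    one of the preceding index. Both sums carry the factor (1 - w^k z^k)(1 - w^k conj z^k), and 1/(1
    - w z) + w conj z / (1 - w conj z) has numerator 1 - w^2 because |z| = 1. *)
Lemma KN_series a b k om eta w S : (1 <= k)%nat -> 0 <= a -> 0 <= b -> Cmod om = 1 -> Cmod eta = 1 -> Cmod w <= 1 / 16 ->
  Cser (fun q => ((w ^ k) ^ q * ev (DD a b (om ^ k) q) (eta ^ k))%C) S ->
  Cser (fun n => (w ^ n * ev (KN a b k om n) eta)%C)
    ((1 - w ^ 2) * (1 - RtoC (2 * Re (om ^ k * Cconj eta ^ k)) * w ^ k + w ^ (2 * k)) /
     (1 - RtoC (2 * Re (om * Cconj eta)) * w + w ^ 2) * S)%C.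
Proof.
  intros Hk Ha Hb Ho He Hw HS. set (D := fun q => ev (DD a b (om ^ k)%C q) (eta ^ k)%C).
  assert (Ho' := unit_pow om k Ho). assert (He' := unit_pow eta k He).
  destruct (DD_bound a b (om ^ k)%C (eta ^ k)%C Ha Hb Ho' He') as [M HM].
  set (z := (Cconj om * eta)%C). assert (Hz : Cmod z = 1) by (unfold z; rewrite Cmod_mult, Cmod_conj, Ho, He; ring).
  assert (Hz' : Cmod (Cconj z) = 1) by (rewrite Cmod_conj; auto).
  assert (T1 := twist_series k D M z (Cconj z ^ k)%C w S Hk HM Hz (unit_pow _ k Hz') Hw HS).
  assert (T2 := twist_series k D M (Cconj z) (z ^ k)%C w S Hk HM Hz' (unit_pow _ k Hz) Hw HS).
  assert (T := Cser_plus _ _ _ _ T1 (Cser_scal (w * Cconj z)%C _ _ (Cser_shift _ _ T2))).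
  assert (EC : forall q, ev (CC a b (om ^ k)%C q) (eta ^ k)%C = (D q - Cconj z ^ k * shift D q)%C).
  { intros [|q]; cbn [CC shift ev]; [fold (D 0%nat); ring|]. rewrite ev_PZb. fold (D (Datatypes.S q)) (D q).
    unfold z. rewrite Cmult_conj, Cconj_conj, Cpow_mult_l, <- Cpow_conj. ring. }
  assert (EK : forall n, ev (KC a b k om n) eta = twist k D z (Cconj z ^ k)%C n).
  { intros n. unfold KC. cbn [ev]. rewrite ev_plift, EC. unfold twist. unfold z at 2. rewrite Cpow_mult_l. ring. }
  assert (DR : forall q, Cconj (D q) = D q).
  { intros q. apply ev_DD_conj. }
  assert (EK' : forall n, Cconj (ev (KC a b k om n) eta) = twist k D (Cconj z) (z ^ k)%C n).
  { intros n. rewrite EK. unfold twist. rewrite Cmult_conj, Cminus_conj, Cmult_conj, !Cpow_conj, Cconj_conj, DR.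
    f_equal. f_equal. f_equal. destruct (n / k)%nat; cbn [shift]; [apply Cconj_RtoC|apply DR]. }
  assert (Zu := unit_conj z Hz).
  assert (N1 : (1 - w * z)%C <> RtoC 0) by (apply one_minus_neq_0; rewrite Cmod_mult, Hz; lra).
  assert (N2 : (1 - w * Cconj z)%C <> RtoC 0) by (apply one_minus_neq_0; rewrite Cmod_mult, Hz'; lra).
  assert (R2 : forall x : C, RtoC (2 * Re x) = (x + Cconj x)%C) by
    (intros [u v]; apply C_ext; unfold RtoC, Cplus, Cconj; simpl; ring).
  assert (Ez : (om * Cconj eta)%C = Cconj z) by (unfold z; rewrite Cmult_conj, Cconj_conj; reflexivity).
  rewrite !R2, <- Cpow_mult_l, Ez, Cpow_conj, Cconj_conj.
  assert (Zk : (z ^ k * Cconj z ^ k = 1)%C) by (rewrite <- Cpow_mult_l, Zu; apply Cpow_1_l).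
  assert (Den : (1 - (Cconj z + z) * w + w ^ 2 = (1 - w * z) * (1 - w * Cconj z))%C).
  { transitivity (1 - (Cconj z + z) * w + (z * Cconj z) * w ^ 2)%C; [rewrite Zu; ring|ring]. }
  assert (Num : (1 - (Cconj z ^ k + z ^ k) * w ^ k + w ^ (2 * k) = (1 - w ^ k * z ^ k) * (1 - w ^ k * Cconj z ^ k))%C).
  { replace (2 * k)%nat with (k + k)%nat by lia. rewrite Cpow_add_r.
    transitivity (1 - (Cconj z ^ k + z ^ k) * w ^ k + (z ^ k * Cconj z ^ k) * (w ^ k * w ^ k))%C; [rewrite Zk; ring|ring]. }
  rewrite Den, Num.
  match type of T with Cser _ ?v => match goal with |- Cser _ ?u => assert (EV : v = u) end end.
  { transitivity ((1 - (z * Cconj z) * w ^ 2) * ((1 - w ^ k * z ^ k) * (1 - w ^ k * Cconj z ^ k)) / ((1 - w * z) * (1 - w * Cconj z)) * S)%C.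
    - field. auto.
    - rewrite Zu. field. auto. }
  rewrite <- EV. eapply Cser_ext; [|exact T]. intros n. cbv beta. rewrite <- EK.
  destruct n as [|n]; cbn [shift KN ev Cpow].
  - ring.
  - rewrite ev_pconj. cbn [ev]. rewrite ev_PZ, !Cmult_conj, EK', Cconj_conj.
    generalize (twist k D (Cconj z) (z ^ k)%C n). intros T0. rewrite <- Ez. ring.
Qed.

(** * Laplace transform of the Dunkl kernel *)

(** With y = x/2, one of the two factors y^m / m! in each term is estimated by e^y; the other one
    sums to e^y. *)
Lemma besselJ_bound nu x : 0 < nu -> 0 <= x ->
  Rabs (besselJ nu x) <= rpow0 (x / 2) nu * exp x * / Gamma (nu + 1).
Proof.
  intros Hn Hx. rewrite besselJ_eq by auto. assert (P := Gamma_pos (nu + 1) ltac:(lra)).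
  rewrite Rabs_mult, (Rabs_pos_eq (rpow0 _ _)), Rmult_assoc by apply rpow0_nonneg.
  apply Rmult_le_compat_l; [apply rpow0_nonneg|].
  set (y := x / 2). assert (Hy : 0 <= y) by (unfold y; lra).
  assert (E := is_series_exp y).
  assert (T := fun m => is_series_term_le _ _ m (fun n => rpw_nonneg y n Hy) E).
  refine (is_series_Rabs_le (fun m => bj nu m * y ^ (2 * m))
    (fun m => (exp y * / Gamma (nu + 1)) * (y ^ m / INR (fact m))) _ _ _ (Series_correct _ (ex_series_bj nu y Hn)) _).
  - intros m. rewrite Rabs_mult, (Rabs_pos_eq (y ^ (2 * m))) by (apply pow_le; auto).
    assert (B := bj_abs nu m Hn). assert (F := inv_fact_le_1 m).
    assert (IG : 0 < / Gamma (nu + 1)) by (apply Rinv_0_lt_compat; auto).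
    assert (Y0 : 0 <= y ^ m) by (apply pow_le; auto).
    replace (y ^ (2 * m)) with (y ^ m * y ^ m) by (rewrite <- pow_add; f_equal; lia).
    apply Rle_trans with ((/ INR (fact m) * / INR (fact m) * / Gamma (nu + 1)) * (y ^ m * y ^ m)).
    + apply Rmult_le_compat_r; auto. apply Rmult_le_pos; auto.
    + specialize (T m). unfold rpw, Rdiv in *.
      replace (/ INR (fact m) * / INR (fact m) * / Gamma (nu + 1) * (y ^ m * y ^ m)) with
        (y ^ m * / INR (fact m) * (/ Gamma (nu + 1) * (y ^ m * / INR (fact m)))) by ring.
      replace (exp y * / Gamma (nu + 1) * (y ^ m * / INR (fact m))) with
        (exp y * (/ Gamma (nu + 1) * (y ^ m * / INR (fact m)))) by ring.
      apply Rmult_le_compat_r; auto. apply Rmult_le_pos; [lra|]. apply Rmult_le_pos; lra.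
  - replace (exp x * / Gamma (nu + 1)) with (exp y * / Gamma (nu + 1) * exp y).
    + exact (is_series_scal_l (exp y * / Gamma (nu + 1)) _ _ E).
    + replace (exp x) with (exp y * exp y) by (rewrite <- exp_plus; f_equal; unfold y; field). ring.
Qed.

Lemma ex_RInt_of_gen (f : R -> R) l Y : 0 <= Y ->
  is_RInt_gen f (at_point 0) (Rbar_locally p_infty) l -> ex_RInt f 0 Y.
Proof.
  intros HY H. destruct (H (fun _ => True) (filter_forall _ (fun _ => I))) as [A B HA [N HN] HAB].
  destruct (HAB 0 (Rmax N Y + 1) HA) as (v & Hv & _).
  { apply HN. assert (L := Rmax_l N Y). lra. }
  apply (ex_RInt_Chasles_1 (V := R_CompleteNormedModule) f 0 Y (Rmax N Y + 1)).
  - assert (L := Rmax_r N Y). lra.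
  - exists v. exact Hv.
Qed.

(** Sum and integral may be exchanged because the bound on the j-th Bessel function contains 1 /
    Gamma (j + kb + 1), which the transform of t^(j + kb) cancels. The majorants then form a
    geometric series despite the growth 16^j. *)
Lemma Laplace_dunklE kb (P : nat -> C -> C -> R) z1 z2 M s V : 0 < kb -> z1 <> RtoC 0 -> z2 <> RtoC 0 ->
  64 * (Cmod z1 * Cmod z2) <= Re s ->
  (forall j, Rabs (P j (unitC z1) (unitC z2)) <= M * 16 ^ j) ->
  Cser (fun j => (ws (Cmod z1 * Cmod z2) s ^ j * RtoC (P j (unitC z1) (unitC z2)))%C) V ->
  laplace_is (dunklE kb P z1 z2) s
    (RtoC (Gamma (kb + 1)) * (RtoC (Rpower 2 kb) /
      (rs (Cmod z1 * Cmod z2) s * Cpowr (Rs (Cmod z1 * Cmod z2) s) kb) * V))%C.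
Proof.
  intros Hk Hz1 Hz2 Hs HP HV. apply Cmod_gt_0 in Hz1, Hz2.
  unfold laplace_is, dunklE. set (b := Cmod z1 * Cmod z2) in *.
  assert (Hb : 0 < b) by (apply Rmult_lt_0_compat; auto).
  set (p := fun j => P j (unitC z1) (unitC z2)) in *.
  change (forall j, Rabs (p j) <= M * 16 ^ j) in HP.
  assert (M0 : 0 <= M) by (specialize (HP 0%nat); assert (Q := Rabs_pos (p 0%nat)); simpl in HP; lra).
  set (K := Rpower 2 kb * Gamma (kb + 1) * Rpower b (- kb)).
  assert (G1 := Gamma_pos (kb + 1) ltac:(lra)).
  assert (K0 : 0 < K).
  { apply Rmult_lt_0_compat; [apply Rmult_lt_0_compat|]; auto; apply exp_pos. }
  set (a := fun t j => K * besselJ (INR j + kb) (b * t) * p j).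
  set (F := fun t => (Series (fun j => Re (Cpow (0, -1) j) * a t j), Series (fun j => Im (Cpow (0, -1) j) * a t j)) : C).
  change (is_RInt_gen (V := C_R_NormedModule) (fun t => (Cexp (- (s * RtoC t)) * F t)%C) (at_point 0) (Rbar_locally p_infty)
    (RtoC (Gamma (kb + 1)) * (RtoC (Rpower 2 kb) / (rs b s * Cpowr (Rs b s) kb) * V))%C).
  apply CRInt_gen_is; [typeclasses eauto|typeclasses eauto|].
  assert (Hnu : forall j, 0 < INR j + kb) by (intros j; assert (Q := pos_INR j); lra).
  assert (Ci1 : forall j, Cmod (Cpow (0, -1) j) = 1).
  { intros j. rewrite Cmod_pow. replace (Cmod (0, -1)) with 1; [apply pow1|].
    unfold Cmod; cbn [fst snd]. replace (0 ^ 2 + (-1) ^ 2) with 1 by ring. symmetry; apply sqrt_1. }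
  assert (Gi : forall j, / Gamma (INR j + kb + 1) <= / Gamma (kb + 1) * / INR (fact j)).
  { intros j. rewrite <- Rinv_mult. apply Rinv_le_contravar.
    - apply Rmult_lt_0_compat; auto. apply INR_fact_lt_0.
    - rewrite Rmult_comm. apply Gamma_ge; auto. }
  assert (Gp : forall j, 0 < / Gamma (INR j + kb + 1)).
  { intros j. apply Rinv_0_lt_compat, Gamma_pos. specialize (Hnu j). lra. }
  assert (Ba : forall t j, 0 <= t -> Cmod (Cpow (0, -1) j * RtoC (a t j)) <=
    K * (rpow0 (b * t / 2) (INR j + kb) * exp (b * t) * / Gamma (INR j + kb + 1)) * (M * 16 ^ j)).
  { intros t j Ht. rewrite Cmod_mult, Ci1, Rmult_1_l, Cmod_R. unfold a. rewrite !Rabs_mult, (Rabs_pos_eq K) by lra.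
    apply Rmult_le_compat; auto using Rabs_pos.
    - apply Rmult_le_pos; [lra|apply Rabs_pos].
    - apply Rmult_le_compat_l; [lra|]. apply besselJ_bound; auto. nra. }
  (* On a bounded interval the Gamma factor yields 1/j!, and an exponential series is a uniform
     majorant. *)
  assert (Bu : forall Y t j, 0 <= t <= Y -> Cmod (Cpow (0, -1) j * RtoC (a t j)) <=
    (K * M * rpow0 (b * Y / 2) kb * exp (b * Y) * / Gamma (kb + 1)) * ((16 * (b * Y / 2)) ^ j / INR (fact j))).
  { intros Y t j Ht. eapply Rle_trans; [apply Ba; lra|]. rewrite (Rplus_comm (INR j)), <- rpow0_plus_nat by (auto; nra).
    rewrite Rpow_mult_distr. rewrite (Rplus_comm kb).
    assert (R1 : rpow0 (b * t / 2) kb * (b * t / 2) ^ j <= rpow0 (b * Y / 2) kb * (b * Y / 2) ^ j).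
    { apply Rmult_le_compat; [apply rpow0_nonneg|apply pow_le; nra| |apply pow_incr; nra].
      unfold rpow0. destruct (Rlt_dec 0 (b * t / 2)) as [T|T]; [|apply (rpow0_nonneg (b * Y / 2) kb)].
      destruct (Rlt_dec 0 (b * Y / 2)) as [T'|T']; [|nra]. unfold Rpower.
      assert (L : kb * ln (b * t / 2) <= kb * ln (b * Y / 2)) by (apply Rmult_le_compat_l; [lra|apply ln_le; nra]).
      destruct L as [L|L]; [left; apply exp_increasing; auto|right; rewrite L; auto]. }
    assert (R2 : exp (b * t) <= exp (b * Y)).
    { destruct (Rle_lt_or_eq_dec (b * t) (b * Y)) as [L|L]; [nra|left; apply exp_increasing; auto|right; rewrite L; auto]. }
    assert (P0 : 0 <= rpow0 (b * t / 2) kb * (b * t / 2) ^ j) by (apply Rmult_le_pos; [apply rpow0_nonneg|apply pow_le; nra]).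
    assert (P1 := exp_pos (b * t)). assert (P2 : 0 < 16 ^ j) by (apply pow_lt; lra).
    apply Rle_trans with (K * (rpow0 (b * Y / 2) kb * (b * Y / 2) ^ j * exp (b * Y) * (/ Gamma (kb + 1) * / INR (fact j))) * (M * 16 ^ j)).
    - apply Rmult_le_compat_r; [apply Rmult_le_pos; lra|]. apply Rmult_le_compat_l; [lra|].
      apply Rmult_le_compat; auto; [apply Rmult_le_pos; lra|specialize (Gp j); lra|]. apply Rmult_le_compat; auto; lra.
    - right. unfold Rdiv. ring. }
  assert (SF : forall t, 0 <= t -> Cser (fun j => (Cpow (0, -1) j * RtoC (a t j))%C) (F t)).
  { intros t Ht. destruct (Cser_dom (fun j => (Cpow (0, -1) j * RtoC (a t j))%C) _ (fun j => Bu t t j (conj Ht (Rle_refl t)))) as [S [S1 S2]].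
    { apply (ex_series_scal (V := R_NormedModule)). eexists; apply is_series_exp. }
    assert (Er : forall j, Re (Cpow (0, -1) j * RtoC (a t j)) = Re (Cpow (0, -1) j) * a t j) by
      (intros j; rewrite Cmult_comm, Re_scal; ring).
    assert (Ei : forall j, Im (Cpow (0, -1) j * RtoC (a t j)) = Im (Cpow (0, -1) j) * a t j) by
      (intros j; rewrite Cmult_comm, Im_scal; ring).
    split; cbn [F Re Im fst snd].
    - eapply is_series_ext; [intros j; symmetry; apply Er|]. apply Series_correct.
      eexists. eapply is_series_ext; [apply Er|exact S1].
    - eapply is_series_ext; [intros j; symmetry; apply Ei|]. apply Series_correct.
      eexists. eapply is_series_ext; [apply Ei|exact S2]. }
  set (L := fun j => (RtoC (Rpower b (INR j + kb)) / (rs b s * Cpowr (Rs b s) (INR j + kb)))%C).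
  assert (HL : forall j, CRInt_gen (fun t => (Cpow (0, -1) j * RtoC (K * p j) * (Cexp (- (s * RtoC t)) * RtoC (besselJ (INR j + kb) (b * t))))%C)
    (at_point 0) (Rbar_locally p_infty) (Cpow (0, -1) j * RtoC (K * p j) * L j)%C).
  { intros j. refine (CRInt_gen_scal _ _ _ _ _ _). apply Laplace_bessel; auto. lra. }
  assert (Ef : forall j t, (Cpow (0, -1) j * RtoC (K * p j) * (Cexp (- (s * RtoC t)) * RtoC (besselJ (INR j + kb) (b * t))) =
    Cexp (- (s * RtoC t)) * (Cpow (0, -1) j * RtoC (a t j)))%C).
  { intros j t. unfold a. rewrite !RtoC_mult. ring. }
  assert (Ee : forall t, Cmod (Cexp (- (s * RtoC t))) = exp (- (Re s * t))).
  { intros t. rewrite Cmod_Cexp. f_equal. unfold Cmult, Copp, RtoC, Re; simpl; ring. }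
  (* The estimate of the Bessel function costs e^(bt), so this is the rate of decay that remains. *)
  set (x := Re s - b). assert (Hx : 0 < x) by (unfold x; lra).
  set (Mj := fun j => (K * M * (Rpower (b / 2) kb * / Rpower x (kb + 1))) * (16 * (b / 2 / x)) ^ j).
  destruct (CRInt_gen_series (fun j t => (Cpow (0, -1) j * RtoC (K * p j) * (Cexp (- (s * RtoC t)) * RtoC (besselJ (INR j + kb) (b * t))))%C)
    (fun t => (Cexp (- (s * RtoC t)) * F t)%C) Mj (fun j => (Cpow (0, -1) j * RtoC (K * p j) * L j)%C)
    (at_point 0) (Rbar_locally p_infty) (fun u v => u = 0 /\ 0 <= v)) as (S & S1 & S2).
  - apply ev_pt0_infty. intros y Hy. simpl. split; auto; lra.
  - intros u Y [-> HY]. split; [auto|split; [|split; [|split]]].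
    + intros j. split; [exact (ex_RInt_of_gen _ _ Y HY (proj1 (HL j)))|exact (ex_RInt_of_gen _ _ Y HY (proj2 (HL j)))].
    + eexists. split; [|intros j t Ht; rewrite Ef, Cmod_mult, Ee].
      2: { eapply Rle_trans; [|apply (Bu Y t j Ht)]. rewrite <- (Rmult_1_l (Cmod (_ * RtoC _))) at 2.
        apply Rmult_le_compat_r; [apply Cmod_ge_0|]. rewrite <- exp_0.
        destruct (proj1 Ht) as [T|T]; [left; apply exp_increasing; nra|right; rewrite <- T; f_equal; ring]. }
      apply (ex_series_scal (V := R_NormedModule)). eexists; apply is_series_exp.
    + intros t Ht. eapply Cser_ext; [|apply (Cser_scal (Cexp (- (s * RtoC t))) _ _ (SF t ltac:(lra)))].
      intros j. cbv beta. rewrite Ef. reflexivity.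
    + intros j. set (c := K * (M * 16 ^ j) * (Rpower (b / 2) (INR j + kb) * / Gamma (INR j + kb + 1))).
      assert (P16 : 0 < 16 ^ j) by (apply pow_lt; lra).
      assert (PRp := exp_pos ((INR j + kb) * ln (b / 2))). fold (Rpower (b / 2) (INR j + kb)) in PRp.
      assert (c0 : 0 <= c).
      { unfold c. specialize (Gp j). apply Rmult_le_pos; apply Rmult_le_pos; try lra. apply Rmult_le_pos; lra. }
      exists (fun t => c * (exp (- (x * t)) * rpow0 t (INR j + kb))). split; [|split].
      * apply cont_ex_RInt. intros t. apply cont_Rmult; [apply cont_const|apply cont_elint; auto].
      * intros t Ht. rewrite Ef, Cmod_mult, Ee.
        eapply Rle_trans; [apply Rmult_le_compat_l; [apply Rlt_le, exp_pos|apply Ba; lra]|].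
        right. rewrite rpow0_half by auto. unfold c.
        replace (exp (- (x * t))) with (exp (- (Re s * t)) * exp (b * t)) by
          (rewrite <- exp_plus; f_equal; unfold x; ring). ring.
      * rewrite (RInt_scal (V := R_CompleteNormedModule) (fun t => exp (- (x * t)) * rpow0 t (INR j + kb))) by
          (apply cont_ex_RInt; intros t; apply cont_elint; auto).
        assert (B := RInt_elint_le x (INR j + kb) Y Hx (Hnu j) HY).
        apply Rle_trans with (c * (Gamma (INR j + kb + 1) / Rpower x (INR j + kb + 1))).
        { unfold scal; cbn; unfold mult; cbn. apply Rmult_le_compat_l; auto. }
        right. unfold c, Mj. specialize (Gp j). 
        replace (Rpower x (INR j + kb + 1)) with (Rpower x (kb + 1) * x ^ j) by
          (rewrite <- Rpower_pow, <- Rpower_plus by lra; f_equal; ring).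
        rewrite (Rpower_plus (INR j) kb (b / 2)), !Rpower_pow by lra.
        rewrite !Rpow_mult_distr. unfold Rdiv. rewrite ?Rinv_mult, !Rpow_mult_distr, !pow_inv.
        assert (G := Gamma_pos (INR j + kb + 1) ltac:(specialize (Hnu j); lra)).
        assert (N2j : 2 ^ j <> 0) by (apply pow_nonzero; lra).
        assert (Nx : x ^ j <> 0) by (apply pow_nonzero; lra).
        assert (Nx2 : Rpower x (kb + 1) <> 0) by (apply Rgt_not_eq, exp_pos).
        field. repeat split; auto; apply Rgt_not_eq; auto.
  - unfold Mj. match goal with |- ex_series (fun j => ?c * ?r ^ j) =>
      apply (ex_series_scal (V := R_NormedModule) c (fun j => r ^ j)) end. apply ex_series_geom.
    (* Here x >= 63 b, so the ratio 16 b / (2x) is below 1. *)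
    assert (0 < b / 2 / x < 1 / 16).
    { split; [apply Rdiv_lt_0_compat; lra|]. apply Rmult_lt_reg_r with x; auto. unfold Rdiv.
      rewrite Rmult_assoc, Rinv_l by lra. unfold x. lra. }
    rewrite Rabs_pos_eq; lra.
  - exact HL.
  - assert (Nr := rs_neq_0 b s Hb ltac:(lra)). assert (NR := Rs_neq_0 b s Hb ltac:(lra)).
    assert (E : S = (RtoC (Gamma (kb + 1)) * (RtoC (Rpower 2 kb) / (rs b s * Cpowr (Rs b s) kb) * V))%C).
    { apply (Cser_unique _ _ _ S1).
      replace (RtoC (Gamma (kb + 1)) * (RtoC (Rpower 2 kb) / (rs b s * Cpowr (Rs b s) kb) * V))%C with
        (RtoC (Gamma (kb + 1)) * (RtoC (Rpower 2 kb) / (rs b s * Cpowr (Rs b s) kb)) * V)%C by ring.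
      eapply Cser_ext; [|apply (Cser_scal _ _ _ HV)]. intros j. cbv beta. fold (p j). unfold L, K.
      assert (Nk := Cpowr_neq_0 (Rs b s) kb NR). assert (Nj := Cpow_nz (Rs b s) j NR).
      rewrite Cpowr_plus, Cpowr_INR, Rpower_plus, Rpower_pow, Rpower_Ropp by auto.
      assert (Nb : Rpower b kb <> 0) by (apply Rgt_not_eq, exp_pos).
      assert (Nb' : RtoC (Rpower b kb) <> RtoC 0) by (apply RtoC_neq_0; auto).
      rewrite !RtoC_mult, RtoC_inv, RtoC_pow by auto.
      unfold ws. replace (- (Ci * RtoC b) / Rs b s)%C with ((0, -1) * RtoC b * / Rs b s)%C.
      - rewrite !Cpow_mult_l, Cpow_inv by auto. field. auto.
      - unfold Cdiv. f_equal. apply C_ext; simpl; ring. }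
    rewrite <- E. exact S2.
Qed.

(** The part of the integrand free of u and v, after cancelling 1 - w^(2k). *)
Definition dih_factor (k : nat) (kb : R) (om eta : C) (b : R) (s : C) : C :=
  let w := ws b s in
  (RtoC (Rpower 2 kb) / (rs b s * Cpowr (Rs b s) kb) *
   ((1 - w ^ 2) * (1 - RtoC (2 * Re (om ^ k * Cconj eta ^ k)) * w ^ k + w ^ (2 * k)) /
     (1 - RtoC (2 * Re (om * Cconj eta)) * w + w ^ 2)))%C.

Lemma dih_integrand_eq k kb e om eta b s X : (1 <= k)%nat -> Cmod (ws b s) < 1 ->
  dih_integrand k kb e om eta b s X =
  (dih_factor k kb om eta b s * / Cpowr (1 - RtoC (2 * X) * ws b s ^ k + ws b s ^ (2 * k)) e)%C.
Proof.
  intros Hk Hw. assert (N : (1 - ws b s ^ (2 * k))%C <> RtoC 0).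
  { apply one_minus_neq_0. rewrite Cmod_pow. assert (W0 := Cmod_ge_0 (ws b s)).
    replace (2 * k)%nat with (S (2 * k - 1)) by lia. cbn [pow].
    assert (P : 0 <= Cmod (ws b s) ^ (2 * k - 1) <= 1).
    { split; [apply pow_le; auto|]. rewrite <- (pow1 (2 * k - 1)). apply pow_incr. lra. }
    nra. }
  unfold dih_integrand, dih_factor.
  change (Cdiv (Copp (Cmult (0, 1) (RtoC b))) (Cplus s (Cpowr (Cplus (Cmult s s) (RtoC (b * b))) (1 / 2)))) with (ws b s).
  change (Cplus s (Cpowr (Cplus (Cmult s s) (RtoC (b * b))) (1 / 2))) with (Rs b s).
  change (Cpowr (Cplus (Cmult s s) (RtoC (b * b))) (1 / 2)) with (rs b s). cbv zeta.
  set (A := (1 - ws b s ^ (2 * k))%C) in *. unfold Cdiv.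
  match goal with |- ?l = (?t1 * (?n1 * ?n3 * ?d3) * ?p)%C =>
    transitivity (t1 * n1 * n3 * d3 * p * (A * / A))%C; [ring|rewrite Cinv_r by auto; ring] end.
Qed.

Lemma Cmod_unitC z : z <> RtoC 0 -> Cmod (unitC z) = 1.
Proof.
  intros H. assert (P := H). apply Cmod_gt_0 in P. unfold unitC.
  rewrite Cmod_div, Cmod_R, Rabs_pos_eq by (try apply RtoC_neq_0; lra). field; lra.
Qed.

Lemma Cmod_ws_small b s : 0 < b -> 64 * b <= Re s -> Cmod (ws b s) <= 1 / 64.
Proof.
  intros Hb Hs. eapply Rle_trans; [apply Cmod_ws; lra|].
  apply Rmult_le_reg_r with (Re s); [lra|]. unfold Rdiv. rewrite Rmult_assoc, Rinv_l; lra.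
Qed.

Lemma Cmod_pow_le w k r : (1 <= k)%nat -> Cmod w <= r -> r <= 1 -> Cmod (w ^ k) <= r.
Proof.
  intros Hk Hw Hr. assert (W0 := Cmod_ge_0 w). rewrite Cmod_pow. destruct k as [|k]; [lia|]. cbn [pow].
  assert (P : 0 <= Cmod w ^ k <= 1).
  { split; [apply pow_le; auto|]. rewrite <- (pow1 k). apply pow_incr. lra. }
  nra.
Qed.

(** The terms of the convergent series of [KN_series] at w = 1/16 are bounded. *)
Lemma KN_bound a b k om eta : (1 <= k)%nat -> 0 <= a -> 0 <= b -> Cmod om = 1 -> Cmod eta = 1 ->
  exists M, forall j, Cmod (ev (KN a b k om j) eta) <= M * 16 ^ j.
Proof.
  intros Hk Ha Hb Ho He. assert (Ho' := unit_pow om k Ho). assert (He' := unit_pow eta k He).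
  assert (Hw : Cmod (RtoC (1 / 16)) <= 1 / 16) by (rewrite Cmod_R, Rabs_pos_eq; lra).
  destruct (gen_series a b _ _ (RtoC (1 / 16) ^ k)%C Ha Hb (unit_cross (om ^ k)%C (eta ^ k)%C Ho' He')) as (S & _ & S2).
  { eapply Rle_trans; [apply (Cmod_pow_le _ _ (1 / 16)); auto; lra|lra]. }
  assert (S3 : Cser (fun q => ((RtoC (1 / 16) ^ k) ^ q * ev (DD a b (om ^ k) q) (eta ^ k))%C) S).
  { eapply Cser_ext; [|exact S2]. intros q. cbv beta. rewrite dq_DD by auto. reflexivity. }
  destruct (Cser_bounded _ _ (KN_series a b k om eta _ _ Hk Ha Hb Ho He Hw S3)) as [M HM].
  exists M. intros j. specialize (HM j). rewrite Cmod_mult, Cmod_pow, Cmod_R, Rabs_pos_eq in HM by lra.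
  assert (P : (1 / 16) ^ j * 16 ^ j = 1) by (rewrite <- Rpow_mult_distr; replace (1 / 16 * 16) with 1 by field; apply pow1).
  assert (P16 : 0 < 16 ^ j) by (apply pow_lt; lra).
  apply (Rmult_le_compat_r (16 ^ j)) in HM; [|lra].
  replace (Cmod (ev (KN a b k om j) eta)) with ((1 / 16) ^ j * 16 ^ j * Cmod (ev (KN a b k om j) eta)) by (rewrite P; ring). lra.
Qed.

(** The series assumed for S is what the integrations over u and v deliver. [gen_series] turns it
    into the series in the D_q, and [KN_series] into the one in the kernels. *)
Lemma Laplace_dunklE_KN k a b kb (P : nat -> C -> C -> R) z1 z2 s S : (1 <= k)%nat -> 0 <= a -> 0 <= b -> 0 < kb ->
  z1 <> RtoC 0 -> z2 <> RtoC 0 -> 64 * (Cmod z1 * Cmod z2) <= Re s ->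
  (forall j, RtoC (P j (unitC z1) (unitC z2)) = ev (KN a b k (unitC z1) j) (unitC z2)) ->
  let w := ws (Cmod z1 * Cmod z2) s in
  let o := (unitC z1 ^ k)%C in let h := (unitC z2 ^ k)%C in
  Cser (fun n => (RtoC (poch (a + b + 1) n) * (w ^ k) ^ n *
    P2 a b (RtoC (2 * (snd o * snd h))) (RtoC (2 * (fst o * fst h))) n (- w ^ k))%C) S ->
  laplace_is (dunklE kb P z1 z2) s
    (RtoC (Gamma (kb + 1)) * (dih_factor k kb (unitC z1) (unitC z2) (Cmod z1 * Cmod z2) s * S))%C.
Proof.
  intros Hk Ha Hb Hkb Hz1 Hz2 Hs HP w o h HS.
  assert (Ho := Cmod_unitC z1 Hz1). assert (He := Cmod_unitC z2 Hz2).
  assert (Pb : 0 < Cmod z1 * Cmod z2) by (apply Rmult_lt_0_compat; apply Cmod_gt_0; auto).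
  assert (Hw : Cmod w <= 1 / 64) by (apply Cmod_ws_small; auto).
  assert (Ho' : Cmod o = 1) by (apply unit_pow; auto). assert (He' : Cmod h = 1) by (apply unit_pow; auto).
  destruct (gen_series a b _ _ (w ^ k)%C Ha Hb (unit_cross o h Ho' He')) as (S' & S1 & S2).
  { eapply Rle_trans; [apply (Cmod_pow_le _ _ (1 / 64)); auto; lra|lra]. }
  rewrite (Cser_unique _ _ _ S1 HS) in S2.
  assert (S3 : Cser (fun q => ((w ^ k) ^ q * ev (DD a b o q) h)%C) S).
  { eapply Cser_ext; [|exact S2]. intros q. cbv beta. rewrite dq_DD by auto. reflexivity. }
  assert (V := KN_series a b k _ _ w S Hk Ha Hb Ho He ltac:(lra) S3).
  destruct (KN_bound a b k _ _ Hk Ha Hb Ho He) as [M HM].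
  assert (V' : Cser (fun j => (w ^ j * RtoC (P j (unitC z1) (unitC z2)))%C)
    ((1 - w ^ 2) * (1 - RtoC (2 * Re (unitC z1 ^ k * Cconj (unitC z2) ^ k)) * w ^ k + w ^ (2 * k)) /
     (1 - RtoC (2 * Re (unitC z1 * Cconj (unitC z2))) * w + w ^ 2) * S)%C).
  { eapply Cser_ext; [|exact V]. intros j. cbv beta. rewrite HP. reflexivity. }
  assert (B : forall j, Rabs (P j (unitC z1) (unitC z2)) <= M * 16 ^ j).
  { intros j. rewrite <- Cmod_R, HP. apply HM. }
  assert (L := Laplace_dunklE kb P z1 z2 M s _ Hkb Hz1 Hz2 Hs B V').
  unfold dih_factor. fold w. rewrite <- Cmult_assoc. exact L.
Qed.

(** Writing 1 - 2 W X + W^2 as 1 - W (2 X - W) gives a binomial series whose argument is affine in u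
    and in v. *)
Lemma quad_affine W (p q u v : R) :
  (1 - RtoC (2 * (q * u + p * v)) * W + W * W)%C =
  (1 - W * (RtoC (2 * q) * RtoC u + (RtoC (2 * p) * RtoC v + - W)))%C.
Proof. rewrite !RtoC_mult, RtoC_plus, !RtoC_mult. ring. Qed.

Lemma dih_integrand_affine k kb e om eta b s u v : (1 <= k)%nat -> Cmod (ws b s) < 1 ->
  dih_integrand k kb e om eta b s (Xuv k om eta u v) =
  (dih_factor k kb om eta b s * / Cpowr (1 - ws b s ^ k *
    (RtoC (2 * (snd (om ^ k)%C * snd (eta ^ k)%C)) * RtoC u +
     (RtoC (2 * (fst (om ^ k)%C * fst (eta ^ k)%C)) * RtoC v + - ws b s ^ k))) e)%C.
Proof.
  intros Hk Hw. rewrite dih_integrand_eq by auto. do 3 f_equal. unfold Xuv.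
  replace (2 * k)%nat with (k + k)%nat by lia. rewrite Cpow_add_r. apply quad_affine.
Qed.

Lemma mu_small W x y v : -1 <= v <= 1 -> Cmod W <= 1 / 64 -> Cmod x + Cmod y <= 2 ->
  Cmod W * (Cmod x + (Cmod y + Cmod (- W))) < 1 /\ Cmod W * (Cmod x + Cmod (y * RtoC v + - W)) < 1.
Proof.
  intros Hv HW Hxy. assert (W0 := Cmod_ge_0 W). assert (H := Cmod_affine y (- W) v Hv).
  assert (X0 := Cmod_ge_0 x). assert (Y0 := Cmod_ge_0 (y * RtoC v + - W)). rewrite Cmod_opp in *. split; nra.
Qed.

Theorem theorem16 :
  (forall (k : nat) (a b : R) (z1 z2 : C) (P : nat -> C -> C -> R),
     (1 <= k)%nat -> 0 < a -> 0 < b -> z1 <> RtoC 0 -> z2 <> RtoC 0 ->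
     (forall j, is_repr_kernel (2 * k) (kap_I2k a b) (ups_I2k k a b) j (P j)) ->
     exists s0 : R, forall s : C, s0 < Re s ->
       laplace_is (dunklE (INR k * (a + b)) P z1 z2) s
         (Cmult (RtoC (Gamma (INR k * (a + b) + 1)))
            (int_mu b (fun v => int_mu a (fun u =>
               f_I2k k a b (unitC z1) (unitC z2) (Cmod z1 * Cmod z2) s u v)))))
  /\
  (forall (k : nat) (a : R) (z1 z2 : C) (P : nat -> C -> C -> R),
     Nat.odd k = true -> 0 < a -> z1 <> RtoC 0 -> z2 <> RtoC 0 ->
     (forall j, is_repr_kernel k (kap_Ik a) (ups_Ik k a) j (P j)) ->
     exists s0 : R, forall s : C, s0 < Re s ->
       laplace_is (dunklE (INR k * a) P z1 z2) s
         (Cmult (RtoC (Gamma (INR k * a + 1)))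
            (int_mu a (fun u =>
               g_Ik k a (unitC z1) (unitC z2) (Cmod z1 * Cmod z2) s u)))).
Proof.
  split.
  (* Beyond this bound |w| <= 1/64, and the same holds for w^k, inside all the regions of
     convergence used. *)
  - intros k a b z1 z2 P Hk Ha Hb Hz1 Hz2 HP. exists (64 * (Cmod z1 * Cmod z2)). intros s Hs.
    assert (Ho := Cmod_unitC z1 Hz1). assert (He := Cmod_unitC z2 Hz2).
    assert (Pb : 0 < Cmod z1 * Cmod z2) by (apply Rmult_lt_0_compat; apply Cmod_gt_0; auto).
    assert (Hkb : 0 < INR k * (a + b)) by (apply Rmult_lt_0_compat; [apply lt_0_INR; lia|lra]).
    set (B := Cmod z1 * Cmod z2) in *. set (w := ws B s).
    assert (Hw : Cmod w <= 1 / 64) by (apply Cmod_ws_small; auto; lra).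
    set (o := (unitC z1 ^ k)%C). set (h := (unitC z2 ^ k)%C).
    assert (Hoh := unit_cross o h (unit_pow _ k Ho) (unit_pow _ k He)).
    set (x := RtoC (2 * (snd o * snd h))) in *. set (y := RtoC (2 * (fst o * fst h))) in *.
    assert (HW : Cmod (w ^ k) <= 1 / 64) by (apply Cmod_pow_le; auto; lra).
    set (Dm := dih_factor k (INR k * (a + b)) (unitC z1) (unitC z2) B s).
    (* The inner integral without [Dm], which depends on neither variable; as a series in [Pm] it
       feeds the outer integration. *)
    set (G := fun v => int_mu a (fun u => (/ Cpowr (1 - w ^ k * (x * RtoC u + (y * RtoC v + - w ^ k))) (a + b + 1))%C)).
    assert (HG : forall v, -1 <= v <= 1 ->
      Cser (fun n => (RtoC (poch (a + b + 1) n) * (w ^ k) ^ n * Pm a x n (y * RtoC v + - w ^ k))%C) (G v) /\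
      int_mu a (fun u => f_I2k k a b (unitC z1) (unitC z2) B s u v) = (Dm * G v)%C).
    { intros v Hv. destruct (mu_small (w ^ k)%C x y v Hv HW Hoh) as [_ Q].
      destruct (mu_inner a (a + b + 1) x (y * RtoC v + - w ^ k)%C (w ^ k)%C Ha ltac:(lra) Q) as (S & S1 & S2).
      assert (EG := int_mu_eq a (fun u => (/ Cpowr (1 - w ^ k * (x * RtoC u + (y * RtoC v + - w ^ k))) (a + b + 1))%C) S S2).
      change (G v = S) in EG. rewrite EG. split; auto.
      apply int_mu_eq. refine (CRInt_gen_m1_1_ext _ _ _ _ (CRInt_gen_scal Dm _ _ _ _ S2)).
      intros u _. unfold f_I2k. rewrite dih_integrand_affine by (auto; fold w; lra). fold w o h x y Dm. ring. }
    destruct (mu_small (w ^ k)%C x y 0 ltac:(lra) HW Hoh) as [Q _].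
    destruct (mu_outer a b (a + b + 1) x y (- w ^ k)%C (w ^ k)%C G Ha Hb ltac:(lra) Q (fun v Hv => proj1 (HG v Hv))) as (S & S1 & S2).
    rewrite (int_mu_eq b _ (Dm * S)%C).
    + refine (Laplace_dunklE_KN k a b _ P z1 z2 s S Hk (Rlt_le _ _ Ha) (Rlt_le _ _ Hb) Hkb Hz1 Hz2 (Rlt_le _ _ Hs) _ S1).
      intros j. apply (repr_kernel_eq (2 * k) (kap_I2k a b) k a b (fun y => powabs y (2 * a)) (fun x => powabs x (2 * b))
        (ups_I2k k a b)); auto using class_sum_I2k, wfun_powabs, ups_I2k_E.
    + refine (CRInt_gen_m1_1_ext _ _ _ _ (CRInt_gen_scal Dm _ _ _ _ S2)).
      intros v Hv. cbv beta. rewrite (proj2 (HG v ltac:(lra))). ring.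
  - intros k a z1 z2 P Hodd Ha Hz1 Hz2 HP. exists (64 * (Cmod z1 * Cmod z2)). intros s Hs.
    assert (Hk : (1 <= k)%nat) by (destruct k; [discriminate|lia]).
    assert (Ho := Cmod_unitC z1 Hz1). assert (He := Cmod_unitC z2 Hz2).
    assert (Pb : 0 < Cmod z1 * Cmod z2) by (apply Rmult_lt_0_compat; apply Cmod_gt_0; auto).
    assert (Hkb : 0 < INR k * a) by (apply Rmult_lt_0_compat; [apply lt_0_INR; lia|lra]).
    set (B := Cmod z1 * Cmod z2) in *. set (w := ws B s).
    assert (Hw : Cmod w <= 1 / 64) by (apply Cmod_ws_small; auto; lra).
    set (o := (unitC z1 ^ k)%C). set (h := (unitC z2 ^ k)%C).
    assert (Hoh := unit_cross o h (unit_pow _ k Ho) (unit_pow _ k He)).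
    set (x := RtoC (2 * (snd o * snd h))) in *. set (y := RtoC (2 * (fst o * fst h))) in *.
    assert (HW : Cmod (w ^ k) <= 1 / 64) by (apply Cmod_pow_le; auto; lra).
    set (Dm := dih_factor k (INR k * a) (unitC z1) (unitC z2) B s).
    destruct (mu_small (w ^ k)%C x y 1 ltac:(lra) HW Hoh) as [_ Q].
    (* The value v = 1 is built into the constant term; with b = 0 the mean [Pm] there is the double
       mean [P2]. *)
    destruct (mu_inner a (a + 1) x (y * RtoC 1 + - w ^ k)%C (w ^ k)%C Ha ltac:(lra) Q) as (S & S1 & S2).
    rewrite (int_mu_eq a _ (Dm * S)%C).
    + refine (Laplace_dunklE_KN k a 0 _ P z1 z2 s S Hk (Rlt_le _ _ Ha) (Rle_refl 0) Hkb Hz1 Hz2 (Rlt_le _ _ Hs) _ _).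
      * intros j. apply (repr_kernel_eq k (kap_Ik a) k a 0 (fun y => powabs y (2 * a)) (fun _ => 1)
          (ups_Ik k a)); auto using class_sum_Ik, wfun_powabs, wfun_one, ups_Ik_E.
      * cbv zeta. fold B w o h x y. eapply Cser_ext; [|exact S1]. intros n. cbv beta.
        rewrite Pm_eq_P2, Rplus_0_r, Cmult_1_r. reflexivity.
    + refine (CRInt_gen_m1_1_ext _ _ _ _ (CRInt_gen_scal Dm _ _ _ _ S2)).
      intros u _. unfold g_Ik. rewrite dih_integrand_affine by (auto; fold w; lra). fold w o h x y Dm. ring.
Qed.
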